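(* Assume the Riemann hypothesis. Then for every real $x\ge4$ there is a prime number in the interval $\left[x,\ x+\frac{22}{25}\sqrt{x}\log x\right]$.
   Context: $\log$ denotes the natural logarithm. *)

(* Defs.v *)
From Stdlib Require Import Reals Znumtheory ZArith.
Open Scope R_scope.

(* The Riemann zeta function on the critical strip 0 < Re s < 1 is given by
   its standard analytic continuation zeta(s) = eta(s) / (1 - 2^(1-s)), where
   eta(s) = sum_{n>=1} (-1)^(n-1) n^(-s) is the Dirichlet eta function, whose
   series converges for Re s > 0.  On the strip the factor 1 - 2^(1-s) never
   vanishes (its zeros lie on Re s = 1), so zeta(s) = 0 iff eta(s) = 0.

   For s = sigma + i t we have n^(-s) = n^(-sigma) (cos(t ln n) - i sin(t ln n)). *)

Definition eta_re_partial (sigma t : R) (N : nat) : R :=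
  sum_f_R0 (fun k => (-1) ^ k * Rpower (INR (S k)) (- sigma)
                       * cos (t * ln (INR (S k)))) N.

Definition eta_im_partial (sigma t : R) (N : nat) : R :=
  sum_f_R0 (fun k => - ((-1) ^ k * Rpower (INR (S k)) (- sigma)
                       * sin (t * ln (INR (S k))))) N.

Definition eta_zero (sigma t : R) : Prop :=
  Un_cv (eta_re_partial sigma t) 0 /\ Un_cv (eta_im_partial sigma t) 0.

Definition zeta_zero_in_strip (sigma t : R) : Prop :=
  0 < sigma < 1 /\ eta_zero sigma t.

Definition RiemannHypothesis : Prop :=
  forall sigma t : R, zeta_zero_in_strip sigma t -> sigma = 1 / 2.

(* Main.v *)
(* The Riemann hypothesis makes Re (X'/X) nonnegative to the right of the critical line, where X is the completed zeta function: |X(s-a)| <= |X(s+a)| by the maximum principle. Integrating this positivity against the nonnegative kernels exp(-al (t-tau)^2) (1 +- cos (la (t-tau))) on a vertical line tending to Re s = 1/2 gives an explicit inequality: the sum of vM(n) n^(-1/2) against a modulated Gaussian in la - ln n differs from its main term by at most twice the archimedean density at height tau. This inequality is then averaged over tau with coefficients whose absolute values sum to 1. If [x, x + H] contains no prime, the positive part of the resulting weight lives, up to prime powers, outside that interval, where Selberg's sieve bounds the sum over primes; with H = 22/25 sqrt x ln x and x >= e^15 the inequality becomes false. Smaller x are covered by an explicit chain of primes. *)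

Require Import Defs.
From Stdlib Require Import Reals Znumtheory ZArith.
From Stdlib Require Import Lra Lia Psatz ClassicalEpsilon Classical List Bool.
From Coquelicot Require Import Coquelicot.
Open Scope R_scope.

(** The constant 22/25 comes from a narrow margin. Put l = ln x and q = sqrt x, and let 2h be the
    logarithmic length of the window, so that h q is about 11 l/25. The heights in the average are
    multiples of 1/h, so the archimedean density costs about -ln(h)/2, that is l/4. The main term is
    about (h q/2) 1.26996, and the primes near the window take off 1.648/50 times the ratio of l to
    the logarithm of the sieving limit. That limit is a little below x^(1/4), so the ratio tends to
    4, and 0.22 (1.26996 - 4 1.648/50) is about 0.2504, just above 1/4. The line Re s = 1/2 may
    carry zeros of X. Hence all line integrals are taken at some s0 > 1/2 with bounds uniform in s0,
    and s0 tends to 1/2 only in the final inequality. For the maximum principle X(s-a)/X(s+a) must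
    not grow too fast, which requires a lower bound for |X| near the critical line. It is extracted
    from Borel-Caratheodory on discs that touch that line. X, Gamma and eta all enter as two-sided
    Laplace transforms of theta series or exponentials, so their identities come from manipulating
    absolutely convergent integrals. *)

Lemma exp_le (x y : R) : x <= y -> exp x <= exp y.
Proof. intros [H| ->]; [left; apply exp_increasing; exact H|right; reflexivity]. Qed.

(* Automation for positivity, monotonicity and routine goals *)
Create HintDb cont.
Ltac pos := solve [assumption | lra | lazymatch goal with
  | |- _ <> 0 => apply Rgt_not_eq; pos
  | |- 0 < exp _ => apply exp_pos
  | |- 0 < _ ^ _ => apply pow_lt; pos
  | |- 0 < INR _ => apply lt_0_INR; lia
  | |- 0 < / _ => apply Rinv_0_lt_compat; pos
  | |- 0 < _ / _ => apply Rdiv_lt_0_compat; pos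
  | |- 0 < _ * _ => apply Rmult_lt_0_compat; pos
  | |- 0 < sqrt _ => apply sqrt_lt_R0; pos
  | |- 0 < PI => apply PI_RGT_0
  | |- 0 < _ + _ => first [apply Rplus_lt_le_0_compat; pos | apply Rplus_le_lt_0_compat; pos]
  | |- 0 <= Rabs _ => apply Rabs_pos
  | |- 0 <= Cmod _ => apply Cmod_ge_0
  | |- 0 <= INR _ => apply pos_INR
  | |- 0 <= sqrt _ => apply sqrt_pos
  | |- 0 <= _ ^ 2 => apply pow2_ge_0
  | |- 0 <= _ ^ _ => apply pow_le; pos
  | |- 0 <= _ / _ => apply Rdiv_le_0_compat; pos
  | |- 0 <= _ * _ => apply Rmult_le_pos; pos
  | |- 0 <= _ + _ => apply Rplus_le_le_0_compat; pos
  | |- 0 <= _ => first [solve [auto 4 with cont] | left; pos]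
  | |- _ => solve [auto 4 with cont]
  end].
Ltac cg := first [assumption | lra | lazymatch goal with
  | |- ?a * _ <= ?a * _ => apply Rmult_le_compat_l; [pos|cg]
  | |- _ * ?a <= _ * ?a => apply Rmult_le_compat_r; [pos|cg]
  | |- _ * _ <= _ * _ => apply Rmult_le_compat; [pos|pos|cg|cg]
  | |- _ / _ <= _ / _ => unfold Rdiv; cg
  | |- _ + _ <= _ + _ => apply Rplus_le_compat; cg
  | |- _ - _ <= _ - _ => apply Rplus_le_compat; cg
  | |- / _ <= / _ => apply Rinv_le_contravar; [pos|cg]
  | |- - _ <= - _ => apply Ropp_le_contravar; cg
  | |- exp _ <= exp _ => apply exp_le; cg
  | |- ln _ <= ln _ => apply ln_le; [pos|cg]
  | |- _ ^ _ <= _ ^ _ => apply pow_incr; split; [pos|cg]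
  | |- sqrt _ <= sqrt _ => apply sqrt_le_1_alt; cg
  | |- INR _ <= INR _ => apply le_INR; lia
  | |- Cmod _ <= Cmod _ + Cmod _ => apply Cmod_triangle
  | |- _ <= _ => solve [auto 5 with cont | eapply Rle_trans; eauto 3 with cont | nra]
  end].
Ltac svars := repeat match goal with x := _ |- _ => subst x end.
Ltac go := solve [auto | lra | lia | pos | auto 7 with cont | cg | field; repeat split; pos | simpl; lra | unfold Re, Im; simpl; solve [ring | lra | field; pos]
  | apply injective_projections; simpl; solve [ring | field; lra] | svars; solve [lra | pos | field; repeat split; pos | cg] | intros; solve [lra | pos | ring | reflexivity | auto 7 with cont | cg] | f_equal; solve [ring | field; pos | lra] | rewrite <- ?exp_plus; f_equal; solve [ring | field; pos] | split; solve [auto | lra | pos | auto 6 with cont | cg] | split; intros; solve [auto | lra | pos] | apply Rabs_le; lra | nra].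

Tactic Notation "have" ident(H) ":=" lconstr(t) := assert (H := t).
Tactic Notation "have" ident(H) ":" lconstr(T) "by" tactic3(t) := assert (H : T) by t.
Tactic Notation "have" ident(H) ":" lconstr(T) := assert (H : T).
Tactic Notation "have" ":" lconstr(T) "by" tactic3(t) := let H := fresh "hyp" in assert (H : T) by t.
Tactic Notation "have" ":" lconstr(T) := let H := fresh "hyp" in assert (H : T).
Ltac le_tr := eapply Rle_trans.
Tactic Notation "ub" open_constr(t) := le_tr; [apply t|].
Ltac mul_l := apply Rmult_le_compat_l.
Ltac mul_r := apply Rmult_le_compat_r.
Ltac em := destruct excluded_middle_informative.
Ltac Cring := apply injective_projections; simpl; ring.
Ltac Cfield := apply injective_projections; simpl; field.
Notation "$" := ltac:(lra) (only parsing).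

(** * Complex exponential and complex derivatives *)

Lemma is_derive_Rplus (f g : R -> R) (x a b : R) :
 is_derive f x a -> is_derive g x b -> is_derive (fun t => f t+g t) x (a+b).
Proof. exact (is_derive_plus f g x a b). Qed.

Lemma is_derive_Rminus (f g : R -> R) (x a b : R) :
 is_derive f x a -> is_derive g x b -> is_derive (fun t => f t-g t) x (a-b).
Proof. exact (is_derive_minus f g x a b). Qed.

Lemma is_derive_Rscal (f : R -> R) (x k a : R) :
 is_derive f x a -> is_derive (fun t => k*f t) x (k*a).
Proof. exact (is_derive_scal f x k a). Qed.

Lemma is_derive_Rmult (f g : R -> R) (x a b : R) :
 is_derive f x a -> is_derive g x b -> is_derive (fun t => f t*g t) x (a*g x+f x*b).
Proof. intros H1 H2. exact (is_derive_mult f g x a b H1 H2 Rmult_comm). Qed.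

Lemma is_derive_eq (f : R -> R) (x a b : R) : is_derive f x a -> a = b -> is_derive f x b.
Proof. intros H <-; exact H. Qed.

Lemma is_derive_cont (f : R -> R) (x a : R) : is_derive f x a -> continuous f x.
Proof. intros H. apply (ex_derive_continuous f x). exists a; exact H. Qed.

Definition Cexp (z : C) : C := (exp (Re z)*cos (Im z), exp (Re z)*sin (Im z)).

Lemma Cexp_add (z w : C) : Cexp (z+w)%C = (Cexp z*Cexp w)%C.
Proof.
 unfold Cexp, Re, Im. apply injective_projections; simpl;
 rewrite exp_plus, ?cos_plus, ?sin_plus; ring.
Qed.

Lemma Cmod_Cexp (z : C) : Cmod (Cexp z) = exp (Re z).
Proof.
 unfold Cexp, Cmod; simpl.
 replace (_+_) with (exp (Re z)*exp (Re z)*(Rsqr (sin (Im z))+Rsqr (cos (Im z)))) by (unfold Rsqr; ring).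
 rewrite sin2_cos2, Rmult_1_r. apply sqrt_square. go.
Qed.

Lemma Cexp_0 : Cexp 0 = 1%C.
Proof. unfold Cexp; simpl. rewrite exp_0, cos_0, sin_0. Cring. Qed.

Lemma Cexp_neq_0 (z : C) : Cexp z <> 0%C.
Proof.
 intros H. assert (Cmod (Cexp z) = 0) by (rewrite H; apply Cmod_0).
 rewrite Cmod_Cexp in H0. generalize (exp_pos (Re z)); lra.
Qed.

Lemma Cexp_RtoC (x : R) : Cexp x = exp x.
Proof. unfold Cexp; simpl. rewrite cos_0, sin_0. Cring. Qed.

Lemma Cexp_opp (z : C) : Cexp (-z) = (/Cexp z)%C.
Proof.
 have H : (Cexp (-z)*Cexp z = 1)%C.
 { rewrite <- Cexp_add. replace (-z+z)%C with (RtoC 0) by Cring. apply Cexp_0. }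
 transitivity (Cexp (-z)*(Cexp z*/Cexp z))%C.
 - rewrite Cinv_r by apply Cexp_neq_0. Cring.
 - rewrite Cmult_assoc, H. Cring.
Qed.

Lemma Cexp_conj (z : C) : Cexp (Cconj z) = Cconj (Cexp z).
Proof. unfold Cexp, Cconj, Re, Im; simpl. rewrite cos_neg, sin_neg. Cring. Qed.

Lemma im_le_Cmod (z : C) : Rabs (Im z) <= Cmod z.
Proof. le_tr; [|apply Rmax_Cmod]. apply Rmax_r. Qed.

Lemma Re_le_Cmod (z : C) : Re z <= Cmod z.
Proof. le_tr; [apply Rle_abs|apply re_le_Cmod]. Qed.

Lemma Cmod_le_Re_Im (z : C) : Cmod z <= Rabs (Re z)+Rabs (Im z).
Proof.
 apply Rsqr_incr_0_var.
 2: generalize (Rabs_pos (Re z)) (Rabs_pos (Im z)); lra.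
 unfold Rsqr. replace (Cmod z*Cmod z) with (Cmod z^2) by ring. rewrite Cmod2_alt.
 rewrite <- (pow2_abs (Re z)), <- (pow2_abs (Im z)).
 generalize (Rabs_pos (Re z)) (Rabs_pos (Im z)); nra.
Qed.

Lemma Cmod_minus_sym (z w : C) : Cmod (z-w) = Cmod (w-z).
Proof. rewrite <- Cmod_opp. go. Qed.

Lemma Cmod_triangle_inv (z w : C) : Cmod z-Cmod w <= Cmod (z-w).
Proof.
 have H := Cmod_triangle (z-w) w.
 replace (z-w+w)%C with z in H by Cring. lra.
Qed.

Lemma Cmod_ge_mult_Re (z w : C) : Re (Cconj w*z)%C <= Cmod w*Cmod z.
Proof. rewrite <- Cmod_conj, <- Cmod_mult. apply Re_le_Cmod. Qed.

Definition Cdr (g : R -> C) (t : R) (l : C) : Prop :=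
 is_derive (fun x => Re (g x)) t (Re l) /\ is_derive (fun x => Im (g x)) t (Im l).

(** Complex curves have no mean value equality. Projecting the curve onto the direction of
    [w = g b - g a] gives a real function whose increment is |w|^2, so the real mean value theorem
    applies and nothing is lost. *)
Lemma C_mvt (g dg : R -> C) (a b M : R) : a <= b ->
 (forall t, a <= t <= b -> Cdr g t (dg t)) ->
 (forall t, a <= t <= b -> Cmod (dg t) <= M) ->
 Cmod (g b-g a)%C <= M*(b-a).
Proof.
 intros Hab Hd HM.
 set (w := (g b-g a)%C).
 destruct (Req_dec (Cmod w) 0) as [H0|H0].
 { rewrite H0. apply Rmult_le_pos; [|lra]. le_tr; [apply Cmod_ge_0|apply (HM a); lra]. }
 have : 0 < Cmod w by (generalize (Cmod_ge_0 w); lra).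
 destruct (MVT_gen (fun t => Re (Cconj w*g t)%C) a b (fun t => Re (Cconj w*dg t)%C)) as [c [Hc E]].
 - intros t Ht. rewrite Rmin_left, Rmax_right in Ht by lra.
  destruct (Hd t) as [H1 H2]; [lra|].
  eapply is_derive_eq; [apply is_derive_Rminus; apply is_derive_Rscal; [apply H1|apply H2]|].
  go.
 - intros t Ht. rewrite Rmin_left, Rmax_right in Ht by lra.
  destruct (Hd t) as [H1 H2]; [lra|].
  apply continuity_pt_filterlim. eapply is_derive_cont.
  apply is_derive_Rminus; apply is_derive_Rscal; [apply H1|apply H2].
 - rewrite Rmin_left, Rmax_right in Hc by lra.
  have E2 : Re (Cconj w*g b)%C-Re (Cconj w*g a)%C = Cmod w^2.
  { rewrite Cmod2_alt. go. }
  rewrite E2 in E.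
  have H3 := Cmod_ge_mult_Re (dg c) w. have H4 := HM c Hc.
  assert (Cmod w^2 <= Cmod w*(M*(b-a))).
  { rewrite E. rewrite <- Rmult_assoc. go. }
  go.
Qed.

Lemma Cexp_line_Cdr (h : C) (t : R) : Cdr (fun x => Cexp (RtoC x*h)) t (h*Cexp (RtoC t*h)).
Proof.
 unfold Cdr, Cexp, Re, Im; simpl; split; auto_derive; auto; unfold Rminus; ring.
Qed.

Lemma Cexp_m1_bound (h : C) : Cmod (Cexp h-1)%C <= Cmod h*exp (Cmod h).
Proof.
 have H := C_mvt (fun x => Cexp (x*h)) (fun t => (h*Cexp (t*h))%C) 0 1 (Cmod h*exp (Cmod h)).
 simpl in H. rewrite Cmult_1_l, Cmult_0_l, Cexp_0, Rminus_0_r, Rmult_1_r in H. apply H.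
 - lra.
 - intros; apply Cexp_line_Cdr.
 - intros t Ht. rewrite Cmod_mult, Cmod_Cexp. mul_l; [go|].
  apply exp_le.
  ub Re_le_Cmod. rewrite Cmod_mult, Cmod_R, Rabs_pos_eq by lra.
  have X := Cmod_ge_0 h. nra.
Qed.

Lemma Cexp_taylor2 (h : C) : Cmod (Cexp h-1-h)%C <= Cmod h^2*exp (Cmod h).
Proof.
 have H := C_mvt (fun x => (Cexp (x*h)-1-x*h)%C) (fun t => (h*(Cexp (t*h)-1))%C) 0 1 (Cmod h^2*exp (Cmod h)).
 simpl in H. rewrite Cmult_1_l, Cmult_0_l, Cexp_0, Rminus_0_r, Rmult_1_r in H.
 replace (Cexp h-1-h-(1-1-0))%C with (Cexp h-1-h)%C in H by Cring.
 simpl. rewrite !Rmult_1_r in H |- *. apply H.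
 - lra.
 - intros t _. destruct (Cexp_line_Cdr h t) as [H1 H2]. split; unfold Re, Im in *; simpl in *.
  + eapply is_derive_eq; [apply is_derive_Rminus; [apply is_derive_Rminus; [apply H1|apply is_derive_const]|
    auto_derive; [go|go]]|]. unfold zero; simpl; ring.
  + eapply is_derive_eq; [apply is_derive_Rminus; [apply is_derive_Rminus; [apply H2|apply is_derive_const]|
    auto_derive; [go|go]]|]. unfold zero; simpl; ring.
 - intros t Ht. rewrite Cmod_mult, Rmult_assoc. mul_l; [go|].
  ub Cexp_m1_bound.
  have X := Cmod_ge_0 h.
  assert (Cmod (t*h)%C <= Cmod h). { rewrite Cmod_mult, Cmod_R, Rabs_pos_eq by lra. nra. }
  go.
Qed.

Lemma is_derive_eps (f : R -> R) (x l : R) :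
 is_derive f x l <->
 (forall eps, 0 < eps -> exists d, 0 < d /\ forall h, Rabs h < d -> Rabs (f (x+h)-f x-l*h) <= eps*Rabs h).
Proof.
 rewrite is_derive_Reals. split.
 - intros H eps He. destruct (H eps He) as [d Hd]. exists d. split; [apply cond_pos|].
  intros h Hh. destruct (Req_dec h 0) as [->|N].
  + rewrite Rplus_0_r, Rmult_0_r. replace (f x-f x-0) with 0 by ring. rewrite Rabs_R0; lra.
  + specialize (Hd h N Hh). replace (f (x+h)-f x-l*h) with (((f (x+h)-f x)/h-l)*h) by go.
   rewrite Rabs_mult. go.
 - intros H eps He. destruct (H (eps/2)) as [d [Hd0 Hd]]; [lra|]. exists (mkposreal d Hd0). intros h N Hh. specialize (Hd h Hh). have Hp := Rabs_pos_lt h N.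
  replace ((f (x+h)-f x)/h-l) with ((f (x+h)-f x-l*h)/h) by go.
  unfold Rdiv. rewrite Rabs_mult, Rabs_inv. apply Rmult_lt_reg_r with (Rabs h); [go|].
  rewrite Rmult_assoc, Rinv_l by lra. nra.
Qed.

Lemma Cdr_eps (g : R -> C) (t : R) (l : C) :
 Cdr g t l <->
 (forall eps, 0 < eps -> exists d, 0 < d /\ forall h, Rabs h < d -> Cmod (g (t+h)%R-g t-l*h)%C <= eps*Rabs h).
Proof.
 unfold Cdr. rewrite !is_derive_eps. split.
 - intros [H1 H2] eps He. destruct (H1 (eps/2)) as [d1 [P1 Q1]]; [lra|]. destruct (H2 (eps/2)) as [d2 [P2 Q2]]; [lra|].
  exists (Rmin d1 d2). split; [apply Rmin_pos; assumption|]. intros h Hh.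
  have A1 := Q1 h ltac:(eapply Rlt_le_trans; [exact Hh|apply Rmin_l]).
  have A2 := Q2 h ltac:(eapply Rlt_le_trans; [exact Hh|apply Rmin_r]).
  ub Cmod_le_Re_Im.
  replace (Re (g (t+h)%R-g t-l*h)%C) with (Re (g (t+h))-Re (g t)-Re l*h) by go.
  replace (Im (g (t+h)%R-g t-l*h)%C) with (Im (g (t+h))-Im (g t)-Im l*h) by go.
  go.
 - split; intros eps He; destruct (H eps He) as [d [P Q]]; exists d; split; auto; intros h Hh;
  (le_tr; [|go]).
  + replace (Re (g (t+h))-Re (g t)-Re l*h) with (Re (g (t+h)%R-g t-l*h)%C) by go.
   apply re_le_Cmod.
  + replace (Im (g (t+h))-Im (g t)-Im l*h) with (Im (g (t+h)%R-g t-l*h)%C) by go.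
   apply im_le_Cmod.
Qed.

(** * Complex derivatives by linear approximation *)

Definition Cd (f : C -> C) (z l : C) : Prop :=
 forall eps, 0 < eps -> exists d, 0 < d /\
  forall h : C, Cmod h < d -> Cmod (f (z+h)-f z-l*h)%C <= eps*Cmod h.

Definition Ccont (f : C -> C) (z : C) : Prop :=
 forall eps, 0 < eps -> exists d, 0 < d /\
  forall h : C, Cmod h < d -> Cmod (f (z+h)-f z)%C <= eps.

Lemma Cd_Ccont (f : C -> C) (z l : C) : Cd f z l -> Ccont f z.
Proof.
 intros H eps He. destruct (H 1) as [d [Hd K]]; [lra|].
 have Hl := Cmod_ge_0 l.
 exists (Rmin d (eps/(1+Cmod l))). split.
 { apply Rmin_pos; auto. go. }
 intros h Hh. have h1 : Cmod h < d by (eapply Rlt_le_trans; [exact Hh|apply Rmin_l]).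
 have h2 : Cmod h < eps/(1+Cmod l) by (eapply Rlt_le_trans; [exact Hh|apply Rmin_r]).
 replace (f (z+h)-f z)%C with ((f (z+h)-f z-l*h)+l*h)%C by Cring.
 ub Cmod_triangle. rewrite Cmod_mult. specialize (K h h1).
 apply Rlt_div_r in h2; [|lra]. nra.
Qed.

Lemma Cd_const (c z : C) : Cd (fun _ => c) z 0.
Proof.
 exists 1. split; [lra|]. intros h _.
 replace (c-c-0*h)%C with (RtoC 0) by Cring. rewrite Cmod_0. go.
Qed.

Lemma Cd_id (z : C) : Cd (fun x => x) z 1.
Proof.
 exists 1. split; [lra|]. intros h _.
 replace (z+h-z-1*h)%C with (RtoC 0) by Cring. rewrite Cmod_0. go.
Qed.

Lemma Cd_plus (f g : C -> C) (z a b : C) : Cd f z a -> Cd g z b -> Cd (fun x => f x+g x)%C z (a+b).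
Proof.
 intros H1 H2 eps He. destruct (H1 (eps/2)) as [d1 [P1 Q1]]; [lra|]. destruct (H2 (eps/2)) as [d2 [P2 Q2]]; [lra|].
 exists (Rmin d1 d2). split; [apply Rmin_pos; assumption|]. intros h Hh.
 have A1 := Q1 h ltac:(eapply Rlt_le_trans; [exact Hh|apply Rmin_l]).
 have A2 := Q2 h ltac:(eapply Rlt_le_trans; [exact Hh|apply Rmin_r]).
 replace (f (z+h)+g (z+h)-(f z+g z)-(a+b)*h)%C with ((f (z+h)-f z-a*h)+(g (z+h)-g z-b*h))%C by Cring.
 ub Cmod_triangle. lra.
Qed.

(** A quadratic remainder is the source of the concrete derivatives below: squares, inverses,
    [Cexp], Laplace transforms and Dirichlet series. *)
Lemma Cd_taylor (f : C -> C) (z l : C) (K d : R) : 0 < d ->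
 (forall h : C, Cmod h < d -> Cmod (f (z+h)-f z-l*h)%C <= K*Cmod h^2) -> Cd f z l.
Proof.
 intros Hd H eps He.
 have : 0 < Rabs K+1 by go.
 exists (Rmin d (eps/(Rabs K+1))). split.
 { apply Rmin_pos; auto. go. }
 intros h Hh. have h1 : Cmod h < d by (eapply Rlt_le_trans; [exact Hh|apply Rmin_l]).
 have h2 : Cmod h < eps/(Rabs K+1) by (eapply Rlt_le_trans; [exact Hh|apply Rmin_r]).
 apply Rlt_div_r in h2; [|lra]. specialize (H h h1). have X := Cmod_ge_0 h. have Y := Rle_abs K.
 go.
Qed.

Lemma Cd_ext_loc (f g : C -> C) (z l : C) (r : R) : 0 < r ->
 (forall h : C, Cmod h < r -> f (z+h)%C = g (z+h)%C) -> Cd f z l -> Cd g z l.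
Proof.
 intros Hr E H eps He. destruct (H eps He) as [d [P Q]]. exists (Rmin d r). split; [apply Rmin_pos; assumption|].
 intros h Hh. rewrite <- E by (eapply Rlt_le_trans; [exact Hh|apply Rmin_r]).
 have E0 := E 0%C. rewrite Cmod_0 in E0. specialize (E0 Hr). replace (z+0)%C with z in E0 by Cring.
 rewrite <- E0. apply Q. eapply Rlt_le_trans; [exact Hh|apply Rmin_l].
Qed.

Lemma Cd_ext (f g : C -> C) (z l : C) : (forall x, f x = g x) -> Cd f z l -> Cd g z l.
Proof. intros E. apply (Cd_ext_loc f g z l 1); [lra|]. go. Qed.

Lemma Cd_eq (f : C -> C) (z a b : C) : Cd f z a -> a = b -> Cd f z b.
Proof. intros H <-; exact H. Qed.

Lemma Cd_comp (f g : C -> C) (z a b : C) : Cd f (g z) a -> Cd g z b -> Cd (fun x => f (g x)) z (a*b).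
Proof.
 intros Hf Hg eps He.
 have Ha := Cmod_ge_0 a. have Hb := Cmod_ge_0 b.
 set (e1 := eps/(2*(Cmod b+1))). have He1 : 0 < e1 by go.
 set (e2 := Rmin 1 (eps/(2*(Cmod a+1)))). have He2 : 0 < e2 by (apply Rmin_pos; [lra|go]).
 destruct (Hf e1 He1) as [d1 [P1 Q1]]. destruct (Hg e2 He2) as [d2 [P2 Q2]].
 exists (Rmin d2 (d1/(Cmod b+1))). split; [apply Rmin_pos; [lra|go]|].
 intros h Hh. have h1 : Cmod h < d2 by (eapply Rlt_le_trans; [exact Hh|apply Rmin_l]).
 have h2 : Cmod h < d1/(Cmod b+1) by (eapply Rlt_le_trans; [exact Hh|apply Rmin_r]).
 apply Rlt_div_r in h2; [|lra].
 specialize (Q2 h h1). set (k := (g (z+h)-g z)%C).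
 have X := Cmod_ge_0 h.
 have : e2 <= 1 by apply Rmin_l.
 have : e2*(2*(Cmod a+1)) <= eps.
 { apply Rle_div_r; [lra|]. apply Rmin_r. }
 have : e1*(2*(Cmod b+1)) = eps by go.
 have : Cmod k <= (Cmod b+1)*Cmod h.
 { unfold k. replace (g (z+h)-g z)%C with ((g (z+h)-g z-b*h)+b*h)%C by Cring.
  ub Cmod_triangle. rewrite Cmod_mult. nra. }
 have Q := Q1 k. replace (g z+k)%C with (g (z+h)%C) in Q by go.
 replace (f (g (z+h))-f (g z)-a*b*h)%C with
  ((f (g (z+h))-f (g z)-a*k)+a*(g (z+h)-g z-b*h))%C by go.
 ub Cmod_triangle. rewrite Cmod_mult.
 go.
Qed.

Lemma Cd_mult (f g : C -> C) (z a b : C) : Cd f z a -> Cd g z b -> Cd (fun x => f x*g x)%C z (a*g z+f z*b).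
Proof.
 (* f g = ((f+g)^2 - (f-g)^2)/4 reduces to the derivative of the square. *)
 have Hsq : forall u, Cd (fun x => x*x)%C u (2*u).
 { intros u. apply (Cd_taylor _ _ _ 1 1); [lra|]. intros h _.
  replace ((u+h)*(u+h)-u*u-2*u*h)%C with (h*h)%C by Cring. rewrite Cmod_mult. lra. }
 have Hl : forall c u, Cd (fun x => c*x)%C u c.
 { intros c u. apply (Cd_taylor _ _ _ 0 1); [lra|]. intros h _.
  replace (c*(u+h)-c*u-c*h)%C with (RtoC 0) by Cring. rewrite Cmod_0. lra. }
 intros Hf Hg.
 have Hm : Cd (fun x => - 1*g x)%C z (- 1*b) by (apply Cd_comp; auto).
 have H1 := Cd_comp _ _ z _ _ (Hsq _) (Cd_plus _ _ _ _ _ Hf Hg).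
 have H2 := Cd_comp _ _ z _ _ (Hsq _) (Cd_plus _ _ _ _ _ Hf Hm).
 have H3 := Cd_comp (fun x => - 1*x)%C _ z _ _ (Hl _ _) H2.
 have H4 := Cd_comp (fun x => RtoC (/4)*x)%C _ z _ _ (Hl _ _) (Cd_plus _ _ _ _ _ H1 H3).
 eapply Cd_eq; [eapply Cd_ext; [|exact H4]|].
 - intros x. go.
 - go.
Qed.

Lemma Cd_scal (c : C) (f : C -> C) (z a : C) : Cd f z a -> Cd (fun x => c*f x)%C z (c*a).
Proof. intros H. eapply Cd_eq; [apply Cd_mult; [apply Cd_const|exact H]|]. Cring. Qed.

Lemma Cd_minus (f g : C -> C) (z a b : C) : Cd f z a -> Cd g z b -> Cd (fun x => f x-g x)%C z (a-b).
Proof.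
 intros Hf Hg. eapply Cd_eq; [eapply Cd_ext; [|apply (Cd_plus _ _ _ _ _ Hf (Cd_scal (-1) _ _ _ Hg))]|].
 - intros x; simpl; Cring.
 - Cring.
Qed.

Lemma Cd_inv_id (z : C) : z <> 0%C -> Cd (fun x => /x)%C z (- /(z*z)).
Proof.
 intros Hz. have : 0 < Cmod z by (apply Cmod_gt_0; exact Hz).
 (* Within half of |z| the point z + h stays at distance at least |z|/2 from 0, which gives the
    constant 2/|z|^3. *)
 apply (Cd_taylor _ _ _ (2/(Cmod z^3)) (Cmod z/2)); [lra|].
 intros h Hh.
 have : Cmod z/2 <= Cmod (z+h)%C.
 { have T := Cmod_triangle_inv z (-h). rewrite Cmod_opp in T. replace (z-- h)%C with (z+h)%C in T by Cring. lra. }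
 have : (z+h)%C <> 0%C by (apply Cmod_gt_0; lra).
 replace (/(z+h)-/z-- /(z*z)*h)%C with (h*h/(z*z*(z+h)))%C by go.
 rewrite Cmod_div by (apply Cmod_gt_0; rewrite !Cmod_mult; apply Rmult_lt_0_compat; [nra|lra]).
 rewrite !Cmod_mult. replace (2/Cmod z^3*Cmod h^2) with (Cmod h*Cmod h/(Cmod z*Cmod z*(Cmod z/2))) by go.
 go.
Qed.

Lemma Cd_inv (f : C -> C) (z a : C) : f z <> 0%C -> Cd f z a -> Cd (fun x => /f x)%C z (-a/(f z*f z)).
Proof.
 intros N H. eapply Cd_eq; [apply (Cd_comp _ f _ _ _ (Cd_inv_id _ N) H)|].
 go.
Qed.

Lemma Cd_div (f g : C -> C) (z a b : C) : g z <> 0%C -> Cd f z a -> Cd g z b ->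
 Cd (fun x => f x/g x)%C z ((a*g z-f z*b)/(g z*g z)).
Proof.
 intros N Hf Hg. eapply Cd_eq; [apply (Cd_mult _ _ _ _ _ Hf (Cd_inv _ _ _ N Hg))|]. go.
Qed.

Lemma Cd_Cexp (z : C) : Cd Cexp z (Cexp z).
Proof.
 apply (Cd_taylor _ _ _ (Cmod (Cexp z)*exp 1) 1); [lra|]. intros h Hh.
 rewrite Cexp_add. replace (Cexp z*Cexp h-Cexp z-Cexp z*h)%C with (Cexp z*(Cexp h-1-h))%C by Cring.
 rewrite Cmod_mult. rewrite Rmult_assoc. mul_l; [go|].
 ub Cexp_taylor2. rewrite Rmult_comm. go.
Qed.

(** Allows an identity between two functions to be differentiated: both expressions for the
    derivative must agree. [Gam1_step], [X_logder] and the Gaussian moments are obtained in this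
    way. *)
Lemma Cd_unique (f : C -> C) (z a b : C) : Cd f z a -> Cd f z b -> a = b.
Proof.
 intros Ha Hb. destruct (Req_dec (Cmod (a-b)%C) 0) as [E|N].
 - apply Cmod_eq_0 in E. replace a with (a-b+b)%C by Cring. rewrite E. Cring.
 - exfalso. have : 0 < Cmod (a-b)%C by (generalize (Cmod_ge_0 (a-b)%C); lra).
  set (e := Cmod (a-b)%C/4). have He : 0 < e by go.
  destruct (Ha e He) as [d1 [P1 Q1]]. destruct (Hb e He) as [d2 [P2 Q2]].
  set (r := Rmin d1 d2/2). have Hm := Rmin_pos _ _ P1 P2.
  have A := Rmin_l d1 d2. have B := Rmin_r d1 d2.
  have Hr : Cmod (r) = r by (rewrite Cmod_R; apply Rabs_pos_eq; unfold r; lra).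
  specialize (Q1 (r)). specialize (Q2 (r)). specialize (Q1 ltac:(go)). specialize (Q2 ltac:(go)).
  have T := Cmod_triangle (f (z+r)-f z-b*r)%C (-(f (z+r)-f z-a*r))%C.
  rewrite Cmod_opp in T. replace (f (z+r)-f z-b*r+- (f (z+r)-f z-a*r))%C with ((a-b)*r)%C in T by Cring.
  rewrite Cmod_mult, Hr in T. assert (0 < r) by go. unfold e in *. nra.
Qed.

Lemma Cd_Cdr (f : C -> C) (g : R -> C) (t : R) (l m : C) : Cd f (g t) l -> Cdr g t m -> Cdr (fun x => f (g x)) t (l*m).
Proof.
 intros Hf Hg. rewrite -> Cdr_eps in *. intros eps He.
 have Hl := Cmod_ge_0 l. have Hm := Cmod_ge_0 m.
 set (e1 := eps/(2*(Cmod m+1))). have He1 : 0 < e1 by go.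
 set (e2 := Rmin 1 (eps/(2*(Cmod l+1)))). have He2 : 0 < e2 by (apply Rmin_pos; [lra|go]).
 destruct (Hf e1 He1) as [d1 [P1 Q1]]. destruct (Hg e2 He2) as [d2 [P2 Q2]].
 exists (Rmin d2 (d1/(Cmod m+1))). split; [apply Rmin_pos; [lra|go]|].
 intros h Hh. have h1 : Rabs h < d2 by (eapply Rlt_le_trans; [exact Hh|apply Rmin_l]).
 have h2 : Rabs h < d1/(Cmod m+1) by (eapply Rlt_le_trans; [exact Hh|apply Rmin_r]).
 apply Rlt_div_r in h2; [|lra].
 specialize (Q2 h h1). set (k := (g (t+h)%R-g t)%C).
 have X := Rabs_pos h.
 have : e2 <= 1 by apply Rmin_l.
 have : e2*(2*(Cmod l+1)) <= eps.
 { apply Rle_div_r; [lra|]. apply Rmin_r. }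
 have : e1*(2*(Cmod m+1)) = eps by go.
 have : Cmod k <= (Cmod m+1)*Rabs h.
 { unfold k. replace (g (t+h)%R-g t)%C with ((g (t+h)%R-g t-m*h)+m*h)%C by Cring.
  ub Cmod_triangle. rewrite Cmod_mult, Cmod_R. nra. }
 have Q := Q1 k. replace (g t+k)%C with (g (t+h)) in Q by go.
 replace (f (g (t+h)%R)-f (g t)-l*m*h)%C with
  ((f (g (t+h)%R)-f (g t)-l*k)+l*(g (t+h)%R-g t-m*h))%C by go.
 ub Cmod_triangle. rewrite Cmod_mult.
 go.
Qed.

#[export] Hint Resolve exp_le Cexp_neq_0 Cd_const Cd_id Cd_plus Cd_mult Cd_scal Cd_minus Cd_Cexp exp_pos le_INR Rmin_pos Cmod_triangle : cont.

(** * Integrals over the line and Laplace transforms *)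

Definition RC (f : R -> R) := forall t, continuous f t.
Definition CC (g : R -> C) := RC (fun t => Re (g t)) /\ RC (fun t => Im (g t)).
Definition CI (g : R -> C) (a b : R) : C := (RInt (fun t => Re (g t)) a b, RInt (fun t => Im (g t)) a b).

Lemma RC_plus f g : RC f -> RC g -> RC (fun t => f t+g t).
Proof. intros H1 H2 t. apply (continuous_plus f g t); auto. Qed.
Lemma RC_minus f g : RC f -> RC g -> RC (fun t => f t-g t).
Proof. intros H1 H2 t. apply (continuous_minus f g t); auto. Qed.
Lemma RC_mult f g : RC f -> RC g -> RC (fun t => f t*g t).
Proof. intros H1 H2 t. apply (continuous_mult f g t); auto. Qed.
Lemma RC_const c : RC (fun _ => c).
Proof. intros t. apply continuous_const. Qed.
Lemma RC_id : RC (fun t => t).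
Proof. intros t. apply continuous_id. Qed.
Lemma RC_comp f g : RC f -> RC g -> RC (fun t => f (g t)).
Proof. intros H1 H2 t. apply continuous_comp; auto. Qed.
Lemma RC_derive f : (forall t, ex_derive f t) -> RC f.
Proof. intros H t. apply (ex_derive_continuous f t); auto. Qed.
Lemma RC_exp : RC exp.
Proof. apply RC_derive. intros t. auto_derive; auto. Qed.
Lemma RC_cos : RC cos.
Proof. apply RC_derive. intros t. auto_derive; auto. Qed.
Lemma RC_sin : RC sin.
Proof. apply RC_derive. intros t. auto_derive; auto. Qed.
Lemma RC_abs : RC Rabs.
Proof. intros t. apply continuous_Rabs. Qed.
Lemma RC_ext f g : (forall t, f t = g t) -> RC f -> RC g.
Proof. intros E H t. apply (continuous_ext f g t E). go. Qed.

Lemma RC_int f a b : RC f -> ex_RInt f a b.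
Proof. intros H. apply (ex_RInt_continuous f a b). go. Qed.

Lemma CC_ext f g : (forall t, f t = g t) -> CC f -> CC g.
Proof. intros E [H1 H2]. split; [apply (RC_ext (fun t => Re (f t)))|apply (RC_ext (fun t => Im (f t)))]; auto; intros t; rewrite E; reflexivity. Qed.
Lemma CC_const (c : C) : CC (fun _ => c).
Proof. split; apply RC_const. Qed.
Lemma CC_RtoC f : RC f -> CC (fun t => RtoC (f t)).
Proof. intros H; split; [go|exact (RC_const 0)]. Qed.
Lemma CC_plus f g : CC f -> CC g -> CC (fun t => f t+g t)%C.
Proof. intros [] []; split; apply RC_plus; auto. Qed.
Lemma CC_minus f g : CC f -> CC g -> CC (fun t => f t-g t)%C.
Proof.
 intros [] []; split; [eapply RC_ext; [|apply RC_minus; [exact H|exact H1]]|eapply RC_ext; [|apply RC_minus; [exact H0|exact H2]]];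
 intros t; unfold Re, Im; simpl; ring.
Qed.
Lemma CC_mult f g : CC f -> CC g -> CC (fun t => f t*g t)%C.
Proof.
 intros [] []; split; [apply RC_minus|apply RC_plus]; apply RC_mult; auto.
Qed.
Lemma CC_Cexp f : CC f -> CC (fun t => Cexp (f t)).
Proof.
 intros [H1 H2]; split; unfold Cexp; simpl; apply RC_mult;
 [apply RC_comp; auto using RC_exp|apply RC_comp; auto using RC_cos|apply RC_comp; auto using RC_exp|apply RC_comp; auto using RC_sin].
Qed.
Lemma CC_conj f : CC f -> CC (fun t => Cconj (f t)).
Proof.
 intros [H1 H2]; split; [go|]. eapply RC_ext; [|apply (RC_minus _ _ (RC_const 0) H2)].
 intros t; unfold Im; simpl; ring.
Qed.
Lemma CC_Cdr f df : (forall t, Cdr f t (df t)) -> CC f.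
Proof.
 intros H; split; intros t; destruct (H t) as [A B]; [exact (is_derive_cont _ _ _ A)|exact (is_derive_cont _ _ _ B)].
Qed.
Lemma RC_Cmod f : CC f -> RC (fun t => Cmod (f t)).
Proof.
 intros [H1 H2]. apply RC_comp.
 - intros t. apply continuous_sqrt.
 - apply (RC_ext (fun t => Re (f t)*Re (f t)+Im (f t)*Im (f t))).
  + intros t; unfold Re, Im; simpl; ring.
  + apply RC_plus; apply RC_mult; auto.
Qed.

Lemma CI_ext f g a b : (forall t, f t = g t) -> CI f a b = CI g a b.
Proof. intros E. unfold CI. f_equal; apply RInt_ext; intros; rewrite E; reflexivity. Qed.

Lemma CI_plus f g a b : CC f -> CC g -> CI (fun t => f t+g t)%C a b = (CI f a b+CI g a b)%C.
Proof.
 intros [] []. apply injective_projections; simpl.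
 - apply (RInt_plus _ (fun t => Re (g t))); apply RC_int; auto.
 - apply (RInt_plus _ (fun t => Im (g t))); apply RC_int; auto.
Qed.

Lemma RInt_Rscal k f a b : RC f -> RInt (fun t => k*f t) a b = k*RInt f a b.
Proof. intros H. exact (RInt_scal (V:=R_CompleteNormedModule) f a b k (RC_int _ _ _ H)). Qed.

Lemma CI_scal c f a b : CC f -> CI (fun t => c*f t)%C a b = (c*CI f a b)%C.
Proof.
 intros [H1 H2]. apply injective_projections; simpl.
 - rewrite <- RInt_Rscal by auto.
  rewrite <- RInt_Rscal by auto.
  apply (RInt_minus _ (fun t => snd c*Im (f t)));
  apply RC_int; apply RC_mult; auto using RC_const.
 - rewrite <- RInt_Rscal by auto.
  rewrite <- RInt_Rscal by auto.
  apply (RInt_plus _ (fun t => snd c*Re (f t)));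
  apply RC_int; apply RC_mult; auto using RC_const.
Qed.

Lemma CI_minus f g a b : CC f -> CC g -> CI (fun t => f t-g t)%C a b = (CI f a b-CI g a b)%C.
Proof.
 intros Hf Hg. rewrite (CI_ext _ (fun t => f t+(-1)*g t)%C) by (intros; Cring).
 rewrite CI_plus, CI_scal; auto. Cring. apply CC_mult; auto using CC_const.
Qed.

Lemma CI_Chasles f a b c : CC f -> CI f a c = (CI f a b+CI f b c)%C.
Proof.
 intros [H1 H2]. apply injective_projections; simpl; symmetry;
 [apply (RInt_Chasles (fun t => Re (f t)))|apply (RInt_Chasles (fun t => Im (f t)))]; apply RC_int; auto.
Qed.

(** Same projection as in [C_mvt]: pairing the integrand with the conjugate of the integral itself
    turns the modulus of the integral into a real integral. *)
Lemma CI_bound f g a b : a <= b -> CC f -> RC g -> (forall t, a <= t <= b -> Cmod (f t) <= g t) ->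
 Cmod (CI f a b) <= RInt g a b.
Proof.
 intros Hab Hf Hg H. set (w := CI f a b).
 have : 0 <= RInt g a b.
 { apply RInt_ge_0; [go|apply RC_int; auto|]. intros t Ht. le_tr; [apply Cmod_ge_0|apply H; lra]. }
 destruct (Req_dec (Cmod w) 0) as [E|N]; [go|].
 have : 0 < Cmod w by (generalize (Cmod_ge_0 w); lra).
 have E : Cmod w^2 = RInt (fun t => Re (Cconj w*f t)%C) a b.
 { change (RInt (fun t => Re (Cconj w*f t)%C) a b) with (Re (CI (fun t => Cconj w*f t)%C a b)).
  rewrite CI_scal by auto. rewrite Cmod2_alt. go. }
 assert (Cmod w^2 <= Cmod w*RInt g a b).
 { rewrite E. rewrite <- RInt_Rscal by auto.
  apply RInt_le; auto.
  - apply RC_int. apply (CC_mult (fun _ => Cconj w) f); auto using CC_const.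
  - apply RC_int. apply RC_mult; auto using RC_const.
  - intros t Ht. ub Cmod_ge_mult_Re. mul_l; [lra|apply H; lra]. }
 nra.
Qed.

Lemma CI_bound_const f a b M : a <= b -> CC f -> (forall t, a <= t <= b -> Cmod (f t) <= M) ->
 Cmod (CI f a b) <= M*(b-a).
Proof.
 intros Hab Hf H. le_tr; [apply (CI_bound f (fun _ => M)); auto using RC_const|].
 rewrite RInt_const. unfold scal; simpl; unfold mult; simpl. lra.
Qed.

Lemma CI_FTC F f a b : (forall t, Cdr F t (f t)) -> CC f -> CI f a b = (F b-F a)%C.
Proof.
 intros H [H1 H2]. apply injective_projections; simpl.
 - apply is_RInt_unique. apply (is_RInt_derive (fun t => Re (F t)) _); [intros; apply H|go].
 - apply is_RInt_unique. apply (is_RInt_derive (fun t => Im (F t)) _); [intros; apply H|go].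
Qed.

Lemma RInt_shift f a b c : RC f -> RInt (fun t => f (t+c)) a b = RInt f (a+c) (b+c).
Proof.
 intros H. have K := RInt_comp_lin (V:=R_CompleteNormedModule) f 1 c a b.
 rewrite !Rmult_1_l in K. rewrite <- K by (apply RC_int; auto).
 apply RInt_ext. intros t _. rewrite !Rmult_1_l. go.
Qed.

Lemma CI_shift f a b c : CC f -> CI (fun t => f (t+c)) a b = CI f (a+c) (b+c).
Proof.
 intros [H1 H2]. unfold CI. f_equal; [apply (RInt_shift (fun t => Re (f t)))|apply (RInt_shift (fun t => Im (f t)))]; auto.
Qed.

Lemma RInt_neg f a b : RC f -> RInt (fun t => f (-t)) a b = RInt f (-b) (-a).
Proof.
 intros H. have K := RInt_comp_lin (V:=R_CompleteNormedModule) f (-1) 0 a b.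
 replace (-1*a+0) with (-a) in K by ring. replace (-1*b+0) with (-b) in K by ring.
 rewrite <- (opp_RInt_swap f) by (apply RC_int; auto). rewrite <- K by (apply RC_int; auto).
 rewrite <- RInt_opp.
 - apply RInt_ext. intros t _. unfold opp, scal; simpl; unfold mult; simpl. replace (-1*t+0) with (-t) by ring. ring.
 - apply RC_int. apply RC_mult; [apply RC_const|]. apply RC_comp; auto.
  apply RC_plus; [apply RC_mult; auto using RC_const, RC_id|apply RC_const].
Qed.

Lemma CI_neg f a b : CC f -> CI (fun t => f (-t)) a b = CI f (-b) (-a).
Proof.
 intros [H1 H2]. unfold CI. f_equal; [apply (RInt_neg (fun t => Re (f t)))|apply (RInt_neg (fun t => Im (f t)))]; auto.
Qed.

(** * Improper integrals over the whole line *)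

(** The two ends tend to infinity independently, so that a translate of an integrand still satisfies
    the definition with the same value ([is_CL_shift]). *)
Definition is_CL (g : R -> C) (l : C) : Prop :=
 forall eps, 0 < eps -> exists N, forall T S, N <= T -> N <= S -> Cmod (CI g (-T) S-l)%C <= eps.

Lemma is_CL_unique g l m : is_CL g l -> is_CL g m -> l = m.
Proof.
 intros H1 H2. have : Cmod (l-m)%C <= 0.
 { apply le_epsilon. intros e He. destruct (H1 (e/2)) as [N1 K1]; [lra|]. destruct (H2 (e/2)) as [N2 K2]; [lra|].
  set (T := Rmax N1 N2). have A := K1 T T (Rmax_l _ _) (Rmax_l _ _). have B := K2 T T (Rmax_r _ _) (Rmax_r _ _).
  replace (l-m)%C with ((CI g (-T) T-m)-(CI g (-T) T-l))%C by Cring.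
  ub Cmod_triangle. rewrite Cmod_opp. lra. }
 have X := Cmod_ge_0 (l-m)%C. have Z := Cmod_eq_0 (l-m)%C $.
 replace l with (l-m+m)%C by Cring. rewrite Z. Cring.
Qed.

Lemma is_CL_ext f g l : (forall t, f t = g t) -> is_CL f l -> is_CL g l.
Proof. intros E H eps He. destruct (H eps He) as [N K]. exists N. intros T S HT HS. rewrite <- (CI_ext f g); auto. Qed.

Lemma is_CL_plus f g l m : CC f -> CC g -> is_CL f l -> is_CL g m -> is_CL (fun t => f t+g t)%C (l+m).
Proof.
 intros Cf Cg H1 H2 e He. destruct (H1 (e/2)) as [N1 K1]; [lra|]. destruct (H2 (e/2)) as [N2 K2]; [lra|].
 exists (Rmax N1 N2). intros T S HT HS. have A1 := Rmax_l N1 N2. have A2 := Rmax_r N1 N2.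
 rewrite CI_plus; auto. have A := K1 T S $ $. have B := K2 T S $ $.
 replace (CI f (-T) S+CI g (-T) S-(l+m))%C with ((CI f (-T) S-l)+(CI g (-T) S-m))%C by Cring.
 le_tr; [go|]. lra.
Qed.

Lemma is_CL_scal c f l : CC f -> is_CL f l -> is_CL (fun t => c*f t)%C (c*l).
Proof.
 intros Cf H e He. have X := Cmod_ge_0 c. destruct (H (e/(Cmod c+1))) as [N K]; [go|].
 exists N. intros T S HT HS. rewrite CI_scal; auto.
 replace (c*CI f (-T) S-c*l)%C with (c*(CI f (-T) S-l))%C by Cring. rewrite Cmod_mult.
 specialize (K T S HT HS). apply Rle_div_r in K; [|lra]. go.
Qed.

Lemma is_CL_minus f g l m : CC f -> CC g -> is_CL f l -> is_CL g m -> is_CL (fun t => f t-g t)%C (l-m).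
Proof.
 intros Cf Cg H1 H2. replace (l-m)%C with (l+(-1)*m)%C by Cring.
 eapply is_CL_ext; [|apply (is_CL_plus f (fun t => (-1)*g t)%C); auto].
 - intros t; simpl. Cring.
 - apply CC_mult; auto using CC_const.
 - apply is_CL_scal; auto.
Qed.

Lemma is_CL_shift f l c : CC f -> is_CL f l -> is_CL (fun t => f (t+c)) l.
Proof.
 intros Cf H e He. destruct (H e He) as [N K]. exists (N+Rabs c). intros T S HT HS. rewrite CI_shift; auto.
 have A := Rle_abs c. have B := Rle_abs (-c). rewrite Rabs_Ropp in B.
 replace (-T+c) with (-(T-c)) by ring. apply K; lra.
Qed.

Lemma is_CL_neg f l : CC f -> is_CL f l -> is_CL (fun t => f (-t)) l.
Proof.
 intros Cf H e He. destruct (H e He) as [N K]. exists N. intros T S HT HS. rewrite CI_neg; auto.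
 replace (- - T) with T by ring. go.
Qed.

Lemma is_CL_conj f l : CC f -> is_CL f l -> is_CL (fun t => Cconj (f t)) (Cconj l).
Proof.
 intros Cf H e He. destruct (H e He) as [N K]. exists N. intros T S HT HS.
 have E : CI (fun t => Cconj (f t)) (-T) S = Cconj (CI f (-T) S).
 { unfold CI, Cconj; simpl. f_equal. apply (RInt_opp (fun t => snd (f t))). apply RC_int. apply Cf. }
 rewrite E. replace (Cconj (CI f (-T) S)-Cconj l)%C with (Cconj (CI f (-T) S-l)) by Cring. rewrite Cmod_conj. go.
Qed.

Lemma is_CL_FTC F f (A B : C) : (forall t, Cdr F t (f t)) -> CC f ->
 (forall eps, 0 < eps -> exists N, forall T, N <= T -> Cmod (F T-B)%C <= eps /\ Cmod (F (-T)%R-A)%C <= eps) ->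
 is_CL f (B-A).
Proof.
 intros HF Cf H e He. destruct (H (e/2)) as [N K]; [lra|]. exists N. intros T S HT HS.
 rewrite (CI_FTC F); auto. destruct (K T HT) as [_ K1]. destruct (K S HS) as [K2 _].
 replace (F S-F (-T)%R-(B-A))%C with ((F S-B)-(F (-T)%R-A))%C by Cring.
 ub Cmod_triangle. rewrite Cmod_opp. lra.
Qed.

Lemma is_CL_Re_le f g l m : CC f -> RC g -> is_CL f l -> is_CL (fun t => RtoC (g t)) m ->
 (forall t, Cmod (f t) <= g t) -> Cmod l <= Re m.
Proof.
 intros Cf Cg H1 H2 H. apply le_epsilon. intros e He. destruct (H1 (e/2)) as [N1 K1]; [lra|]. destruct (H2 (e/2)) as [N2 K2]; [lra|].
 set (T := Rmax 0 (Rmax N1 N2)). have A1 := Rmax_l N1 N2. have A2 := Rmax_r N1 N2.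
 have A3 := Rmax_l 0 (Rmax N1 N2). have A4 := Rmax_r 0 (Rmax N1 N2). fold T in A3, A4.
 specialize (K1 T T $ $). specialize (K2 T T $ $).
 have B := CI_bound f g (-T) T $ Cf Cg ltac:(auto).
 have D := re_le_Cmod (CI (fun t => (g t)) (-T) T-m)%C. apply Rabs_le_between in D.
 have D2 := Cmod_triangle_inv l (CI f (-T) T). rewrite Cmod_minus_sym in D2.
 have : Re (CI (fun t => (g t)) (-T) T-m)%C = RInt g (-T) T-Re m by reflexivity.
 go.
Qed.

Lemma is_CL_RtoC_Im g m : RC g -> is_CL (fun t => RtoC (g t)) m -> Im m = 0.
Proof.
 intros Cg H. have H2 := is_CL_conj _ _ (CC_RtoC g Cg) H.
 have E : Cconj m = m.
 { eapply is_CL_unique; [|exact H]. eapply is_CL_ext; [|exact H2]. intros t; simpl. Cring. }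
 have F : Im (Cconj m) = Im m by (rewrite E; reflexivity). unfold Im, Cconj in *; simpl in F. lra.
Qed.

Lemma is_CL_Re_ge0 g m : RC g -> is_CL (fun t => RtoC (g t)) m -> (forall t, 0 <= g t) -> 0 <= Re m.
Proof.
 intros Cg H P. have K := is_CL_Re_le _ g m m (CC_RtoC _ Cg) Cg H H.
 le_tr; [apply Cmod_ge_0|apply K]. intros t. rewrite Cmod_R, Rabs_pos_eq; auto. lra.
Qed.

Definition ebound (M c : R) (g : R -> C) := forall t, Cmod (g t) <= M*exp (-c*Rabs t).

Lemma RC_eabs c : RC (fun t => exp (-c*Rabs t)).
Proof. apply RC_comp; [apply RC_exp|]. apply RC_mult; auto using RC_const, RC_abs. Qed.

Lemma RInt_exp_neg c a b : 0 < c -> RInt (fun t => exp (-c*t)) a b = (exp (-c*a)-exp (-c*b))/c.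
Proof.
 intros Hc. apply is_RInt_unique.
 replace ((exp (-c*a)-exp (-c*b))/c) with (minus (-exp (-c*b)/c) (-exp (-c*a)/c)) by (unfold minus, plus, opp; simpl; field; lra).
 apply (is_RInt_derive (fun t => - exp (-c*t)/c)).
 - intros t _. auto_derive; auto. go.
 - intros t _. apply RC_comp; [apply RC_exp|]. apply RC_mult; auto using RC_const, RC_id.
Qed.

Lemma CI_tail_pos M c g a b : 0 < c -> 0 <= M -> CC g -> ebound M c g -> 0 <= a <= b ->
 Cmod (CI g a b) <= M/c*exp (-c*a).
Proof.
 intros Hc HM Cg H Hab.
 have K := CI_bound g (fun t => M*exp (-c*t)) a b $ Cg.
 ub K.
 - apply RC_mult; [apply RC_const|]. apply RC_comp; [apply RC_exp|]. apply RC_mult; auto using RC_const, RC_id.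
 - intros t Ht. rewrite <- (Rabs_pos_eq t) at 2 by lra. go.
 - rewrite RInt_Rscal by (apply RC_comp; [apply RC_exp|]; apply RC_mult; auto using RC_const, RC_id).
  rewrite RInt_exp_neg by lra.
  unfold Rdiv. rewrite Rmult_assoc. mul_l; [lra|]. rewrite (Rmult_comm (/c)).
  mul_r; [go|]. generalize (exp_pos (-c*b)); lra.
Qed.

Lemma CI_tail_neg M c g a b : 0 < c -> 0 <= M -> CC g -> ebound M c g -> 0 <= a <= b ->
 Cmod (CI g (-b) (-a)) <= M/c*exp (-c*a).
Proof.
 intros Hc HM Cg H Hab. rewrite <- CI_neg by auto.
 apply CI_tail_pos; auto.
 - destruct Cg as [C1 C2]. have : RC (fun t => - t).
  { eapply RC_ext; [|apply (RC_minus _ _ (RC_const 0) RC_id)]. go. }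
  split; [apply (RC_comp (fun t => Re (g t)))|apply (RC_comp (fun t => Im (g t)))]; auto.
 - intros t. rewrite <- Rabs_Ropp. go.
Qed.

Lemma ebound_M M c g : ebound M c g -> 0 <= M.
Proof.
 intros H. specialize (H 0). rewrite Rabs_R0, Rmult_0_r, exp_0 in H. generalize (Cmod_ge_0 (g 0)); lra.
Qed.

Lemma exp_small c : 0 < c -> forall K eps, 0 < eps -> exists N, 0 <= N /\ forall T, N <= T -> K*exp (-c*T) <= eps.
Proof.
 intros Hc K eps He. exists (Rmax 0 (Rabs K/(eps*c))). split; [apply Rmax_l|].
 intros T HT. have H1 : Rabs K/(eps*c) <= T by (le_tr; [apply Rmax_r|exact HT]).
 apply Rle_div_l in H1; [|nra].
 have E1 := exp_ineq1_le (c*T).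
 replace (exp (-c*T)) with (/exp (c*T)) by (rewrite <- exp_Ropp; f_equal; ring).
 have P := exp_pos (c*T).
 apply Rmult_le_reg_r with (exp (c*T)); [go|]. rewrite Rmult_assoc, Rinv_l by lra.
 have Q := Rle_abs K. nra.
Qed.

(** The constants are kept explicit because [mainI_closed] uses this to replace a finite range of
    integration by the whole line. *)
Lemma CL_tail M c g l : 0 < c -> CC g -> ebound M c g -> is_CL g l -> forall T S, 0 <= T -> 0 <= S ->
 Cmod (CI g (-T) S-l)%C <= M/c*(exp (-c*T)+exp (-c*S)).
Proof.
 intros Hc Cg H HL T S HT HS. have HM := ebound_M _ _ _ H.
 apply le_epsilon. intros e He. destruct (HL e He) as [N K].
 set (U := Rmax N (Rmax T S)). have A1 := Rmax_l N (Rmax T S). have A2 := Rmax_r N (Rmax T S).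
 have A3 := Rmax_l T S. have A4 := Rmax_r T S. fold U in A1, A2.
 specialize (K U U A1 A1).
 rewrite (CI_Chasles g _ (-T) U Cg), (CI_Chasles g _ S U Cg) in K.
 replace (CI g (-T) S-l)%C with ((CI g (-U) (-T)+(CI g (-T) S+CI g S U)-l)-CI g (-U) (-T)-CI g S U)%C by Cring.
 have B1 := CI_tail_neg M c g T U Hc HM Cg H $.
 have B2 := CI_tail_pos M c g S U Hc HM Cg H $.
 ub Cmod_triangle. rewrite Cmod_opp.
 have Q := Cmod_triangle (CI g (-U) (-T)+(CI g (-T) S+CI g S U)-l) (-CI g (-U) (-T)). rewrite Cmod_opp in Q.
 unfold Cminus in *. lra.
Qed.

Lemma CL_exists M c g : 0 < c -> CC g -> ebound M c g -> exists l, is_CL g l.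
Proof.
 intros Hc Cg H. have HM := ebound_M _ _ _ H.
 assert (Hcau : forall eps, 0 < eps -> exists N, 0 <= N /\ forall T S U V, N <= T -> N <= S -> N <= U -> N <= V ->
   Cmod (CI g (-T) S-CI g (-U) V)%C <= eps).
 { intros eps He. destruct (exp_small c Hc (M/c) (eps/4)) as [N [HN K]]; [lra|]. exists N. split; auto.
  have Q : forall T S, N <= T -> N <= S -> Cmod (CI g (-T) S-CI g (-N) N)%C <= eps/2.
  { intros T S HT HS. rewrite (CI_Chasles g _ (-N) S Cg), (CI_Chasles g _ N S Cg).
   replace (CI g (-T) (-N)+(CI g (-N) N+CI g N S)-CI g (-N) N)%C with (CI g (-T) (-N)+CI g N S)%C by Cring.
   have B1 := CI_tail_neg M c g N T Hc HM Cg H $.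
   have B2 := CI_tail_pos M c g N S Hc HM Cg H $.
   specialize (K N $). le_tr; [go|]. lra. }
  intros T S U V HT HS HU HV. have Q1 := Q T S HT HS. have Q2 := Q U V HU HV.
  replace (CI g (-T) S-CI g (-U) V)%C with ((CI g (-T) S-CI g (-N) N)-(CI g (-U) V-CI g (-N) N))%C by Cring.
  ub Cmod_triangle. rewrite Cmod_opp. lra. }
 assert (HR : forall p : C -> R, (forall z, Rabs (p z) <= Cmod z) -> (forall z w, p (z-w)%C = p z-p w) ->
   ex_finite_lim_seq (fun n => p (CI g (-INR n) (INR n)))).
 { intros p P1 P2. apply ex_lim_seq_cauchy_corr. intros eps. destruct (Hcau (eps/2)) as [N [HN K]]; [generalize (cond_pos eps); lra|].
  destruct (INR_unbounded N) as [n0 Hn0]. exists n0. intros n m Hn Hm.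
  apply le_INR in Hn. apply le_INR in Hm.
  rewrite <- P2. eapply Rle_lt_trans; [go|]. eapply Rle_lt_trans; [apply K; lra|]. generalize (cond_pos eps); lra. }
 destruct (HR Re re_le_Cmod) as [a Ha]; [go|].
 destruct (HR Im im_le_Cmod) as [b Hb]; [go|].
 exists (a, b). intros eps He. destruct (Hcau (eps/2)) as [N [HN K]]; [lra|].
 apply is_lim_seq_spec in Ha. apply is_lim_seq_spec in Hb.
 destruct (Ha (mkposreal (eps/4) $)) as [n1 K1]. destruct (Hb (mkposreal (eps/4) $)) as [n2 K2].
 destruct (INR_unbounded N) as [n0 Hn0].
 exists N. intros T S HT HS. set (n := (n0+n1+n2)%nat).
 specialize (K1 n ltac:(go)). specialize (K2 n ltac:(go)).
 change (Rabs (Re (CI g (-INR n) (INR n))-a) < eps/4) in K1. change (Rabs (Im (CI g (-INR n) (INR n))-b) < eps/4) in K2.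
 have Hn : N <= INR n. { have X := le_INR n0 n ltac:(go). lra. }
 specialize (K T S (INR n) (INR n) HT HS Hn Hn).
 replace (CI g (-T) S-(a, b))%C with ((CI g (-T) S-CI g (-INR n) (INR n))+(CI g (-INR n) (INR n)-(a, b)))%C by Cring.
 le_tr; [go|].
 have Q := Cmod_le_Re_Im (CI g (-INR n) (INR n)-(a, b))%C.
 replace (Re (CI g (-INR n) (INR n)-(a, b))%C) with (Re (CI g (-INR n) (INR n))-a) in Q by go.
 replace (Im (CI g (-INR n) (INR n)-(a, b))%C) with (Im (CI g (-INR n) (INR n))-b) in Q by go.
  go.
Qed.

(** Symmetric truncations at the integers give a total function; it is the improper integral
    whenever one exists ([is_CL_IL]). *)
Definition IL (g : R -> C) : C :=
 (real (Lim_seq (fun n => Re (CI g (-INR n) (INR n)))), real (Lim_seq (fun n => Im (CI g (-INR n) (INR n))))).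

Lemma is_CL_IL g l : is_CL g l -> IL g = l.
Proof.
 intros H. apply injective_projections; simpl.
 - rewrite (is_lim_seq_unique _ (Re l)); [go|]. apply is_lim_seq_spec. intros eps.
  destruct (H (eps/2)) as [N K]; [generalize (cond_pos eps); lra|]. destruct (INR_unbounded N) as [n0 Hn0]. exists n0. intros n Hn.
  apply le_INR in Hn. specialize (K (INR n) (INR n) $ $).
  have Q := re_le_Cmod (CI g (-INR n) (INR n)-l)%C.
  change (Rabs (Re (CI g (-INR n) (INR n))-Re l) < eps).
  replace (Re (CI g (-INR n) (INR n)-l)%C) with (Re (CI g (-INR n) (INR n))-Re l) in Q by go.
  generalize (cond_pos eps); lra.
 - rewrite (is_lim_seq_unique _ (Im l)); [go|]. apply is_lim_seq_spec. intros eps.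
  destruct (H (eps/2)) as [N K]; [generalize (cond_pos eps); lra|]. destruct (INR_unbounded N) as [n0 Hn0]. exists n0. intros n Hn.
  apply le_INR in Hn. specialize (K (INR n) (INR n) $ $).
  have Q := im_le_Cmod (CI g (-INR n) (INR n)-l)%C.
  change (Rabs (Im (CI g (-INR n) (INR n))-Im l) < eps).
  replace (Im (CI g (-INR n) (INR n)-l)%C) with (Im (CI g (-INR n) (INR n))-Im l) in Q by go.
  generalize (cond_pos eps); lra.
Qed.

Lemma IL_is_CL M c g : 0 < c -> CC g -> ebound M c g -> is_CL g (IL g).
Proof. intros Hc Cg H. destruct (CL_exists M c g Hc Cg H) as [l Hl]. rewrite (is_CL_IL g l Hl). go. Qed.

Lemma CL_norm_bound M c g l : 0 < c -> CC g -> ebound M c g -> is_CL g l -> Cmod l <= 2*M/c.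
Proof.
 intros Hc Cg H HL. have K := CL_tail M c g l Hc Cg H HL 0 0 $ $.
 rewrite Ropp_0 in K. unfold CI in K. rewrite !RInt_point in K.
 rewrite Cmod_minus_sym in K.
 match type of K with Cmod ?x <= _ => replace x with l in K by (apply injective_projections; simpl; unfold zero; simpl; ring) end.
 rewrite Rmult_0_r, exp_0 in K. lra.
Qed.

(** * Two-sided Laplace transforms *)

Definition Lin (phi : R -> R) (s : C) (v : R) : C := (RtoC (phi v)*Cexp (s*RtoC v))%C.
(** In the variable y = e^v this is a Mellin transform, which is how Gamma, eta and X are
    represented below. *)
Definition Lap (phi : R -> R) (s : C) : C := IL (Lin phi s).
Definition dom (phi : R -> R) (a b : R) : Prop :=
 forall sg, a < sg < b -> exists M c, 0 < c /\ forall v, Rabs (phi v)*exp (sg*v) <= M*exp (-c*Rabs v).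

Lemma Cmod_Lin phi s v : Cmod (Lin phi s v) = Rabs (phi v)*exp (Re s*v).
Proof.
 unfold Lin. rewrite Cmod_mult, Cmod_R, Cmod_Cexp. f_equal. f_equal. go.
Qed.

Lemma CC_Lin phi s : RC phi -> CC (Lin phi s).
Proof.
 intros H. apply CC_mult; [apply CC_RtoC; exact H|]. apply CC_Cexp. apply CC_mult; [apply CC_const|apply CC_RtoC, RC_id].
Qed.

Lemma dom_ebound phi a b s : dom phi a b -> a < Re s < b -> exists M c, 0 < c /\ ebound M c (Lin phi s).
Proof.
 intros H Hs. destruct (H (Re s) Hs) as [M [c [Hc K]]]. exists M, c. split; auto. intros v. rewrite Cmod_Lin. go.
Qed.

Lemma Lap_CL phi a b s : RC phi -> dom phi a b -> a < Re s < b -> is_CL (Lin phi s) (Lap phi s).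
Proof.
 intros Hp H Hs. destruct (dom_ebound _ a b s H Hs) as [M [c [Hc K]]]. apply (IL_is_CL M c); auto using CC_Lin.
Qed.

Lemma abs_exp_le c v : 0 < c -> Rabs v*exp (-c*Rabs v) <= 2/c*exp (-(c/2)*Rabs v).
Proof.
 intros Hc. replace (-c*Rabs v) with (-(c/2)*Rabs v+- (c/2)*Rabs v) by field.
 rewrite exp_plus, <- Rmult_assoc. mul_r; [go|].
 have E := exp_ineq1_le (c/2*Rabs v). replace (-(c/2)*Rabs v) with (-(c/2*Rabs v)) by ring.
 rewrite exp_Ropp. apply Rmult_le_reg_r with (exp (c/2*Rabs v)); [go|]. rewrite Rmult_assoc, Rinv_l by (generalize (exp_pos (c/2*Rabs v)); lra).
 assert (Rabs v = 2/c*(c/2*Rabs v)) by go.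
 rewrite Rmult_1_r, H at 1. go.
Qed.

Lemma dom_id_mult phi a b : dom phi a b -> dom (fun v => v*phi v) a b.
Proof.
 intros H sg Hs. destruct (H sg Hs) as [M [c [Hc K]]].
 have : 0 <= M. { specialize (K 0). rewrite Rabs_R0, !Rmult_0_r, exp_0 in K. generalize (Rabs_pos (phi 0)); lra. }
 exists (M*(2/c)), (c/2). split; [lra|]. intros v. rewrite Rabs_mult.
 rewrite Rmult_assoc. le_tr; [mul_l; [go|go]|].
 rewrite Rmult_assoc, <- Rmult_assoc, (Rmult_comm (Rabs v)), Rmult_assoc. mul_l; auto.
 apply abs_exp_le; auto.
Qed.

Lemma Lap_Cd phi a b s : RC phi -> dom phi a b -> a < Re s < b ->
 Cd (Lap phi) s (Lap (fun v => v*phi v) s).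
Proof.
 intros Hp H Hs. destruct (H (Re s) Hs) as [M [c [Hc K]]].
 have : 0 <= M. { specialize (K 0). rewrite Rabs_R0, !Rmult_0_r, exp_0 in K. generalize (Rabs_pos (phi 0)); lra. }
 (* The quadratic Taylor remainder brings |v|^2. Each factor |v| costs half of the decay rate, which
    leaves c/4; with |h| < c/8 a rate of c/8 remains for convergence. *)
 set (d := Rmin (c/8) (Rmin (Re s-a) (b-Re s))).
 have : d <= c/8 by apply Rmin_l.
 have : d <= Re s-a by (le_tr; [apply Rmin_r|apply Rmin_l]).
 have : d <= b-Re s by (le_tr; [apply Rmin_r|apply Rmin_r]).
 have : 0 < d by (repeat apply Rmin_pos; lra).
 set (M2 := M*(2/c)*(2/(c/2))).
 apply (Cd_taylor _ _ _ (2*M2/(c/8)) d); [go|].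
 intros h Hh.
 have Hre := re_le_Cmod h. apply Rabs_le_between in Hre.
 have Hsh : a < Re (s+h)%C < b by (unfold Re in *; simpl; lra).
 have A1 := Lap_CL _ a b _ Hp H Hsh. have A2 := Lap_CL _ a b _ Hp H Hs.
 have Hvp : RC (fun v => v*phi v) by (apply RC_mult; auto using RC_id).
 have A3 := Lap_CL _ a b s Hvp (dom_id_mult _ _ _ H) Hs.
 have A4 := is_CL_minus _ _ _ _ (CC_minus _ _ (CC_Lin _ _ Hp) (CC_Lin _ s Hp)) (CC_mult _ _ (CC_const h) (CC_Lin _ s Hvp))
   (is_CL_minus _ _ _ _ (CC_Lin _ _ Hp) (CC_Lin _ _ Hp) A1 A2) (is_CL_scal h _ _ (CC_Lin _ s Hvp) A3).
 rewrite Cmult_comm.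
 set (g := fun t : R => (Lin phi (s+h) t-Lin phi s t-h*Lin (fun v : R => (v*phi v)%R) s t)%C).
 have Cg : CC g.
 { apply CC_minus; [apply CC_minus; apply CC_Lin; auto|]. apply CC_mult; [apply CC_const|apply CC_Lin; auto]. }
 have Eb : ebound (M2*Cmod h^2) (c/8) g.
 { intros v. unfold g, Lin.
  replace ((phi v)*Cexp ((s+h)*v)-phi v*Cexp (s*v)-h*(RtoC (v*phi v)%R*Cexp (s*v)))%C
   with ((phi v)*Cexp (s*v)*(Cexp (h*v)-1-h*v))%C.
  2:{ replace ((s+h)*v)%C with (s*v+h*v)%C by Cring. rewrite Cexp_add. go. }
  rewrite Cmod_mult. fold (Lin phi s v). rewrite Cmod_Lin.
  le_tr; [apply Rmult_le_compat; [|go|go|apply Cexp_taylor2]|].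
  { go. }
  rewrite Cmod_mult, Cmod_R.
  have X := Rabs_pos v.
  have Q1 := abs_exp_le c v Hc. have Q2 := abs_exp_le (c/2) v $.
  have Q4 : Rabs v*(Rabs v*exp (-c*Rabs v)) <= 2/c*(2/(c/2))*exp (-(c/2/2)*Rabs v).
  { le_tr; [mul_l; [go|exact Q1]|].
   replace (Rabs v*(2/c*exp (-(c/2)*Rabs v))) with (2/c*(Rabs v*exp (-(c/2)*Rabs v))) by ring.
   rewrite Rmult_assoc. go. }
  replace (M*exp (-c*Rabs v)*((Cmod h*Rabs v)^2*exp (Cmod h*Rabs v)))
   with (M*Cmod h^2*((Rabs v*(Rabs v*exp (-c*Rabs v)))*exp (Cmod h*Rabs v))) by ring.
  replace (M2*Cmod h^2*exp (-(c/8)*Rabs v)) with (M*Cmod h^2*(2/c*(2/(c/2))*exp (-(c/8)*Rabs v))) by go.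
  mul_l; [go|].
  le_tr; [mul_r; [go|exact Q4]|].
  rewrite Rmult_assoc, <- exp_plus. go. }
 have Fin := CL_norm_bound _ (c/8) _ _ $ Cg Eb A4.
 go.
Qed.

#[export] Hint Resolve RC_plus RC_minus RC_mult RC_const RC_id RC_derive RC_exp RC_cos RC_sin RC_abs RC_int CC_const CC_RtoC CC_plus CC_minus CC_mult CC_Cexp CC_conj RC_Cmod RC_eabs CC_Lin : cont.

Lemma RtoC_neq0 (x : R) : x <> 0 -> RtoC x <> 0%C.
Proof. intros N H. apply N. exact (f_equal Re H). Qed.

Lemma Lin_RtoC phi (x v : R) : Lin phi (RtoC x) v = RtoC (phi v*exp (x*v)).
Proof. unfold Lin. rewrite <- RtoC_mult, Cexp_RtoC, <- RtoC_mult. go. Qed.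

Lemma RC_exp_lin x : RC (fun v => exp (x*v)).
Proof. apply RC_comp; [go|]. go. Qed.

Lemma Lap_real phi a b (x : R) : RC phi -> dom phi a b -> a < x < b -> Im (Lap phi (RtoC x)) = 0.
Proof.
 intros Cp Dp Hx. apply (is_CL_RtoC_Im (fun v => phi v*exp (x*v))).
 - apply RC_mult; auto using RC_exp_lin.
 - eapply is_CL_ext; [|apply (Lap_CL _ a b); auto]. apply Lin_RtoC.
Qed.

Lemma Lap_conj phi a b s : RC phi -> dom phi a b -> a < Re s < b -> Lap phi (Cconj s) = Cconj (Lap phi s).
Proof.
 intros Cp Dp Hs. apply is_CL_IL. eapply is_CL_ext; [|apply is_CL_conj; [|apply (Lap_CL _ a b); eauto]].
 - intros t. unfold Lin. replace (Cconj s*t)%C with (Cconj (s*t)) by Cring. rewrite Cexp_conj. Cring.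
 - go.
Qed.

Lemma Lap_even phi a b s : RC phi -> dom phi a b -> a < Re s < b -> (forall v, phi (-v) = phi v) ->
 Lap phi (-s)%C = Lap phi s.
Proof.
 intros Cp Dp Hs H. apply is_CL_IL. eapply is_CL_ext; [|apply is_CL_neg; [|apply (Lap_CL _ a b); eauto]].
 - intros t. unfold Lin. rewrite H. f_equal. f_equal. Cring.
 - go.
Qed.

Lemma Lap_shift phi a b s c : RC phi -> dom phi a b -> a < Re s < b ->
 Lap (fun v => phi (v+c)) s = (Cexp (-(s*RtoC c))*Lap phi s)%C.
Proof.
 intros Cp Dp Hs. apply is_CL_IL.
 eapply is_CL_ext; [|apply is_CL_scal; [|apply (is_CL_shift _ _ c (CC_Lin _ s Cp)); apply (Lap_CL _ a b); auto]].
 - intros t. unfold Lin.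
  replace (s*RtoC (t+c))%C with (s*t+s*c)%C by Cring. rewrite Cexp_add.
  transitivity (phi (t+c)%R*Cexp (s*t)*(Cexp (-(s*c))*Cexp (s*c)))%C; [Cring|].
  rewrite <- Cexp_add. replace (-(s*c)+s*c)%C with (RtoC 0) by Cring. rewrite Cexp_0. Cring.
 - destruct (CC_Lin _ s Cp) as [H1 H2].
  have : RC (fun t => t+c) by go.
  split; [apply (RC_comp (fun t => Re (Lin phi s t)))|apply (RC_comp (fun t => Im (Lin phi s t)))]; auto.
Qed.

Lemma Lap_lin phi psi a b s x y : RC phi -> RC psi -> dom phi a b -> dom psi a b -> a < Re s < b ->
 Lap (fun v => x*phi v+y*psi v) s = (RtoC x*Lap phi s+RtoC y*Lap psi s)%C.
Proof.
 intros Cp Cq Dp Dq Hs. apply is_CL_IL. have L1 := CC_Lin phi s Cp. have L2 := CC_Lin psi s Cq.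
 apply is_CL_ext with (fun t => RtoC x*Lin phi s t+RtoC y*Lin psi s t)%C.
 - intros t. unfold Lin. rewrite RtoC_plus, !RtoC_mult. Cring.
 - apply is_CL_plus; [exact (CC_mult _ _ (CC_const _) L1)|exact (CC_mult _ _ (CC_const _) L2)|apply is_CL_scal; auto; apply (Lap_CL phi a b); auto|apply is_CL_scal; auto; apply (Lap_CL psi a b); auto].
Qed.

Lemma Lap_ext phi psi s : (forall v, phi v = psi v) -> IL (Lin phi s) = IL (Lin psi s).
Proof.
 intros H. unfold IL. f_equal; f_equal; apply Lim_seq_ext; intros n; f_equal; apply CI_ext; intros t; unfold Lin; rewrite H; reflexivity.
Qed.

Lemma Cdr_ext f g t l : (forall x, f x = g x) -> Cdr f t l -> Cdr g t l.
Proof.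
 intros E [H1 H2]. split; [apply (is_derive_ext (fun x => Re (f x)))|apply (is_derive_ext (fun x => Im (f x)))]; auto;
 intros x; rewrite E; reflexivity.
Qed.

Lemma Cdr_eq f t a b : Cdr f t a -> a = b -> Cdr f t b.
Proof. intros H <-; exact H. Qed.

Lemma Cdr_mult f g t a b : Cdr f t a -> Cdr g t b -> Cdr (fun x => f x*g x)%C t (a*g t+f t*b)%C.
Proof.
 intros [A1 A2] [B1 B2]. split; unfold Re, Im in *; simpl.
 - eapply is_derive_eq; [apply is_derive_Rminus; apply is_derive_Rmult; eauto|]. go.
 - eapply is_derive_eq; [apply is_derive_Rplus; apply is_derive_Rmult; eauto|]. go.
Qed.

Lemma Lap_parts (phi dphi : R -> R) a b s : (forall v, is_derive phi v (dphi v)) -> RC dphi -> dom phi a b -> dom dphi a b -> a < Re s < b ->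
 Lap dphi s = (-(s*Lap phi s))%C.
Proof.
 intros Hd Cdp Dp Dd Hs.
 have Cp : RC phi by (intros t; apply (is_derive_cont _ _ _ (Hd t))).
 have K : is_CL (fun v => Lin dphi s v+s*Lin phi s v)%C (0-0)%C.
 { apply (is_CL_FTC (Lin phi s)).
  - intros v. unfold Lin.
   have Hd1 : Cdr (fun t => (phi t)) v ((dphi v)) by (split; [go|exact (is_derive_const 0 v)]).
   eapply Cdr_eq; [eapply Cdr_ext; [|apply (Cdr_mult _ _ _ _ _ Hd1 (Cexp_line_Cdr s v))]|].
   + intros t. simpl. f_equal. go.
   + replace (v*s)%C with (s*v)%C by Cring. Cring.
  - go.
  - intros eps He. destruct (dom_ebound _ a b s Dp Hs) as [M [c [Hc Eb]]].
   destruct (exp_small c Hc M _ He) as [N [HN K]]. exists N. intros T HT.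
   have Eb1 := Eb T. have Eb2 := Eb (-T). rewrite Rabs_Ropp in Eb2. rewrite Rabs_pos_eq in Eb1, Eb2 by lra.
   specialize (K T HT).
   replace (Lin phi s T-0)%C with (Lin phi s T) by Cring. replace (Lin phi s (-T)%R-0)%C with (Lin phi s (-T)) by Cring. lra. }
 have K2 := is_CL_plus _ _ _ _ (CC_Lin _ s Cdp) (CC_mult _ _ (CC_const s) (CC_Lin _ s Cp)) (Lap_CL _ a b s Cdp Dd Hs)
   (is_CL_scal s _ _ (CC_Lin _ s Cp) (Lap_CL _ a b s Cp Dp Hs)).
 have E := is_CL_unique _ _ _ K K2.
 replace (Lap dphi s) with ((Lap dphi s+s*Lap phi s)-s*Lap phi s)%C by Cring.
 rewrite <- E. Cring.
Qed.

(** * The Gaussian and its transform *)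

Definition gauss (al v : R) : R := exp (-al*v^2).

Lemma RC_gauss al : RC (gauss al).
Proof. apply RC_derive. intros t. unfold gauss. auto_derive; auto. Qed.

Lemma gauss_dom_sharp al : 0 < al -> forall sg v,
 gauss al v*exp (sg*v) <= exp ((Rabs sg+1)^2/(4*al))*exp (- 1*Rabs v).
Proof.
 intros Ha sg v. unfold gauss. rewrite <- !exp_plus. apply exp_le.
 have X := Rle_abs (sg*v). rewrite Rabs_mult in X. rewrite <- (pow2_abs v).
 set (w := Rabs v) in *. set (u := Rabs sg) in *.
 assert (0 <= al*(w-(u+1)/(2*al))^2) by go.
 replace (al*(w-(u+1)/(2*al))^2) with (al*w^2-(u+1)*w+(u+1)^2/(4*al)) in H by go.
 lra.
Qed.

Lemma gauss_dom al a b : 0 < al -> dom (gauss al) a b.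
Proof.
 intros Ha sg _. exists (exp ((Rabs sg+1)^2/(4*al))), 1. split; [lra|]. intros v.
 rewrite Rabs_pos_eq by (left; apply exp_pos). apply gauss_dom_sharp; auto.
Qed.

Definition Gs (al : R) (mu : C) : C := Lap (gauss al) mu.

(** Integrating g' = -2 al v g by parts yields the differential equation G' = mu/(2 al) G for the
    transform. *)
Lemma Gs_Cd al mu : 0 < al -> Cd (Gs al) mu (mu/RtoC (2*al)*Gs al mu).
Proof.
 intros Ha. eapply Cd_eq.
 - apply (Lap_Cd _ (Re mu-1) (Re mu+1)); [apply RC_gauss|apply gauss_dom; auto|lra].
 - have D := gauss_dom _ (Re mu-1) (Re mu+1) Ha. have D' := dom_id_mult _ _ _ D.
  have K := Lap_parts (gauss al) (fun v => 0*gauss al v+(- 2*al)*(v*gauss al v)) (Re mu-1) (Re mu+1) mu.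
  rewrite (Lap_lin _ _ (Re mu-1) (Re mu+1)) in K; auto using RC_gauss; [|apply RC_mult; auto using RC_id, RC_gauss|lra].
  have K2 : (0*Lap (gauss al) mu+RtoC (-2*al)*Lap (fun v : R => (v*gauss al v)%R) mu)%C = (-(mu*Lap (gauss al) mu))%C.
  { apply K; auto; [| | |lra].
   - intros v. unfold gauss. auto_derive; auto. go.
   - apply RC_plus; apply RC_mult; auto using RC_const, RC_gauss. apply RC_mult; auto using RC_id, RC_gauss.
   - intros sg Hs. destruct (D' sg Hs) as [M [c [Hc Q]]]. exists (2*al*M), c. split; auto. intros v.
    rewrite Rmult_0_l, Rplus_0_l, Rabs_mult. rewrite Rabs_left by lra. specialize (Q v).
    go. }
  have K3 : (RtoC (2*al)*Lap (fun v : R => (v*gauss al v)%R) mu = mu*Lap (gauss al) mu)%C.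
  { transitivity (-(0*Lap (gauss al) mu+RtoC (-2*al)*Lap (fun v : R => (v*gauss al v)%R) mu))%C; [Cring|]. rewrite K2. Cring. }
  transitivity (RtoC (2*al)*Lap (fun v : R => (v*gauss al v)%R) mu/RtoC (2*al))%C; [go|]. rewrite K3. go.
Qed.

Lemma C_zero_derive (F : C -> C) (mu : C) : (forall t : R, Cd F (t*mu)%C 0) -> F mu = F 0%C.
Proof.
 intros H. have K := C_mvt (fun t => F (t*mu)%C) (fun _ => 0%C) 0 1 0.
 simpl in K. rewrite Cmult_1_l, Cmult_0_l in K.
 have E : Cmod (F mu-F 0%C)%C <= 0.
 { ub K; [lra| | |lra].
  - intros t _. replace (RtoC 0) with (0*mu)%C by Cring. apply Cd_Cdr; [go|].
   split; unfold Re, Im; simpl; auto_derive; auto; ring.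
  - intros; rewrite Cmod_0; lra. }
 have X := Cmod_ge_0 (F mu-F 0%C)%C. have Z := Cmod_eq_0 _ (Rle_antisym _ _ E X).
 replace (F mu) with (F mu-F 0+F 0)%C by Cring. rewrite Z. Cring.
Qed.

(** Solves the equation of [Gs_Cd] along the ray from 0 to [mu]. The factor [Gs al 0] is still an
    unknown number at this point; its value is settled by [Kg_PI]. *)
Lemma Gs_formula al mu : 0 < al -> Gs al mu = (Gs al 0*Cexp (mu*mu/RtoC (4*al)))%C.
Proof.
 intros Ha.
 have H := C_zero_derive (fun m => Gs al m*Cexp (- /RtoC (4*al)*(m*m)))%C mu.
 have E : (Gs al mu*Cexp (- /RtoC (4*al)*(mu*mu)) = Gs al 0)%C.
 { rewrite H.
  - replace (- /RtoC (4*al)*(0*0))%C with (RtoC 0) by Cring. rewrite Cexp_0. Cring.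
  - intros t. eapply Cd_eq.
   + apply Cd_mult; [apply Gs_Cd; auto|]. apply Cd_comp; [go|].
    go.
   + go. }
 rewrite <- E. rewrite <- Cmult_assoc, <- Cexp_add.
 replace (- /RtoC (4*al)*(mu*mu)+mu*mu/RtoC (4*al))%C with (RtoC 0) by go. rewrite Cexp_0. Cring.
Qed.

Lemma is_CL_scale g l k : 0 < k -> CC g -> is_CL g l -> is_CL (fun t => RtoC k*g (k*t)%R)%C l.
Proof.
 intros Hk Cg H e He. destruct (H e He) as [N K]. exists (N/k). intros T S HT HS.
 apply Rle_div_l in HT; [|go]. apply Rle_div_l in HS; [|go].
 have E : CI (fun t => k*g (k*t)%R)%C (-T) S = CI g (-(T*k)) (S*k).
 { destruct Cg as [C1 C2]. unfold CI.
  have A := RInt_comp_lin (V:=R_CompleteNormedModule) (fun t => Re (g t)) k 0 (-T) S.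
  have B := RInt_comp_lin (V:=R_CompleteNormedModule) (fun t => Im (g t)) k 0 (-T) S.
  rewrite !Rplus_0_r in A, B. replace (k*- T) with (-(T*k)) in A, B by ring. rewrite (Rmult_comm k S) in A, B.
  rewrite <- A by go. rewrite <- B by go.
  f_equal; apply RInt_ext; intros t _; unfold Re, Im; simpl; unfold scal; simpl; unfold mult; simpl; rewrite Rplus_0_r; ring. }
 rewrite E. go.
Qed.

Lemma Gs0_scale al k : 0 < al -> 0 < k -> Gs (al*k^2) 0 = (/RtoC k*Gs al 0)%C.
Proof.
 intros Ha Hk. apply is_CL_IL.
 have H := Lap_CL _ (-1) 1 0 (RC_gauss _) (gauss_dom _ _ _ Ha) ltac:(simpl; lra).
 have Nk : RtoC k <> 0%C by (apply RtoC_neq0; lra).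
 have Cs : CC (fun t : R => (k*Lin (gauss al) 0 (k*t)%R)%C).
 { eapply CC_ext; [|apply (CC_RtoC (fun t => k*gauss al (k*t)))].
  - intros t. unfold Lin. rewrite Cmult_0_l, Cexp_0, RtoC_mult. Cring.
  - apply RC_mult; [apply RC_const|]. apply RC_comp; [apply RC_gauss|]. go. }
 eapply is_CL_ext; [|apply is_CL_scal; [exact Cs|apply is_CL_scale; [go|apply CC_Lin, RC_gauss|go]]].
 intros t. unfold Lin. rewrite !Cmult_0_l. rewrite Cmult_assoc, Cinv_l, Cmult_1_l by exact Nk. f_equal. f_equal.
 unfold gauss. go.
Qed.

#[export] Hint Resolve RtoC_neq0 RC_exp_lin RC_gauss : cont.

(** * Poisson kernel and the theta function *)

Definition is_RL (f : R -> R) (l : R) : Prop := is_CL (fun t => RtoC (f t)) (RtoC l).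

Lemma is_RL_ext f g l : (forall t, f t = g t) -> is_RL f l -> is_RL g l.
Proof. intros E. apply is_CL_ext. intros t; rewrite E; reflexivity. Qed.

Lemma is_RL_plus f g l m : RC f -> RC g -> is_RL f l -> is_RL g m -> is_RL (fun t => f t+g t) (l+m).
Proof.
 intros Cf Cg H1 H2. unfold is_RL. rewrite RtoC_plus. eapply is_CL_ext; [|apply (is_CL_plus (fun t => (f t)) (fun t => (g t))); eauto using CC_RtoC].
 intros t; simpl. go.
Qed.

Lemma is_RL_scal k f l : RC f -> is_RL f l -> is_RL (fun t => k*f t) (k*l).
Proof.
 intros Cf H. unfold is_RL. rewrite RtoC_mult. eapply is_CL_ext; [|apply is_CL_scal; eauto using CC_RtoC].
 intros t; simpl. go.
Qed.

Lemma is_RL_Re g l : CC g -> is_CL g l -> is_RL (fun t => Re (g t)) (Re l).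
Proof.
 intros Cg H. have Cc := CC_conj g Cg. unfold is_RL. apply is_CL_ext with (fun t => RtoC (/2)*(g t+Cconj (g t)))%C.
 - intros t. apply injective_projections; unfold Re; simpl; field.
 - replace (RtoC (Re l)) with (RtoC (/2)*(l+Cconj l))%C by (apply injective_projections; unfold Re; simpl; field).
  apply is_CL_scal; [exact (CC_plus _ _ Cg Cc)|]. exact (is_CL_plus _ _ _ _ Cg Cc H (is_CL_conj _ _ Cg H)).
Qed.

Lemma is_RL_abs_le f g l m : RC f -> RC g -> is_RL f l -> is_RL g m -> (forall t, Rabs (f t) <= g t) -> Rabs l <= m.
Proof.
 intros Cf Cg H1 H2 H. rewrite <- Cmod_R. change m with (Re (m)).
 apply (is_CL_Re_le (fun t => (f t)) g); auto using CC_RtoC. intros t; rewrite Cmod_R; auto.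
Qed.

Lemma is_RL_RInt f l : is_RL f l -> forall eps, 0 < eps -> exists N, forall T S, N <= T -> N <= S -> Rabs (RInt f (-T) S-l) <= eps.
Proof.
 intros H eps He. destruct (H eps He) as [N K]. exists N. intros T S HT HS.
 le_tr; [|apply (K T S HT HS)]. apply (re_le_Cmod (CI (fun t : R => f t) (-T) S-l)%C).
Qed.

Lemma exp_INR (a : R) (n : nat) : exp (INR n*a) = exp a^n.
Proof.
 induction n as [|n IH]; [simpl; rewrite Rmult_0_l, exp_0; reflexivity|].
 rewrite S_INR, Rmult_plus_distr_r, Rmult_1_l, exp_plus, IH. go.
Qed.

Lemma INR_S_ge1 n : 1 <= INR (S n).
Proof. rewrite S_INR. generalize (pos_INR n); lra. Qed.

Lemma ex_series_exp_lin c : 0 < c -> ex_series (fun n => exp (-c*INR (S n))).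
Proof.
 intros Hc. apply (ex_series_ext (fun n => exp (-c)^n*exp (-c))).
 - intros n. rewrite S_INR, <- exp_INR, <- exp_plus. go.
 - apply ex_series_scal_r. apply ex_series_geom. rewrite Rabs_pos_eq by go.
  rewrite <- exp_0. apply exp_increasing. lra.
Qed.

Lemma ex_series_pos_le (a b : nat -> R) : (forall n, 0 <= a n <= b n) -> ex_series b -> ex_series a.
Proof.
 intros H Hb. apply (ex_series_le (V:=R_CompleteNormedModule) a b); auto.
 intros n. rewrite Rabs_pos_eq; apply H.
Qed.

Lemma sum_n_le_Series (a : nat -> R) N : (forall n, 0 <= a n) -> ex_series a -> sum_n a N <= Series a.
Proof.
 intros Ha Hs. have K := Series_correct _ Hs.
 apply (is_lim_seq_incr_compare _ _ K).
 intros n. rewrite sum_Sn. change (sum_n a n <= sum_n a n+a (S n)). generalize (Ha (S n)); lra.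
Qed.

Lemma Series_pos (a : nat -> R) : (forall n, 0 <= a n) -> ex_series a -> 0 <= Series a.
Proof.
 intros Ha Hs. le_tr; [|apply (sum_n_le_Series a 0 Ha Hs)]. rewrite sum_O. go.
Qed.

Lemma exp_sq_le c n : 0 < c -> exp (-c*INR (S n)^2) <= exp (-c*INR (S n)).
Proof. intros Hc. apply exp_le. have H := INR_S_ge1 n. set (m := INR (S n)) in *. assert (0 <= c*(m^2-m)) by (apply Rmult_le_pos; nra). lra. Qed.

Lemma ex_series_exp_sq c : 0 < c -> ex_series (fun n => exp (-c*INR (S n)^2)).
Proof.
 intros Hc. apply (ex_series_pos_le _ (fun n => exp (-c*INR (S n)))); [|apply ex_series_exp_lin; auto].
 split; [go|apply exp_sq_le; auto].
Qed.

Lemma ex_series_n_exp_sq c : 0 < c -> ex_series (fun n => INR (S n)*exp (-c*INR (S n)^2)).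
Proof.
 intros Hc. apply (ex_series_pos_le _ (fun n => 2/c*exp (-(c/2)*INR (S n)))).
 - intros n. have H := INR_S_ge1 n. split; [go|].
  have K := abs_exp_le c (INR (S n)) Hc. rewrite Rabs_pos_eq in K by lra.
  le_tr; [|exact K]. mul_l; [lra|]. apply exp_sq_le; auto.
 - apply (ex_series_scal_l (V:=R_NormedModule) _ _).
  apply ex_series_exp_lin. lra.
Qed.

Definition om (x : R) : R := Series (fun n => exp (-(PI*x)*INR (S n)^2)).

Definition poissonN (r : R) (N : nat) (y : R) : R := 1+2*sum_n (fun k => r^(S k)*cos (2*PI*INR (S k)*y)) N.
Definition poisson (r y : R) : R := (1-r^2)/(1-2*r*cos (2*PI*y)+r^2).

Lemma poisson_den r y : 0 < r < 1 -> (1-r)^2 <= 1-2*r*cos (2*PI*y)+r^2.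
Proof. intros H. generalize (COS_bound (2*PI*y)). nra. Qed.

(** Multiplication by the denominator of the kernel makes the cosine series telescope, and only the
    two last terms survive. *)
Lemma poissonN_mult r N y :
 poissonN r N y*(1-2*r*cos (2*PI*y)+r^2) =
 1-r^2-2*r^(N+2)*cos (2*PI*INR (N+2)*y)+2*r^(N+3)*cos (2*PI*INR (N+1)*y).
Proof.
 induction N as [|N IH].
 - unfold poissonN. rewrite sum_O. simpl (0+2)%nat. simpl (0+1)%nat.
  replace (INR 2) with 2 by go. replace (INR 1) with 1 by reflexivity.
  replace (2*PI*2*y) with (2*(2*PI*y)) by ring. rewrite cos_2a_cos.
  replace (2*PI*1*y) with (2*PI*y) by ring. go.
 - unfold poissonN in *. rewrite sum_Sn.
  set (s := sum_n _ N) in *.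
  change (plus s (r^S (S N)*cos (2*PI*INR (S (S N))*y))) with (s+r^S (S N)*cos (2*PI*INR (S (S N))*y)).
  replace (1+2*(s+r^S (S N)*cos (2*PI*INR (S (S N))*y))) with ((1+2*s)+2*r^S (S N)*cos (2*PI*INR (S (S N))*y)) by ring.
  rewrite Rmult_plus_distr_r, IH.
  replace (S N+2)%nat with (S (S (S N))) by lia. replace (S N+3)%nat with (S (S (S (S N)))) by lia.
  replace (S N+1)%nat with (S (S N)) by lia. replace (N+2)%nat with (S (S N)) by lia.
  replace (N+3)%nat with (S (S (S N))) by lia. replace (N+1)%nat with (S N) by lia.
  set (t := 2*PI*y). set (m := 2*PI*INR (S (S N))*y).
  replace (2*PI*INR (S (S (S N)))*y) with (m+t) by (unfold m, t; rewrite (S_INR (S (S N))); ring).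
  replace (2*PI*INR (S N)*y) with (m-t) by (unfold m, t; rewrite (S_INR (S N)); ring).
  rewrite cos_plus, cos_minus. go.
Qed.

Lemma poisson_approx r N y : 0 < r < 1 -> Rabs (poisson r y-poissonN r N y) <= 4*r^(N+2)/(1-r)^2.
Proof.
 intros Hr. have HD := poisson_den r y Hr. have HP := poissonN_mult r N y.
 set (D := 1-2*r*cos (2*PI*y)+r^2) in *.
 have : 0 < (1-r)^2 by go. unfold poisson. fold D.
 replace ((1-r^2)/D-poissonN r N y) with ((2*r^(N+2)*cos (2*PI*INR (N+2)*y)-2*r^(N+3)*cos (2*PI*INR (N+1)*y))/D)
  by (replace (poissonN r N y) with ((poissonN r N y*D)/D) by go; rewrite HP; field; lra).
 unfold Rdiv. rewrite Rabs_mult, Rabs_inv, (Rabs_pos_eq D) by lra.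
 have : 0 <= r^(N+2) by go.
 have : 0 <= r^(N+3) <= r^(N+2).
 { replace (N+3)%nat with (S (N+2)) by lia. simpl. nra. }
 apply Rmult_le_compat; [go|go| |go].
 generalize (COS_bound (2*PI*INR (N+2)*y)) (COS_bound (2*PI*INR (N+1)*y)). intros.
 apply Rabs_le. nra.
Qed.

Lemma RC_poly_cos k : RC (fun y => cos (k*y)).
Proof. apply RC_comp; [go|]. go. Qed.

Lemma RC_poisson r : 0 < r < 1 -> RC (poisson r).
Proof.
 intros Hr. apply RC_derive. intros y. unfold poisson. have H := poisson_den r y Hr.
 auto_derive. go.
Qed.

Lemma RC_sum (f : nat -> R -> R) N : (forall k, RC (f k)) -> RC (fun y => sum_n (fun k => f k y) N).
Proof.
 intros H. induction N as [|N IH].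
 - apply (RC_ext (f O)); [intros; rewrite sum_O; reflexivity|go].
 - apply (RC_ext (fun y => sum_n (fun k => f k y) N+f (S N) y)); [intros; rewrite sum_Sn; reflexivity|go].
Qed.

Lemma RC_pterm r k : RC (fun y => r^S k*cos (2*PI*INR (S k)*y)).
Proof. apply RC_mult; [go|apply RC_poly_cos]. Qed.

Lemma RC_poissonN r N : RC (poissonN r N).
Proof.
 apply RC_plus; [go|]. apply RC_mult; [go|]. apply RC_sum. apply RC_pterm.
Qed.

Lemma sin_INR_PI k : sin (INR k*PI) = 0.
Proof. apply sin_eq_0_1. exists (Z.of_nat k). rewrite INR_IZR_INZ. go. Qed.

Lemma RInt_cos_period k : RInt (fun y => cos (2*PI*INR (S k)*y)) (-(1/2)) (1/2) = 0.
Proof.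
 have Hk := INR_S_ge1 k. have Hpi := PI_RGT_0.
 apply is_RInt_unique.
 replace 0 with (minus (sin (2*PI*INR (S k)*(1/2))/(2*PI*INR (S k))) (sin (2*PI*INR (S k)*- (1/2))/(2*PI*INR (S k)))).
 - apply (is_RInt_derive (fun y => sin (2*PI*INR (S k)*y)/(2*PI*INR (S k)))).
  + intros y _. set (K := 2*PI*INR (S k)). auto_derive; auto. go.
  + intros y _. apply RC_poly_cos.
 - replace (2*PI*INR (S k)*- (1/2)) with (-(INR (S k)*PI)) by field. replace (2*PI*INR (S k)*(1/2)) with (INR (S k)*PI) by field.
  rewrite sin_neg, sin_INR_PI. unfold minus, plus, opp; simpl. go.
Qed.

Lemma RInt_poissonN r N : RInt (poissonN r N) (-(1/2)) (1/2) = 1.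
Proof.
 unfold poissonN. induction N as [|N IH].
 - rewrite (RInt_ext _ (fun y => 1+2*r^1*cos (2*PI*INR 1*y))).
  2:{ intros y _. rewrite sum_O. go. }
  rewrite (RInt_plus (V:=R_CompleteNormedModule) _ _).
  + rewrite RInt_Rscal by apply RC_poly_cos. rewrite RInt_cos_period, RInt_const. unfold plus, scal; simpl. unfold mult; simpl. field.
  + go.
  + apply RC_int. apply RC_mult; [go|apply RC_poly_cos].
 - transitivity (RInt (fun y0 : R => 1+2*sum_n (fun k : nat => r^S k*cos (2*PI*INR (S k)*y0)) N) (-(1/2)) (1/2)); [|go].
  rewrite (RInt_ext _ (fun y => (1+2*sum_n (fun k => r^S k*cos (2*PI*INR (S k)*y)) N)+2*r^(S (S N))*cos (2*PI*INR (S (S N))*y))).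
  2:{ intros y _. rewrite sum_Sn. match goal with |- context [plus ?a ?b] => change (plus a b) with (a+b) end. go. }
  rewrite (RInt_plus (V:=R_CompleteNormedModule) _ _).
  + rewrite RInt_Rscal by apply RC_poly_cos. rewrite RInt_cos_period, Rmult_0_r. match goal with |- plus ?a ?b = _ => change (plus a b) with (a+b) end. go.
  + apply RC_int. apply RC_poissonN.
  + apply RC_int. apply RC_mult; [go|apply RC_poly_cos].
Qed.

Lemma geom_small r K : 0 < r < 1 -> forall eps, 0 < eps -> exists N, forall n, (N <= n)%nat -> K*r^(n+2) <= eps.
Proof.
 intros Hr eps He. destruct (pow_lt_1_zero r ltac:(rewrite Rabs_pos_eq; lra) (eps/(Rabs K+1))) as [N HN].
 { go. }
 exists N. intros n Hn. specialize (HN (n+2)%nat ltac:(lia)). have : 0 <= r^(n+2) by go.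
 rewrite Rabs_pos_eq in HN by auto. have Q := Rabs_pos K. apply Rlt_div_r in HN; [|lra]. have Z := Rle_abs K. nra.
Qed.

Lemma RInt_poisson r : 0 < r < 1 -> RInt (poisson r) (-(1/2)) (1/2) = 1.
Proof.
 intros Hr. apply Rminus_diag_uniq. apply Rabs_eq_0. apply Rle_antisym; [|go]. apply le_epsilon. intros e He.
 destruct (geom_small r (4/(1-r)^2) Hr e He) as [N HN]. specialize (HN N (le_n N)).
 have E : RInt (fun y => poisson r y-poissonN r N y) (-(1/2)) (1/2) = RInt (poisson r) (-(1/2)) (1/2)-1.
 { transitivity (RInt (poisson r) (-(1/2)) (1/2)-RInt (poissonN r N) (-(1/2)) (1/2)); [|rewrite RInt_poissonN; reflexivity].
  apply (RInt_minus (V:=R_CompleteNormedModule) _ _); apply RC_int; [apply RC_poisson; auto|apply RC_poissonN]. }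
 rewrite <- E.
 have K := abs_RInt_le_const (fun y => poisson r y-poissonN r N y) (-(1/2)) (1/2) (4*r^(N+2)/(1-r)^2) $.
 ub K.
 - apply RC_int. apply RC_minus; auto using RC_poisson, RC_poissonN.
 - intros t _. apply poisson_approx; auto.
 - lra.
Qed.

(** Weaker than the chord bound 2t/PI, but since PI >= 3 it gives w <= sin(PI w) on [0, 1/2], the
    form used in [poisson_sq]. *)
Lemma sin_lower t : 0 <= t <= PI/2 -> t/3 <= sin t.
Proof.
 intros Ht. have P4 := PI_4.
 destruct (Rle_lt_dec t (PI/3)) as [H|H].
 - destruct (MVT_gen (fun u => sin u-u/2) 0 t (fun u => cos u-1/2)) as [c [Hc E]].
  + intros u _. auto_derive; auto. field.
  + intros u _. apply continuity_pt_filterlim. have X : RC (fun u => sin u-u/2) by (apply RC_derive; intros w; auto_derive; auto). exact (X u).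
  + rewrite Rmin_left, Rmax_right in Hc by lra. rewrite sin_0 in E.
   assert (1/2 <= cos c). { rewrite <- cos_PI3. apply cos_decr_1; lra. }
   go.
 - assert (sin (PI/3) <= sin t) by (apply sin_incr_1; lra). rewrite sin_PI3 in H0.
  assert (17/10 < sqrt 3). { rewrite <- (sqrt_Rsqr _) by lra. apply sqrt_lt_1; unfold Rsqr; lra. }
  go.
Qed.

(** The denominator is (1-r)^2 + 4 r sin(PI u)^2 >= 4 r u^2. The bound tends to 0 with r -> 1: this
    is the concentration of the kernel at 0. *)
Lemma poisson_sq r u : 0 < r < 1 -> - (1/2) <= u <= 1/2 -> poisson r u*u^2 <= (1-r^2)/(4*r).
Proof.
 intros Hr Hu. have HD := poisson_den r u Hr. set (D := 1-2*r*cos (2*PI*u)+r^2) in *.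
 have : 0 < (1-r)^2 by go.
 have : 4*r*u^2 <= D.
 { have : D = (1-r)^2+4*r*(sin (PI*u))^2.
  { unfold D. replace (2*PI*u) with (2*(PI*u)) by ring. rewrite cos_2a_sin. ring. }
  have : Rabs u <= Rabs (sin (PI*u)).
  { have : 3 <= PI by (generalize PI2_3_2; lra).
   have L : forall w, 0 <= w <= 1/2 -> w <= sin (PI*w). { intros w Hw. have X := sin_lower (PI*w) ltac:(nra). nra. }
   destruct (Rle_lt_dec 0 u).
   - rewrite !Rabs_pos_eq; [apply L; lra| |lra]. apply Rle_trans with u; [lra|apply L; lra].
   - rewrite <- Rabs_Ropp, <- (Rabs_Ropp (sin (PI*u))), <- sin_neg. replace (-(PI*u)) with (PI*- u) by ring.
    rewrite !Rabs_pos_eq; [apply L; lra| |lra]. apply Rle_trans with (-u); [lra|apply L; lra]. }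
  have : u^2 <= sin (PI*u)^2. { rewrite <- (pow2_abs u), <- (pow2_abs (sin (PI*u))). go. }
  go. }
 apply (proj1 (Rle_div_r ((1-r^2)/D*u^2) _ (4*r) $)). unfold Rdiv.
 replace ((1-r^2)*/D*u^2*(4*r)) with ((1-r^2)*(4*r*u^2*/D)) by ring.
 rewrite <- (Rmult_1_r (1-r^2)) at 2. mul_l; [nra|].
 apply (proj2 (Rle_div_l _ 1 D $)); lra.
Qed.

Lemma poisson_pos r u : 0 < r < 1 -> 0 <= poisson r u.
Proof.
 intros Hr. have HD := poisson_den r u Hr. have : 0 < (1-r)^2 by go.
 apply Rlt_le, Rdiv_lt_0_compat; [nra|lra].
Qed.

(** One half of the Gaussian absorbs y^2, the other half supplies the decay e^(-|y|) that makes the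
    errors summable over the integers. *)
Lemma gauss_second a y : 0 < a -> Rabs ((4*a^2*y^2-2*a)*gauss a y) <= 10*a*exp (1/(2*a))*exp (-Rabs y).
Proof.
 intros Ha. rewrite Rabs_mult, (Rabs_pos_eq (gauss a y)) by (left; apply exp_pos).
 have E : gauss a y = gauss (a/2) y*gauss (a/2) y by (unfold gauss; rewrite <- exp_plus; f_equal; field).
 have G := gauss_dom_sharp (a/2) $ 0 y. rewrite Rabs_R0, Rmult_0_l, exp_0, Rmult_1_r in G.
 replace ((0+1)^2/(4*(a/2))) with (1/(2*a)) in G by go. replace (- 1*Rabs y) with (-Rabs y) in G by ring.
 have : gauss (a/2) y <= 1. { rewrite <- exp_0. apply exp_le. go. }
 have : 0 < gauss (a/2) y by apply exp_pos.
 have : (a/2*y^2)*gauss (a/2) y <= 1.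
 { unfold gauss. replace (-(a/2)*y^2) with (-(a/2*y^2)) by ring. rewrite exp_Ropp.
  have X := exp_ineq1_le (a/2*y^2). apply (proj2 (Rle_div_l _ 1 _ (exp_pos _))); lra. }
 rewrite E, <- Rmult_assoc. rewrite (Rmult_assoc (10*a)). apply Rmult_le_compat; [| | |go].
 - go.
 - lra.
 - have X : Rabs (4*a^2*y^2-2*a) <= 4*a^2*y^2+2*a.
  { apply Rabs_le. go. }
  go.
Qed.

(** The Poisson kernel is even, so first-order variation around n cancels and only the second
    difference remains. It is O(u^2), to be paired with [poisson_sq]. *)
Lemma gauss_secdiff a n u : 0 < a -> 0 <= n -> - (1/2) <= u <= 1/2 ->
 Rabs (gauss a (n+u)+gauss a (n-u)-2*gauss a n) <= 20*a*exp (1/(2*a))*exp (1/2)*exp (-n)*u^2.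
Proof.
 intros Ha Hn Hu. set (B := 10*a*exp (1/(2*a))*exp (1/2)*exp (-n)).
 have HB : forall y, Rabs (y-n) <= 1/2 -> Rabs ((4*a^2*y^2-2*a)*gauss a y) <= B.
 { intros y Hy. le_tr; [apply gauss_second; auto|]. unfold B. rewrite (Rmult_assoc (10*a*exp (1/(2*a)))).
  mul_l; [go|]. rewrite <- exp_plus. apply exp_le.
  have T := Rabs_triang_inv n y. rewrite Rabs_minus_sym, Rabs_pos_eq in T by lra. lra. }
 set (dg := fun y => - 2*a*y*gauss a y).
 have : forall y, is_derive dg y ((4*a^2*y^2-2*a)*gauss a y) by (intros y; unfold dg, gauss; auto_derive; auto; simpl; ring).
 have D1 : forall t, Rabs t <= 1/2 -> Rabs (dg (n+t)-dg (n-t)) <= B*(2*Rabs t).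
 { intros t Ht.
  have K : forall v, Rabs v = Rabs t -> Rabs (dg (n+v)-dg n) <= B*Rabs t.
  { intros v Hv. have K := bounded_variation dg (fun y => (4*a^2*y^2-2*a)*gauss a y) B n (n+v).
   replace (n+v-n) with v in K by ring. rewrite Hv in K. apply K.
   split; [go|apply HB; lra]. }
  have K1 := K t eq_refl. have K2 := K (-t) (Rabs_Ropp t).
  replace (dg (n+t)-dg (n-t)) with ((dg (n+t)-dg n)+- (dg (n+- t)-dg n)) by (unfold Rminus; ring).
  ub Rabs_triang. rewrite Rabs_Ropp. lra. }
 have K := bounded_variation (fun t => gauss a (n+t)+gauss a (n-t)-2*gauss a n) (fun t => dg (n+t)-dg (n-t)) (B*(2*Rabs u)) 0 u.
 cbv beta in K. rewrite !Rplus_0_r, !Rminus_0_r in K. replace (gauss a n+gauss a n-2*gauss a n) with 0 in K by ring.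
 rewrite !Rminus_0_r in K. ub K.
 - intros t Ht. rewrite Rminus_0_r in Ht. have : Rabs u <= 1/2 by (apply Rabs_le; lra). split.
  + unfold dg, gauss, Rminus. auto_derive; auto. go.
  + le_tr; [apply D1; lra|]. go.
 - right. rewrite <- (pow2_abs u). go.
Qed.

#[export] Hint Resolve RC_poly_cos RC_poisson RC_sum RC_pterm RC_poissonN poisson_pos : cont.

Ltac Rring := match goal with |- ?a = ?b => change (@eq R a b) end; ring.

Definition Kg (al : R) : R := Re (Gs al 0).

Lemma Gs0_Kg al : 0 < al -> Gs al 0 = RtoC (Kg al).
Proof.
 intros Ha. apply injective_projections; [go|]. apply (Lap_real _ (-1) 1 0); auto using RC_gauss, gauss_dom. lra.
Qed.

Lemma gauss_RL al : 0 < al -> is_RL (gauss al) (Kg al).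
Proof.
 intros Ha. unfold is_RL. rewrite <- Gs0_Kg by auto.
 eapply is_CL_ext; [|apply (Lap_CL _ (-1) 1); auto using RC_gauss, gauss_dom; simpl; lra].
 intros t. unfold Lin. rewrite Cmult_0_l, Cexp_0. Cring.
Qed.

Lemma gauss_cos_RL al w : 0 < al -> is_RL (fun y => gauss al y*cos (w*y)) (Kg al*exp (-(w^2/(4*al)))).
Proof.
 intros Ha. have K := Lap_CL _ (-1) 1 (0, w) (RC_gauss _) (gauss_dom _ _ _ Ha) ltac:(go).
 apply is_RL_Re in K; [|go].
 change (Lap (gauss al) (0, w)) with (Gs al (0, w)) in K. rewrite Gs_formula, Gs0_Kg in K by auto.
 replace ((0, w)*(0, w)/RtoC (4*al))%C with (RtoC (-(w^2/(4*al)))) in K.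
 2:{ go. }
 rewrite Cexp_RtoC, <- RtoC_mult in K.
 eapply is_RL_ext; [|exact K]. intros t. unfold Lin, Cexp, Re, Im; simpl. rewrite Rmult_0_l, Rminus_0_l.
 replace (-(w*0)) with 0 by ring. rewrite exp_0. replace (0*0+w*t) with (w*t) by ring. ring.
Qed.

Lemma Kg_pos al : 0 < al -> 0 < Kg al.
Proof.
 intros Ha.
 have : exp (-al)*1 <= Kg al.
 { apply le_epsilon. intros e He. destruct (is_RL_RInt _ _ (gauss_RL _ Ha) e He) as [N K].
  set (T := Rmax N 1). have A := Rmax_l N 1. have B := Rmax_r N 1. specialize (K T T A A). apply Rabs_le_between in K.
  have : RInt (gauss al) (-T) T = RInt (gauss al) (-T) 0+(RInt (gauss al) 0 1+RInt (gauss al) 1 T).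
  { have : forall a b, ex_RInt (gauss al) a b by go.
   rewrite <- (RInt_Chasles (V:=R_CompleteNormedModule) _ _ 0 T) by auto.
   rewrite <- (RInt_Chasles (V:=R_CompleteNormedModule) _ 0 1 T) by auto. go. }
  have P : forall a b, a <= b -> 0 <= RInt (gauss al) a b.
  { intros a b Hab. apply RInt_ge_0; auto; [go|]. intros; left; apply exp_pos. }
  have P1 := P (-T) 0 ltac:(go). have P2 := P 1 T B.
  have : exp (-al)*1 <= RInt (gauss al) 0 1.
  { have X : RInt (fun _ => exp (-al)) 0 1 <= RInt (gauss al) 0 1.
   { apply RInt_le; [lra|go|go|]. intros x Hx. apply exp_le. assert (0 <= al*(1-x^2)) by (apply Rmult_le_pos; nra). lra. }
   rewrite RInt_const in X. change ((1-0)*exp (-al) <= RInt (gauss al) 0 1) in X. lra. }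
  go. }
 generalize (exp_pos (-al)); lra.
Qed.

Lemma Kg_scale x : 0 < x -> Kg (PI*x) = /sqrt x*Kg PI.
Proof.
 intros Hx. have Hpi := PI_RGT_0. have S : 0 < sqrt x by go.
 have E := Gs0_scale _ _ Hpi S.
 replace (sqrt x^2) with x in E by (simpl; rewrite Rmult_1_r, sqrt_sqrt; lra).
 unfold Kg. rewrite E, Gs0_Kg by auto. go.
Qed.

Lemma ex_om x : 0 < x -> ex_series (fun n => exp (-(PI*x)*INR (S n)^2)).
Proof. intros Hx. apply ex_series_exp_sq. go. Qed.

Lemma ex_series_exp1 : ex_series (fun n => exp (-INR (S n))).
Proof.
 apply (ex_series_ext (fun n => exp (-(1)*INR (S n)))); [intros; f_equal; ring|]. apply ex_series_exp_lin; lra.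
Qed.

(** * Poisson summation for the Gaussian *)

Section theta.
Variables (x r : R).
Hypotheses (Hx : 0 < x) (Hr : 0 < r < 1).
Let a := PI*x.
Let g := gauss a.
Let P := poisson r.
(** For an integer n this is the part of the line integral of [g] times [P] closest to n, moved to
    [-1/2, 1/2] by periodicity of the kernel. It tends to [g n] as r tends to 1. *)
Let c (n : R) : R := RInt (fun u => g (n+u)*P u) (-(1/2)) (1/2).

Lemma theta_a : 0 < a.
Proof. go. Qed.

Lemma RC_gP : RC (fun u => g u*P u).
Proof. go. Qed.

Lemma RC_gPn n : RC (fun u => g (n+u)*P u).
Proof.
 apply RC_mult; [|go]. apply RC_comp; [go|]. go.
Qed.

Lemma poisson_even u : P (-u) = P u.
Proof. unfold P, poisson. replace (2*PI*- u) with (-(2*PI*u)) by ring. rewrite cos_neg. go. Qed.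

Lemma poisson_period u n : P (INR n+u) = P u.
Proof.
 unfold P, poisson. replace (2*PI*(INR n+u)) with (2*PI*u+2*INR n*PI) by ring. rewrite cos_period. go.
Qed.

Lemma c_shift n : RInt (fun y => g y*P y) (INR n-1/2) (INR n+1/2) = c (INR n).
Proof.
 replace (INR n-1/2) with (-(1/2)+INR n) by ring. replace (INR n+1/2) with (1/2+INR n) by ring.
 rewrite <- RInt_shift by apply RC_gP. apply RInt_ext. intros u _.
 rewrite Rplus_comm, poisson_period. go.
Qed.

(** [sum_n] up to [M] reaches the block at [S M], one beyond the interval, which is why that block
    is subtracted. Evenness pairs the blocks at n and -n. *)
Lemma c_sum M : RInt (fun y => g y*P y) (-(INR M+1/2)) (INR M+1/2) = c 0+2*(sum_n (fun n => c (INR (S n))) M-c (INR (S M))).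
Proof.
 have : forall u v, ex_RInt (fun y => g y*P y) u v by go.
 induction M as [|M IH].
 - rewrite sum_O. have Q := c_shift 0%nat. change (INR 0) with 0 in *. replace (-(0+1/2)) with (0-1/2) by ring. go.
 - rewrite sum_Sn.
  match goal with |- context [plus ?u ?v] => change (plus u v) with (u+v) end.
  replace (c 0+2*(sum_n _ M+c (INR (S (S M)))-c (INR (S (S M)))))
   with ((c 0+2*(sum_n (fun n => c (INR (S n))) M-c (INR (S M))))+2*c (INR (S M))) by ring.
  rewrite <- IH. rewrite <- c_shift.
  rewrite <- (RInt_Chasles (V:=R_CompleteNormedModule) _ _ (-(INR M+1/2)) _) by auto.
  rewrite <- (RInt_Chasles (V:=R_CompleteNormedModule) _ (-(INR M+1/2)) (INR M+1/2) _) by auto.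
  have E : RInt (fun y => g y*P y) (-(INR (S M)+1/2)) (-(INR M+1/2)) = RInt (fun y => g y*P y) (INR M+1/2) (INR (S M)+1/2).
  { rewrite <- RInt_neg by apply RC_gP. apply RInt_ext. intros u _. rewrite poisson_even. f_equal.
   unfold g, gauss. go. }
  rewrite E. replace (INR (S M)-1/2) with (INR M+1/2) by (rewrite S_INR; field).
  match goal with |- plus ?u (plus ?v ?w) = _ => change (plus u (plus v w)) with (u+(v+w)) end. Rring.
Qed.

Let C0 := 20*a*exp (1/(2*a))*exp (1/2).

Lemma c_approx n : 0 <= n -> Rabs (c n-g n) <= C0*exp (-n)*((1-r^2)/(4*r)).
Proof.
 intros Hn.
 have : RC P by go.
 have E1 : RInt (fun u => (g (n+u)+g (n-u)-2*g n)*P u) (-(1/2)) (1/2) = 2*(c n-g n).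
 { have : RC (fun u => g (n-u)*P u).
  { apply RC_mult; auto. apply RC_comp; [go|]. go. }
  have E2 : RInt (fun u => g (n-u)*P u) (-(1/2)) (1/2) = c n.
  { unfold c. have K := RInt_neg _ (-(1/2)) (1/2) (RC_gPn n).
   rewrite Ropp_involutive in K. rewrite <- K. apply RInt_ext. intros u _. rewrite poisson_even. go. }
  rewrite (RInt_ext _ (fun u => (g (n+u)*P u+g (n-u)*P u)+(- 2*g n)*P u)) by go.
  rewrite (RInt_plus (V:=R_CompleteNormedModule) _ _).
  2:{ apply RC_int. apply RC_plus; [apply RC_gPn|go]. }
  2:{ go. }
  rewrite (RInt_plus (V:=R_CompleteNormedModule) _ _) by (apply RC_int; auto using RC_gPn).
  rewrite RInt_Rscal by auto. rewrite E2. unfold P at 2. rewrite RInt_poisson by auto. match goal with |- plus (plus ?u ?v) ?w = _ => change (plus (plus u v) w) with ((u+v)+w) end. go. }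
 have E3 : Rabs (2*(c n-g n)) <= C0*exp (-n)*((1-r^2)/(4*r)).
 { rewrite <- E1. ub ((abs_RInt_le_const _ _ _ (C0*exp (-n)*((1-r^2)/(4*r))))).
  - lra.
  - apply RC_int. apply RC_mult; auto. apply RC_minus; [|go]. apply RC_plus; (apply RC_comp; [go|]).
   + go.
   + go.
  - intros u Hu. rewrite Rabs_mult, (Rabs_pos_eq (P u)) by go.
   have S := gauss_secdiff a n u theta_a Hn Hu. fold C0 in S.
   le_tr; [mul_r; [go|exact S]|].
   replace (C0*exp (-n)*u^2*P u) with (C0*exp (-n)*(P u*u^2)) by ring.
   mul_l; [go|]. apply poisson_sq; auto.
  - lra. }
 rewrite Rabs_mult, Rabs_pos_eq in E3 by lra. generalize (Rabs_pos (c n-g n)); lra.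
Qed.

Let E1 := Series (fun n => exp (-INR (S n))).

Lemma theta_sum_approx M : Rabs ((c 0+2*(sum_n (fun n => c (INR (S n))) M))-(1+2*sum_n (fun n => g (INR (S n))) M))
 <= C0*(1+2*E1)*((1-r^2)/(4*r)).
Proof.
 have : 0 <= (1-r^2)/(4*r) by (apply Rlt_le, Rdiv_lt_0_compat; nra).
 have H0 := c_approx 0 $. rewrite Ropp_0, exp_0 in H0.
 have G0 : g 0 = 1 by (unfold g, gauss; rewrite <- exp_0; f_equal; ring). rewrite G0 in H0.
 have : Rabs (sum_n (fun n => c (INR (S n))) M-sum_n (fun n => g (INR (S n))) M) <= sum_n (fun n => exp (-INR (S n))) M*(C0*((1-r^2)/(4*r))).
 { induction M as [|M IH].
  - rewrite !sum_O. le_tr; [apply c_approx; apply pos_INR|]. go.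
  - rewrite !sum_Sn. repeat match goal with |- context [plus ?u ?v] => change (plus u v) with (u+v) end.
   have H1 := c_approx (INR (S (S M))) (pos_INR _).
   match goal with |- Rabs (?u+?v-(?w+?z)) <= _ => replace (u+v-(w+z)) with ((u-w)+(v-z)) by ring end.
   ub Rabs_triang. go. }
 have : sum_n (fun n => exp (-INR (S n))) M <= E1.
 { apply sum_n_le_Series; [go|apply ex_series_exp1]. }
 replace (c 0+2*sum_n _ M-(1+2*sum_n _ M)) with
  ((c 0-1)+2*(sum_n (fun n => c (INR (S n))) M-sum_n (fun n => g (INR (S n))) M)) by ring.
 ub Rabs_triang. rewrite Rabs_mult, (Rabs_pos_eq 2) by lra.
 assert (0 <= C0*((1-r^2)/(4*r))) by go. nra.
Qed.

Lemma c_small : is_lim_seq (fun M => c (INR (S M))) 0.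
Proof.
 have Hl : forall k, 0 < k -> is_lim_seq (fun M => exp (-k*INR (S M))) 0.
 { intros k Hk. apply ex_series_lim_0. apply ex_series_exp_lin; auto. }
 have : is_lim_seq (fun M => (C0*((1-r^2)/(4*r))+1)*exp (-INR (S M))+exp (-a*INR (S M))) 0.
 { replace 0 with ((C0*((1-r^2)/(4*r))+1)*0+0) at 1 by ring. apply is_lim_seq_plus'; [|apply Hl, theta_a].
  apply (is_lim_seq_scal_l _ _ 0).
  apply (is_lim_seq_ext (fun M => exp (-(1)*INR (S M)))); [intros; f_equal; ring|apply (Hl 1); lra]. }
 apply (is_lim_seq_le_le (fun M => - ((C0*((1-r^2)/(4*r))+1)*exp (-INR (S M))+exp (-a*INR (S M)))) _ (fun M => (C0*((1-r^2)/(4*r))+1)*exp (-INR (S M))+exp (-a*INR (S M)))).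
 - intros M. have H := c_approx (INR (S M)) (pos_INR _). apply Rabs_le_between in H.
  have : 0 < g (INR (S M)) <= exp (-a*INR (S M)).
  { split; [apply exp_pos|apply exp_sq_le, theta_a]. }
  have X := exp_pos (-INR (S M)). nra.
 - replace (Finite 0) with (Rbar_opp 0) by (simpl; f_equal; ring). apply (is_lim_seq_opp _ 0). go.
 - go.
Qed.

(** The same line integral through the cosine series of the kernel: each cosine produces a Gaussian
    at the dual frequency, so the dual theta series at [/x] appears. *)
Lemma gP_RL : exists I, is_RL (fun y => g y*P y) I /\
 forall N, Rabs (I-Kg a*(1+2*sum_n (fun k => r^S k*exp (-(PI*/x)*INR (S k)^2)) N)) <= 4*r^(N+2)/(1-r)^2*Kg a.
Proof.
 have Ha := theta_a. have Hpi := PI_RGT_0.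
 destruct (CL_exists (exp ((Rabs 0+1)^2/(4*a))*((1-r^2)/(1-r)^2)) 1 (fun y => RtoC (g y*P y))) as [l Hl]; [lra|go| |].
 { intros y. rewrite Cmod_R, Rabs_mult, Rabs_pos_eq, Rabs_pos_eq by (try (left; apply exp_pos); apply poisson_pos; auto).
  have G := gauss_dom_sharp a Ha 0 y. rewrite Rmult_0_l, exp_0, Rmult_1_r in G.
  have Pb : P y <= (1-r^2)/(1-r)^2.
  { have D := poisson_den r y Hr. mul_l; [nra|]. go. }
  have P0 : 0 <= P y by go.
  have G0 : 0 <= g y by (left; apply exp_pos).
  le_tr; [apply (Rmult_le_compat _ _ _ _ G0 P0 G Pb)|right]. replace (-1*Rabs y) with (-(1)*Rabs y) by ring. ring. }
 exists (Re l). have : is_RL (fun y => g y*P y) (Re l).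
 { unfold is_RL. replace (RtoC (Re l)) with l; [go|]. apply injective_projections; [go|]. exact (is_CL_RtoC_Im _ _ RC_gP Hl). }
 split; [go|]. intros N.
 have : is_RL (fun y => g y*poissonN r N y) (Kg a*(1+2*sum_n (fun k => r^S k*exp (-(PI*/x)*INR (S k)^2)) N)).
 { have : forall k, is_RL (fun y => 2*(r^S k)*(g y*cos (2*PI*INR (S k)*y))) (2*(r^S k)*(Kg a*exp (-(PI*/x)*INR (S k)^2))).
  { intros k. apply is_RL_scal; [go|].
   replace (-(PI*/x)*INR (S k)^2) with (-((2*PI*INR (S k))^2/(4*a))) by go. apply gauss_cos_RL; auto. }
  have : forall k, RC (fun y => 2*(r^S k)*(g y*cos (2*PI*INR (S k)*y))).
  { go. }
  unfold poissonN. induction N as [|N IH].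
  - rewrite sum_O. eapply is_RL_ext; [|].
   2:{ replace (Kg a*(1+2*(r^1*exp (-(PI*/x)*INR 1^2)))) with (Kg a+2*(r^1)*(Kg a*exp (-(PI*/x)*INR 1^2))) by ring.
     apply is_RL_plus; [apply RC_gauss|go|apply gauss_RL; auto|go]. }
   intros y. rewrite sum_O. go.
  - rewrite sum_Sn. match goal with |- context [plus ?u ?v] => change (plus u v) with (u+v) end.
   eapply is_RL_ext; [|].
   2:{ match goal with |- is_RL _ (Kg a*(1+2*(?s+?t*?e))) => replace (Kg a*(1+2*(s+t*e))) with (Kg a*(1+2*s)+2*t*(Kg a*e)) by ring end.
     apply is_RL_plus; [|go|exact IH|go]. apply RC_mult; [go|go]. }
   intros y. cbv beta. rewrite sum_Sn. match goal with |- context [plus ?u ?v] => change (plus u v) with (u+v) end. ring. }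
 have : is_RL (fun y => g y*P y+(- 1)*(g y*poissonN r N y)) (Re l+(-1)*(Kg a*(1+2*sum_n (fun k => r^S k*exp (-(PI*/x)*INR (S k)^2)) N))).
 { assert (RC (fun y => g y*poissonN r N y)) by go.
  apply is_RL_plus; [go| |go|apply is_RL_scal; auto]. go. }
 match goal with |- Rabs (?u-?v) <= _ => replace (u-v) with (u+(-1)*v) by ring end.
 apply (is_RL_abs_le (fun y => g y*P y+(- 1)*(g y*poissonN r N y)) (fun y => 4*r^(N+2)/(1-r)^2*g y) _ _); [| |go|apply is_RL_scal; [go|apply gauss_RL; auto]|].
 - go.
 - go.
 - intros y. replace (g y*P y+-1*(g y*poissonN r N y)) with ((P y-poissonN r N y)*g y) by ring.
  rewrite Rabs_mult, (Rabs_pos_eq (g y)) by (left; apply exp_pos). mul_r; [left; apply exp_pos|]. apply poisson_approx; auto.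
Qed.

Let E2 := Series (fun n => INR (S n)*exp (-(PI*/x)*INR (S n)^2)).

(** Compares the two evaluations of the line integral, over unit blocks and over frequencies; each
    is off by O(1 - r). *)
Lemma theta_r : Rabs ((1+2*om x)-Kg a*(1+2*om (/x))) <= C0*(1+2*E1)*((1-r^2)/(4*r))+Kg a*(2*((1-r)*E2)).
Proof.
 have Ha := theta_a. have Hpi := PI_RGT_0. have Hx' : 0 < /x by go.
 have KP := Kg_pos a Ha.
 destruct gP_RL as [I [HI HN]].
 have : Rabs ((1+2*om x)-I) <= C0*(1+2*E1)*((1-r^2)/(4*r)).
 { have : is_lim_seq (fun M => (c 0+2*(sum_n (fun n => c (INR (S n))) M-c (INR (S M))))) I.
  { apply (is_lim_seq_ext (fun M => RInt (fun y => g y*P y) (-(INR M+1/2)) (INR M+1/2))); [intros; apply c_sum|].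
   apply is_lim_seq_spec. intros eps. destruct (is_RL_RInt _ _ HI (eps/2)) as [N K]; [generalize (cond_pos eps); lra|].
   destruct (INR_unbounded N) as [n0 Hn0]. exists n0. intros n Hn. apply le_INR in Hn.
   specialize (K (INR n+1/2) (INR n+1/2) $ $). generalize (cond_pos eps); lra. }
  have L2 : is_lim_seq (fun M => 1+2*sum_n (fun n => g (INR (S n))) M) (1+2*om x).
  { apply is_lim_seq_plus'; [apply is_lim_seq_const|]. apply (is_lim_seq_scal_l _ 2 (om x)). apply (Series_correct _ (ex_om x Hx)). }
  have L3 : is_lim_seq (fun M => Rabs ((c 0+2*(sum_n (fun n => c (INR (S n))) M-c (INR (S M))))+2*c (INR (S M))-(1+2*sum_n (fun n => g (INR (S n))) M))) (Rabs (I+2*0-(1+2*om x))).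
  { apply (is_lim_seq_abs _ (Finite (I+2*0-(1+2*om x)))). apply is_lim_seq_minus'; [|go]. apply is_lim_seq_plus'; [go|].
   apply (is_lim_seq_scal_l _ 2 0). apply c_small. }
  rewrite Rabs_minus_sym. replace (I-(1+2*om x)) with (I+2*0-(1+2*om x)) by ring.
  apply (is_lim_seq_le _ (fun _ => C0*(1+2*E1)*((1-r^2)/(4*r))) _ (C0*(1+2*E1)*((1-r^2)/(4*r)))) in L3; [go| |apply is_lim_seq_const].
  intros M. match goal with |- Rabs ?u <= _ => replace u with ((c 0+2*(sum_n (fun n => c (INR (S n))) M))-(1+2*sum_n (fun n => g (INR (S n))) M)) by ring end.
  apply theta_sum_approx. }
 have : Rabs (I-Kg a*(1+2*om (/x))) <= Kg a*(2*((1-r)*E2)).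
 { set (e := fun k => exp (-(PI*/x)*INR (S k)^2)).
  have BN : forall N, Rabs (I-Kg a*(1+2*sum_n e N)) <= 4/(1-r)^2*Kg a*r^(N+2)+Kg a*(2*((1-r)*E2)).
  { intros N. have : 0 <= sum_n e N-sum_n (fun k => r^S k*e k) N <= (1-r)*sum_n (fun n => INR (S n)*e n) N.
   { have T : forall k, 0 <= e k-r^S k*e k <= (1-r)*(INR (S k)*e k).
    { intros k. have : 0 < e k by apply exp_pos.
     have T : 0 <= 1-r^S k <= (1-r)*INR (S k).
     { induction k as [|k IH]; [go|]. rewrite S_INR. change (r^S (S k)) with (r*r^S k).
      specialize (IH (exp_pos _)). nra. }
     go. }
    induction N as [|N IH]; [rewrite !sum_O; apply T|]. rewrite !sum_Sn. repeat match goal with |- context [plus ?u ?v] => change (plus u v) with (u+v) end.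
    specialize (T (S N)). lra. }
   have : sum_n (fun n => INR (S n)*e n) N <= E2.
   { apply sum_n_le_Series; [intros n; apply Rmult_le_pos; [go|go]|]. apply ex_series_n_exp_sq. nra. }
   specialize (HN N). replace (I-Kg a*(1+2*sum_n e N)) with ((I-Kg a*(1+2*sum_n (fun k => r^S k*e k) N))+- (Kg a*(2*(sum_n e N-sum_n (fun k => r^S k*e k) N)))) by ring.
   ub Rabs_triang. rewrite Rabs_Ropp. apply Rplus_le_compat.
   - go.
   - rewrite Rabs_pos_eq by go. go. }
  have L2 : is_lim_seq (fun N => Rabs (I-Kg a*(1+2*sum_n e N))) (Rabs (I-Kg a*(1+2*om (/x)))).
  { apply (is_lim_seq_abs _ (Finite (I-Kg a*(1+2*om (/x))))). apply is_lim_seq_minus'; [apply is_lim_seq_const|]. apply (is_lim_seq_scal_l _ _ (1+2*om (/x))).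
   apply is_lim_seq_plus'; [apply is_lim_seq_const|]. apply (is_lim_seq_scal_l _ 2 (om (/x))). apply (Series_correct _ (ex_om _ Hx')). }
  have L3 : is_lim_seq (fun N => 4/(1-r)^2*Kg a*r^(N+2)+Kg a*(2*((1-r)*E2))) (4/(1-r)^2*Kg a*0+Kg a*(2*((1-r)*E2))).
  { apply is_lim_seq_plus'; [|apply is_lim_seq_const]. apply (is_lim_seq_scal_l _ _ 0).
   apply is_lim_seq_incr_n. apply is_lim_seq_geom. rewrite Rabs_pos_eq; lra. }
  have F := is_lim_seq_le _ _ _ _ BN L2 L3. simpl in F. lra. }
 replace (1+2*om x-Kg a*(1+2*om (/x))) with ((1+2*om x-I)+(I-Kg a*(1+2*om (/x)))) by ring.
 ub Rabs_triang. lra.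
Qed.
End theta.

Lemma theta_K x : 0 < x -> 1+2*om x = Kg (PI*x)*(1+2*om (/x)).
Proof.
 intros Hx. apply Rminus_diag_uniq. apply Rabs_eq_0. apply Rle_antisym; [|go]. apply le_epsilon. intros e He. have Hpi := PI_RGT_0. have Ha : 0 < PI*x by nra. have KP := Kg_pos _ Ha.
 set (A := 20*(PI*x)*exp (1/(2*(PI*x)))*exp (1/2)*(1+2*Series (fun n => exp (-INR (S n))))).
 set (B := Series (fun n => INR (S n)*exp (-(PI*/x)*INR (S n)^2))).
 have : 0 <= A.
 { assert (0 <= Series (fun n : nat => exp (-INR (S n)))) by (apply Series_pos; [go|apply ex_series_exp1]).
  go. }
 have : 0 <= B.
 { apply Series_pos; [go|]. apply ex_series_n_exp_sq. go. }
 set (L := A+Kg (PI*x)*2*B+1). have : 1 <= L by (unfold L; nra).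
 (* The kernel is used at r = 1 - d. [L] collects the constants of [theta_r], so the total error is
    at most d L <= e. *)
 set (d := Rmin (1/2) (e/L)). have : d <= 1/2 by apply Rmin_l. have : d <= e/L by apply Rmin_r.
 have : 0 < d by (apply Rmin_pos; [lra|go]).
 le_tr; [apply (theta_r x (1-d) Hx); lra|]. fold A. fold B.
 have : (1-(1-d)^2)/(4*(1-d)) <= d.
 { apply (proj2 (Rle_div_l _ d (4*(1-d)) $)). nra. }
 have D3 : d*L <= e. { apply (proj2 (Rle_div_r d e L $)). go. }
 unfold L in D3. go.
Qed.

Lemma om_pos x : 0 < x -> 0 <= om x.
Proof. intros Hx. apply Series_pos; [go|apply ex_om; auto]. Qed.

(** At x = 1 the relation [theta_K] compares 1 + 2 om(1) with itself, which forces the Gaussian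
    integral to be 1. *)
Lemma Kg_PI : Kg PI = 1.
Proof.
 have H := theta_K 1 Rlt_0_1. rewrite Rinv_1, Rmult_1_r in H. have P := om_pos 1 Rlt_0_1. nra.
Qed.

Theorem theta_modular x : 0 < x -> 1+2*om (/x) = sqrt x*(1+2*om x).
Proof.
 intros Hx. have : 0 < sqrt x by go.
 rewrite (theta_K x Hx), Kg_scale, Kg_PI by auto. go.
Qed.

#[export] Hint Resolve Kg_pos om_pos : cont.

(** * The completed zeta function *)

Lemma om_decay x : 1 <= x -> om x <= exp (-PI*(x-1))*om 1.
Proof.
 intros Hx. have Hpi := PI_RGT_0. unfold om. rewrite <- Series_scal_l. apply Series_le.
 - split; [go|]. rewrite <- exp_plus. apply exp_le. have H := INR_S_ge1 n. set (m := INR (S n)) in *.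
  assert (0 <= PI*(x-1)*(m^2-1)) by (apply Rmult_le_pos; nra). lra.
 - apply (ex_series_scal_l _ (fun n => exp (-(PI*1)*INR (S n)^2))). apply ex_om; lra.
Qed.

Lemma ex_series_n2_exp_sq c : 0 < c -> ex_series (fun n => INR (S n)^2*exp (-c*INR (S n)^2)).
Proof.
 intros Hc. apply (ex_series_pos_le _ (fun n => 2/c*exp (-(c/2)*INR (S n)^2))).
 - intros n. set (m := INR (S n)). split; [go|].
  replace (-c*m^2) with (-(c/2*m^2)+- (c/2)*m^2) by field. rewrite exp_plus, <- Rmult_assoc.
  mul_r; [go|]. rewrite exp_Ropp.
  have E := exp_ineq1_le (c/2*m^2). apply (proj2 (Rle_div_l _ _ _ (exp_pos _))).
  replace (m^2) with (2/c*(c/2*m^2)) at 1 by go. go.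
 - apply (ex_series_scal_l _ (fun n => exp (-(c/2)*INR (S n)^2))). apply ex_series_exp_sq. lra.
Qed.

Lemma om_cont x : 0 < x -> continuous om x.
Proof.
 intros Hx. have Hpi := PI_RGT_0. set (d := x/2).
 set (L := PI*Series (fun n => INR (S n)^2*exp (-(PI*d)*INR (S n)^2))).
 have Hd : 0 < PI*d by go.
 have HE := ex_series_n2_exp_sq _ Hd.
 have : 0 <= L. { apply Rmult_le_pos; [lra|]. apply Series_pos; auto. go. }
 have HB : forall y, Rabs (y-x) < d -> Rabs (om y-om x) <= L*Rabs (y-x).
 { intros y Hy. apply Rabs_lt_between in Hy. have : 0 < y by go.
  unfold om. rewrite <- Series_minus by (apply ex_om; auto).
  have T : forall n, Rabs (exp (-(PI*y)*INR (S n)^2)-exp (-(PI*x)*INR (S n)^2)) <= PI*Rabs (y-x)*(INR (S n)^2*exp (-(PI*d)*INR (S n)^2)).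
  { intros n. set (m := INR (S n)^2). have : 0 <= m by apply pow2_ge_0.
   have K := bounded_variation (fun u => exp (-(PI*u)*m)) (fun u => - PI*m*exp (-(PI*u)*m)) (PI*m*exp (-(PI*d)*m)) x y.
   replace (PI*Rabs (y-x)*(m*exp (-(PI*d)*m))) with (PI*m*exp (-(PI*d)*m)*Rabs (y-x)) by ring. apply K.
   intros t Ht. split; [auto_derive; auto; ring|]. rewrite Rabs_mult, (Rabs_pos_eq (exp _)) by go.
   rewrite Rabs_left1 by nra. replace (-(-PI*m)) with (PI*m) by ring. have : d <= t. { have : Rabs (y-x) <= d by (apply Rabs_le; lra). apply Rabs_le_between in Ht. go. }
   go. }
  have HS : ex_series (fun n => PI*Rabs (y-x)*(INR (S n)^2*exp (-(PI*d)*INR (S n)^2))) by (apply (ex_series_scal_l _ _ HE)).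
  ub Series_Rabs.
  - apply (ex_series_pos_le _ _ (fun n => conj (Rabs_pos _) (T n)) HS).
  - ub ((Series_le _ _ (fun n => conj (Rabs_pos _) (T n)) HS)). rewrite Series_scal_l. go. }
 apply continuity_pt_filterlim. intros eps He.
 exists (Rmin d (eps/(L+1))). split; [apply Rmin_pos; [go|go]|].
 intros y [_ Hy]. simpl in *. unfold R_dist in *. have A := Rmin_l d (eps/(L+1)). have B := Rmin_r d (eps/(L+1)).
 specialize (HB y $). have C : Rabs (y-x) < eps/(L+1) by lra. apply Rlt_div_r in C; [|lra]. go.
Qed.

Lemma RC_om_exp (f : R -> R) : RC f -> RC (fun v => om (exp (f v))).
Proof.
 intros Hf v. apply continuous_comp.
 - apply RC_comp; [go|go].
 - apply om_cont, exp_pos.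
Qed.

(** Mellin integrand of the theta series at x = e^(2v), centred at s = 1/2, with the half x < 1
    folded onto x > 1 by [theta_modular]. Its evenness is the functional equation [X_sym]. *)
Definition ph (v : R) : R := 2*om (exp (2*Rabs v))*exp (Rabs v/2).

Lemma RC_ph : RC ph.
Proof.
 apply RC_mult; [apply RC_mult; [go|]|].
 - apply RC_om_exp. go.
 - apply RC_comp; [go|]. apply RC_mult; [go|go].
Qed.

Lemma exp_2w_lower w : 0 <= w -> 1+2*w+w^2 <= exp (2*w).
Proof.
 replace (2*w) with (w+w) by ring. rewrite exp_plus. have E := exp_ineq1_le w. nra.
Qed.

Lemma exp_2abs_ge1 v : 1 <= exp (2*Rabs v).
Proof. rewrite <- exp_0. apply exp_le. go. Qed.

Lemma ph_nonneg v : 0 <= ph v.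
Proof. unfold ph. go. Qed.

Lemma ph_bound B sg v : Rabs sg <= B -> ph v*exp (sg*v) <= 2*om 1*exp ((B+2)^2/4)*exp (-(1)*Rabs v).
Proof.
 intros HB. set (w := Rabs v). have Hw : 0 <= w by apply Rabs_pos. have Hpi := PI2_3_2.
 have O1 := om_pos 1 Rlt_0_1. have H1 := om_decay _ (exp_2abs_ge1 v).
 have H2 := exp_2w_lower w Hw.
 have : sg*v <= B*w. { ub Rle_abs. rewrite Rabs_mult. go. }
 unfold ph. apply Rle_trans with (2*(exp (-PI*(exp (2*w)-1))*om 1)*exp (w/2)*exp (B*w)).
 { go. }
 replace (2*(exp (-PI*(exp (2*w)-1))*om 1)*exp (w/2)*exp (B*w)) with (2*om 1*(exp (-PI*(exp (2*w)-1))*exp (w/2)*exp (B*w))) by ring.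
 rewrite (Rmult_assoc (2*om 1)). mul_l; [lra|]. rewrite <- !exp_plus. apply exp_le.
 assert (0 <= (w-(B+2)/2)^2) by apply pow2_ge_0.
 go.
Qed.

Lemma ph_dom a b : dom ph a b.
Proof.
 intros sg _. exists (2*om 1*exp ((Rabs sg+2)^2/4)), 1. split; [lra|]. intros v.
 rewrite Rabs_pos_eq by apply ph_nonneg. apply ph_bound. lra.
Qed.

Lemma ph_even v : ph (-v) = ph v.
Proof. unfold ph. rewrite Rabs_Ropp. go. Qed.

Definition vph (v : R) := v*ph v.
Definition vvph (v : R) := v*vph v.

Lemma RC_vph : RC vph.
Proof. apply RC_mult; [go|apply RC_ph]. Qed.
Lemma vph_dom a b : dom vph a b.
Proof. apply dom_id_mult, ph_dom. Qed.

(* X(s) = s (s-1) pi^(-s/2) Gamma(s/2) zeta(s), as Riemann's integral of the theta function; X1 and X2 are X' and X''. *)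
Definition X (s : C) : C := (1+((s-RtoC (/2))*(s-RtoC (/2))-RtoC (/4))*Lap ph (s-RtoC (/2)))%C.
Definition X1 (s : C) : C := (2*(s-RtoC (/2))*Lap ph (s-RtoC (/2)) +
  ((s-RtoC (/2))*(s-RtoC (/2))-RtoC (/4))*Lap vph (s-RtoC (/2)))%C.
Definition X2 (s : C) : C := (2*Lap ph (s-RtoC (/2))+4*(s-RtoC (/2))*Lap vph (s-RtoC (/2)) +
  ((s-RtoC (/2))*(s-RtoC (/2))-RtoC (/4))*Lap vvph (s-RtoC (/2)))%C.

Lemma Cd_shift f s l c : Cd f (s-c)%C l -> Cd (fun x => f (x-c)%C) s l.
Proof.
 intros H. eapply Cd_eq; [apply Cd_comp; [exact H|]|].
 - go.
 - Cring.
Qed.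

Lemma X_Cd s : Cd X s (X1 s).
Proof.
 apply (Cd_eq _ _ (0+(((1-0)*(s-RtoC (/2))+(s-RtoC (/2))*(1-0))-0)*Lap ph (s-RtoC (/2)) +
  ((s-RtoC (/2))*(s-RtoC (/2))-RtoC (/4))*Lap vph (s-RtoC (/2)))%C); [|go].
 eapply Cd_eq; [apply Cd_plus; [go|apply Cd_mult]|].
 - go.
 - apply Cd_shift. apply (Lap_Cd _ (Re (s-RtoC (/2))%C-1) (Re (s-RtoC (/2))%C+1)); [apply RC_ph|apply ph_dom|lra].
 - cbv beta. unfold vph. Cring.
Qed.

Lemma X1_Cd s : Cd X1 s (X2 s).
Proof.
 have L1 : Cd (fun x => Lap ph (x-RtoC (/2))) s (Lap vph (s-RtoC (/2))).
 { apply Cd_shift. apply (Lap_Cd _ (Re (s-RtoC (/2))%C-1) (Re (s-RtoC (/2))%C+1)); [apply RC_ph|apply ph_dom|lra]. }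
 have L2 : Cd (fun x => Lap vph (x-RtoC (/2))) s (Lap vvph (s-RtoC (/2))).
 { apply Cd_shift. apply (Lap_Cd _ (Re (s-RtoC (/2))%C-1) (Re (s-RtoC (/2))%C+1)); [apply RC_vph|apply vph_dom|lra]. }
 eapply Cd_eq; [apply Cd_plus; [apply Cd_mult|apply Cd_mult]|].
 - go.
 - exact L1.
 - go.
 - exact L2.
 - go.
Qed.

Lemma X_sym s : X (1-s)%C = X s.
Proof.
 unfold X. replace (1-s-RtoC (/2))%C with (-(s-RtoC (/2)))%C by go.
 rewrite (Lap_even _ (Re (s-RtoC (/2))%C-1) (Re (s-RtoC (/2))%C+1)); [Cring|apply RC_ph|apply ph_dom|lra|apply ph_even].
Qed.

Lemma X_conj s : X (Cconj s) = Cconj (X s).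
Proof.
 unfold X. replace (Cconj s-RtoC (/2))%C with (Cconj (s-RtoC (/2)))%C by Cring.
 rewrite (Lap_conj _ (Re (s-RtoC (/2))%C-1) (Re (s-RtoC (/2))%C+1)); [|apply RC_ph|apply ph_dom|lra].
 go.
Qed.

(** On a vertical strip [Lap ph] is bounded, so X grows at most like its quadratic factor. *)
Lemma X_bound B : 0 <= B -> exists M, 0 < M /\ forall s, Rabs (Re s-/2) <= B -> Cmod (X s) <= M*(1+Im s^2).
Proof.
 set (K := 2*(2*om 1*exp ((B+2)^2/4))/1).
 have : 0 <= K. { have O1 := om_pos 1 Rlt_0_1. go. }
 exists (1+(B^2+2)*K). split; [nra|]. intros s Hs. set (z := (s-RtoC (/2))%C).
 have Hz : Re z = Re s-/2 by reflexivity. have Iz : Im z = Im s by go.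
 have : Cmod (Lap ph z) <= K.
 { apply (CL_norm_bound _ 1 (Lin ph z)); [lra|apply CC_Lin, RC_ph| |apply (Lap_CL _ (Re z-1) (Re z+1)); [apply RC_ph|apply ph_dom|lra]].
  intros v. rewrite Cmod_Lin, Rabs_pos_eq by apply ph_nonneg. apply ph_bound. go. }
 unfold X. le_tr; [go|]. rewrite Cmod_1, Cmod_mult.
 have : Cmod (z*z-RtoC (/4)) <= B^2+Im s^2+1.
 { unfold Cminus. le_tr; [go|]. rewrite Cmod_opp, Cmod_R, Rabs_pos_eq by lra. rewrite Cmod_mult.
  replace (Cmod z*Cmod z) with (Cmod z^2) by ring. rewrite Cmod2_alt, Hz, Iz. rewrite <- (pow2_abs (Re s-/2)).
  go. }
 have P := Cmod_ge_0 (Lap ph z). set (T := Im s^2) in *. assert (0 <= K*T) by go. go.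
Qed.

#[export] Hint Resolve RC_om_exp RC_ph ph_nonneg RC_vph X_Cd X1_Cd : cont.

(** * The Gamma function *)

Definition ga (v : R) : R := 2*exp (-exp (2*v)).
Definition vga (v : R) : R := v*ga v.
(* [Gam s] is Euler's Gamma function at [s / 2]. *)
Definition Gam (s : C) : C := Lap ga s.
Definition Gam1 (s : C) : C := Lap vga s.

Lemma RC_ga : RC ga.
Proof. apply RC_derive. intros t. unfold ga. auto_derive; auto. Qed.
Lemma RC_vga : RC vga.
Proof. apply RC_mult; [go|apply RC_ga]. Qed.
Lemma ga_pos v : 0 < ga v.
Proof. unfold ga. go. Qed.

Lemma ga_dom b : dom ga 0 b.
Proof.
 intros sg Hs. set (c := Rmin sg 1). assert (c <= sg) by apply Rmin_l. assert (c <= 1) by apply Rmin_r.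
 assert (0 < c) by (apply Rmin_pos; lra). exists (2*exp ((sg+2)^2/4)), c. split; auto. intros v. rewrite Rabs_pos_eq by (left; apply ga_pos).
 unfold ga. rewrite !Rmult_assoc. mul_l; [lra|]. rewrite <- !exp_plus. apply exp_le.
 destruct (Rle_lt_dec 0 v) as [Hv|Hv].
 - rewrite Rabs_pos_eq by auto. have H2 := exp_2w_lower v Hv. assert (0 <= (v-(sg+2)/2)^2) by apply pow2_ge_0.
  go.
 - rewrite Rabs_left by auto. have P := exp_pos (2*v). go.
Qed.

Lemma vga_dom b : dom vga 0 b.
Proof. apply dom_id_mult, ga_dom. Qed.

Lemma Gam_CL s : 0 < Re s -> is_CL (Lin ga s) (Gam s).
Proof. intros H. apply (Lap_CL _ 0 (Re s+1)); [apply RC_ga|apply ga_dom|lra]. Qed.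
Lemma Gam1_CL s : 0 < Re s -> is_CL (Lin vga s) (Gam1 s).
Proof. intros H. apply (Lap_CL _ 0 (Re s+1)); [apply RC_vga|apply vga_dom|lra]. Qed.

Lemma Gam_Cd s : 0 < Re s -> Cd Gam s (Gam1 s).
Proof. intros H. apply (Lap_Cd _ 0 (Re s+1)); [apply RC_ga|apply ga_dom|lra]. Qed.

Lemma Lin_ga_2 s v : Lin (fun v => exp (2*v)*ga v) s v = Lin ga (s+2)%C v.
Proof.
 unfold Lin. replace ((s+2)*v)%C with (s*v+RtoC (2*v))%C by go.
 rewrite Cexp_add, Cexp_RtoC, RtoC_mult. Cring.
Qed.

Lemma Gam_step s : 0 < Re s -> Gam (s+2)%C = (s/2*Gam s)%C.
Proof.
 intros Hs.
 have : dom (fun v => - 2*(exp (2*v)*ga v)) 0 (Re s+1).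
 { intros sg Hsg. destruct (ga_dom (sg+3) (sg+2) $) as [M [c [Hc K]]]. exists (2*M), c. split; auto. intros v.
  specialize (K v). rewrite !Rabs_mult, Rabs_left, Rabs_pos_eq by go.
  replace ((sg+2)*v) with (2*v+sg*v) in K by ring. rewrite exp_plus in K.
  go. }
 have K := Lap_parts ga (fun v => - 2*(exp (2*v)*ga v)) 0 (Re s+1) s.
 have E : Lap (fun v => - 2*(exp (2*v)*ga v)) s = (- 2*Gam (s+2))%C.
 { apply is_CL_IL. apply (is_CL_ext (fun t => (- 2*Lin ga (s+2) t)%C)); [|apply is_CL_scal; [|apply Gam_CL]].
  - intros t. rewrite <- Lin_ga_2. go.
  - apply CC_Lin, RC_ga.
  - unfold Re in *; simpl; lra. }
 rewrite E in K. have K2 : (- 2*Gam (s+2))%C = (-(s*Gam s))%C.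
 { apply K; [| |apply ga_dom|go|lra].
  - intros v. unfold ga. auto_derive; auto. ring.
  - apply RC_mult; [go|]. apply RC_mult; [go|apply RC_ga]. }
 transitivity (- /2*(- 2*Gam (s+2)))%C; [go|]. rewrite K2. Cfield.
Qed.

Lemma Gam1_step s : 0 < Re s -> Gam1 (s+2)%C = (/2*Gam s+s/2*Gam1 s)%C.
Proof.
 intros Hs. apply (Cd_unique (fun z => Gam (z+2)%C) s).
 - eapply Cd_eq; [apply Cd_comp; [apply Gam_Cd; unfold Re in *; simpl; lra|go]|Cring].
 - apply (Cd_ext_loc (fun z => z/2*Gam z)%C _ _ _ (Re s)); [go| |].
  + symmetry. apply Gam_step. have Q := re_le_Cmod h. apply Rabs_le_between in Q. unfold Re in *; simpl; lra.
  + eapply Cd_eq; [apply Cd_mult; [|apply Gam_Cd; auto]|].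
   * apply Cd_mult; [go|go].
   * go.
Qed.

Lemma Gam_2 : Gam 2 = 1%C.
Proof.
 apply is_CL_IL. replace (RtoC 1) with (0-RtoC (- 1))%C by Cring.
 apply (is_CL_FTC (fun v => RtoC (-exp (-exp (2*v))))).
 - intros v. rewrite Lin_RtoC. split; [|exact (is_derive_const 0 v)]. simpl. unfold ga. auto_derive; auto. ring.
 - apply CC_Lin, RC_ga.
 - intros e He. destruct (exp_small 1 $ 1 e He) as [N [HN K]]. exists N. intros T HT. specialize (K T HT).
  replace (RtoC (-exp (-exp (2*T)))-0)%C with (RtoC (-exp (-exp (2*T)))) by Cring.
  replace (RtoC (-exp (-exp (2*- T)))-RtoC (- 1))%C with (RtoC (1-exp (-exp (2*- T)))) by Cring.
  rewrite !Cmod_R, Rabs_Ropp.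
  have Q1 := exp_ineq1_le (2*T). have Q2 := exp_ineq1_le (-exp (2*- T)). have P := exp_pos (-exp (2*T)). have P3 := exp_pos (2*- T).
  split.
  + rewrite Rabs_pos_eq by lra. le_tr; [|exact K]. rewrite Rmult_1_l. go.
  + assert (exp (-exp (2*- T)) <= 1) by (rewrite <- exp_0; apply exp_le; lra). rewrite Rabs_pos_eq by lra.
   assert (exp (2*- T) <= exp (-(1)*T)) by (apply exp_le; lra). lra.
Qed.

(* [Wn N] is [(N-1)!] for [N >= 1]. *)
Fixpoint Wn (N : nat) : R := match N with O => 1 | S O => 1 | S M => INR M*Wn M end.

Lemma Wn_S N : Wn (S (S N)) = INR (S N)*Wn (S N).
Proof. go. Qed.

Lemma Wn_pos N : 0 < Wn N.
Proof. induction N as [|[|N] IH]; [go|go|]. rewrite Wn_S. go. Qed.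

Lemma Gam_nat N : Gam (RtoC (2*INR (S N))) = RtoC (Wn (S N)).
Proof.
 induction N as [|N IH].
 - simpl. replace (2*1) with 2 by ring. apply Gam_2.
 - replace (RtoC (2*INR (S (S N)))) with (RtoC (2*INR (S N))+2)%C by go.
  rewrite Gam_step by (change (0 < 2*INR (S N)); generalize (lt_0_INR (S N) ltac:(lia)); lra). rewrite IH, Wn_S, !RtoC_mult. go.
Qed.

Lemma Wn_up N m : (1 <= N)%nat -> (m <= N)%nat -> Wn (N+m) <= Wn N*(2*INR N)^m.
Proof.
 intros HN Hm. induction m as [|m IH]; [rewrite Nat.add_0_r; simpl; lra|].
 specialize (IH ltac:(lia)). destruct N as [|N]; [lia|]. replace (S N+S m)%nat with (S (S (N+m))) by lia. rewrite Wn_S.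
 replace (S (N+m)) with (S N+m)%nat by lia. have P := Wn_pos (S N+m).
 assert (INR (S N+m) <= 2*INR (S N)). { rewrite plus_INR. assert (INR m <= INR (S N)) by go. lra. }
 change ((2*INR (S N))^S m) with (2*INR (S N)*(2*INR (S N))^m). assert (0 <= INR (S N+m)) by apply pos_INR.
 go.
Qed.

Lemma Wn_down N m : (2*m < N)%nat -> Wn (N-m)*INR N^m <= Wn N*2^m.
Proof.
 intros Hm. induction m as [|m IH]; [rewrite Nat.sub_0_r; simpl; lra|].
 specialize (IH ltac:(lia)). destruct (N-S m)%nat as [|k] eqn:E; [lia|].
 replace (N-m)%nat with (S (S k)) in IH by lia. rewrite Wn_S in IH.
 have : INR N <= 2*INR (S k). { change 2 with (INR 2). rewrite <- mult_INR. go. }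
 simpl pow. have P := Wn_pos (S k). have : INR N*(Wn (S k)*INR N^m) <= 2*INR (S k)*(Wn (S k)*INR N^m) by go.
 lra.
Qed.

(* Concentration of the Gamma(N) law around N, tested against the variable w = v - ln N / 2, i.e. y = e^{2v}/N = e^{2w}. *)
Definition hbound (N M : nat) (y : R) : R := sqrt (INR N)*(y-1)^2+/sqrt (INR N)*(y^M+(/y)^M).

(** With y = e^(2w), |w| is at most y - 1 or 1/y - 1, so this is an instance of a b <= q a^2 + b^2/q
    with |a| = |y - 1|. Every resulting term is a power of y, whose mean under the Gamma law is a
    ratio of values of [Wn]. *)
Lemma w_bound (N K : nat) w : (1 <= N)%nat -> Rabs w*exp (2*INR K*Rabs w) <= hbound N (2*K+2) (exp (2*w)).
Proof.
 intros HN. unfold hbound. set (q := sqrt (INR N)). have : 0 < q by go.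
 have : forall a b, a*b <= q*a^2+/q*b^2.
 { intros a b. have Z : 0 <= q*(a-/(2*q)*b)^2 by go.
  replace (q*(a-/(2*q)*b)^2) with (q*a^2-a*b+/4*(/q*b^2)) in Z by go.
  assert (0 <= /q*b^2) by go. lra. }
 have : 0 < /q by go.
 have EK : forall u, exp (2*INR K*u) = exp (2*u)^K by (intros u; rewrite <- exp_INR; f_equal; ring).
 have Hy := exp_pos (2*w). have E := exp_ineq1_le (2*Rabs w).
 destruct (Rle_lt_dec 0 w) as [Hw|Hw].
 - rewrite Rabs_pos_eq in * by auto. rewrite EK. set (y := exp (2*w)) in *.
  have : 0 < y^K by go. have P2 : 0 <= (/y)^(2*K+2) by go.
  apply Rle_trans with ((y-1)*(y^K*y)). { go. }
  le_tr; [go|]. apply Rplus_le_compat_l, Rmult_le_compat_l; [lra|]. replace ((y^K*y)^2) with (y^(2*K+2)); [lra|].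
  rewrite pow_add, pow_mult. replace (y^2) with (y*y) by ring. rewrite Rpow_mult_distr. ring.
 - rewrite Rabs_left in * by auto. rewrite EK. replace (2*- w) with (-(2*w)) in * by ring. rewrite exp_Ropp in *. set (y := exp (2*w)) in *.
  have P2 : 0 <= y^(2*K+2) by go.
  apply Rle_trans with ((1-y)*((/y)^K*/y)).
  { replace ((1-y)*((/y)^K*/y)) with ((/y-1)*(/y)^K) by go. go. }
  le_tr; [go|]. replace ((1-y)^2) with ((y-1)^2) by ring. apply Rplus_le_compat_l, Rmult_le_compat_l; [lra|]. replace (((/y)^K*/y)^2) with ((/y)^(2*K+2)); [lra|].
  rewrite pow_add, pow_mult. replace ((/y)^2) with (/y*/y) by ring. rewrite Rpow_mult_distr. ring.
Qed.

#[export] Hint Resolve RC_ga RC_vga ga_pos Gam_Cd Wn_pos : cont.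

Lemma exp_ge_3 x : 0 <= x -> 1+x+x^2/2+x^3/6 <= exp x.
Proof. intros H. have K := exp_ge_taylor x 3 H. simpl in K. go. Qed.

Lemma ga_nat_RL n : (1 <= n)%nat -> is_RL (fun v => ga v*exp (2*INR n*v)) (Wn n).
Proof.
 intros Hn. destruct n as [|n]; [lia|]. unfold is_RL. rewrite <- Gam_nat.
 eapply is_CL_ext; [|apply Gam_CL].
 - apply Lin_RtoC.
 - change (0 < 2*INR (S n)). go.
Qed.

Lemma RC_ga_nat n : RC (fun v => ga v*exp (2*INR n*v)).
Proof. go. Qed.

Definition hN (N M : nat) (v : R) : R := ga v*exp (2*INR N*v)*hbound N M (exp (2*(v-ln (INR N)/2))).

(** The Gamma(N) law of y N has mean N and variance N, so the square term contributes sqrt(N)/N; the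
    means of y^M and y^(-M) are at most 2^M. *)
Lemma hN_RL N M : (2*M < N)%nat -> exists l, is_RL (hN N M) l /\ l <= Wn N*((1+2*2^M)/sqrt (INR N)).
Proof.
 intros HN. have : 0 < INR N by go. set (n := INR N) in *. set (q := sqrt n). have : 0 < q by go.
 have Hqq : q*q = n by (apply sqrt_sqrt; lra).
 set (f := fun k v => ga v*exp (2*INR k*v)).
 have HR : forall k c, (1 <= k)%nat -> is_RL (fun v => c*f k v) (c*Wn k) by (intros; apply is_RL_scal; [apply RC_ga_nat|apply ga_nat_RL; auto]).
 have HC : forall k c, RC (fun v => c*f k v) by go.
 exists ((((q/n^2*Wn (N+2)+- 2*q/n*Wn (N+1))+q*Wn N)+/q/n^M*Wn (N+M))+/q*n^M*Wn (N-M)). split.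
 - eapply is_RL_ext; [|].
  2:{ have H1 := is_RL_plus _ _ _ _ (HC (N+2)%nat (q/n^2)) (HC (N+1)%nat (- 2*q/n)) (HR (N+2)%nat (q/n^2) ltac:(lia)) (HR (N+1)%nat (- 2*q/n) ltac:(lia)).
    have C1 := RC_plus _ _ (HC (N+2)%nat (q/n^2)) (HC (N+1)%nat (- 2*q/n)).
    have H2 := is_RL_plus _ _ _ _ C1 (HC N q) H1 (HR N q ltac:(lia)). have C2 := RC_plus _ _ C1 (HC N q).
    have H3 := is_RL_plus _ _ _ _ C2 (HC (N+M)%nat (/q/n^M)) H2 (HR (N+M)%nat (/q/n^M) ltac:(lia)). have C3 := RC_plus _ _ C2 (HC (N+M)%nat (/q/n^M)).
    exact (is_RL_plus _ _ _ _ C3 (HC (N-M)%nat (/q*n^M)) H3 (HR (N-M)%nat (/q*n^M) ltac:(lia))). }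
  intros v. cbv beta. unfold f, hN, hbound. fold n. fold q.
  have Ey : exp (2*(v-ln n/2)) = exp (2*v)/n.
  { replace (2*(v-ln n/2)) with (2*v+- ln n) by field. rewrite exp_plus, exp_Ropp, exp_ln by auto. go. }
  rewrite Ey. set (y := exp (2*v)). have : 0 < y by apply exp_pos.
  have EN : forall k, exp (2*INR k*v) = y^k by (intros k; unfold y; rewrite <- exp_INR; f_equal; ring).
  rewrite !EN, !pow_add. replace (y^(N-M)) with (y^N*(/y)^M).
  2:{ replace (y^N) with (y^(N-M)*y^M) by (rewrite <- pow_add; f_equal; lia). rewrite pow_inv. field. apply pow_nonzero; lra. }
  replace ((y/n)^M) with (y^M*(/n)^M) by (unfold Rdiv; rewrite Rpow_mult_distr; reflexivity).
  replace ((/(y/n))^M) with ((/y)^M*n^M) by (rewrite <- Rpow_mult_distr; f_equal; field; lra).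
  rewrite (pow_inv n). have EN' := EN N. fold n in EN'. rewrite EN'. field. repeat split; try lra. apply pow_nonzero; lra.
 - have HM : 0 < n^M by go.
  destruct N as [|N']; [lia|]. replace (S N'+2)%nat with (S (S (S N'))) by lia. replace (S N'+1)%nat with (S (S N')) by lia.
  rewrite Wn_S, Wn_S. replace (INR (S (S N'))) with (n+1) by go.
  have U := Wn_up (S N') M ltac:(lia) ltac:(lia). have D := Wn_down _ M HN. fold n in U, D.
  have : 0 < /q by go.
  have : /q/n^M*Wn (S N'+M) <= /q*(Wn (S N')*2^M).
  { unfold Rdiv. rewrite Rmult_assoc. mul_l; [lra|]. rewrite Rmult_comm. apply (proj2 (Rle_div_l _ _ _ HM)). rewrite Rpow_mult_distr in U. lra. }
  have : q/n^2*((n+1)*(n*Wn (S N')))+-2*q/n*(n*Wn (S N'))+q*Wn (S N') = /q*Wn (S N').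
  { rewrite <- Hqq. go. }
  go.
Qed.

Lemma RC_hN N M : (1 <= N)%nat -> RC (hN N M).
Proof.
 intros HN. unfold hN, hbound. apply RC_derive. intros v. unfold ga. auto_derive. repeat split; auto; apply Rgt_not_eq, exp_pos.
Qed.

Notation sft s N := (s+RtoC (2*INR N))%C.

(** Gauss's limit: [Gam] at s + 2N behaves like Wn N times N^(s/2), and its logarithmic derivative
    like ln(N)/2. Both follow from integrating e^(s(v-L)) - 1 and v - L, with L = ln(N)/2, against a
    density concentrated at L. *)
Lemma Gam_conc (s : C) : 0 < Re s -> exists K, 0 < K /\ exists N0, forall N, (N0 <= N)%nat ->
 Cmod (Gam (sft s N)*Cexp (-(s*RtoC (ln (INR N)/2)))-RtoC (Wn N))%C <= Wn N*(K/sqrt (INR N)) /\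
 Cmod ((Gam1 (sft s N)-RtoC (ln (INR N)/2)*Gam (sft s N))*Cexp (-(s*RtoC (ln (INR N)/2))))%C <= Wn N*(K/sqrt (INR N)).
Proof.
 (* An integer k above |s| makes [w_bound] dominate e^(|s| |w|); M = 2k + 2 is the power of y which
    that lemma produces. *)
 destruct (INR_unbounded (Cmod s)) as [k Hk]. set (M := (2*k+2)%nat). set (B := 1+2*2^M).
 have : 0 < B by go. have Hc := Cmod_ge_0 s.
 exists ((Cmod s+1)*B). split; [nra|]. exists (2*M+1)%nat. intros N HN.
 destruct (hN_RL N M ltac:(lia)) as [l [Hl Hb]]. fold B in Hb.
 have : 0 < INR N by go. set (L := ln (INR N)/2). set (q := sqrt (INR N)) in *. have HsN : 0 < Re (sft s N)%C by (unfold Re in *; simpl; lra).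
 have : 0 <= Wn N*(B/q) by go.
 have Elin : forall v, (Lin ga (sft s N) v*Cexp (-(s*L)))%C = (RtoC (ga v*exp (2*INR N*v))*Cexp (RtoC (v-L)*s))%C.
 { intros v. unfold Lin. replace ((sft s N)*v)%C with (s*v+RtoC (2*INR N*v))%C by go.
  rewrite Cexp_add, Cexp_RtoC, RtoC_mult. replace (RtoC (v-L)*s)%C with (s*v+- (s*L))%C by go. rewrite Cexp_add. Cring. }
 have Bw : forall v, Rabs (v-L)*exp (Rabs (v-L)*Cmod s) <= hbound N M (exp (2*(v-L))).
 { intros v. le_tr; [|apply w_bound; lia]. mul_l; [go|]. apply exp_le.
  have Z := Rabs_pos (v-L). go. }
 have : forall v, 0 <= ga v*exp (2*INR N*v) by go.
 split.
 - have H1 : is_CL (fun v => (Lin ga (sft s N) v*Cexp (-(s*L))-RtoC (ga v*exp (2*INR N*v)))%C) (Gam (sft s N)*Cexp (-(s*L))-(Wn N)).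
  { apply is_CL_minus.
   - go.
   - go.
   - rewrite (Cmult_comm (Gam _)). apply (is_CL_ext (fun v => (Cexp (-(s*L))*Lin ga (sft s N) v)%C)); [go|].
    apply is_CL_scal; [go|apply Gam_CL; auto].
   - apply ga_nat_RL; lia. }
  apply Rle_trans with (Cmod s*l).
  + change (Cmod s*l) with (Re (RtoC (Cmod s*l))).
   eapply (is_CL_Re_le _ (fun v => Cmod s*hN N M v)); [| |exact H1|apply is_RL_scal; [apply RC_hN; lia|go]|].
   * go.
   * apply RC_mult; [go|apply RC_hN; lia].
   * intros v. cbv beta. rewrite Elin. unfold hN. fold L.
    replace (RtoC (ga v*exp (2*INR N*v))*Cexp (RtoC (v-L)*s)-RtoC (ga v*exp (2*INR N*v)))%C with (RtoC (ga v*exp (2*INR N*v))*(Cexp (RtoC (v-L)*s)-1))%C by Cring.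
    rewrite Cmod_mult, Cmod_R, Rabs_pos_eq by auto.
    replace (Cmod s*(ga v*exp (2*INR N*v)*hbound N M (exp (2*(v-L))))) with (ga v*exp (2*INR N*v)*(Cmod s*hbound N M (exp (2*(v-L))))) by ring.
    mul_l; auto. ub Cexp_m1_bound. rewrite Cmod_mult, Cmod_R.
    specialize (Bw v). go.
  + go.
 - assert (H1 : is_CL (fun v => (Cexp (-(s*L))*(Lin vga (sft s N) v-L*Lin ga (sft s N) v))%C)
    (Cexp (-(s*L))*(Gam1 (sft s N)-L*Gam (sft s N)))).
  { have CA := CC_Lin _ (sft s N)%C RC_vga. have CB := CC_Lin _ (sft s N)%C RC_ga.
   exact (is_CL_scal _ _ _ (CC_minus _ _ CA (CC_mult _ _ (CC_const _) CB)) (is_CL_minus _ _ _ _ CA (CC_mult _ _ (CC_const _) CB) (Gam1_CL _ HsN) (is_CL_scal _ _ _ CB (Gam_CL _ HsN)))). }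
  rewrite Cmult_comm. apply Rle_trans with l.
  + change l with (Re (l)).
   eapply (is_CL_Re_le _ (hN N M)); [| |exact H1|go|].
   * go.
   * apply RC_hN; lia.
   * intros v. cbv beta. replace (Cexp (-(s*L))*(Lin vga (sft s N) v-L*Lin ga (sft s N) v))%C
     with (RtoC (v-L)*(Lin ga (sft s N) v*Cexp (-(s*L))))%C by (unfold Lin, vga; rewrite RtoC_mult, RtoC_minus; Cring).
    rewrite Elin, !Cmod_mult, !Cmod_R, Cmod_Cexp, (Rabs_pos_eq (ga v*_)) by auto. rewrite Rmult_comm, Rmult_assoc, (Rmult_comm (exp _)). mul_l; auto.
    le_tr; [|go]. mul_l; [go|]. apply exp_le.
    ub Re_le_Cmod. rewrite Cmod_mult, Cmod_R. lra.
  + go.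
Qed.

Lemma INR_sqrt_large K eps : 0 < eps -> exists N0, forall N, (N0 <= N)%nat -> K/sqrt (INR N) <= eps /\ (1 <= N)%nat.
Proof.
 destruct (INR_unbounded ((Rabs K/eps)^2+1)) as [n Hn]. exists (S n). split; [|lia].
 have : INR n <= INR N by go. have Hq : 0 < sqrt (INR N) by go.
 apply (proj2 (Rle_div_l K _ _ Hq)). have Q : Rabs K/eps <= sqrt (INR N).
 { rewrite <- (sqrt_pow2 _); [go|]. go. }
 apply Rle_div_l in Q; [|go]. generalize (Rle_abs K); lra.
Qed.

Lemma Gam_steps_0 s N : 0 < Re s -> Gam s = 0%C -> Gam (sft s N)%C = 0%C.
Proof.
 intros Hs H0. induction N as [|N IH].
 - rewrite Rmult_0_r. replace (s+0)%C with s by Cring. go.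
 - replace (s+RtoC (2*INR (S N)))%C with (s+RtoC (2*INR N)+2)%C by (rewrite S_INR; Cring).
  rewrite Gam_step, IH; [Cring|]. unfold Re in *; simpl. go.
Qed.

(** A zero would propagate to every s + 2N by the recursion, where concentration keeps the
    normalised value close to the positive number [Wn N]. *)
Lemma Gam_neq0 s : 0 < Re s -> Gam s <> 0%C.
Proof.
 intros Hs H0. destruct (Gam_conc s Hs) as [K [HK [N0 HN]]]. destruct (INR_sqrt_large K (1/2) $) as [N1 HN1].
 destruct (HN (N0+N1)%nat ltac:(lia)) as [A _]. destruct (HN1 (N0+N1)%nat ltac:(lia)) as [B _].
 rewrite (Gam_steps_0 s _ Hs H0) in A. have P := Wn_pos (N0+N1).
 rewrite Cmult_0_l, Cmod_minus_sym in A. replace ((Wn (N0+N1))-0)%C with (RtoC (Wn (N0+N1))) in A by Cring.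
 rewrite Cmod_R, Rabs_pos_eq in A by lra. nra.
Qed.

(** * The logarithmic derivative of Gamma *)

(** Half the digamma function at s/2, because [Gam s] is Gamma(s/2). *)
Definition LG (s : C) : C := (Gam1 s/Gam s)%C.
Fixpoint cs (s : C) (N : nat) : C := match N with O => 0%C | S n => (cs s n+/(s+RtoC (2*INR n)))%C end.

Lemma Re_neq0 s : 0 < Re s -> s <> 0%C.
Proof. intros H E. rewrite E in H. simpl in H. lra. Qed.

Lemma LG_steps s N : 0 < Re s -> LG (sft s N)%C = (LG s+cs s N)%C.
Proof.
 intros Hs. induction N as [|N IH].
 - rewrite Rmult_0_r. replace (s+0)%C with s by Cring. Cring.
 - replace (s+RtoC (2*INR (S N)))%C with (s+RtoC (2*INR N)+2)%C by (rewrite S_INR; Cring).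
  set (z := (sft s N)%C) in *. have Hz : 0 < Re z by (unfold z, Re in *; simpl; generalize (pos_INR N); lra).
  simpl cs. fold z. replace (LG s+(cs s N+/z))%C with ((LG s+cs s N)+/z)%C by Cring. rewrite <- IH.
  unfold LG. rewrite Gam_step, Gam1_step by auto. have N1 := Gam_neq0 z Hz. have N2 := Re_neq0 z Hz.
  go.
Qed.

Lemma LG_limit s eps : 0 < Re s -> 0 < eps -> exists N0, forall N, (N0 <= N)%nat -> (1 <= N)%nat /\ Cmod (LG s+cs s N-RtoC (ln (INR N)/2))%C <= eps.
Proof.
 intros Hs He. destruct (Gam_conc s Hs) as [K [HK [N0 HN]]]. destruct (INR_sqrt_large K (Rmin (1/2) (eps/2)) ltac:(apply Rmin_pos; lra)) as [N1 HN1].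
 exists (N0+N1)%nat. intros N HNN. destruct (HN N ltac:(lia)) as [A B]. destruct (HN1 N ltac:(lia)) as [D D1]. split; auto.
 have M1 := Rmin_l (1/2) (eps/2). have M2 := Rmin_r (1/2) (eps/2).
 rewrite <- LG_steps by auto. set (z := (sft s N)%C) in *. have Hz : 0 < Re z by (unfold z, Re in *; simpl; generalize (pos_INR N); lra).
 set (E := Cexp (-(s*RtoC (ln (INR N)/2)))) in *. have P := Wn_pos N. have NG := Gam_neq0 z Hz. have T := Cmod_triangle_inv ((Wn N)) (Gam z*E). rewrite Cmod_minus_sym, Cmod_R, Rabs_pos_eq in T by lra.
 have : Wn N/2 <= Cmod (Gam z*E) by nra.
 unfold LG. replace (Gam1 z/Gam z-RtoC (ln (INR N)/2))%C with ((Gam1 z-RtoC (ln (INR N)/2)*Gam z)*E/(Gam z*E))%C by go.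
 rewrite Cmod_div by (apply Cmod_gt_0; lra). apply (proj2 (Rle_div_l _ _ (Cmod (Gam z*E)) $)). nra.
Qed.

Lemma Re_Cinv z : Re (/z)%C = Re z/(Re z^2+Im z^2).
Proof. go. Qed.

(** The added 1/4 turns the arguments into V + 1/2 + u and V + 1/2 - u with V = u^2 + y^2. The
    inequality then holds termwise, and the left side telescopes when u runs through steps of 1. *)
Lemma digamma_term u y : 0 < u -> ln ((u+1/2)^2+y^2+1/4)-ln ((u-1/2)^2+y^2+1/4) <= 2*(u/(u^2+y^2)).
Proof.
 intros Hu. set (V := u^2+y^2). have : 0 < V by go. set (m := u/V).
 have : 0 < m by go. have : u = m*V by go.
 have : m^2*V <= 1. { go. }
 have HD : 0 < V+1/2-u by go.
 replace ((u+1/2)^2+y^2+1/4) with (V+1/2+u) by go. replace ((u-1/2)^2+y^2+1/4) with (V+1/2-u) by go.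
 rewrite <- ln_div by lra. rewrite <- ln_exp. apply ln_le; [go|].
 le_tr; [|apply exp_ge_3; lra]. apply (proj2 (Rle_div_l _ _ _ HD)).
 assert (0 <= (1-m^2*V)*(2/3*m+4/3*m^2)) by go.
 go.
Qed.

Lemma ln_ge_1m x : 0 < x -> 1-/x <= ln x.
Proof.
 intros Hx. have K := exp_ineq1_le (ln (/x)). rewrite exp_ln in K by go. rewrite ln_Rinv in K by auto. lra.
Qed.

Lemma ln_le_m1 x : 0 < x -> ln x <= x-1.
Proof. intros Hx. have K := exp_ineq1_le (ln x). rewrite exp_ln in K by auto. lra. Qed.

Lemma Re_cs s N : 0 < Re s ->
 /4*(ln ((Re s/2+INR N-1/2)^2+(Im s/2)^2+1/4)-ln ((Re s/2-1/2)^2+(Im s/2)^2+1/4)) <= Re (cs s N).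
Proof.
 intros Hs. induction N as [|N IH].
 - rewrite Rplus_0_r. go.
 - set (u := Re s/2+INR N). have Hu : 0 < u by go.
  have D := digamma_term u (Im s/2) Hu. fold u in IH.
  have : Re (cs s (S N)) = Re (cs s N)+/2*(u/(u^2+(Im s/2)^2)).
  { change (Re (cs s N)+Re (/(sft s N))%C = Re (cs s N)+/2*(u/(u^2+(Im s/2)^2))). rewrite Re_Cinv.
   replace (Re (sft s N)%C) with (2*u) by (unfold u, Re; simpl; field). replace (Im (sft s N)%C) with (2*(Im s/2)) by go.
   field. go. }
  rewrite S_INR. replace (Re s/2+(INR N+1)-1/2) with (u+1/2) by go. lra.
Qed.

(** Explicit upper bound for the digamma function with the correct logarithm at large height.
    Through [EE_lower] it becomes the archimedean density [dens]. *)
Lemma LG_Re_le s : 0 < Re s -> Re (LG s) <= /4*ln ((Re s/2-1/2)^2+(Im s/2)^2+1/4).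
Proof.
 intros Hs. apply le_epsilon. intros e He. destruct (LG_limit s (e/2) Hs $) as [N0 HN].
 destruct (INR_unbounded (2/e+1)) as [n1 Hn1]. set (N := (N0+n1)%nat). destruct (HN N ltac:(go)) as [HN1 K].
 have K2 := Rle_trans _ _ _ (Re_le_Cmod _) K. change (Re (LG s)+Re (cs s N)-ln (INR N)/2 <= e/2) in K2.
 have C := Re_cs s N Hs. have : INR n1 <= INR N by (apply le_INR; unfold N; lia). set (n := INR N) in *.
 have : 0 < 2/e by go.
 have : 2*ln (n-1/2) <= ln ((Re s/2+n-1/2)^2+(Im s/2)^2+1/4).
 { replace (2*ln (n-1/2)) with (ln ((n-1/2)^2)) by (rewrite ln_pow by lra; simpl; ring). go. }
 have : ln n-ln (n-1/2) <= e/2.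
 { rewrite <- ln_div by lra. le_tr; [apply ln_le_m1; apply Rdiv_lt_0_compat; lra|].
  replace (n/(n-1/2)-1) with (1/2/(n-1/2)) by go. apply (proj2 (Rle_div_l _ _ (n-1/2) $)).
  assert (2/e*e = 2) by go. nra. }
 lra.
Qed.

Lemma Re_cs_up s N : 0 < Re s -> Re (cs s N) <= /Re s+/2*ln ((Re s+2*INR N)/Re s).
Proof.
 intros Hs. set (x := Re s) in *. destruct N as [|N].
 { simpl. rewrite Rmult_0_r, Rplus_0_r. unfold Rdiv. rewrite Rinv_r, ln_1 by lra. go. }
 have T : forall k, Re (/(sft s k))%C <= /(x+2*INR k).
 { intros k. set (a := x+2*INR k). have : 0 < a by go.
  set (b := Im (sft s k)%C). apply (proj2 (Rle_div_l a _ (a^2+b^2) ltac:(nra))).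
  apply Rmult_le_reg_l with a; [auto|]. rewrite <- Rmult_assoc, Rinv_r by lra. nra. }
 have Q : Re (cs s (S N)) <= /x+/2*ln ((x+2*INR N)/x).
 { induction N as [|N IH].
  - change (Re (cs s 1)) with (0+Re (/(s+RtoC (2*INR 0)))%C). have T0 := T O. rewrite Rmult_0_r, Rplus_0_r in *. unfold Rdiv. rewrite Rinv_r, ln_1 by lra. lra.
  - change (Re (cs s (S (S N)))) with (Re (cs s (S N))+Re (/(s+RtoC (2*INR (S N))))%C). specialize (T (S N)).
   have Hk := pos_INR N. rewrite S_INR in *. have L := ln_ge_1m ((x+2*(INR N+1))/(x+2*INR N)) ltac:(go).
   rewrite ln_div in * by lra.
   replace (1-/((x+2*(INR N+1))/(x+2*INR N))) with (2*/(x+2*(INR N+1))) in L by go. lra. }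
 le_tr; [exact Q|]. go.
Qed.

Lemma LG_Re_ge s : 0 < Re s -> /2*ln (Re s/2)-/Re s <= Re (LG s).
Proof.
 intros Hs. apply le_epsilon. intros e He. destruct (LG_limit s (e/2) Hs $) as [N0 HN].
 destruct (INR_unbounded (Re s/e)) as [n1 Hn1]. set (N := (N0+n1)%nat). destruct (HN N ltac:(go)) as [HN1 K].
 rewrite Cmod_minus_sym in K. have K2 := Rle_trans _ _ _ (Re_le_Cmod _) K. change (ln (INR N)/2-(Re (LG s)+Re (cs s N)) <= e/2) in K2.
 have C := Re_cs_up s N Hs. have : INR n1 <= INR N by go. have : 1 <= INR N by (change 1 with (INR 1); apply le_INR; auto). set (n := INR N) in *. set (x := Re s) in *.
 have L := ln_le_m1 ((x+2*n)/(2*n)) ltac:(go). rewrite ln_div in L by lra. rewrite ln_div in C by lra.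
 rewrite ln_mult in L by lra. rewrite ln_div by lra.
 assert ((x+2*n)/(2*n)-1 <= e/2).
 { replace ((x+2*n)/(2*n)-1) with (x/(2*n)) by go. apply (proj2 (Rle_div_l x _ (2*n) $)).
  have X : x/e < n by lra. apply Rlt_div_l in X; [|auto]. lra. }
 lra.
Qed.

Lemma cs_diff s N : 0 < Re s -> Cmod (cs s N-cs (RtoC (Re s)) N)%C <= Rabs (Im s)*(/(Re s)^2+/2*/Re s).
Proof.
 intros Hs. set (x := Re s) in *. have Hi := Rabs_pos (Im s). have T : forall k, Cmod (/(sft s k)-/(x+RtoC (2*INR k)))%C <= Rabs (Im s)*/(x+2*INR k)^2.
 { intros k. set (a := x+2*INR k). have Ha : 0 < a by go.
  have : Re (sft s k)%C = a by reflexivity.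
  have : (sft s k)%C <> 0%C by (apply Re_neq0; lra). rewrite <- RtoC_plus. fold a. have : RtoC a <> 0%C by (apply RtoC_neq0; lra).
  replace (/(sft s k)-/a)%C with ((a-(sft s k))/((sft s k)*a))%C by go.
  rewrite Cmod_div by (apply Cmult_neq_0; auto). rewrite Cmod_mult, Cmod_R, Rabs_pos_eq by lra.
  replace (a-(sft s k))%C with (-(Ci*(Im s)))%C by (unfold a, x, Re, Im; Cring).
  rewrite Cmod_opp, Cmod_mult, Cmod_Ci, Cmod_R, Rmult_1_l. mul_l; auto. have Q := Re_le_Cmod (sft s k)%C. go. }
 destruct N as [|N].
 { simpl. replace (0-0)%C with (RtoC 0) by Cring. rewrite Cmod_0. go. }
 have Q : Cmod (cs s (S N)-cs (x) (S N))%C <= Rabs (Im s)*(/x^2+/2*(/x-/(x+2*INR N))).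
 { induction N as [|N IH].
  - specialize (T O). change (INR 0) with 0 in *. simpl cs. rewrite Rmult_0_r, Rplus_0_r in *.
   replace (0+/(s+0)-(0+/(x+0)))%C with (/(s+0)-/(x+0))%C by Cring. go.
  - specialize (T (S N)). change (cs s (S (S N))) with (cs s (S N)+/(s+RtoC (2*INR (S N))))%C. change (cs (x) (S (S N))) with (cs (x) (S N)+/(x+RtoC (2*INR (S N))))%C.
   match goal with |- Cmod (?a+?b-(?c+?d))%C <= _ => replace (a+b-(c+d))%C with ((a-c)+(b-d))%C by Cring end.
   le_tr; [go|]. le_tr; [apply Rplus_le_compat; [exact IH|exact T]|]. rewrite <- Rmult_plus_distr_l. mul_l; auto.
   rewrite S_INR. set (a := x+2*INR N). replace (x+2*(INR N+1)) with (a+2) by go. have Ha : 0 < a by go.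
   assert (/(a+2)^2 <= /2*(/a-/(a+2))); [|lra]. replace (/2*(/a-/(a+2))) with (/(a*(a+2))) by go. go. }
 le_tr; [exact Q|]. mul_l; auto. assert (0 < /(x+2*INR N)) by go. lra.
Qed.

(** Linear growth in the imaginary part: this feeds the polynomial growth bounds for X1/X and [EE],
    which justify moving lines and the maximum principle. *)
Lemma LG_Im_growth s : 0 < Re s -> Cmod (LG s-LG (RtoC (Re s)))%C <= Rabs (Im s)*(/(Re s)^2+/2*/Re s).
Proof.
 intros Hs. apply le_epsilon. intros e He. destruct (LG_limit s (e/2) Hs $) as [N0 HN]. destruct (LG_limit ((Re s)) (e/2) Hs $) as [N1 HN1].
 set (N := (N0+N1)%nat). destruct (HN N ltac:(go)) as [_ A]. destruct (HN1 N ltac:(go)) as [_ B]. have C := cs_diff s N Hs.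
 replace (LG s-LG ((Re s)))%C with ((LG s+cs s N-RtoC (ln (INR N)/2))+(-(LG ((Re s))+cs ((Re s)) N-RtoC (ln (INR N)/2))+- (cs s N-cs ((Re s)) N)))%C by Cring.
 le_tr; [go|]. le_tr; [apply Rplus_le_compat_l, Cmod_triangle|]. rewrite !Cmod_opp. lra.
Qed.

#[export] Hint Resolve RC_ga_nat RC_hN Gam_neq0 Re_neq0 : cont.

(** * The Dirichlet eta function and the zeros of X *)

Fixpoint rsum (u : nat -> R) (n : nat) : R := match n with O => 0 | S m => rsum u m+u m end.
Fixpoint csum (u : nat -> C) (n : nat) : C := match n with O => 0%C | S m => (csum u m+u m)%C end.

Lemma rsum_sum_n u n : rsum u (S n) = sum_n u n.
Proof.
 induction n as [|n IH]; [rewrite sum_O; simpl; ring|]. rewrite sum_Sn, <- IH. go.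
Qed.

Lemma rsum_shift u n : rsum u (S n) = u O+rsum (fun k => u (S k)) n.
Proof. induction n as [|n IH]; [go|]. change (rsum u (S (S n))) with (rsum u (S n)+u (S n)). rewrite IH. go. Qed.

Lemma rsum_ext u v n : (forall k, (k < n)%nat -> u k = v k) -> rsum u n = rsum v n.
Proof. induction n as [|n IH]; intros H; [go|]. simpl. rewrite IH, H by go. go. Qed.

Lemma rsum_scal c u n : rsum (fun k => c*u k) n = c*rsum u n.
Proof. induction n as [|n IH]; simpl; [ring|]. go. Qed.

Lemma csum_ext u v n : (forall k, (k < n)%nat -> u k = v k) -> csum u n = csum v n.
Proof. induction n as [|n IH]; intros H; [go|]. simpl. rewrite IH, H by go. go. Qed.

Lemma csum_scal c u n : csum (fun k => c*u k)%C n = (c*csum u n)%C.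
Proof. induction n as [|n IH]; simpl; [Cring|]. rewrite IH. Cring. Qed.

Lemma csum_Re u n : Re (csum u n) = rsum (fun k => Re (u k)) n.
Proof. induction n as [|n IH]; [go|]. simpl. rewrite <- IH. go. Qed.
Lemma csum_Im u n : Im (csum u n) = rsum (fun k => Im (u k)) n.
Proof. induction n as [|n IH]; [go|]. simpl. rewrite <- IH. go. Qed.

Lemma alt_bound n : forall b : nat -> R, (forall k, 0 <= b (S k) <= b k) -> 0 <= rsum (fun k => (-1)^k*b k) n <= b O.
Proof.
 induction n as [|n IH]; intros b Hb; [simpl; generalize (Hb O); lra|].
 rewrite rsum_shift. have K := IH (fun k => b (S k)) (fun k => Hb (S k)).
 rewrite (rsum_ext _ (fun k => -1*((-1)^k*b (S k)))) by (intros; simpl; ring). rewrite rsum_scal. generalize (Hb O); lra.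
Qed.

Lemma rsum_split u n m : rsum u (n+m) = rsum u n+rsum (fun k => u (n+k)%nat) m.
Proof. induction m as [|m IH]; [rewrite Nat.add_0_r; simpl; ring|]. rewrite Nat.add_succ_r. go. Qed.

Lemma alt_remainder (b : nat -> R) n m : (forall k, 0 <= b (S k) <= b k) ->
 Rabs (rsum (fun k => (-1)^k*b k) (n+m)-rsum (fun k => (-1)^k*b k) n) <= b n.
Proof.
 intros Hb. rewrite rsum_split. replace (_+_-_) with (rsum (fun k => (-1)^(n+k)*b (n+k)%nat) m) by ring.
 rewrite (rsum_ext _ (fun k => (-1)^n*((-1)^k*b (n+k)%nat))) by (intros; rewrite pow_add; ring). rewrite rsum_scal, Rabs_mult, pow_1_abs, Rmult_1_l.
 have K := alt_bound m (fun k => b (n+k)%nat). cbv beta in K. rewrite Nat.add_0_r in K. rewrite Rabs_pos_eq; apply K; intros k; rewrite Nat.add_succ_r; apply Hb.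
Qed.

Definition te (x : R) (n : nat) : R := exp (-(PI*x)*INR (S n)^2).

Lemma te_decr x : 0 < x -> forall k, 0 <= te x (S k) <= te x k.
Proof.
 split; [left; apply exp_pos|]. apply exp_le. rewrite (S_INR (S k)). set (m := INR (S k)) in *.
 assert (0 <= PI*x*(2*m+1)) by go. nra.
Qed.

(** The terms with negative sign belong to the even integers 2m, and (2m)^2 x = m^2 (4x). *)
Lemma te_alt_even x K : 0 < x -> rsum (fun k => (-1)^k*te x k) (2*K) = rsum (te x) (2*K)-2*rsum (te (4*x)) K.
Proof.
 induction K as [|K IH]; [go|]. replace (2*S K)%nat with (S (S (2*K))) by lia. set (n := (2*K)%nat) in *. cbn [rsum]. have : te (4*x) K = te x (S n). { unfold te. f_equal. have En : INR n = 2*INR K by exact (mult_INR 2 K). rewrite !S_INR, En. ring. }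
  have En : (-1)^n = 1 by apply pow_1_even. cbn [pow]. go.
Qed.

Lemma te_lim x : 0 < x -> is_lim_seq (rsum (te x)) (om x).
Proof.
 intros Hx. apply is_lim_seq_incr_1. apply (is_lim_seq_ext (sum_n (te x))); [intros; symmetry; apply rsum_sum_n|]. apply (Series_correct _ (ex_om x Hx)).
Qed.

Lemma om_alt x N : 0 < x -> Rabs (om x-2*om (4*x)-rsum (fun k => (-1)^k*te x k) N) <= te x N.
Proof.
 intros Hx. set (S := rsum (fun k => (-1)^k*te x k)).
 have L : is_lim_seq (fun K => Rabs (S (2*(N+K))%nat-S N)) (Rabs (om x-2*om (4*x)-S N)).
 { apply (is_lim_seq_abs _ (Finite (om x-2*om (4*x)-S N))). apply is_lim_seq_minus'; [|apply is_lim_seq_const].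
  apply (is_lim_seq_ext (fun K => rsum (te x) (2*(N+K))%nat-2*rsum (te (4*x)) (N+K)%nat)); [intros; symmetry; apply te_alt_even; auto|].
  apply is_lim_seq_minus'.
  - apply is_lim_seq_subseq; [|apply te_lim; auto]. apply eventually_subseq. go.
  - apply (is_lim_seq_scal_l _ 2 (om (4*x))). apply is_lim_seq_subseq; [|apply te_lim; lra]. apply eventually_subseq. go. }
 apply (is_lim_seq_le _ (fun _ => te x N) _ (te x N)) in L; [go| |apply is_lim_seq_const].
 intros K. replace (2*(N+K))%nat with (N+(N+2*K))%nat by lia. apply alt_remainder. apply te_decr; auto.
Qed.

(** Twice the alternating theta series at x = e^(2v). Unlike [om] it stays bounded as x tends to 0,
    so its transform converges for Re s > 0 with no pole to remove. *)
Definition al (v : R) : R := 2*(om (exp (2*v))-2*om (4*exp (2*v))).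

Definition lm (n : nat) : R := ln (INR (S n))+ln PI/2.

Lemma te_ga v n : 2*te (exp (2*v)) n = ga (v+lm n).
Proof.
 unfold te, ga, lm. f_equal. f_equal. have Hpi := PI_RGT_0. have H := INR_S_ge1 n.
 replace (2*(v+(ln (INR (S n))+ln PI/2))) with (2*v+(ln (INR (S n))+ln (INR (S n))+ln PI)) by field.
 rewrite !exp_plus, !exp_ln by lra. ring.
Qed.

Lemma RC_al : RC al.
Proof.
 apply RC_mult; [go|]. apply RC_minus; [go|]. apply RC_mult; [go|].
 apply (RC_ext (fun v => om (exp (2*v+ln 4)))).
 - intros v. rewrite exp_plus, exp_ln by lra. go.
 - go.
Qed.

Lemma al_approx v N : Rabs (al v-2*rsum (fun k => (-1)^k*te (exp (2*v)) k) N) <= ga (v+lm N).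
Proof.
 rewrite <- te_ga. unfold al. replace (2*_-2*_) with (2*(om (exp (2*v))-2*om (4*exp (2*v))-rsum (fun k => (-1)^k*te (exp (2*v)) k) N)) by ring.
 rewrite Rabs_mult, Rabs_pos_eq by lra. mul_l; [lra|]. apply om_alt, exp_pos.
Qed.

Lemma al_le_ga v : Rabs (al v) <= ga v.
Proof.
 have H := al_approx v 0. rewrite Rmult_0_r, Rminus_0_r in H. le_tr; [exact H|].
 unfold ga, lm. mul_l; [lra|]. apply exp_le. apply Ropp_le_contravar, exp_le. simpl INR. rewrite ln_1.
 assert (0 <= ln PI) by (rewrite <- ln_1; apply ln_le; generalize PI2_3_2; lra). lra.
Qed.

Lemma al_dom b : dom al 0 b.
Proof.
 intros sg Hs. destruct (ga_dom b _ Hs) as [M [c [Hc K]]]. exists M, c. split; auto. intros v. le_tr; [|go].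
 mul_r; [go|]. rewrite (Rabs_pos_eq (ga v)) by go. apply al_le_ga.
Qed.

(* AA(s) = pi^(-s/2) Gamma(s/2) eta(s). *)
Definition AA (s : C) : C := Lap al s.
Definition ns (s : C) (n : nat) : C := Cexp (-(s*RtoC (ln (INR (S n))))).
Definition piC (s : C) : C := Cexp (-(s*RtoC (ln PI/2))).

Lemma AA_CL s : 0 < Re s -> is_CL (Lin al s) (AA s).
Proof. intros H. apply (Lap_CL _ 0 (Re s+1)); [apply RC_al|apply al_dom|lra]. Qed.

Lemma ga_shift_CL s n : 0 < Re s -> is_CL (Lin (fun v => ga (v+lm n)) s) (ns s n*piC s*Gam s)%C.
Proof.
 intros Hs. have E := Lap_shift _ 0 (Re s+1) s (lm n) RC_ga (ga_dom _) $.
 replace (Cexp (-(s*(lm n)))) with (ns s n*piC s)%C in E.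
 2:{ unfold ns, piC, lm. rewrite <- Cexp_add. f_equal. go. }
 fold (Gam s) in E. rewrite <- E.
 have H := is_CL_shift _ _ (lm n) (CC_Lin _ s RC_ga) (Gam_CL s Hs).
 have H2 : is_CL (Lin (fun v => ga (v+lm n)) s) (Cexp (-(s*(lm n)))*Gam s)%C.
 { eapply is_CL_ext; [|apply is_CL_scal; [|exact H]].
  - intros t. unfold Lin. rewrite Cmult_assoc, (Cmult_comm (Cexp _)), <- Cmult_assoc, <- Cexp_add. f_equal. f_equal. go.
  - have : RC (fun t => t+lm n) by go. destruct (CC_Lin _ s RC_ga) as [H1 H2].
   split; [apply (RC_comp (fun t => Re (Lin ga s t)))|apply (RC_comp (fun t => Im (Lin ga s t)))]; auto. }
 unfold Lap. rewrite (is_CL_IL _ _ H2). go.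
Qed.

Lemma RC_ga_shift c : RC (fun v => ga (v+c)).
Proof. apply RC_comp; [go|go]. Qed.

(** An alternating series is off by at most its first omitted term; integrated against e^(v Re s),
    that term is a translate of the Gamma integrand. *)
Lemma AA_eta_approx s N : 0 < Re s ->
 Cmod (AA s-piC s*Gam s*csum (fun k => RtoC ((-1)^k)*ns s k) N)%C <= exp (-(Re s*lm N))*Re (Gam (RtoC (Re s))).
Proof.
 intros Hs.
 assert (HS : forall n, CC (fun v => csum (fun k => RtoC ((-1)^k)*Lin (fun v => ga (v+lm k)) s v)%C n) /\
   is_CL (fun v => csum (fun k => RtoC ((-1)^k)*Lin (fun v => ga (v+lm k)) s v)%C n) (piC s*Gam s*csum (fun k => RtoC ((-1)^k)*ns s k) n)%C).
 { have : forall k, CC (fun v => RtoC ((-1)^k)*Lin (fun v => ga (v+lm k)) s v)%C by (intros; apply CC_mult; [go|apply CC_Lin, RC_ga_shift]).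
  induction n as [|n [IH1 IH2]]; simpl csum.
  - split; [go|]. replace (piC s*Gam s*0)%C with (0*Gam s)%C by Cring. eapply is_CL_ext; [|apply is_CL_scal; [|apply Gam_CL; auto]]; [intros; simpl; Cring|go].
  - split; [go|]. replace (piC s*Gam s*(csum (fun k => RtoC ((-1)^k)*ns s k) n+RtoC ((-1)^n)*ns s n))%C with
    (piC s*Gam s*csum (fun k => RtoC ((-1)^k)*ns s k) n+RtoC ((-1)^n)*(ns s n*piC s*Gam s))%C by Cring.
   apply is_CL_plus; auto. apply is_CL_scal; [apply CC_Lin, RC_ga_shift|apply ga_shift_CL; auto]. }
 destruct (HS N) as [C1 C2]. have CLf := is_CL_minus _ _ _ _ (CC_Lin _ s RC_al) C1 (AA_CL s Hs) C2.
 have Hg := ga_shift_CL ((Re s)) N Hs.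
 have Eg : is_CL (fun v => RtoC (ga (v+lm N)*exp (Re s*v))) (ns ((Re s)) N*piC ((Re s))*Gam ((Re s)))%C.
 { eapply is_CL_ext; [|exact Hg]. apply Lin_RtoC. }
 have K := is_CL_Re_le _ _ _ _ (CC_minus _ _ (CC_Lin _ s RC_al) C1) (RC_mult _ _ (RC_ga_shift _) (RC_exp_lin _)) CLf Eg.
 ub K.
 - intros v. cbv beta.
  have E : csum (fun k => RtoC ((-1)^k)*Lin (fun v => ga (v+lm k)) s v)%C N = (RtoC (2*rsum (fun k => ((-1)^k*te (exp (2*v)) k)%R) N)*Cexp (s*v))%C.
  { clear. induction N as [|N IH]; simpl; [go|]. rewrite IH. unfold Lin. rewrite <- te_ga, Rmult_plus_distr_l, RtoC_plus, !RtoC_mult. Cring. }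
  rewrite E. unfold Lin. replace ((al v)*Cexp (s*v)-RtoC (2*rsum (fun k => ((-1)^k*te (exp (2*v)) k)%R) N)*Cexp (s*v))%C with
   (RtoC (al v-2*rsum (fun k => ((-1)^k*te (exp (2*v)) k)%R) N)*Cexp (s*v))%C by go.
  rewrite Cmod_mult, Cmod_R, Cmod_Cexp. replace (Re (s*v)%C) with (Re s*v) by go. mul_r; [go|apply al_approx].
 - right. unfold ns, piC. rewrite <- Cexp_add. replace (-((Re s)*RtoC (ln (INR (S N))))+- ((Re s)*RtoC (ln PI/2)))%C with (RtoC (-(Re s*lm N))) by (unfold lm; Cring).
  rewrite Cexp_RtoC. go.
Qed.

Lemma ln_large K : exists N, forall n, (N <= n)%nat -> K <= ln (INR (S n)).
Proof.
 destruct (INR_unbounded (exp K)) as [N HN]. exists N. intros n Hn. rewrite <- (ln_exp K). apply ln_le; [go|]. rewrite S_INR. apply le_INR in Hn. lra.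
Qed.

Lemma AA_eta_lim s eps : 0 < Re s -> 0 < eps -> exists N0, forall N, (N0 <= N)%nat ->
 Cmod (AA s-piC s*Gam s*csum (fun k => RtoC ((-1)^k)*ns s k) N)%C <= eps.
Proof.
 intros Hs He. destruct (exp_small _ Hs (Re (Gam ((Re s)))) _ He) as [T [HT K]]. destruct (ln_large T) as [N0 HN]. exists N0. intros N Hn.
 le_tr; [apply AA_eta_approx; auto|]. rewrite Rmult_comm. replace (-(Re s*lm N)) with (-Re s*lm N) by ring. apply K.
 unfold lm. specialize (HN N Hn). assert (0 <= ln PI) by (rewrite <- ln_1; apply ln_le; generalize PI2_3_2; lra). lra.
Qed.

(** Link to [eta_zero]: the factor [piC s * Gam s] does not vanish, so a zero of [AA] forces the
    partial sums of eta to 0. The sum [sum_f_R0 f N] has S N terms, hence the shifted index. *)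
Lemma AA_zero_eta s : 0 < Re s -> AA s = 0%C -> eta_zero (Re s) (Im s).
Proof.
 intros Hs H0. have NG := Gam_neq0 s Hs. have : piC s <> 0%C by apply Cexp_neq_0.
 have : 0 < Cmod (piC s*Gam s)%C by (apply Cmod_gt_0, Cmult_neq_0; auto).
 have H : forall eps, 0 < eps -> exists N0, forall N, (N0 <= N)%nat -> Cmod (csum (fun k => RtoC ((-1)^k)*ns s k)%C (S N)) < eps.
 { intros eps He. destruct (AA_eta_lim s (Cmod (piC s*Gam s)%C*(eps/2)) Hs ltac:(nra)) as [N0 HN]. exists N0. intros N HN0. specialize (HN (S N) ltac:(lia)).
  rewrite H0 in HN. replace (0-piC s*Gam s*csum (fun k => RtoC ((-1)^k)*ns s k) (S N))%C with (-(piC s*Gam s*csum (fun k => RtoC ((-1)^k)*ns s k) (S N)))%C in HN by Cring.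
  rewrite Cmod_opp, Cmod_mult in HN. go. }
 have T : forall k, Cexp (-(s*RtoC (ln (INR (S k)))))%C = (RtoC (Rpower (INR (S k)) (-Re s))*((cos (Im s*ln (INR (S k))), - sin (Im s*ln (INR (S k))))%R : C))%C.
 { intros k. unfold Cexp, Rpower.
  replace (Re (-(s*RtoC (ln (INR (S k)))))%C) with (-Re s*ln (INR (S k))) by go.
  replace (Im (-(s*RtoC (ln (INR (S k)))))%C) with (-(Im s*ln (INR (S k)))) by go. rewrite cos_neg, sin_neg. Cring. }
 have sf : forall f N, sum_f_R0 f N = rsum f (S N) by (intros f N; induction N as [|N IH]; simpl; [ring|rewrite IH; simpl; ring]).
 split; intros eps He; destruct (H eps He) as [N0 HN]; exists N0; intros N HN0; specialize (HN N HN0); unfold R_dist; rewrite Rminus_0_r; (eapply Rle_lt_trans; [|exact HN]).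
 - replace (eta_re_partial (Re s) (Im s) N) with (Re (csum (fun k => RtoC ((-1)^k)*ns s k)%C (S N))); [apply re_le_Cmod|].
  rewrite csum_Re. unfold eta_re_partial. rewrite sf. apply rsum_ext. intros k _. unfold ns. rewrite T. go.
 - replace (eta_im_partial (Re s) (Im s) N) with (Im (csum (fun k => RtoC ((-1)^k)*ns s k)%C (S N))); [apply im_le_Cmod|].
  rewrite csum_Im. unfold eta_im_partial. rewrite sf. apply rsum_ext. intros k _. unfold ns. rewrite T. go.
Qed.

Lemma Cminus_neq0 (a b : C) : a <> b -> (a-b)%C <> 0%C.
Proof. intros N E. apply N. transitivity (a-b+b)%C; [Cring|]. rewrite E. Cring. Qed.

(** * From the alternating transform to X *)

Definition mn (v : R) : R := Rmin v 0.

Lemma RC_mn : RC mn.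
Proof.
 apply (RC_ext (fun v => /2*(v-Rabs v))).
 - intros v. unfold mn, Rmin. destruct Rle_dec; [rewrite Rabs_left1 by auto|rewrite Rabs_pos_eq by lra]; field.
 - go.
Qed.

(* For v < 0 modularity gives 2 om(e^{2v}) e^{sv} = ph(v) e^{(s-1/2)v} + Edge s v. *)
Definition Edge (s : C) (v : R) : C := (Cexp ((s-1)*RtoC (mn v))-Cexp (s*RtoC (mn v)))%C.
Definition Pedge (s : C) (m : R) : C := (Cexp ((s-1)*RtoC m)/(s-1)-Cexp (s*RtoC m)/s)%C.

Lemma CC_Edge s : CC (Edge s).
Proof.
 apply CC_minus; apply CC_Cexp; apply CC_mult; auto using CC_const, CC_RtoC, RC_mn.
Qed.

Lemma Cdr_exp_line c t : Cdr (fun v => Cexp (c*RtoC v)) t (c*Cexp (c*RtoC t)).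
Proof.
 eapply Cdr_eq; [eapply Cdr_ext; [|apply (Cexp_line_Cdr c t)]|]; [intros x; simpl; f_equal; Cring|]. f_equal. go.
Qed.

Lemma Cdr_minus f g t a b : Cdr f t a -> Cdr g t b -> Cdr (fun x => f x-g x)%C t (a-b)%C.
Proof.
 intros [A1 A2] [B1 B2]. split; unfold Re, Im in *; simpl.
 - eapply is_derive_ext; [|apply is_derive_Rminus; eauto]. go.
 - eapply is_derive_ext; [|apply is_derive_Rminus; eauto]. go.
Qed.

Lemma Cdr_scal c f t a : Cdr f t a -> Cdr (fun x => c*f x)%C t (c*a)%C.
Proof.
 intros H. eapply Cdr_eq; [apply (Cdr_mult _ f t 0 a); [split; exact (is_derive_const _ _)|go]|]. Cring.
Qed.

Lemma Pedge_Cdr (s : C) (t : R) : s <> 0%C -> s <> 1%C -> Cdr (Pedge s) t (Cexp ((s-1)*RtoC t)-Cexp (s*RtoC t)).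
Proof.
 intros N0 N1. have N2 := Cminus_neq0 _ _ N1.
 eapply Cdr_eq; [apply Cdr_minus; [eapply Cdr_ext; [|apply (Cdr_scal (/(s-1))%C), (Cdr_exp_line (s-1) t)]|eapply Cdr_ext; [|apply (Cdr_scal (/s)%C), (Cdr_exp_line s t)]]|].
 - intros x; simpl; unfold Cdiv; Cring.
 - intros x; simpl; unfold Cdiv; Cring.
 - go.
Qed.

Lemma Cdr_ext_loc f g t l d : 0 < d -> (forall x, Rabs (x-t) < d -> f x = g x) -> Cdr f t l -> Cdr g t l.
Proof.
 intros Hd E [H1 H2]. split; [apply (is_derive_ext_loc (fun x => Re (f x)))|apply (is_derive_ext_loc (fun x => Im (f x)))]; auto;
 exists (mkposreal d Hd); intros x Hx; rewrite E; auto.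
Qed.

(** At the kink of [mn] the derivative exists because [Edge] vanishes at 0. *)
Lemma Pedge_mn_Cdr (s : C) (t : R) : s <> 0%C -> s <> 1%C -> Cdr (fun v => Pedge s (mn v)) t (Edge s t).
Proof.
 intros N0 N1. unfold Edge. destruct (Rtotal_order t 0) as [H|[H|H]].
 - replace (mn t) with t by (unfold mn; rewrite Rmin_left; lra). apply (Cdr_ext_loc (Pedge s) _ _ _ (-t)); [lra| |apply Pedge_Cdr; auto].
  intros x Hx. apply Rabs_lt_between in Hx. unfold mn. rewrite Rmin_left by lra. go.
 - subst t. have K := Pedge_Cdr s 0 N0 N1. replace (mn 0) with 0 by (unfold mn; rewrite Rmin_left; lra).
  replace (Cexp ((s-1)*0)-Cexp (s*0))%C with (RtoC 0) in * by (rewrite !Cmult_0_r; Cring).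
  rewrite -> Cdr_eps in *. intros e He. destruct (K e He) as [d [Hd Q]]. exists d. split; auto. intros h Hh. rewrite Rplus_0_l.
  replace (mn 0) with 0 by (unfold mn; rewrite Rmin_left; lra).
  have : Rabs (mn h) <= Rabs h by (unfold mn, Rmin; destruct Rle_dec; [lra|rewrite Rabs_R0; apply Rabs_pos]).
  specialize (Q (mn h) $). rewrite Rplus_0_l in Q. rewrite Cmult_0_l in *. nra.
 - replace (mn t) with 0 by (unfold mn; rewrite Rmin_right; lra). rewrite !Cmult_0_r. replace (Cexp 0-Cexp 0)%C with (RtoC 0) by Cring.
  apply (Cdr_ext_loc (fun _ => Pedge s 0) _ _ _ t); [lra| |split; exact (is_derive_const _ _)].
  intros x Hx. apply Rabs_lt_between in Hx. unfold mn. rewrite Rmin_right by lra. go.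
Qed.

Lemma om_edge s v : (RtoC (2*om (exp (2*v)))*Cexp (s*RtoC v) = Lin ph (s-RtoC (/2)) v+Edge s v)%C.
Proof.
 unfold Lin, ph, Edge, mn. destruct (Rle_lt_dec 0 v) as [Hv|Hv].
 - rewrite Rmin_right, Rabs_pos_eq by auto. rewrite !Cmult_0_r.
  rewrite (RtoC_mult (2*om (exp (2*v)))). rewrite <- Cexp_RtoC. rewrite <- Cmult_assoc, <- Cexp_add.
  replace (RtoC (v/2)+(s-RtoC (/2))*v)%C with (s*v)%C by go. Cring.
 - rewrite Rmin_left, Rabs_left by lra. have T := theta_modular (exp (-(2*v))) (exp_pos _).
  replace (/exp (-(2*v))) with (exp (2*v)) in T by (rewrite exp_Ropp, Rinv_inv; reflexivity).
  have Es : sqrt (exp (-(2*v))) = exp (-v). { replace (-(2*v)) with (-v+- v) by ring. rewrite exp_plus. apply sqrt_square. go. }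
  rewrite Es in T. replace (2*- v) with (-(2*v)) by ring. set (o := om (exp (-(2*v)))) in *.
  replace (2*om (exp (2*v))) with (exp (-v)*(1+2*o)-1) by lra.
  have E1 : Cexp ((s-1)*v) = ((exp (-v))*Cexp (s*v))%C. { rewrite <- Cexp_RtoC, <- Cexp_add. f_equal. Cring. }
  have E2 : ((exp (-v/2))*Cexp ((s-RtoC (/2))*v) = Cexp ((s-1)*v))%C. { rewrite <- Cexp_RtoC, <- Cexp_add. f_equal. go. }
  rewrite RtoC_mult, <- Cmult_assoc, E2, E1. go.
Qed.

(** Replacing x by 4x in [om] is the shift of v by ln 2, which multiplies a transform by 2^(-s);
    this is the origin of the factor 1 - 2^(1-s). *)
Lemma AA_X (s : C) : 0 < Re s -> s <> 1%C -> (s*(s-1)*AA s)%C = ((1-2*Cexp (-(s*RtoC (ln 2))))*X s)%C.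
Proof.
 intros Hs N1. have N0 := Re_neq0 s Hs.
 have N2 := Cminus_neq0 _ _ N1.
 set (l := ln 2). set (z := (s-RtoC (/2))%C). set (c := (2*Cexp (-(s*l)))%C). have : 0 < l by (unfold l; rewrite <- ln_1; apply ln_increasing; lra).
 have Eal : forall v, Lin al s v = ((Lin ph z v-c*Lin ph z (v+l))+(Edge s v-c*Edge s (v+l)))%C.
 { intros v. have A := om_edge s v. have B := om_edge s (v+l). fold z in A, B.
  transitivity ((Lin ph z v+Edge s v)-c*(Lin ph z (v+l)+Edge s (v+l)))%C; [|Cring]. rewrite <- A, <- B. unfold Lin, al, c.
  replace (exp (2*(v+l))) with (4*exp (2*v)).
  2:{ replace (2*(v+l)) with (2*v+(l+l)) by ring. rewrite !exp_plus. unfold l. rewrite exp_ln by lra. ring. }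
  replace (s*RtoC (v+l))%C with (s*v+s*l)%C by go. rewrite Cexp_add, Cexp_opp. rewrite !RtoC_mult, RtoC_minus, !RtoC_mult.
  go. }
 have CCs : forall f, CC f -> CC (fun v => f (v+l)).
 { intros f [C1 C2]. have : RC (fun t => t+l) by go. split; [apply (RC_comp (fun t => Re (f t)))|apply (RC_comp (fun t => Im (f t)))]; auto. }
 have CP := CC_Lin _ z RC_ph. have CE := CC_Edge s.
 have HP : is_CL (Lin ph z) (Lap ph z) by (apply (Lap_CL _ (Re z-1) (Re z+1)); [go|apply ph_dom|lra]).
 have H1 := is_CL_minus _ _ _ _ CP (CC_mult _ _ (CC_const c) (CCs _ CP)) HP (is_CL_scal c _ _ (CCs _ CP) (is_CL_shift _ _ l CP HP)).
 (* For Re s < 1 the term e^((s-1)v) of [Edge] blows up at minus infinity. The shifted copy cancels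
    it because c e^((s-1) l) = 1, so the combination has an antiderivative that tends to 0 there. *)
 set (P := fun v => (Pedge s (mn v)-c*Pedge s (mn (v+l)))%C).
 have H2 : is_CL (fun v => (Edge s v-c*Edge s (v+l))%C) ((1-c)*Pedge s 0-0)%C.
 { apply (is_CL_FTC P).
  - intros t. apply Cdr_minus; [apply Pedge_mn_Cdr; auto|]. apply Cdr_scal.
   destruct (Pedge_mn_Cdr s (t+l) N0 N1) as [D1 D2]. split.
   + eapply is_derive_eq; [apply (is_derive_comp (fun v => Re (Pedge s (mn v))) _); [exact D1|auto_derive; auto]|]. unfold scal; simpl; unfold mult; simpl. ring.
   + eapply is_derive_eq; [apply (is_derive_comp (fun v => Im (Pedge s (mn v))) _); [exact D2|auto_derive; auto]|]. unfold scal; simpl; unfold mult; simpl. ring.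
  - go.
  - intros e He. destruct (exp_small _ Hs (/Cmod s) e He) as [N [HN K]]. exists (Rmax N l). have A1 := Rmax_l N l. have A2 := Rmax_r N l. split.
   + unfold P, mn. rewrite !Rmin_right by lra. replace (Pedge s 0-c*Pedge s 0-(1-c)*Pedge s 0)%C with (RtoC 0) by Cring. rewrite Cmod_0; lra.
   + unfold P, mn. rewrite !Rmin_left by lra.
    have E : (Pedge s (-T)-c*Pedge s (-T+l)-0)%C = (Cexp (s*RtoC (-T))/s)%C.
    { unfold Pedge, c. replace (s*RtoC (-T+l))%C with (s*RtoC (-T)+s*l)%C by go.
     replace ((s-1)*RtoC (-T+l))%C with ((s-1)*RtoC (-T)+(s*l+RtoC (-l)))%C by go.
     rewrite !Cexp_add, Cexp_RtoC, exp_Ropp, Cexp_opp. unfold l at 3. rewrite exp_ln by lra. rewrite RtoC_inv by lra.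
     go. }
    rewrite E, Cmod_div, Cmod_Cexp by auto. replace (Re (s*RtoC (-T))%C) with (-Re s*T) by go. unfold Rdiv. rewrite Rmult_comm. apply K; lra. }
 have H3 := is_CL_plus _ _ _ _ (CC_minus _ _ CP (CC_mult _ _ (CC_const c) (CCs _ CP))) (CC_minus _ _ CE (CC_mult _ _ (CC_const c) (CCs _ CE))) H1 H2.
 have H4 := is_CL_unique _ _ _ (AA_CL s Hs) (is_CL_ext _ _ _ (fun t => eq_sym (Eal t)) H3). rewrite H4.
 unfold X. fold z. replace (z*z-RtoC (/4))%C with (s*(s-1))%C by go.
 unfold Pedge. rewrite !Cmult_0_r, Cexp_0. go.
Qed.

Lemma X_neq0_strip s : RiemannHypothesis -> /2 < Re s < 1 -> X s <> 0%C.
Proof.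
 intros RH Hs HX. have N1 : s <> 1%C by (intros ->; simpl in Hs; lra).
 have E := AA_X s $ N1. rewrite HX, Cmult_0_r in E.
 have N0 := Re_neq0 s $.
 have N2 := Cminus_neq0 _ _ N1.
 have HA : AA s = 0%C.
 { transitivity (s*(s-1)*AA s/(s*(s-1)))%C; [go|]. rewrite E. go. }
 have Z := AA_zero_eta s $ HA. have Q := RH (Re s) (Im s). have H0 : 0 < Re s < 1 by go. specialize (Q (conj H0 Z)). lra.
Qed.

#[export] Hint Resolve RC_al RC_ga_shift RC_mn CC_Edge : cont.

(** * Mean values, gradient estimate, maximum principle *)

Lemma choose_delta (P : R -> posreal -> Prop) a b : (forall t, a <= t <= b -> exists d, P t d) ->
 exists delta : R -> posreal, forall t, a <= t <= b -> P t (delta t).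
Proof.
 exists (fun t => epsilon (inhabits (mkposreal 1 Rlt_0_1)) (P t)). intros t Ht. apply epsilon_spec, H; auto.
Qed.

Lemma unif_segment (F : R -> R -> C) r0 a b :
 (forall t eps, a <= t <= b -> 0 < eps -> exists d : posreal, forall r t', Rabs (r-r0) < d -> Rabs (t'-t) < d -> Cmod (F r t'-F r0 t)%C <= eps) ->
 forall eps, 0 < eps -> exists d : posreal, forall r t, Rabs (r-r0) < d -> a <= t <= b -> Cmod (F r t-F r0 t)%C <= eps.
Proof.
 intros H eps He.
 destruct (choose_delta (fun t d => forall r t', Rabs (r-r0) < d -> Rabs (t'-t) < d -> Cmod (F r t'-F r0 t)%C <= eps/2) a b) as [delta Hd].
 { intros t Ht. apply (H t (eps/2)); auto. lra. }
 destruct (compactness_value_1d a b delta) as [d Kd]. exists d. intros r t Hr Ht.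
 apply Rnot_lt_le. intros Hn. apply (Kd t Ht). intros [u [Hu [Hut Hdu]]]. apply (Rlt_not_le _ _ Hn).
 have A := Hd u Hu r t $ Hut. have B := Hd u Hu r0 t ltac:(rewrite Rminus_diag, Rabs_R0; apply cond_pos) Hut.
 replace (F r t-F r0 t)%C with ((F r t-F r0 u)-(F r0 t-F r0 u))%C by Cring. ub Cmod_triangle. rewrite Cmod_opp. lra.
Qed.

(** [C_mvt] in r, applied to F - r F1(r0), bounds the difference quotient for each t; [unif_segment]
    makes this bound uniform over the segment of integration. *)
Lemma leibniz (F F1 : R -> R -> C) r0 a b (e : R) : a <= b -> 0 < e ->
 (forall r, Rabs (r-r0) < e -> CC (F r)) -> CC (F1 r0) ->
 (forall r t, Rabs (r-r0) < e -> Cdr (fun r => F r t) r (F1 r t)) ->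
 (forall t eps, a <= t <= b -> 0 < eps -> exists d : posreal, forall r t', Rabs (r-r0) < d -> Rabs (t'-t) < d -> Cmod (F1 r t'-F1 r0 t)%C <= eps) ->
 Cdr (fun r => CI (F r) a b) r0 (CI (F1 r0) a b).
Proof.
 intros Hab He CF CF1 HD HU. rewrite Cdr_eps. intros eps Heps.
 destruct (unif_segment _ _ a b HU (eps/(b-a+1)) ltac:(go)) as [d Hd].
 exists (Rmin d e). split; [apply Rmin_pos; [apply cond_pos|auto]|]. intros h Hh.
 have h1 := Rlt_le_trans _ _ _ Hh (Rmin_l d e). have h2 := Rlt_le_trans _ _ _ Hh (Rmin_r d e).
 have : CC (F r0) by (apply CF; rewrite Rminus_diag, Rabs_R0; auto). have : CC (F (r0+h)) by (apply CF; replace (r0+h-r0) with h by ring; auto).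
 replace (CI (F (r0+h)%R) a b-CI (F r0) a b-CI (F1 r0) a b*h)%C with (CI (fun t => F (r0+h)%R t-F r0 t-h*F1 r0 t)%C a b).
 2:{ rewrite CI_minus, CI_minus, CI_scal; auto using CC_minus. { Cring. } go. }
 le_tr; [apply (CI_bound_const _ _ _ (eps/(b-a+1)*Rabs h)); [auto|go|]|].
 - intros t Ht.
  have M := fun x y Hxy HH => C_mvt (fun r => F r t-r*F1 r0 t)%C (fun r => F1 r t-F1 r0 t)%C x y (eps/(b-a+1)) Hxy HH.
  have HD' : forall r, Rabs (r-r0) < e -> Cdr (fun r => F r t-r*F1 r0 t)%C r (F1 r t-F1 r0 t)%C.
  { intros r Hr. apply Cdr_minus; [go|]. eapply Cdr_eq; [apply (Cdr_mult _ _ r 1 0)|Cring].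
   - split; [exact (is_derive_id r)|exact (is_derive_const _ _)].
   - split; exact (is_derive_const _ _). }
  have Hin : forall r, Rmin r0 (r0+h) <= r <= Rmax r0 (r0+h) -> Rabs (r-r0) <= Rabs h.
  { intros r Hr. unfold Rmin, Rmax in Hr. destruct Rle_dec; [rewrite !Rabs_pos_eq by lra|rewrite !Rabs_left1 by lra]; lra. }
  destruct (Rle_lt_dec 0 h) as [Hh0|Hh0].
  + rewrite Rabs_pos_eq in * by auto. rewrite Rmin_left, Rmax_right in Hin by lra.
   have Q := M r0 (r0+h) $ ltac:(intros r Hr; apply HD'; specialize (Hin r Hr); lra) ltac:(intros r Hr; apply Hd; [specialize (Hin r Hr); lra|auto]).
   replace (F (r0+h)%R t-F r0 t-h*F1 r0 t)%C with ((F (r0+h)%R t-RtoC (r0+h)*F1 r0 t)-(F r0 t-r0*F1 r0 t))%C by go.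
   go.
  + rewrite Rabs_left in * by auto. rewrite Rmin_right, Rmax_left in Hin by lra.
   have Q := M (r0+h) r0 $ ltac:(intros r Hr; apply HD'; specialize (Hin r Hr); lra) ltac:(intros r Hr; apply Hd; [specialize (Hin r Hr); lra|auto]).
   rewrite Cmod_minus_sym in Q.
   replace (F (r0+h)%R t-F r0 t-h*F1 r0 t)%C with ((F (r0+h)%R t-RtoC (r0+h)*F1 r0 t)-(F r0 t-r0*F1 r0 t))%C by go.
   go.
 - replace (eps/(b-a+1)*Rabs h*(b-a)) with (eps*Rabs h*((b-a)/(b-a+1))) by go.
  rewrite <- (Rmult_1_r (eps*Rabs h)) at 2. mul_l; [go|]. apply (proj2 (Rle_div_l _ 1 (b-a+1) $)). lra.
Qed.

Definition eit (t : R) : C := (cos t, sin t).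

Lemma Cmod_eit t : Cmod (eit t) = 1.
Proof. unfold Cmod, eit; simpl. replace (_+_) with (Rsqr (sin t)+Rsqr (cos t)) by (unfold Rsqr; ring). rewrite sin2_cos2. apply sqrt_1. Qed.
Lemma CC_eit : CC eit.
Proof. go. Qed.
Lemma Cdr_eit t : Cdr eit t (Ci*eit t).
Proof. split; unfold Re, Im, eit; simpl; auto_derive; auto; ring. Qed.
Lemma eit_2PI : eit (2*PI) = eit 0.
Proof. unfold eit. rewrite cos_2PI, sin_2PI, cos_0, sin_0. go. Qed.

Definition circ (z0 : C) (r t : R) : C := (z0+RtoC r*eit t)%C.

Lemma circ_dist z0 r t : Cmod (circ z0 r t-z0)%C = Rabs r.
Proof. unfold circ. replace (z0+r*eit t-z0)%C with (r*eit t)%C by Cring. rewrite Cmod_mult, Cmod_eit, Cmod_R. ring. Qed.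

Lemma Cdr_circ_r z0 r t : Cdr (fun r => circ z0 r t) r (eit t).
Proof. split; unfold circ, Re, Im, eit; simpl; auto_derive; auto; ring. Qed.
Lemma Cdr_circ_t z0 r t : Cdr (fun t => circ z0 r t) t (Ci*RtoC r*eit t).
Proof. split; unfold circ, Re, Im, eit; simpl; auto_derive; auto; ring. Qed.

Lemma circ_close z0 r t : forall eps, 0 < eps -> exists d : posreal, forall r' t', Rabs (r'-r) < d -> Rabs (t'-t) < d -> Cmod (circ z0 r' t'-circ z0 r t)%C < eps.
Proof.
 intros eps He. have K := proj1 (Cdr_eps _ _ _) (Cdr_eit t) 1 Rlt_0_1. destruct K as [d [Hd K]].
 have Hr := Rabs_pos r.
 set (m := Rmin (Rmin 1 d) (eps/(2*(2*(Rabs r+1)+1)))). have Hm : 0 < m by (repeat apply Rmin_pos; try lra; apply Rdiv_lt_0_compat; lra).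
 have : m <= d by (le_tr; [apply Rmin_l|apply Rmin_r]). have : m*(2*(2*(Rabs r+1)+1)) <= eps by (apply Rle_div_r; [lra|apply Rmin_r]).
 exists (mkposreal m Hm). simpl. intros r' t' H1 H2. unfold circ.
 replace (z0+r'*eit t'-(z0+r*eit t))%C with (RtoC (r'-r)*eit t'+r*(eit t'-eit t))%C by go.
 specialize (K (t'-t) $). replace (t+(t'-t)) with t' in K by ring.
 have : Cmod (eit t'-eit t)%C <= 2*m.
 { replace (eit t'-eit t)%C with ((eit t'-eit t-Ci*eit t*RtoC (t'-t))+Ci*eit t*RtoC (t'-t))%C by Cring.
  le_tr; [go|]. rewrite !Cmod_mult, Cmod_Ci, Cmod_eit, Cmod_R. lra. }
 eapply Rle_lt_trans; [go|]. rewrite !Cmod_mult, Cmod_eit, !Cmod_R.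
 go.
Qed.

Lemma Ccont_mod f z : Ccont f z -> forall eps, 0 < eps -> exists d, 0 < d /\ forall w, Cmod (w-z)%C < d -> Cmod (f w-f z)%C <= eps.
Proof.
 intros H eps He. destruct (H eps He) as [d [Hd K]]. exists d. split; auto. intros w Hw. specialize (K (w-z)%C Hw).
 replace (z+(w-z))%C with w in K by Cring. go.
Qed.

Definition C1on (f f1 : C -> C) (z0 : C) (R0 : R) : Prop := forall z, Cmod (z-z0)%C < R0 -> Cd f z (f1 z) /\ Ccont f1 z.

Lemma in_disc z0 r t R0 : Rabs r < R0 -> Cmod (circ z0 r t-z0)%C < R0.
Proof. rewrite circ_dist. auto. Qed.

Lemma CI_const0 (c : C) a b : CI (fun _ => c) a b = (RtoC (b-a)*c)%C.
Proof. unfold CI. rewrite !RInt_const. apply injective_projections; simpl; unfold scal; simpl; unfold mult; simpl; unfold Re, Im; ring. Qed.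

Lemma CC_scalr c f : CC f -> CC (fun t => c*f t)%C.
Proof. go. Qed.

(** The derivative of the circle integral in the radius q is the integral of f1 eit. For q <> 0 this
    is, up to the factor i q, the integral of the derivative of f along the closed circle, hence
    0. *)
Lemma mean_value f f1 z0 R0 r : C1on f f1 z0 R0 -> 0 <= r < R0 -> CI (fun t => f (circ z0 r t)) 0 (2*PI) = (RtoC (2*PI)*f z0)%C.
Proof.
 intros HC Hr. have Hpi := PI_RGT_0.
 have HF : forall q, Rabs q < R0 -> CC (fun t => f (circ z0 q t)).
 { intros q Hq. apply (CC_Cdr _ (fun t => f1 (circ z0 q t)*(Ci*q*eit t))%C). intros t. apply Cd_Cdr; [apply HC, in_disc; auto|apply Cdr_circ_t]. }
 have HU : forall q, Rabs q < R0 -> forall t eps, 0 < eps -> exists d : posreal, forall r' t', Rabs (r'-q) < d -> Rabs (t'-t) < d -> Cmod (f1 (circ z0 r' t')*eit t'-f1 (circ z0 q t)*eit t)%C <= eps.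
 { intros q Hq t eps He. destruct (HC _ (in_disc _ q t _ Hq)) as [_ Hc].
  have HP := Cmod_ge_0 (f1 (circ z0 q t)).
  destruct (Ccont_mod _ _ Hc (eps/2) $) as [d [Hd K]]. destruct (circ_close z0 q t d Hd) as [d1 K1].
  destruct (circ_close 0 1 t (eps/(2*(Cmod (f1 (circ z0 q t))+1))) ltac:(go)) as [d2 K2].
  have Hm : 0 < Rmin d1 d2 by (apply Rmin_pos; apply cond_pos). exists (mkposreal _ Hm). simpl. intros r' t' A B.
  have L1 := Rmin_l d1 d2. have L2 := Rmin_r d1 d2. specialize (K _ (K1 r' t' $ $)).
  specialize (K2 1 t' ltac:(rewrite Rminus_diag, Rabs_R0; apply cond_pos) $).
  replace (circ 0 1 t'-circ 0 1 t)%C with (eit t'-eit t)%C in K2 by (unfold circ; Cring).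
  apply Rlt_div_r in K2; [|lra].
  replace (f1 (circ z0 r' t')*eit t'-f1 (circ z0 q t)*eit t)%C with ((f1 (circ z0 r' t')-f1 (circ z0 q t))*eit t'+f1 (circ z0 q t)*(eit t'-eit t))%C by Cring.
  ub Cmod_triangle. rewrite !Cmod_mult, Cmod_eit. go. }
 have HF1 : forall q, Rabs q < R0 -> CC (fun t => f1 (circ z0 q t)*eit t)%C.
 { intros q Hq.
  have HX : forall t eps, 0 < eps -> exists d, 0 < d /\ forall t', Rabs (t'-t) < d -> Cmod (f1 (circ z0 q t')*eit t'-f1 (circ z0 q t)*eit t)%C <= eps.
  { intros t eps He. destruct (HU q Hq t eps He) as [d K]. exists d. split; [apply cond_pos|]. intros t' Ht'. apply K; auto. rewrite Rminus_diag, Rabs_R0; apply cond_pos. }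
  have HY : forall p : C -> R, (forall z, Rabs (p z) <= Cmod z) -> (forall z w, p (z-w)%C = p z-p w) -> RC (fun t => p (f1 (circ z0 q t)*eit t)%C).
  { intros p P1 P2 t. apply continuity_pt_filterlim. intros eps He. destruct (HX t (eps/2) $) as [d [Hd K]]. exists d. split; auto.
   intros t' [_ Ht']. simpl in *. unfold R_dist in *. rewrite <- P2. eapply Rle_lt_trans; [go|]. specialize (K t' Ht'). lra. }
  split; apply HY; intros; try apply re_le_Cmod; try apply im_le_Cmod; unfold Re, Im; simpl; ring. }
 set (M := fun q => CI (fun t => f (circ z0 q t)) 0 (2*PI)).
 have : forall q, Rabs q < R0 -> Cdr M q (CI (fun t => f1 (circ z0 q t)*eit t)%C 0 (2*PI)).
 { intros q Hq. apply (leibniz _ (fun q t => f1 (circ z0 q t)*eit t)%C q 0 _ (R0-Rabs q)); [lra|lra| |auto| |].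
  - intros r' H. apply HF. have T := Rabs_triang (r'-q) q. replace (r'-q+q) with r' in T by ring. lra.
  - intros r' t H. apply Cd_Cdr; [apply HC, in_disc|apply Cdr_circ_r]. have T := Rabs_triang (r'-q) q. replace (r'-q+q) with r' in T by ring. lra.
  - go. }
 have H0 : forall q, Rabs q < R0 -> CI (fun t => f1 (circ z0 q t)*eit t)%C 0 (2*PI) = 0%C.
 { intros q Hq. destruct (Req_dec q 0) as [->|Nq].
  - rewrite (CI_ext _ (fun t => f1 z0*eit t)%C) by (intros t; unfold circ; f_equal; f_equal; Cring). rewrite CI_scal by apply CC_eit.
   rewrite (CI_FTC (fun t => (-Ci*eit t)%C)); [|intros t; eapply Cdr_eq; [apply Cdr_scal, Cdr_eit|Cring]|apply CC_eit].
   rewrite eit_2PI. Cring.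
  - have E := CI_FTC (fun t => f (circ z0 q t)) (fun t => f1 (circ z0 q t)*(Ci*q*eit t))%C 0 (2*PI).
   rewrite (CI_ext _ (fun t => Ci*q*(f1 (circ z0 q t)*eit t))%C) in E by (intros; Cring). rewrite CI_scal in E by go.
   have Z : (Ci*q*CI (fun t => f1 (circ z0 q t)*eit t)%C 0 (2*PI))%C = 0%C.
   { rewrite E; [unfold circ; rewrite eit_2PI; Cring| |].
    - intros t. apply Cd_Cdr; [apply HC, in_disc; auto|apply Cdr_circ_t].
    - eapply CC_ext; [|apply (CC_scalr (Ci*q)%C), (HF1 q Hq)]. intros t; Cring. }
   set (W := CI (fun t => f1 (circ z0 q t)*eit t)%C 0 (2*PI)) in *. transitivity (Ci*q*W/(Ci*q))%C; [field; split; [apply RtoC_neq0; auto|intros EC; apply (f_equal Im) in EC; simpl in EC; lra]|]. rewrite Z. go. }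
 have K := C_mvt M (fun q => CI (fun t => f1 (circ z0 q t)*eit t)%C 0 (2*PI)) 0 r 0 $.
 have E : Cmod (M r-M 0)%C <= 0.
 { le_tr; [apply K|lra]; intros t Ht; assert (Rabs t < R0) by (rewrite Rabs_pos_eq; lra); [go|rewrite H0, Cmod_0 by auto; lra]. }
 have E2 := Cmod_eq_0 _ (Rle_antisym _ _ E (Cmod_ge_0 _)).
 have E3 : M r = M 0 by (generalize (M r) (M 0) E2; intros a b E4; transitivity (a-b+b)%C; [Cring|rewrite E4; Cring]). fold (M r). rewrite E3. unfold M.
 rewrite (CI_ext _ (fun _ => f z0)) by (intros t; unfold circ; f_equal; Cring). rewrite CI_const0, Rminus_0_r. Cring.
Qed.

#[export] Hint Resolve CC_eit Cdr_eit Cdr_circ_r Cdr_circ_t CC_scalr : cont.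

(** * Fourier coefficients on circles and the gradient estimate *)

(** Joint continuity in (r, t) at r = q, the form in which [leibniz] asks for the derivative of the
    integrand. *)
Definition JC (F : R -> R -> C) (q : R) : Prop := forall t eps, 0 < eps ->
 exists d : posreal, forall r t', Rabs (r-q) < d -> Rabs (t'-t) < d -> Cmod (F r t'-F q t)%C <= eps.

Lemma JC_mult F G q : JC F q -> JC G q -> JC (fun r t => F r t*G r t)%C q.
Proof.
 intros HF HG t eps He. have A0 := Cmod_ge_0 (F q t). have B0 := Cmod_ge_0 (G q t).
 have HK : exists K, K = Cmod (F q t)+Cmod (G q t)+1 by eauto. destruct HK as [K HK].
 have He' : 0 < Rmin 1 (eps/(2*K)) by (apply Rmin_pos; [lra|go]).
 have L1 := Rmin_l 1 (eps/(2*K)). have L2 := Rmin_r 1 (eps/(2*K)).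
 destruct (HF t _ He') as [d1 K1]. destruct (HG t _ He') as [d2 K2].
 have Hm : 0 < Rmin d1 d2 by (apply Rmin_pos; apply cond_pos). exists (mkposreal _ Hm). cbn [pos]. intros r t' A B.
 have M1 := Rmin_l d1 d2. have M2 := Rmin_r d1 d2.
 specialize (K1 r t' $ $). specialize (K2 r t' $ $).
 set (a := (F r t'-F q t)%C) in *. set (b := (G r t'-G q t)%C) in *.
 replace (F r t'*G r t'-F q t*G q t)%C with (a*b+a*G q t+F q t*b)%C by (unfold a, b; Cring).
 have Ga := Cmod_ge_0 a. le_tr; [le_tr; [apply Cmod_triangle|apply Rplus_le_compat_r, Cmod_triangle]|]. rewrite !Cmod_mult.
 have : Rmin 1 (eps/(2*K))*(2*K) <= eps. { apply Rle_trans with (eps/(2*K)*(2*K)); [go|right; field; lra]. }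
 go.
Qed.

Lemma JC_plus F G q : JC F q -> JC G q -> JC (fun r t => F r t+G r t)%C q.
Proof.
 intros HF HG t eps He. destruct (HF t (eps/2) $) as [d1 K1]. destruct (HG t (eps/2) $) as [d2 K2].
 have Hm : 0 < Rmin d1 d2 by (apply Rmin_pos; apply cond_pos). exists (mkposreal _ Hm). cbn [pos]. intros r t' A B.
 have M1 := Rmin_l d1 d2. have M2 := Rmin_r d1 d2.
 specialize (K1 r t' $ $). specialize (K2 r t' $ $).
 replace (F r t'+G r t'-(F q t+G q t))%C with ((F r t'-F q t)+(G r t'-G q t))%C by Cring.
 le_tr; [go|lra].
Qed.

Lemma JC_conj F q : JC F q -> JC (fun r t => Cconj (F r t)) q.
Proof.
 intros HF t eps He. destruct (HF t eps He) as [d1 K1]. exists d1. intros r t' A B. rewrite <- Cminus_conj, Cmod_conj. auto.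
Qed.

Lemma JC_circ f z0 q : (forall t, Ccont f (circ z0 q t)) -> JC (fun r t => f (circ z0 r t)) q.
Proof.
 intros Hf t eps He. destruct (Ccont_mod _ _ (Hf t) _ He) as [d [Hd K]]. destruct (circ_close z0 q t d Hd) as [d1 K1].
 exists d1. go.
Qed.

Lemma JC_fun f q : CC f -> JC (fun _ t => f t) q.
Proof.
 intros [H1 H2] t eps He. specialize (H1 t). specialize (H2 t). apply continuity_pt_filterlim in H1. apply continuity_pt_filterlim in H2.
 destruct (H1 (eps/2) $) as [d1 [D1 K1]]. destruct (H2 (eps/2) $) as [d2 [D2 K2]].
 have Hm : 0 < Rmin d1 d2 by go. exists (mkposreal _ Hm). cbn [pos]. intros r t' _ B.
 have M1 := Rmin_l d1 d2. have M2 := Rmin_r d1 d2. have B1 : Rabs (t'-t) < d1 by lra. have B2 : Rabs (t'-t) < d2 by lra. simpl in K1, K2. unfold R_dist in *.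
 destruct (Req_dec t' t) as [->|N]. { replace (f t-f t)%C with (RtoC 0) by Cring. rewrite Cmod_0. lra. }
 have N' : t <> t' by auto.
 have K1' := K1 t' (conj (conj I N') B1). have K2' := K2 t' (conj (conj I N') B2). clear K1 K2. rename K1' into K1. rename K2' into K2.
 ub Cmod_le_Re_Im. unfold Re, Im in *. simpl in *. unfold Rminus in *. lra.
Qed.

Lemma JC_CC F q : JC F q -> CC (F q).
Proof.
 intros H.
 have HY : forall p : C -> R, (forall z, Rabs (p z) <= Cmod z) -> (forall z w, p (z-w)%C = p z-p w) -> RC (fun t => p (F q t)).
 { intros p P1 P2 t. apply continuity_pt_filterlim. intros eps He. destruct (H t (eps/2) $) as [d K]. exists d. split; [apply cond_pos|].
  intros t' [_ Ht']. simpl in *. unfold R_dist in *. rewrite <- P2. eapply Rle_lt_trans; [go|].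
  specialize (K q t' ltac:(rewrite Rminus_diag, Rabs_R0; apply cond_pos) Ht'). lra. }
 split; apply HY; intros; try apply re_le_Cmod; try apply im_le_Cmod; unfold Re, Im; simpl; ring.
Qed.

Lemma Ccont_mult f g z : Ccont f z -> Ccont g z -> Ccont (fun w => f w*g w)%C z.
Proof.
 intros Hf Hg. intros eps He. have HK : exists K, K = Cmod (f z)+Cmod (g z)+1 by eauto. destruct HK as [K HK]. have A0 := Cmod_ge_0 (f z). have B0 := Cmod_ge_0 (g z).
 have He' : 0 < Rmin 1 (eps/(2*K)) by (apply Rmin_pos; [lra|go]).
 have L1 := Rmin_l 1 (eps/(2*K)). have L2 := Rmin_r 1 (eps/(2*K)).
 destruct (Hf _ He') as [d1 [D1 K1]]. destruct (Hg _ He') as [d2 [D2 K2]].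
 exists (Rmin d1 d2). split; [apply Rmin_pos; auto|]. intros h Hh.
 specialize (K1 h (Rlt_le_trans _ _ _ Hh (Rmin_l _ _))). specialize (K2 h (Rlt_le_trans _ _ _ Hh (Rmin_r _ _))).
 set (a := (f (z+h)-f z)%C) in *. set (b := (g (z+h)-g z)%C) in *.
 replace (f (z+h)*g (z+h)-f z*g z)%C with (a*b+a*g z+f z*b)%C by (unfold a, b; Cring).
 have Ga := Cmod_ge_0 a. le_tr; [le_tr; [apply Cmod_triangle|apply Rplus_le_compat_r, Cmod_triangle]|]. rewrite !Cmod_mult.
 have : Rmin 1 (eps/(2*K))*(2*K) <= eps. { apply Rle_trans with (eps/(2*K)*(2*K)); [go|right; field; lra]. }
 go.
Qed.

Lemma Ccont_ext f g z : (forall w, f w = g w) -> Ccont f z -> Ccont g z.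
Proof. intros E H eps He. destruct (H eps He) as [d [Hd K]]. exists d. split; auto. intros h Hh. rewrite <- !E. auto. Qed.

Lemma Ccont_plus f g z : Ccont f z -> Ccont g z -> Ccont (fun w => f w+g w)%C z.
Proof.
 intros Hf Hg eps He. destruct (Hf (eps/2) $) as [d1 [D1 K1]]. destruct (Hg (eps/2) $) as [d2 [D2 K2]].
 exists (Rmin d1 d2). split; [go|]. intros h Hh.
 specialize (K1 h (Rlt_le_trans _ _ _ Hh (Rmin_l _ _))). specialize (K2 h (Rlt_le_trans _ _ _ Hh (Rmin_r _ _))).
 replace (f (z+h)+g (z+h)-(f z+g z))%C with ((f (z+h)-f z)+(g (z+h)-g z))%C by Cring.
 le_tr; [go|lra].
Qed.

Lemma is_derive_ln_Cmod (f : R -> C) t l : f t <> 0%C -> Cdr f t l -> is_derive (fun x => ln (Cmod (f x))) t (Re (l/f t)%C).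
Proof.
 intros Nz [D1 D2].
 have : 0 < Re (f t)*Re (f t)+Im (f t)*Im (f t).
 { have Q := Cmod_gt_0 (f t). apply Q in Nz. unfold Cmod in Nz. destruct (Rle_lt_dec (fst (f t)^2+snd (f t)^2) 0) as [L|L]; [rewrite sqrt_neg_0 in Nz by auto; lra|]. go. }
 apply (is_derive_ext (fun x => /2*ln (Re (f x)*Re (f x)+Im (f x)*Im (f x)))).
 { intros x. unfold Cmod. have : 0 <= fst (f x)^2+snd (f x)^2 by nra. unfold Re, Im.
  replace (fst (f x)*fst (f x)+snd (f x)*snd (f x)) with (fst (f x)^2+snd (f x)^2) by ring.
  destruct (Req_dec (fst (f x)^2+snd (f x)^2) 0) as [E|E].
  (* [is_derive_ext] wants the identity everywhere, including at zeros of f; there it holds because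
     [ln 0 = 0] by convention. *)
  - rewrite E, sqrt_0. have : ln 0 = 0 by (unfold ln; destruct Rlt_dec as [L|L]; [exfalso; apply (Rlt_irrefl 0 L)|go]). go.
  - rewrite <- Rpower_sqrt by lra. unfold Rpower. rewrite ln_exp. go. }
 evar_last.
 - apply is_derive_Rscal. apply is_derive_comp.
  + apply is_derive_ln; auto.
  + apply is_derive_Rplus; apply is_derive_Rmult; eassumption.
 - unfold scal; simpl; unfold mult; simpl. go.
Qed.

Lemma circ_0 z0 t : circ z0 0 t = z0.
Proof. go. Qed.

(** The mean value property of (z - z0) g(z), which vanishes at the centre; on the circle it
    contributes the extra factor r eit. *)
Lemma mean_1 g g1 z0 R0 r : C1on g g1 z0 R0 -> 0 <= r < R0 -> CI (fun t => g (circ z0 r t)*eit t)%C 0 (2*PI) = 0%C.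
Proof.
 intros HC Hr. destruct (Req_dec r 0) as [->|Nr].
 - rewrite (CI_ext _ (fun t => g z0*eit t)%C) by (intros; rewrite circ_0; auto). rewrite CI_scal by apply CC_eit.
  rewrite (CI_FTC (fun t => (-Ci*eit t)%C)); [|intros t; eapply Cdr_eq; [apply Cdr_scal, Cdr_eit|go]|go].
  rewrite eit_2PI. Cring.
 - have K := mean_value (fun z => (z-z0)*g z)%C (fun z => 1*g z+(z-z0)*g1 z)%C z0 R0 r.
  have : CC (fun t => g (circ z0 r t)*eit t)%C.
  { apply CC_mult; [|go]. apply (JC_CC (fun r t => g (circ z0 r t))). apply JC_circ. intros t. eapply Cd_Ccont, HC, in_disc. rewrite Rabs_pos_eq; lra. }
  rewrite (CI_ext _ (fun t => r*(g (circ z0 r t)*eit t))%C) in K by (intros; unfold circ; Cring).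
  rewrite CI_scal in K by auto.
  have E : (r*CI (fun t => g (circ z0 r t)*eit t)%C 0 (2*PI))%C = 0%C.
  { rewrite K; [Cring| |auto]. intros z Hz. destruct (HC z Hz) as [D1 D2].
   have : Cd (fun z => z-z0)%C z 1%C by (eapply Cd_eq; [go|Cring]).
   split; [apply (Cd_mult (fun z => z-z0)%C g); auto|]. apply Ccont_plus; apply Ccont_mult; auto; try (eapply Cd_Ccont; eauto). go. }
  set (W := CI (fun t => g (circ z0 r t)*eit t)%C 0 (2*PI)) in *. transitivity (r*W/r)%C; [go|].
  rewrite E. go.
Qed.

Lemma mean_2 g g1 z0 R0 r : C1on g g1 z0 R0 -> (forall z, Cmod (z-z0)%C < R0 -> Ccont g1 z) -> 0 <= r < R0 -> CI (fun t => g (circ z0 r t)*eit t*eit t)%C 0 (2*PI) = 0%C.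
Proof.
 intros HC HC1 Hr.
 have : CC (fun t => g (circ z0 r t)*eit t*eit t)%C.
 { apply CC_mult; [|go]. apply CC_mult; [|go]. apply (JC_CC (fun r t => g (circ z0 r t))). apply JC_circ. intros t. eapply Cd_Ccont, HC, in_disc. rewrite Rabs_pos_eq; lra. }
 destruct (Req_dec r 0) as [->|Nr].
 - rewrite (CI_ext _ (fun t => g z0*(eit t*eit t))%C) by (intros; rewrite circ_0; Cring). rewrite CI_scal by go.
  rewrite (CI_FTC (fun t => (-Ci/2*(eit t*eit t))%C)); [|intros t; eapply Cdr_eq; [apply Cdr_scal, Cdr_mult; apply Cdr_eit|]|go].
  + rewrite eit_2PI. Cring.
  + go.
 - have K := mean_1 (fun z => (z-z0)*g z)%C (fun z => 1*g z+(z-z0)*g1 z)%C z0 R0 r.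
  rewrite (CI_ext _ (fun t => r*(g (circ z0 r t)*eit t*eit t))%C) in K by (intros; unfold circ; Cring).
  rewrite CI_scal in K by auto.
  have E : (r*CI (fun t => g (circ z0 r t)*eit t*eit t)%C 0 (2*PI))%C = 0%C.
  { rewrite K; [Cring| |auto]. intros z Hz. destruct (HC z Hz) as [D1 D2].
   have : Cd (fun z => z-z0)%C z 1%C by (eapply Cd_eq; [go|Cring]).
   split; [apply (Cd_mult (fun z => z-z0)%C g); auto|]. apply Ccont_plus; apply Ccont_mult; auto; try (eapply Cd_Ccont; eauto). go. }
  set (W := CI (fun t => g (circ z0 r t)*eit t*eit t)%C 0 (2*PI)) in *. transitivity (r*W/r)%C; [go|].
  rewrite E. go.
Qed.

Lemma Cdr_RtoC f t l : is_derive f t l -> Cdr (fun x => RtoC (f x)) t (RtoC l).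
Proof. intros H. split; [go|exact (is_derive_const _ _)]. Qed.

(* Borel-Caratheodory for log f: the zeroth and first Fourier coefficients of log|f| on circles are 2 pi log|f(z0)| and pi r (f'/f)(z0). *)
Lemma gradient_estimate f f1 f2 z0 R0 M r : 0 < r < R0 ->
 (forall z, Cmod (z-z0)%C < R0 -> Cd f z (f1 z) /\ Cd f1 z (f2 z) /\ Ccont f2 z /\ f z <> 0%C /\ Cmod (f z) <= exp M) ->
 r*Cmod (f1 z0/f z0)%C <= 2*(M-ln (Cmod (f z0))).
Proof.
 intros Hr H. set (g := fun z => (f1 z/f z)%C). set (g1 := fun z => ((f2 z*f z-f1 z*f1 z)/(f z*f z))%C). have Hpi := PI_RGT_0.
 have HC : C1on g g1 z0 R0.
 { intros z Hz. destruct (H z Hz) as [D1 [D2 [D3 [D4 _]]]]. split; [apply Cd_div; auto|].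
  apply Ccont_mult.
  - apply (Ccont_ext (fun z => f2 z*f z+(-(1))*(f1 z*f1 z))%C); [go|].
   apply Ccont_plus; [|apply Ccont_mult; [apply (Cd_Ccont _ _ _ (Cd_const _ _))|]]; apply Ccont_mult; auto; eapply Cd_Ccont; eauto.
  - eapply Cd_Ccont, Cd_inv; [apply Cmult_neq_0; auto|apply Cd_mult; eauto]. }
 set (u := fun q t => ln (Cmod (f (circ z0 q t)))).
 have Hu : forall q t, Rabs q < R0 -> is_derive (fun q => u q t) q (Re (g (circ z0 q t)*eit t)%C).
 { intros q t Hq. destruct (H _ (in_disc _ q t _ Hq)) as [D1 [_ [_ [D4 _]]]]. eapply is_derive_eq; [apply is_derive_ln_Cmod; [auto|apply Cd_Cdr; [exact D1|go]]|]. go. }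
 have Hut : forall q, Rabs q < R0 -> RC (u q).
 { intros q Hq. apply RC_derive. intros t. destruct (H _ (in_disc _ q t _ Hq)) as [D1 [_ [_ [D4 _]]]]. eexists.
  apply is_derive_ln_Cmod; [auto|apply Cd_Cdr; [exact D1|go]]. }
 set (w := fun q t => (g (circ z0 q t)*eit t)%C).
 (* The real part is written as (w + conj w)/2 so that the integral splits into complex circle means
    known from [mean_value], [mean_1] and [mean_2]. *)
 set (rw := fun q t => (/2*(w q t+Cconj (w q t)))%C).
 have Erw : forall q t, rw q t = (Re (w q t)) by (intros q t; unfold rw; generalize (w q t); intros [a b]; Cfield).
 have JCw : forall q, Rabs q < R0 -> JC w q.
 { intros q Hq. apply JC_mult; [apply JC_circ; intros t; eapply Cd_Ccont, HC, in_disc; auto|apply JC_fun, CC_eit]. }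
 have JCrw : forall q, Rabs q < R0 -> JC rw q.
 { intros q Hq. apply JC_mult; [apply JC_fun, CC_const|apply JC_plus; [|apply JC_conj]; apply JCw; auto]. }
 have : forall q r', Rabs q < R0 -> Rabs (r'-q) < R0-Rabs q -> Rabs r' < R0.
 { intros q r' Hq Hd. have T := Rabs_triang (r'-q) q. replace (r'-q+q) with r' in T by ring. lra. }
 have : forall q, Rabs q < R0 -> CC (w q) by (intros; apply JC_CC; auto).
 have Conj : forall q (h : R -> C), CC h -> CI (fun t => Cconj (h t)) 0 q = Cconj (CI h 0 q).
 { intros q h [_ Hh]. unfold CI, Cconj. f_equal. unfold Im, Re. simpl. rewrite (RInt_ext _ (fun t => (-1)*snd (h t))) by go.
  rewrite RInt_Rscal by exact Hh. ring. }
 have Iw : forall q, 0 <= q < R0 -> CI (w q) 0 (2*PI) = 0%C by (intros; eapply mean_1; eauto).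
 have DA : forall q, 0 <= q < R0 -> Cdr (fun q => CI (fun t => (u q t)) 0 (2*PI)) q 0%C.
 { intros q Hq. have Hq' : Rabs q < R0 by (rewrite Rabs_pos_eq; lra).
  eapply Cdr_eq; [apply (leibniz _ rw q 0 _ (R0-Rabs q)); [lra|lra| | | |]|].
  - intros r' Hr'. apply CC_RtoC, Hut; eauto.
  - apply JC_CC; auto.
  - intros r' t Hr'. rewrite Erw. apply Cdr_RtoC, Hu; eauto.
  - intros; apply JCrw; auto.
  - unfold rw. rewrite CI_scal, CI_plus, Conj, Iw; auto using CC_plus, CC_conj. Cring. }
 have DB : forall q, 0 <= q < R0 -> Cdr (fun q => CI (fun t => (u q t)*Cconj (eit t))%C 0 (2*PI)) q (PI*g z0)%C.
 { intros q Hq. have Hq' : Rabs q < R0 by (rewrite Rabs_pos_eq; lra).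
  have CE : CC (fun t => Cconj (eit t)) by go.
  eapply Cdr_eq; [apply (leibniz _ (fun q t => rw q t*Cconj (eit t))%C q 0 _ (R0-Rabs q)); [lra|lra| | | |]|].
  - intros r' Hr'. apply CC_mult; auto. apply CC_RtoC, Hut; eauto.
  - apply CC_mult; auto. apply JC_CC; auto.
  - intros r' t Hr'. rewrite Erw. eapply Cdr_eq; [apply (Cdr_mult _ _ _ ((Re (w r' t))) 0%C); [apply Cdr_RtoC, Hu; eauto|split; exact (is_derive_const _ _)]|].
   go.
  - intros t eps _ He. apply JC_mult; auto. apply JC_fun; auto.
  - rewrite (CI_ext _ (fun t => /2*(g (circ z0 q t)+Cconj (g (circ z0 q t)*eit t*eit t)))%C).
   2:{ intros t. transitivity (/2*(g (circ z0 q t)*(eit t*Cconj (eit t))+Cconj (g (circ z0 q t))*Cconj (eit t)*Cconj (eit t)))%C; [Cring|].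
     replace (eit t*Cconj (eit t))%C with (RtoC 1). { Cring. } have T := sin2_cos2 t. unfold Rsqr in T. apply injective_projections; simpl; nra. }
   have : CC (fun t => g (circ z0 q t)) by (apply (JC_CC (fun r t => g (circ z0 r t))), JC_circ; intros t; eapply Cd_Ccont, HC, in_disc; auto).
   have : CC (fun t => g (circ z0 q t)*eit t*eit t)%C by go.
   rewrite CI_scal, CI_plus, Conj, (mean_value g g1 _ R0 q), (mean_2 g g1 _ R0 q); auto using CC_plus, CC_conj.
   + replace (Cconj 0) with (RtoC 0) by go. rewrite RtoC_mult. go.
   + apply HC; auto. }
 have Hr' : Rabs r < R0 by (rewrite Rabs_pos_eq; lra).
 have EA : CI (fun t => (u r t)) 0 (2*PI) = RtoC (2*PI*ln (Cmod (f z0))).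
 { have K := C_mvt (fun q => CI (fun t => (u q t)) 0 (2*PI)) (fun _ => 0%C) 0 r 0 $. cbv beta in K.
  have E0 : CI (fun t => (u 0 t)) 0 (2*PI) = RtoC (2*PI*ln (Cmod (f z0))).
  { rewrite (CI_ext _ (fun _ => RtoC (ln (Cmod (f z0))))) by (intros; unfold u; rewrite circ_0; auto). rewrite CI_const0, <- RtoC_mult. go. }
  rewrite E0 in K. have K2 : Cmod (CI (fun t => (u r t)) 0 (2*PI)-RtoC (2*PI*ln (Cmod (f z0))))%C <= 0.
  { le_tr; [apply K|lra]; intros t Ht; [apply DA; lra|rewrite Cmod_0; lra]. }
  have E2 := Cmod_eq_0 _ (Rle_antisym _ _ K2 (Cmod_ge_0 _)). revert E2. generalize (CI (fun t => (u r t)) 0 (2*PI)). intros a E2.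
  transitivity (a-RtoC (2*PI*ln (Cmod (f z0)))+RtoC (2*PI*ln (Cmod (f z0))))%C; [Cring|rewrite E2; Cring]. }
 have CE : CC (fun t => Cconj (eit t)) by go.
 have IE : CI (fun t => Cconj (eit t)) 0 (2*PI) = 0%C.
 { rewrite Conj by apply CC_eit. rewrite (CI_FTC (fun t => (-Ci*eit t)%C)); [|intros t; eapply Cdr_eq; [apply Cdr_scal, Cdr_eit|go]|go].
  rewrite eit_2PI. go. }
 have EB : CI (fun t => (u r t)*Cconj (eit t))%C 0 (2*PI) = (r*(PI*g z0))%C.
 { have K := C_mvt (fun q => CI (fun t => (u q t)*Cconj (eit t))%C 0 (2*PI)-q*(PI*g z0))%C (fun _ => 0%C) 0 r 0 $. cbv beta in K.
  have E0 : CI (fun t => (u 0 t)*Cconj (eit t))%C 0 (2*PI) = 0%C.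
  { rewrite (CI_ext _ (fun t => RtoC (ln (Cmod (f z0)))*Cconj (eit t))%C) by (intros; unfold u; rewrite circ_0; auto). rewrite CI_scal, IE by auto. Cring. }
  rewrite E0 in K. have K2 : Cmod (CI (fun t => (u r t)*Cconj (eit t))%C 0 (2*PI)-r*(PI*g z0)-(0-0*(PI*g z0)))%C <= 0.
  { le_tr; [apply K|lra]; intros t Ht; [|rewrite Cmod_0; lra].
   eapply Cdr_eq; [apply Cdr_minus; [apply DB; lra|apply (Cdr_mult _ _ t 1%C 0%C); [split; [exact (is_derive_id _)|exact (is_derive_const _ _)]|split; exact (is_derive_const _ _)]]|].
   go. }
  have E2 := Cmod_eq_0 _ (Rle_antisym _ _ K2 (Cmod_ge_0 _)). revert E2. generalize (CI (fun t => (u r t)*Cconj (eit t))%C 0 (2*PI)). intros a E2.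
  transitivity (a-r*(PI*g z0)-(0-0*(PI*g z0))+r*(PI*g z0))%C; [Cring|rewrite E2; Cring]. }
 have ID : CI (fun t => RtoC (u r t-M)*Cconj (eit t))%C 0 (2*PI) = (r*(PI*g z0))%C.
 { rewrite (CI_ext _ (fun t => (u r t)*Cconj (eit t)-M*Cconj (eit t))%C) by (intros; rewrite RtoC_minus; Cring).
  rewrite CI_minus, CI_scal, IE, EB; auto using CC_scalr. { Cring. } go. }
 have IB : Cmod (CI (fun t => RtoC (u r t-M)*Cconj (eit t))%C 0 (2*PI)) <= RInt (fun t => M-u r t) 0 (2*PI).
 { apply CI_bound; [lra| | |].
  - go.
  - go.
  - intros t Ht. rewrite Cmod_mult, Cmod_conj, Cmod_eit, Cmod_R, Rmult_1_r. destruct (H _ (in_disc _ r t _ Hr')) as [_ [_ [_ [N1 N2]]]].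
   rewrite Rabs_left1; [lra|]. unfold u. apply Cmod_gt_0 in N1. apply ln_le in N2; auto. rewrite ln_exp in N2. lra. }
 have IC : RInt (fun t => M-u r t) 0 (2*PI) = 2*PI*(M-ln (Cmod (f z0))).
 { transitivity (Re (CI (fun t => M-(u r t))%C 0 (2*PI))); [go|].
  rewrite CI_minus, CI_const0, EA; [go|go|go]. }
 rewrite ID, IC, !Cmod_mult, !Cmod_R, !Rabs_pos_eq in IB by lra. fold (g z0).
 go.
Qed.

#[export] Hint Resolve Cdr_RtoC : cont.

(** * The maximum principle on a strip *)

Lemma continuity_pt_eps (f : R -> R) x : (forall eps, 0 < eps -> exists d, 0 < d /\ forall y, Rabs (y-x) < d -> Rabs (f y-f x) <= eps) -> continuity_pt f x.
Proof.
 intros H eps He. destruct (H (eps/2) $) as [d [Hd K]]. exists d. split; auto. intros y [_ Hy].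
 change (Rabs (f y-f x) < eps). specialize (K y Hy). lra.
Qed.

(** The maximum is taken in t first. By uniformity over the segment it depends continuously on x,
    and the clamp [cl] extends that function beyond the ends of [a, b]. *)
Lemma extreme_value_2d (phi : R -> R -> R) a b c d : a <= b -> c <= d ->
 (forall x t eps, a <= x <= b -> c <= t <= d -> 0 < eps -> exists e : posreal, forall x' t', Rabs (x'-x) < e -> Rabs (t'-t) < e -> Rabs (phi x' t'-phi x t) <= eps) ->
 exists x0 t0, a <= x0 <= b /\ c <= t0 <= d /\ forall x t, a <= x <= b -> c <= t <= d -> phi x t <= phi x0 t0.
Proof.
 intros Hab Hcd H.
 have H1 : forall x, a <= x <= b -> exists t0, c <= t0 <= d /\ forall t, c <= t <= d -> phi x t <= phi x t0.
 { intros x Hx. destruct (continuity_ab_maj (phi x) c d Hcd) as [t0 [A B]]; [|exists t0; auto].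
  intros t Ht. apply continuity_pt_eps. intros eps He. destruct (H x t eps Hx Ht He) as [e K]. exists e. split; [apply cond_pos|].
  intros y Hy. apply K; auto. rewrite Rminus_diag, Rabs_R0. apply cond_pos. }
 set (tm := fun x => epsilon (inhabits 0) (fun t0 => c <= t0 <= d /\ forall t, c <= t <= d -> phi x t <= phi x t0)).
 have Htm : forall x, a <= x <= b -> c <= tm x <= d /\ forall t, c <= t <= d -> phi x t <= phi x (tm x) by (intros x Hx; apply epsilon_spec, H1, Hx).
 set (cl := fun x => Rmax a (Rmin b x)).
 have Hcl : forall x, a <= cl x <= b by (intros x; unfold cl, Rmax, Rmin; destruct Rle_dec; destruct Rle_dec; lra).
 have Hcl2 : forall x y, Rabs (cl x-cl y) <= Rabs (x-y).
 { intros x y. unfold cl, Rmax, Rmin. destruct Rle_dec; destruct Rle_dec; repeat destruct Rle_dec; unfold Rabs; repeat destruct Rcase_abs; lra. }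
 have Hcl3 : forall x, a <= x <= b -> cl x = x by (intros x Hx; unfold cl; rewrite Rmin_right, Rmax_right; lra).
 destruct (continuity_ab_maj (fun x => phi (cl x) (tm (cl x))) a b Hab) as [x0 [A B]].
 - intros x Hx. apply continuity_pt_eps. intros eps He.
  destruct (unif_segment (fun r t => (phi r t)) (cl x) c d) with (eps := eps) as [e K]; [|auto|].
  { intros t ep Ht Hep. destruct (H (cl x) t (ep/2) (Hcl x) Ht $) as [e K]. exists e. intros r t' Hr Ht'. rewrite <- RtoC_minus, Cmod_R.
   have Z := K r t' Hr Ht'. go. }
  exists e. split; [apply cond_pos|]. intros y Hy.
  destruct (Htm _ (Hcl x)) as [X1 X2]. destruct (Htm _ (Hcl y)) as [Y1 Y2].
  have Hyx := Hcl2 y x.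
  have K1 := K (cl y) (tm (cl x)) $ X1. have K2 := K (cl y) (tm (cl y)) $ Y1.
  rewrite <- RtoC_minus, Cmod_R in K1, K2. apply Rabs_le_between in K1. apply Rabs_le_between in K2.
  specialize (X2 _ Y1). specialize (Y2 _ X1). go.
 - exists x0, (tm x0). split; [auto|]. split; [apply Htm; auto|]. intros x t Hx Ht. specialize (A x Hx). cbv beta in A. rewrite !Hcl3 in A by auto.
  le_tr; [apply Htm; auto|go].
Qed.

Lemma Cmod_sq z : Cmod z^2 = Re z^2+Im z^2.
Proof. unfold Cmod. rewrite pow2_sqrt by go. go. Qed.

(* At an interior maximum of |G|^2 + eta (Re z - a)^2 the circle mean of G^2 would be too large. *)
Lemma max_principle_strip (G G1 : C -> C) (a b B : R) : a < b -> 0 <= B ->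
 (forall z, a <= Re z <= b -> Cd G z (G1 z)) -> (forall z, a < Re z < b -> Ccont G1 z) ->
 (forall eps, 0 < eps -> exists T, forall z, a <= Re z <= b -> T <= Rabs (Im z) -> Cmod (G z) <= eps) ->
 (forall z, Re z = a \/ Re z = b -> Cmod (G z) <= B) ->
 forall z, a <= Re z <= b -> Cmod (G z) <= B.
Proof.
 intros Hab HB HD HC HT HS z Hz. apply Rnot_lt_le. intros Hn. have Hpi := PI_RGT_0.
 set (del := Cmod (G z)^2-B^2). have : 0 < del by (unfold del; nra).
 (* The perturbation stays below half the excess of |G|^2 over B^2, so the maximum of the perturbed
    function can lie neither on the vertical sides nor at large height. *)
 set (eta := del/(2*((b-a)^2+1))).
 have : 0 < eta by go.
 have : eta*(b-a)^2 < del/2.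
 { unfold eta. apply Rmult_lt_reg_r with (2*((b-a)^2+1)); [nra|]. replace (del/(2*((b-a)^2+1))*(b-a)^2*(2*((b-a)^2+1))) with (del*(b-a)^2) by (field; nra). nra. }
 destruct (HT (sqrt (del/4)) (sqrt_lt_R0 (del/4) $)) as [T0 KT].
 set (T := Rabs T0+Rabs (Im z)+1). have T1 := Rle_abs T0. have T2 := Rabs_pos T0. have T3 := Rabs_pos (Im z).
 set (phi := fun x t => Cmod (G (x, t))^2+eta*(x-a)^2).
 destruct (extreme_value_2d phi a b (-T) T $ ltac:(go)) as [x0 [t0 [Hx0 [Ht0 Hmax]]]].
 { intros x t eps Hx Ht He.
  have C1 := HD (x, t) ltac:(go). apply Cd_Ccont in C1.
  set (N := Cmod (G (x, t))) in *. have HN := Cmod_ge_0 (G (x, t)). fold N in HN.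
  have He2 : 0 < Rmin 1 (eps/(2*(2*N+1))) by (apply Rmin_pos; [lra|go]).
  destruct (Ccont_mod _ _ C1 _ He2) as [d1 [Hd1 K1]]. have L1 := Rmin_l 1 (eps/(2*(2*N+1))). have L2 := Rmin_r 1 (eps/(2*(2*N+1))).
  apply Rle_div_r in L2; [|lra].
  set (e3 := Rmin 1 (eps/(2*(eta*(2*(b-a)+1))))).
  have : 0 < e3 by (apply Rmin_pos; [lra|go]). have L3 := Rmin_l 1 (eps/(2*(eta*(2*(b-a)+1)))). have L4 := Rmin_r 1 (eps/(2*(eta*(2*(b-a)+1)))).
  fold e3 in L3, L4. apply Rle_div_r in L4; [|nra].
  have Hm : 0 < Rmin (d1/2) e3 by (apply Rmin_pos; lra). exists (mkposreal _ Hm). cbn [pos]. intros x' t' A1 A2.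
  have R1 := Rmin_l (d1/2) e3. have R2 := Rmin_r (d1/2) e3.
  have Kz := K1 (x', t'). have : Cmod ((x', t')-(x, t))%C < d1.
  { eapply Rle_lt_trans; [apply Cmod_le_Re_Im|]. simpl. unfold Rminus in *. lra. }
  unfold phi.
  have Q1 := Cmod_triangle_inv (G (x', t')) (G (x, t)). have Q2 := Cmod_triangle_inv (G (x, t)) (G (x', t')). rewrite Cmod_minus_sym in Q2. fold N in Q1, Q2.
  set (N' := Cmod (G (x', t'))) in *.
  have P1 : Rabs (N'^2-N^2) <= eps/2 by (apply Rabs_le_between; have HN' := Cmod_ge_0 (G (x', t')); fold N' in HN'; nra).
  have P2 : Rabs (eta*(x'-a)^2-eta*(x-a)^2) <= eps/2.
  { replace (eta*(x'-a)^2-eta*(x-a)^2) with (eta*((x'-x)*((x'-x)+2*(x-a)))) by ring.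
   rewrite !Rabs_mult, Rabs_pos_eq by lra.
   have : Rabs (x'-x+2*(x-a)) <= 2*(b-a)+1. { apply Rabs_le_between. have Y := proj1 (Rabs_le_between (x'-x) 1) $. lra. }
   apply Rle_trans with (eta*(e3*(2*(b-a)+1))); [|lra]. go. }
  change (Cmod (G (x, t))) with N. apply Rabs_le_between in P1. apply Rabs_le_between in P2. apply Rabs_le_between. lra. }
 have : Cmod (G z)^2 <= phi x0 t0.
 { le_tr; [|apply (Hmax (Re z) (Im z)); [auto|exact (proj1 (Rabs_le_between (Im z) T) ltac:(go))]]. unfold phi. destruct z as [x t]. unfold Re, Im in *. simpl fst. simpl snd. generalize (pow2_ge_0 (x-a)). nra. }
 have : phi x0 t0 <= Cmod (G (x0, t0))^2+eta*(b-a)^2.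
 { apply Rplus_le_compat_l, Rmult_le_compat_l; [lra|]. go. }
 have HN0 := Cmod_ge_0 (G (x0, t0)).
 have : x0 <> a /\ x0 <> b.
 { split; intros ->; [have Y := HS (a, t0) (or_introl eq_refl)|have Y := HS (b, t0) (or_intror eq_refl)]; unfold del in *; nra. }
 have Nt : Rabs t0 < T.
 { apply Rnot_le_lt. intros L. have Y := KT (x0, t0) ltac:(go) ltac:(simpl; unfold T in L; lra).
  have : Cmod (G (x0, t0))^2 <= del/4. { rewrite <- (pow2_sqrt (del/4)) by lra. go. }
  unfold del in *. nra. }
 apply Rabs_lt_between in Nt.
 set (R0 := Rmin (Rmin (x0-a) (b-x0)) (Rmin (t0+T) (T-t0))).
 have : 0 < R0 /\ R0 <= x0-a /\ R0 <= b-x0 /\ R0 <= t0+T /\ R0 <= T-t0.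
 { unfold R0. unfold Rmin. repeat destruct Rle_dec; lra. }
 have Hin : forall w, Cmod (w-(x0, t0))%C < R0 -> a < Re w < b /\ - T <= Im w <= T.
 { intros w Hw. have U := re_le_Cmod (w-(x0, t0))%C. have V := im_le_Cmod (w-(x0, t0))%C.
  have U2 : Rabs (Re (w-(x0, t0))%C) < R0 by lra. have V2 : Rabs (Im (w-(x0, t0))%C) < R0 by lra. apply Rabs_lt_between in U2. apply Rabs_lt_between in V2. simpl in U2, V2. go. }
 set (r := R0/2). have : 0 <= r < R0 by go.
 have MV := mean_value (fun w => G w*G w)%C (fun w => G1 w*G w+G w*G1 w)%C (x0, t0) R0 r.
 have Hw : forall t, Cmod (circ (x0, t0) r t-(x0, t0))%C < R0 by (intros t; rewrite circ_dist, Rabs_pos_eq; lra).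
 have : CC (fun t => G (circ (x0, t0) r t)*G (circ (x0, t0) r t))%C.
 { have : CC (fun t => G (circ (x0, t0) r t)); [|go].
  apply (JC_CC (fun r t => G (circ (x0, t0) r t))), JC_circ. intros t. eapply Cd_Ccont, HD. destruct (Hin _ (Hw t)). lra. }
 have HMV : 2*PI*Cmod (G (x0, t0))^2 <= RInt (fun t => phi x0 t0-eta*(x0-a+r*cos t)^2) 0 (2*PI).
 { replace (2*PI*Cmod (G (x0, t0))^2) with (Cmod (RtoC (2*PI)*(G (x0, t0)*G (x0, t0)))%C) by (rewrite !Cmod_mult, Cmod_R, Rabs_pos_eq by lra; ring).
  rewrite <- MV; [|intros w Hw'; destruct (Hin w Hw') as [I1 I2]|auto].
  - apply CI_bound; [lra|go| |].
   + apply RC_derive. intros t. auto_derive. auto.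
   + intros t _. rewrite Cmod_mult. destruct (Hin _ (Hw t)) as [I1 I2].
    have Y := Hmax _ _ (conj (Rlt_le _ _ (proj1 I1)) (Rlt_le _ _ (proj2 I1))) I2. unfold phi at 1 in Y.
    have EC : (Re (circ (x0, t0) r t), Im (circ (x0, t0) r t)) = circ (x0, t0) r t by go. rewrite EC in Y. replace (Re (circ (x0, t0) r t)) with (x0+r*cos t) in Y by go. go.
  - split.
   + apply Cd_mult; apply HD; lra.
   + apply Ccont_plus; apply Ccont_mult; auto; eapply Cd_Ccont; apply HD; lra. }
 have HI : RInt (fun t => phi x0 t0-eta*(x0-a+r*cos t)^2) 0 (2*PI) = 2*PI*phi x0 t0-eta*(2*PI*(x0-a)^2+PI*r^2).
 { apply is_RInt_unique. set (P := fun t => phi x0 t0*t-eta*((x0-a)^2*t+2*(x0-a)*r*sin t+r^2*(t/2+sin t*cos t/2))).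
  evar_last; [apply (is_RInt_derive P)|unfold P, minus, plus, opp; simpl; rewrite sin_2PI, sin_0; field].
  - intros t _. unfold P. auto_derive; auto. have T4 := sin2_cos2 t. unfold Rsqr in T4. match goal with |- ?A = ?B => replace A with (B+eta*r^2/2*(sin t*sin t+cos t*cos t-1)) by field end. rewrite T4. Rring.
  - intros t _. apply (@ex_derive_continuous R_AbsRing R_NormedModule). auto_derive. auto. }
 rewrite HI in HMV. unfold phi in HMV. assert (0 < eta*(PI*r^2)) by go. nra.
Qed.

(** * Von Mangoldt function and Dirichlet series *)

Definition pr (p : nat) : Prop := prime (Z.of_nat p).

Lemma pr_ge2 p : pr p -> (2 <= p)%nat.
Proof. intros [H _]. lia. Qed.

Lemma divide_Z a b : Nat.divide a b <-> (Z.of_nat a | Z.of_nat b)%Z.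
Proof.
 split.
 - intros [c ->]. exists (Z.of_nat c). lia.
 - intros [c Hc]. destruct (Nat.eq_dec a 0) as [->|Na].
  + exists O. lia.
  + exists (Z.to_nat c). go.
Qed.

Lemma pr_mult p a b : pr p -> Nat.divide p (a*b) -> Nat.divide p a \/ Nat.divide p b.
Proof. intros Hp H. rewrite divide_Z, Nat2Z.inj_mul in H. destruct (prime_mult _ Hp _ _ H); [left|right]; apply divide_Z; auto. Qed.

Lemma pr_pow p a k : pr p -> Nat.divide p (a^k) -> Nat.divide p a.
Proof.
 intros Hp. induction k as [|k IH]; simpl; intros H.
 - apply Nat.divide_1_r in H. apply pr_ge2 in Hp. lia.
 - destruct (pr_mult _ _ _ Hp H); auto.
Qed.

Lemma pr_eq p q : pr p -> pr q -> Nat.divide p q -> p = q.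
Proof.
 intros Hp Hq H. apply divide_Z in H. apply prime_div_prime in H; auto. lia.
Qed.

Lemma pr_divisor n : (2 <= n)%nat -> exists p, pr p /\ Nat.divide p n.
Proof.
 induction n as [n IH] using (well_founded_induction lt_wf). intros Hn.
 destruct (prime_dec (Z.of_nat n)) as [Hp|Hp].
 - exists n. split; [go|apply Nat.divide_refl].
 - destruct (not_prime_divide (Z.of_nat n)) as [m [Hm D]]; [lia|auto|].
  destruct (IH (Z.to_nat m)) as [p [P1 P2]]; [lia|lia|]. exists p. split; auto.
  eapply Nat.divide_trans; [exact P2|]. apply divide_Z. rewrite Z2Nat.id; auto. lia.
Qed.

(* n = p^k with k >= 1; vM is the von Mangoldt function. *)
Definition ppow (n p : nat) : Prop := pr p /\ exists k, n = (p^S k)%nat.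
Definition vM (n : nat) : R := if excluded_middle_informative (exists p, ppow n p) then ln (INR (epsilon (inhabits O) (ppow n))) else 0.

Lemma ppow_unique n p q : ppow n p -> ppow n q -> p = q.
Proof.
 intros [Hp [k ->]] [Hq [l E]]. apply pr_eq; auto. apply (pr_pow p q (S l) Hp). rewrite <- E. exists (p^k)%nat. go.
Qed.

Lemma vM_pp n p : ppow n p -> vM n = ln (INR p).
Proof.
 intros H. unfold vM. destruct excluded_middle_informative as [E|E]; [|exfalso; eauto].
 f_equal. f_equal. apply (ppow_unique n); auto. apply epsilon_spec; auto.
Qed.

Lemma vM_npp n : (~ exists p, ppow n p) -> vM n = 0.
Proof. unfold vM. em; tauto. Qed.

Lemma vM_nonneg n : 0 <= vM n.
Proof.
 destruct (classic (exists p, ppow n p)) as [[p H]|H].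
 - rewrite (vM_pp n p H). destruct H as [Hp _]. apply pr_ge2 in Hp. rewrite <- ln_1. apply ln_le; [lra|]. apply (le_INR 1). lia.
 - rewrite vM_npp; auto. lra.
Qed.

Lemma vM_le_ln n : (1 <= n)%nat -> vM n <= ln (INR n).
Proof.
 intros Hn. destruct (classic (exists p, ppow n p)) as [[p H]|H].
 - rewrite (vM_pp n p H). destruct H as [Hp [k ->]]. apply pr_ge2 in Hp. apply ln_le; [go|]. apply le_INR. simpl. assert (p^k <> 0)%nat by (apply Nat.pow_nonzero; lia). nia.
 - rewrite vM_npp; auto. rewrite <- ln_1. apply ln_le; [lra|]. apply (le_INR 1). lia.
Qed.

Lemma pp_coprime p q k m : pr p -> pr q -> p <> q -> Nat.divide (q^k) (p*m) -> Nat.divide (q^k) m.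
Proof.
 intros Hp Hq N. revert m. induction k as [|k IH]; intros m H.
 - exists m. go.
 - have D : Nat.divide q (p*m). { eapply Nat.divide_trans; [|exact H]. exists (q^k)%nat. go. }
  destruct (pr_mult _ _ _ Hq D) as [D1|[c ->]]; [exfalso; apply N; symmetry; apply pr_eq; auto|].
  destruct H as [e He]. have H2 : Nat.divide (q^k) (p*c). { exists e. apply pr_ge2 in Hq. simpl in He. apply (Nat.mul_cancel_r _ _ q); nia. }
  destruct (IH c H2) as [f ->]. exists f. go.
Qed.

Definition dvb (d n : nat) : bool := Nat.eqb (n mod d) 0.

Lemma dvb_spec d n : (1 <= d)%nat -> dvb d n = true <-> Nat.divide d n.
Proof. intros Hd. unfold dvb. rewrite Nat.eqb_eq. apply Nat.Lcm0.mod_divide. Qed.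

Lemma exact_power p m : (2 <= p)%nat -> (1 <= m)%nat -> exists a, Nat.divide (p^a) m /\ ~ Nat.divide (p^S a) m.
Proof.
 intros Hp. induction m as [m IH] using (well_founded_induction lt_wf). intros Hm.
 destruct (classic (Nat.divide p m)) as [[c Hc]|N].
 - destruct (IH c) as [a [A B]]; [nia|nia|]. exists (S a). subst m. split.
  + destruct A as [e ->]. exists e. go.
  + intros [e He]. apply B. exists e. simpl in *. apply (Nat.mul_cancel_r _ _ p); nia.
 - exists O. split; [exists m; simpl; lia|]. simpl. rewrite Nat.mul_1_r. auto.
Qed.

Lemma rsum_single (v : R) n k : (k < n)%nat -> rsum (fun j => if Nat.eqb j k then v else 0) n = v.
Proof.
 induction n as [|n IH]; intros H; [lia|]. cbn [rsum]. destruct (Nat.eqb_spec n k) as [->|N].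
 - replace (rsum (fun j => if Nat.eqb j k then v else 0) k) with 0; [ring|].
  have G : forall m, (m <= k)%nat -> rsum (fun j => if Nat.eqb j k then v else 0) m = 0.
  { induction m as [|m IHm]; intros Hm; [go|]. cbn [rsum]. rewrite IHm by lia. destruct (Nat.eqb_spec m k); [lia|ring]. }
  rewrite G; auto.
 - rewrite IH by lia. ring.
Qed.

Lemma rsum_plus u v n : rsum (fun k => u k+v k) n = rsum u n+rsum v n.
Proof. induction n as [|n IH]; cbn [rsum]; [ring|]. go. Qed.

Lemma rsum_zero u n m : (n <= m)%nat -> (forall k, (n <= k < m)%nat -> u k = 0) -> rsum u m = rsum u n.
Proof.
 intros H. induction H as [|m H IH]; intros Hz; [go|]. cbn [rsum]. rewrite IH, Hz by (intros; auto with zarith; apply Hz; lia). ring.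
Qed.

(** Write n = p m with p^a the exact power of p in m. The prime powers dividing n are those dividing
    m and one new one, p^(a+1), which accounts for ln p. *)
Lemma ln_vM n : (1 <= n)%nat -> rsum (fun k => if dvb (S k) n then vM (S k) else 0) n = ln (INR n).
Proof.
 induction n as [n IH] using (well_founded_induction lt_wf). intros Hn.
 destruct (Nat.eq_dec n 1) as [->|N1].
 { replace (INR 1) with 1 by reflexivity. rewrite ln_1. have V : vM 1 = 0. { apply Rle_antisym; [|apply vM_nonneg]. rewrite <- ln_1. apply vM_le_ln. lia. } go. }
 destruct (pr_divisor n ltac:(lia)) as [p [Hp [m Hm]]]. have Hp2 := pr_ge2 p Hp.
 have Hm1 : (1 <= m)%nat by nia. have : (m < n)%nat by nia.
 destruct (exact_power p m Hp2 Hm1) as [a [A1 A2]].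
 have : (1 <= p^a)%nat by (assert (p^a <> 0)%nat by (apply Nat.pow_nonzero; lia); lia).
 have : Nat.divide (p^S a) n. { destruct A1 as [e ->]. exists e. rewrite Hm. go. }
 have : (p^S a <= n)%nat by (apply Nat.divide_pos_le; [lia|auto]).
 have PS : exists k0, (p^S a)%nat = S k0 by (exists (pred (p^S a)); simpl; nia). destruct PS as [k0 Hk0].
 rewrite (rsum_ext _ (fun k => (if dvb (S k) m then vM (S k) else 0)+(if Nat.eqb k k0 then ln (INR p) else 0))).
 - rewrite rsum_plus, rsum_single by lia. rewrite (rsum_zero _ m n).
  + rewrite IH by auto. rewrite Hm, mult_INR, ln_mult by go. go.
  + lia.
  + intros k Hk. destruct (dvb (S k) m) eqn:E; [|go]. apply dvb_spec in E; [|lia]. apply Nat.divide_pos_le in E; lia.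
 - intros k Hk. destruct (Nat.eqb_spec k k0) as [->|Nk].
  + rewrite <- Hk0. have E1 : dvb (p^S a) n = true by (apply dvb_spec; [go|auto]). rewrite E1.
   have E2 : dvb (p^S a) m = false. { destruct (dvb (p^S a) m) eqn:E; [|go]. apply dvb_spec in E; [tauto|go]. }
   rewrite E2. rewrite (vM_pp _ p); [ring|]. split; [auto|]. exists a. go.
  + destruct (classic (exists q, ppow (S k) q)) as [[q [Hq [j Hj]]]|V].
   2:{ rewrite (vM_npp _ V). destruct (dvb (S k) n), (dvb (S k) m); ring. }
   have E : dvb (S k) n = dvb (S k) m.
   { apply Bool.eq_iff_eq_true. rewrite !dvb_spec by lia. rewrite Hj. split; intros D.
    - destruct (Nat.eq_dec p q) as [<-|Npq].
     + destruct (le_lt_dec (S j) a) as [L|L].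
      * eapply Nat.divide_trans; [|exact A1]. exists (p^(a-S j))%nat. rewrite <- Nat.pow_add_r. f_equal. lia.
      * exfalso. destruct (Nat.eq_dec j a) as [->|Nj]; [go|].
       apply A2. destruct D as [e He]. assert (Nat.divide (p^j) m) by (exists e; simpl in He; apply (Nat.mul_cancel_r _ _ p); nia).
       eapply Nat.divide_trans; [|eassumption]. exists (p^(j-S a))%nat. rewrite <- Nat.pow_add_r. f_equal. lia.
     + apply (pp_coprime p); auto. rewrite Nat.mul_comm, <- Hm. auto.
    - rewrite Hm. apply Nat.divide_mul_l. auto. }
   rewrite E. go.
Qed.

Lemma csum_plus u v n : csum (fun k => u k+v k)%C n = (csum u n+csum v n)%C.
Proof. induction n as [|n IH]; cbn [csum]; [Cring|]. rewrite IH. Cring. Qed.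

Lemma csum_RtoC u n : csum (fun k => RtoC (u k)) n = RtoC (rsum u n).
Proof. induction n as [|n IH]; cbn [csum rsum]; [go|]. rewrite IH, RtoC_plus. go. Qed.

Lemma csum_scal_r u c n : csum (fun k => u k*c)%C n = (csum u n*c)%C.
Proof. induction n as [|n IH]; cbn [csum]; [Cring|]. rewrite IH. Cring. Qed.

Lemma ns_mult s a b c : (S a*S b = S c)%nat -> (ns s a*ns s b)%C = ns s c.
Proof.
 intros H. unfold ns. rewrite <- Cexp_add. f_equal. rewrite <- H, mult_INR, ln_mult, RtoC_plus by go. Cring.
Qed.

(** Exact at the level of partial sums: when the integer S N is added, the inner sums grow precisely
    for its divisors, and [ln_vM] collects their contributions. *)
Lemma dirichlet_identity s N : csum (fun n => RtoC (ln (INR (S n)))*ns s n)%C N =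
 csum (fun k => RtoC (vM (S k))*ns s k*csum (ns s) (N/S k))%C N.
Proof.
 induction N as [|N IH]; [go|].
 cbn [csum]. rewrite IH. rewrite <- ln_vM by lia. rewrite <- csum_RtoC. rewrite <- csum_scal_r. cbn [csum].
 have HN : dvb (S N) (S N) = true by (apply dvb_spec; [lia|go]). rewrite HN.
 rewrite Nat.div_same by lia. replace (csum (ns s) 1) with (ns s 0) by go.
 rewrite <- Cmult_assoc, (ns_mult s N 0 N) by lia.
 rewrite Cplus_assoc. f_equal. rewrite <- csum_plus. apply csum_ext. intros k Hk.
 have Dm := Nat.div_mod N (S k) ltac:(lia). have Db := Nat.mod_upper_bound N (S k) ltac:(lia).
 destruct (dvb (S k) (S N)) eqn:E.
 - apply dvb_spec in E; [|lia]. destruct E as [q Hq]. destruct q as [|q]; [lia|].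
  have E1 : (N/S k = q)%nat by (symmetry; apply (Nat.div_unique N (S k) q k); lia).
  rewrite Hq, Nat.div_mul by lia. rewrite E1. rewrite <- (ns_mult s k q N) by lia. Cring.
 - have E1 : (S N/S k = N/S k)%nat.
  { symmetry. apply (Nat.div_unique (S N) (S k) (N/S k) (S (N mod S k))); [|lia].
   destruct (Nat.eq_dec (S (N mod S k)) (S k)) as [E2|]; [|lia]. exfalso.
   assert (dvb (S k) (S N) = true); [|congruence]. apply dvb_spec; [lia|]. exists (S (N/S k)). nia. }
  rewrite E1. Cring.
Qed.

#[export] Hint Resolve pr_ge2 vM_nonneg : cont.

(** * Limits of partial sums and Dirichlet series *)

Definition Cl (u : nat -> C) (l : C) : Prop := forall eps, 0 < eps -> exists N, forall n, (N <= n)%nat -> Cmod (u n-l)%C <= eps.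

Lemma Cl_small u l M : Cl u l -> (forall e, 0 < e -> exists N, forall n, (N <= n)%nat -> Cmod (u n) <= M+e) -> Cmod l <= M.
Proof.
 intros H HM. apply le_epsilon. intros e He. destruct (H (e/2) $) as [N HN]. destruct (HM (e/2) $) as [N1 HN1].
 specialize (HN (max N N1) ltac:(lia)). specialize (HN1 (max N N1) ltac:(lia)). rewrite Cmod_minus_sym in HN. have T := Cmod_triangle_inv l (u (max N N1)). lra.
Qed.

Lemma Cl_bound u l M N0 : Cl u l -> (forall n, (N0 <= n)%nat -> Cmod (u n) <= M) -> Cmod l <= M.
Proof. intros H HM. apply (Cl_small u); auto. exists N0. intros n Hn. specialize (HM n Hn). lra. Qed.

Lemma Cl_plus u v l m : Cl u l -> Cl v m -> Cl (fun n => u n+v n)%C (l+m)%C.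
Proof.
 intros H1 H2 e He. destruct (H1 (e/2) $) as [N HN]. destruct (H2 (e/2) $) as [N1 HN1]. exists (max N N1). intros n Hn.
 specialize (HN n ltac:(lia)). specialize (HN1 n ltac:(lia)). replace (u n+v n-(l+m))%C with ((u n-l)+(v n-m))%C by Cring. le_tr; [go|lra].
Qed.

Lemma Cl_scal c u l : Cl u l -> Cl (fun n => c*u n)%C (c*l)%C.
Proof.
 intros H e He. have P := Cmod_ge_0 c. destruct (H (e/(Cmod c+1)) ltac:(go)) as [N HN]. exists N. intros n Hn. specialize (HN n Hn).
 replace (c*u n-c*l)%C with (c*(u n-l))%C by Cring. rewrite Cmod_mult. apply Rle_div_r in HN; [|lra]. go.
Qed.

Lemma Cl_ext u v l : (forall n, u n = v n) -> Cl u l -> Cl v l.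
Proof. intros E H e He. destruct (H e He) as [N HN]. exists N. intros n Hn. rewrite <- E. auto. Qed.

Lemma Cl_const c : Cl (fun _ => c) c.
Proof. exists O. intros n _. replace (c-c)%C with (RtoC 0) by Cring. rewrite Cmod_0. lra. Qed.

Lemma Cl_unique u l m : Cl u l -> Cl u m -> l = m.
Proof.
 intros H1 H2. have H : Cmod (l+(-(1))*m)%C <= 0.
 { apply (Cl_bound (fun n => u n+(-(1))*u n)%C _ 0 O); [apply Cl_plus, Cl_scal; auto|]. intros n _. replace (u n+(-(1))*u n)%C with (RtoC 0) by Cring. rewrite Cmod_0. lra. }
 have E := Cmod_eq_0 _ (Rle_antisym _ _ H (Cmod_ge_0 _)). transitivity (l+(-(1))*m+m)%C; [Cring|rewrite E; Cring].
Qed.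

Lemma Cl_sub u l (f : nat -> nat) : (forall n, (n <= f n)%nat) -> Cl u l -> Cl (fun n => u (f n)) l.
Proof. intros Hf H e He. destruct (H e He) as [N HN]. exists N. intros n Hn. apply HN. specialize (Hf n). lia. Qed.

Lemma csum_diff_abs u v M k : (forall n, Cmod (u n) <= v n) -> Cmod (csum u (M+k)-csum u M)%C <= rsum v (M+k)-rsum v M.
Proof.
 intros H. induction k as [|k IH].
 - rewrite Nat.add_0_r. replace (csum u M-csum u M)%C with (RtoC 0) by Cring. rewrite Cmod_0. lra.
 - rewrite Nat.add_succ_r. cbn [csum rsum]. replace (csum u (M+k)+u (M+k)%nat-csum u M)%C with ((csum u (M+k)-csum u M)+u (M+k)%nat)%C by Cring.
  le_tr; [go|]. specialize (H (M+k)%nat). lra.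
Qed.

Lemma rsum_incr v n m : (forall k, 0 <= v k) -> (n <= m)%nat -> rsum v n <= rsum v m.
Proof. intros H Hnm. induction Hnm as [|m Hm IH]; [lra|]. cbn [rsum]. specialize (H m). lra. Qed.

Lemma Cl_exists u v B : (forall n, Cmod (u n) <= v n) -> (forall N, rsum v N <= B) -> exists l, Cl (csum u) l.
Proof.
 intros H HB. have : forall k, 0 <= v k by (intros k; le_tr; [apply Cmod_ge_0|go]).
 destruct (growing_cv (rsum v)) as [L HL].
 { intros n. apply rsum_incr; auto. }
 { exists B. intros x [n ->]. go. }
 have Cau : forall e, 0 < e -> exists N, forall n m, (N <= n)%nat -> (n <= m)%nat -> Cmod (csum u m-csum u n)%C <= e.
 { intros e He. destruct (HL (e/2) $) as [N HN]. exists N. intros n m Hn Hm. replace m with (n+(m-n))%nat by lia.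
  le_tr; [apply csum_diff_abs; auto|]. have A := HN n Hn. have A2 := HN (n+(m-n))%nat ltac:(lia). apply Rabs_lt_between in A. apply Rabs_lt_between in A2. lra. }
 have CR : forall p : C -> R, (forall z, Rabs (p z) <= Cmod z) -> (forall z w, p (z-w)%C = p z-p w) -> exists l, forall eps, 0 < eps -> exists N, forall n, (N <= n)%nat -> Rabs (p (csum u n)-l) < eps.
 { intros p P1 P2. destruct (Rcomplete.R_complete (fun n => p (csum u n))) as [l Hl].
  - intros e He. destruct (Cau (e/2) $) as [N HN]. exists N. intros n m Hn Hm. unfold R_dist.
   destruct (le_lt_dec n m) as [Q|Q]; [rewrite Rabs_minus_sym|]; rewrite <- P2; (eapply Rle_lt_trans; [go|]); (eapply Rle_lt_trans; [apply HN; lia|lra]).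
  - exists l. go. }
 destruct (CR Re) as [a Ha]; [apply re_le_Cmod|go|]. destruct (CR Im) as [b Hb]; [apply im_le_Cmod|go|].
 exists (a, b). intros e He. destruct (Ha (e/2) $) as [N1 K1]. destruct (Hb (e/2) $) as [N2 K2]. exists (max N1 N2). intros n Hn.
 specialize (K1 n ltac:(lia)). specialize (K2 n ltac:(lia)). ub Cmod_le_Re_Im. unfold Re, Im in *. simpl in *. unfold Rminus in *. lra.
Qed.

Lemma Cl_tail u l M tau : Cl u l -> (forall n, (M <= n)%nat -> Cmod (u n-u M)%C <= tau) -> Cmod (u M-l)%C <= tau.
Proof.
 intros H HM. rewrite Cmod_minus_sym. apply (Cl_bound (fun n => u n+(-u M))%C _ _ M).
 - apply Cl_plus; [auto|apply Cl_const].
 - go.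
Qed.

(* Dirichlet series are indexed from 0: np sg n = (n+1)^(-sg), ns s n = (n+1)^(-s), vMn n = vM (n+1). *)
Definition np (sg : R) (n : nat) : R := exp (-(sg*ln (INR (S n)))).

Lemma Cmod_ns s n : Cmod (ns s n) = np (Re s) n.
Proof. unfold ns, np. rewrite Cmod_Cexp. f_equal. go. Qed.

Lemma np_pos sg n : 0 < np sg n.
Proof. apply exp_pos. Qed.

Lemma np_add a b n : np a n*np b n = np (a+b) n.
Proof. unfold np. go. Qed.

Lemma lnS_nonneg n : 0 <= ln (INR (S n)).
Proof. rewrite <- ln_1. apply ln_le; [lra|]. apply (le_INR 1). lia. Qed.

(** A telescoping substitute for comparing the sum with the integral of u^(-sg). *)
Lemma np_step sg n : 1 < sg -> np sg (S n) <= (np (sg-1) n-np (sg-1) (S n))/(sg-1).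
Proof.
 intros Hs. apply (proj1 (Rle_div_r _ _ (sg-1) $)).
 set (L := ln (INR (S (S n)))). set (l := ln (INR (S n))).
 have : np (sg-1) n = np (sg-1) (S n)*exp ((sg-1)*(L-l)) by (unfold np; rewrite <- exp_plus; f_equal; unfold L, l; ring).
 have : 0 < INR (S n) by go. have : 0 < INR (S (S n)) by go.
 have : /INR (S (S n)) <= L-l.
 { unfold L, l. rewrite <- ln_div by auto. le_tr; [|apply ln_ge_1m; apply Rdiv_lt_0_compat; auto]. right. rewrite (S_INR (S n)) in *. go. }
 have : np sg (S n) = np (sg-1) (S n)*/INR (S (S n)).
 { unfold np. rewrite <- (exp_ln (/INR (S (S n)))) by go. rewrite ln_Rinv by auto. go. }
 have Pn := np_pos (sg-1) (S n). have X := exp_ineq1_le ((sg-1)*(L-l)).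
 assert ((sg-1)*/INR (S (S n)) <= (sg-1)*(L-l)) by go. nra.
Qed.

Lemma np_sum sg N : 1 < sg -> rsum (np sg) N <= 1+/(sg-1).
Proof.
 intros Hs. have : 0 < /(sg-1) by go. destruct N as [|N]; [go|].
 have : rsum (np sg) (S N) <= 1+(1-np (sg-1) N)/(sg-1).
 { induction N as [|N IH].
  - cbn [rsum]. unfold np. replace (INR 1) with 1 by reflexivity. rewrite ln_1, !Rmult_0_r, Ropp_0, exp_0. go.
  - cbn [rsum] in *. have K := np_step _ N Hs. go. }
 have P := np_pos (sg-1) N. go.
Qed.

Lemma np_decr d n m : 0 <= d -> (n <= m)%nat -> np d m <= np d n.
Proof.
 intros Hd H. apply exp_le. go.
Qed.

Lemma rsum_le u v n : (forall k, (k < n)%nat -> u k <= v k) -> rsum u n <= rsum v n.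
Proof. intros H. induction n as [|n IH]; [go|]. cbn [rsum]. go. Qed.

Lemma np_tail sg d M k : 0 <= d -> 1 < sg-d -> rsum (np sg) (M+k)-rsum (np sg) M <= np d M*(1+/(sg-d-1)).
Proof.
 intros Hd Hs. rewrite rsum_split. replace (rsum (np sg) M+rsum (fun j => np sg (M+j)) k-rsum (np sg) M) with (rsum (fun j => np sg (M+j)%nat) k) by ring.
 apply Rle_trans with (rsum (fun j => np d M*np (sg-d) (M+j)%nat) k).
 - apply rsum_le. intros j _. replace sg with (d+(sg-d)) at 1 by ring. rewrite <- np_add. mul_r; [left; apply np_pos|]. apply np_decr; auto. lia.
 - rewrite rsum_scal. mul_l; [left; apply np_pos|]. le_tr; [|apply (np_sum _ (M+k)); lra]. rewrite rsum_split.
  assert (0 <= rsum (np (sg-d)) M) by (apply (rsum_incr _ 0 M); [intros; left; apply np_pos|lia]). lra.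
Qed.

Lemma ln_np d n : 0 < d -> ln (INR (S n)) <= /d*np (-d) n.
Proof.
 intros Hd. apply Rmult_le_reg_l with d; auto. rewrite <- Rmult_assoc, Rinv_r, Rmult_1_l by lra. unfold np. replace (-(-d*ln (INR (S n)))) with (d*ln (INR (S n))) by ring.
 have X := exp_ineq1_le (d*ln (INR (S n))). lra.
Qed.

Lemma np_lim d e : 0 < d -> 0 < e -> exists N, forall n, (N <= n)%nat -> np d n <= e.
Proof.
 intros Hd He. destruct (exp_small d Hd 1 e He) as [T [HT K]]. destruct (ln_large T) as [N HN]. exists N. intros n Hn. unfold np. specialize (K _ (HN n Hn)). replace (-(d*ln (INR (S n)))) with (-d*ln (INR (S n))) by ring. lra.
Qed.

(* An arbitrary value where the series diverges. *)
Definition DS (c : nat -> R) (s : C) : C := epsilon (inhabits (RtoC 0)) (Cl (csum (fun n => RtoC (c n)*ns s n)%C)).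

Lemma DS_term c K d s n : (forall n, Rabs (c n) <= K*np (-d) n) -> Cmod (RtoC (c n)*ns s n)%C <= K*np (Re s-d) n.
Proof.
 intros Hc. rewrite Cmod_mult, Cmod_R, Cmod_ns. replace (Re s-d) with (-d+Re s) by ring. rewrite <- np_add, <- Rmult_assoc. mul_r; [left; apply np_pos|auto].
Qed.

Lemma K_nonneg c K d : (forall n, Rabs (c n) <= K*np (-d) n) -> 0 <= K.
Proof. intros Hc. have H := Hc O. have P := np_pos (-d) 0. have Q := Rabs_pos (c O). nra. Qed.

Lemma DS_Cl c K d s : (forall n, Rabs (c n) <= K*np (-d) n) -> 1 < Re s-d -> Cl (csum (fun n => RtoC (c n)*ns s n)%C) (DS c s).
Proof.
 intros Hc Hs. unfold DS. apply epsilon_spec. have HK := K_nonneg _ _ _ Hc. apply (Cl_exists _ (fun n => K*np (Re s-d) n) (K*(1+/(Re s-d-1)))).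
 - intros n. apply DS_term; auto.
 - intros N. rewrite rsum_scal. mul_l; [auto|apply np_sum; auto].
Qed.

Lemma csum_abs u n : Cmod (csum u n) <= rsum (fun k => Cmod (u k)) n.
Proof. induction n as [|n IH]; cbn [csum rsum]; [rewrite Cmod_0; lra|]. le_tr; [go|]. lra. Qed.

Lemma DS_bound c K d s : (forall n, Rabs (c n) <= K*np (-d) n) -> 1 < Re s-d -> Cmod (DS c s) <= K*(1+/(Re s-d-1)).
Proof.
 intros Hc Hs. apply (Cl_bound _ _ _ O (DS_Cl c K d s Hc Hs)). intros n _. ub csum_abs.
 le_tr; [apply rsum_le; intros; apply DS_term; auto|]. rewrite rsum_scal. mul_l; [eapply K_nonneg; eauto|apply np_sum; auto].
Qed.

Definition one (n : nat) : R := 1.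
Definition lnn (n : nat) : R := ln (INR (S n)).
Definition vMn (n : nat) : R := vM (S n).

Lemma np_0 n : np (- 0) n = 1.
Proof. unfold np. rewrite <- exp_0. go. Qed.

Lemma one_bd n : Rabs (one n) <= 1*np (- 0) n.
Proof. unfold one. rewrite np_0, Rabs_R1. lra. Qed.

Lemma lnn_bd d n : 0 < d -> Rabs (lnn n) <= /d*np (-d) n.
Proof. rewrite Rabs_pos_eq by apply lnS_nonneg. apply ln_np; auto. Qed.

Lemma vMn_bd d n : 0 < d -> Rabs (vMn n) <= /d*np (-d) n.
Proof. intros Hd. rewrite Rabs_pos_eq by apply vM_nonneg. le_tr; [apply vM_le_ln; lia|apply ln_np; auto]. Qed.

Lemma ns_add s h n : ns (s+h)%C n = (ns s n*Cexp (-(h*RtoC (ln (INR (S n))))))%C.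
Proof. unfold ns. rewrite <- Cexp_add. go. Qed.

Lemma Zeta_Cd s : 1 < Re s -> Cd (DS one) s (-DS lnn s)%C.
Proof.
 intros Hs. set (d := (Re s-1)/4). have Hd : 0 < d by go.
 apply (Cd_taylor _ _ _ (4/d^2*(1+/(Re s-2*d-1))) d Hd). intros h Hh.
 have : Re s-d < Re (s+h)%C. { have R1 := re_le_Cmod h. apply Rabs_le_between in R1. simpl. unfold Re in *. lra. }
 have C1 := DS_Cl _ 1 0 (s+h)%C one_bd ltac:(go).
 have C2 := DS_Cl _ 1 0 s one_bd $.
 have C3 := DS_Cl _ _ d s (fun n => lnn_bd d n Hd) ltac:(go).
 replace (DS one (s+h)-DS one s-- DS lnn s*h)%C with (DS one (s+h)+((-(1))*DS one s+h*DS lnn s))%C by Cring.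
 apply (Cl_bound (fun n => csum (fun n => (one n)*ns (s+h) n) n+((-(1))*csum (fun n => (one n)*ns s n) n+h*csum (fun n => (lnn n)*ns s n) n))%C _ _ O).
 { apply Cl_plus; [go|apply Cl_plus; apply Cl_scal; auto]. }
 intros n _. rewrite <- !csum_scal, <- !csum_plus. ub csum_abs.
 apply Rle_trans with (rsum (fun k => Cmod h^2*(4/d^2)*np (Re s-2*d) k) n).
 2:{ rewrite rsum_scal. have K := np_sum (Re s-2*d) n ltac:(go). replace (4/d^2*(1+/(Re s-2*d-1))*Cmod h^2) with (Cmod h^2*(4/d^2)*(1+/(Re s-2*d-1))) by ring.
   go. }
 apply rsum_le. intros k _. set (L := lnn k). have : 0 <= L by apply lnS_nonneg.
 replace ((one k)*ns (s+h) k+(-(1)*((one k)*ns s k)+h*(L*ns s k)))%C with (ns s k*(Cexp (-(h*L))-1-(-(h*L))))%C by (rewrite ns_add; fold (lnn k); fold L; unfold one; Cring).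
 rewrite Cmod_mult, Cmod_ns. have T := Cexp_taylor2 (-(h*L))%C. rewrite Cmod_opp, Cmod_mult, Cmod_R, Rabs_pos_eq in T by auto.
 have : exp (Cmod h*L) <= np (-d) k. { apply exp_le. fold (lnn k). go. }
 have : L^2 <= 4/d^2*np (-d) k.
 { have Q := lnn_bd (d/2) k $. rewrite Rabs_pos_eq in Q by auto. replace (4/d^2*np (-d) k) with ((/(d/2)*np (-(d/2)) k)^2). { go. }
  replace (-d) with (-(d/2)+- (d/2)) by field. rewrite <- np_add. go. }
 replace (np (Re s-2*d) k) with (np (Re s) k*(np (-d) k*np (-d) k)) by (rewrite !np_add; f_equal; ring).
 have P1 := np_pos (Re s) k. replace (Cmod h^2*(4/d^2)*(np (Re s) k*(np (-d) k*np (-d) k))) with (np (Re s) k*(Cmod h^2*(4/d^2*np (-d) k)*np (-d) k)) by ring.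
 mul_l; [lra|]. le_tr; [exact T|]. go.
Qed.

Lemma ns_one s : forall n, (RtoC (one n)*ns s n)%C = ns s n.
Proof. intros n. unfold one. Cring. Qed.

(** In [dirichlet_identity] the inner sum up to N/k misses a tail of order (N/k)^(-d), at most a
    constant times N^(-d) k^d. The factor k^d is absorbed by convergence of the outer sum and N^(-d)
    tends to 0. *)
Lemma lnn_product s : 1 < Re s -> DS lnn s = (DS one s*DS vMn s)%C.
Proof.
 intros Hs. set (d := (Re s-1)/4). have Hd : 0 < d by go.
 have C1 := DS_Cl _ _ d s (fun n => lnn_bd d n Hd) ltac:(go).
 have C2 := DS_Cl _ 1 0 s one_bd $.
 have C3 := DS_Cl _ _ d s (fun n => vMn_bd d n Hd) ltac:(go).
 have : Cl (csum (ns s)) (DS one s) by (eapply Cl_ext; [|exact C2]; intros n; apply csum_ext; intros; apply ns_one).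
 apply (Cl_unique _ _ _ C1).
 have B0 : forall M, Cmod (csum (ns s) M-DS one s)%C <= np d M*(1+/(Re s-d-1)).
 { intros M. apply Cl_tail; auto. intros n Hn. replace n with (M+(n-M))%nat by lia. le_tr; [apply (csum_diff_abs _ (np (Re s))); intros; rewrite Cmod_ns; lra|]. apply np_tail; unfold d; lra. }
 set (B := 1+/(Re s-d-1)) in *. have : 0 < B by go.
 set (B2 := /d*(1+/(Re s-2*d-1))). have : 0 < B2. { go. }
 have Cdiff : Cl (fun N => csum (fun k => (vMn k)*ns s k*(csum (ns s) (N/S k)-DS one s))%C N) 0.
 { intros e He. destruct (np_lim d (e/(B*B2)) Hd ltac:(go)) as [N0 HN]. exists N0. intros N Hn. specialize (HN N Hn). apply Rle_div_r in HN; [|nra].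
  replace (csum (fun k => (vMn k)*ns s k*(csum (ns s) (N/S k)-DS one s)) N-0)%C with (csum (fun k => (vMn k)*ns s k*(csum (ns s) (N/S k)-DS one s)) N)%C by Cring.
  ub csum_abs. apply Rle_trans with (rsum (fun k => np d N*B*/d*np (Re s-2*d) k) N).
  2:{ rewrite rsum_scal. have K := np_sum (Re s-2*d) N ltac:(go). have P := np_pos d N. le_tr; [mul_l; [|exact K]|].
    - go.
    - go. }
  apply rsum_le. intros k Hk. rewrite Cmod_mult.
  have Q1 := DS_term _ _ d s k (fun n => vMn_bd d n Hd). have Q2 := B0 (N/S k)%nat.
  have : np d (N/S k) <= np d N*np (-d) k.
  { unfold np. rewrite <- exp_plus. have Dm := Nat.div_mod N (S k) ltac:(lia). have Db := Nat.mod_upper_bound N (S k) ltac:(lia).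
   assert (ln (INR (S N)) <= ln (INR (S k))+ln (INR (S (N/S k)))).
   { rewrite <- ln_mult by go. rewrite <- mult_INR. go. }
   go. }
  replace (np d N*B*/d*np (Re s-2*d) k) with (/d*np (Re s-d) k*(np d N*np (-d) k*B)).
  2:{ replace (Re s-2*d) with (Re s-d+- d) by ring. rewrite <- np_add. ring. }
  go. }
 have C4 := Cl_plus _ _ _ _ Cdiff (Cl_scal (DS one s) _ _ C3). replace (0+DS one s*DS vMn s)%C with (DS one s*DS vMn s)%C in C4 by Cring.
 eapply Cl_ext; [|exact C4]. intros N. cbv beta. rewrite <- csum_scal, <- csum_plus. rewrite dirichlet_identity. apply csum_ext. intros k _. unfold vMn. Cring.
Qed.

#[export] Hint Resolve np_pos lnS_nonneg : cont.

(** * Non-vanishing on Re s = 1; positivity of Re (X1 / X) under RH *)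

Lemma csum_alt s K : csum (fun k => RtoC ((-1)^k)*ns s k)%C (2*K) = (csum (ns s) (2*K)-2*Cexp (-(s*RtoC (ln 2)))*csum (ns s) K)%C.
Proof.
 induction K as [|K IH]; [go|].
 replace (2*S K)%nat with (S (S (2*K))) by lia. cbn [csum]. rewrite IH.
 have E : ns s (S (2*K)) = (Cexp (-(s*(ln 2)))*ns s K)%C by (rewrite <- (ns_mult s 1 K _) by lia; reflexivity).
 rewrite E. rewrite pow_1_even. replace ((-1)^S (2*K)) with (-1) by (rewrite pow_1_odd; reflexivity). Cring.
Qed.

Definition zeta (s : C) : C := DS one s.

Lemma zeta_Cl s : 1 < Re s -> Cl (csum (ns s)) (zeta s).
Proof. intros Hs. eapply Cl_ext; [|apply (DS_Cl _ 1 0 s one_bd); lra]. intros n; apply csum_ext; intros; apply ns_one. Qed.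

Lemma two_pow_neq s : 1 < Re s -> (1-2*Cexp (-(s*RtoC (ln 2))))%C <> 0%C.
Proof.
 intros Hs E. have E2 : Cmod (2*Cexp (-(s*(ln 2))))%C = 1.
 { replace (2*Cexp (-(s*(ln 2))))%C with (1-(1-2*Cexp (-(s*(ln 2)))))%C by Cring. rewrite E. replace (1-0)%C with (RtoC 1) by Cring. apply Cmod_1. }
 have : 0 < ln 2 by (rewrite <- ln_1; apply ln_increasing; lra).
 rewrite Cmod_mult, Cmod_R, Rabs_pos_eq, Cmod_Cexp in E2 by lra.
 replace (Re (-(s*(ln 2)))%C) with (-(Re s*ln 2)) in E2 by go.
 assert (exp (-(Re s*ln 2)) < exp (-ln 2)) by (apply exp_increasing; nra). replace (exp (-ln 2)) with (/2) in H by (rewrite exp_Ropp, exp_ln; lra). lra.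
Qed.

Definition WW (s : C) : C := (s*(s-1)*(piC s*Gam s))%C.

(** Along even partial sums eta is (1 - 2^(1-s)) zeta by [csum_alt]; the same factor stands in
    [AA_X] and is cancelled, being nonzero for Re s > 1. *)
Lemma X_zeta s : 1 < Re s -> X s = (WW s*zeta s)%C.
Proof.
 intros Hs. have N1 : s <> 1%C by (intros ->; simpl in Hs; lra).
 have E := AA_X s $ N1. have N2 := two_pow_neq s Hs. set (c := (1-2*Cexp (-(s*(ln 2))))%C) in *.
 have C1 : Cl (fun N => piC s*Gam s*csum (fun k => RtoC ((-1)^k)*ns s k) N)%C (AA s).
 { intros e He. destruct (AA_eta_lim s e $ He) as [N HN]. exists N. intros n Hn. rewrite Cmod_minus_sym. auto. }
 have C2 := Cl_sub _ _ (fun n => 2*n)%nat ltac:(intros n; cbv beta; lia) C1.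
 have C3 := Cl_sub _ _ (fun n => 2*n)%nat ltac:(intros n; cbv beta; lia) (zeta_Cl s Hs).
 have C4 := Cl_scal (piC s*Gam s) _ _ (Cl_plus _ _ _ _ C3 (Cl_scal (-(2*Cexp (-(s*(ln 2))))) _ _ (zeta_Cl s Hs))).
 have EA : AA s = (piC s*Gam s*(c*zeta s))%C.
 { eapply Cl_unique; [exact C2|]. replace (c*zeta s)%C with (zeta s+- (2*Cexp (-(s*(ln 2))))*zeta s)%C by go.
  eapply Cl_ext; [|exact C4]. intros n. cbv beta. rewrite csum_alt. go. }
 rewrite EA in E. transitivity (c*X s/c)%C; [go|]. rewrite <- E. unfold WW. go.
Qed.

Lemma piC_Cd s : Cd piC s (-RtoC (ln PI/2)*piC s)%C.
Proof.
 eapply Cd_eq; [apply (Cd_comp Cexp _ s); [go|]|apply Cmult_comm].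
 apply (Cd_ext (fun s => (-RtoC (ln PI/2))*s)%C); [go|]. eapply Cd_eq; [go|Cring].
Qed.

Definition AF (s : C) : C := (/s+/(s-1)-RtoC (ln PI/2)+LG s)%C.

Lemma WW_Cd s : 1 < Re s -> Cd WW s (AF s*WW s)%C.
Proof.
 intros Hs. have N0 := Re_neq0 s $. have : (s-1)%C <> 0%C by (apply Cminus_neq0; intros ->; simpl in Hs; lra).
 have NG := Gam_neq0 s $.
 eapply Cd_eq.
 - apply Cd_mult; [go|apply Cd_mult; [apply piC_Cd|apply Gam_Cd; lra]].
 - unfold AF, LG, WW. go.
Qed.

Lemma X_logder s : 1 < Re s -> X1 s = ((AF s-DS vMn s)*X s)%C.
Proof.
 intros Hs. apply (Cd_unique X s); [go|].
 apply (Cd_ext_loc (fun s => WW s*zeta s)%C _ s _ (Re s-1)); [lra| |].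
 - intros w Hw. symmetry. apply X_zeta. have R1 := re_le_Cmod (w)%C. apply Rabs_le_between in R1. simpl. unfold Re in *. lra.
 - eapply Cd_eq; [apply Cd_mult; [apply WW_Cd; auto|apply Zeta_Cd; auto]|]. rewrite X_zeta, lnn_product by auto. unfold zeta. Cring.
Qed.

Lemma mono_decr f df a b : a <= b -> (forall x, a <= x <= b -> is_derive f x (df x)) -> (forall x, a <= x <= b -> df x <= 0) -> f b <= f a.
Proof.
 intros Hab HD Hd. destruct (MVT_gen f a b df) as [c [Hc E]].
 - intros x Hx. rewrite Rmin_left, Rmax_right in Hx by auto. apply HD. lra.
 - intros x Hx. rewrite Rmin_left, Rmax_right in Hx by auto. apply continuity_pt_filterlim, (is_derive_cont _ _ (df x)), HD. lra.
 - rewrite Rmin_left, Rmax_right in Hc by auto. have Q := Hd c $. nra.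
Qed.

Lemma zeta_near_1 s : 3 <= Re s -> /2 <= Cmod (zeta s).
Proof.
 intros Hs. have : Cmod (zeta s+- (1))%C <= /2.
 { apply (Cl_bound (fun n => csum (ns s) n+- (1))%C _ _ 1%nat); [apply Cl_plus; [apply zeta_Cl; lra|apply Cl_const]|].
  intros n Hn. replace (csum (ns s) n+- (1))%C with (csum (ns s) (1+(n-1))-csum (ns s) 1)%C.
  2:{ replace (1+(n-1))%nat with n by lia. cbn [csum]. replace (ns s 0) with (RtoC 1). { Cring. }
    unfold ns. replace (INR 1) with 1 by reflexivity. rewrite ln_1. replace (-(s*0))%C with (RtoC 0) by Cring. symmetry; apply Cexp_0. }
  le_tr; [apply (csum_diff_abs _ (np (Re s))); intros; rewrite Cmod_ns; lra|].
  have Q := np_sum (Re s) (1+(n-1)) $. replace (rsum (np (Re s)) 1) with 1.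
  - assert (/(Re s-1) <= /2) by (apply Rinv_le_contravar; lra). lra.
  - cbn [rsum]. unfold np. replace (INR 1) with 1 by reflexivity. rewrite ln_1, Rmult_0_r, Ropp_0, exp_0. ring. }
 have T := Cmod_triangle_inv (1) (zeta s). rewrite Cmod_minus_sym, Cmod_1 in T. replace (zeta s-1)%C with (zeta s+- (1))%C in T by Cring. lra.
Qed.

Lemma Cdr_hline (f : C -> C) (z l : C) (x : R) : Cd f (RtoC x+z)%C l -> Cdr (fun x => f (RtoC x+z)%C) x l.
Proof.
 intros H. eapply Cdr_eq; [apply (Cd_Cdr f _ x l 1%C); [go|]|Cring].
 split; simpl.
 - eapply is_derive_eq; [apply is_derive_Rplus; [exact (is_derive_id x)|exact (is_derive_const _ x)]|]. change (1+0 = 1). ring.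
 - eapply is_derive_eq; [apply is_derive_Rplus; [exact (is_derive_const 0 x)|exact (is_derive_const _ x)]|]. change (0+0 = 0). ring.
Qed.

Lemma D_bound s0 s : 1 < s0 -> s0 <= Re s -> Cmod (DS vMn s) <= 2/(s0-1)*(1+2/(s0-1)).
Proof.
 intros H0 Hs. set (d := (s0-1)/2). le_tr; [apply (DS_bound _ _ d s (fun n => vMn_bd d n ltac:(go))); unfold d; lra|].
 replace (2/(s0-1)) with (/d) by go. go.
Qed.

(** Along a horizontal line y = |zeta|^2 satisfies y' = -2 Re(D) y with |D| <= B, so y e^(-2Bx) is
    nonincreasing. A zero would persist to the right, where zeta is close to 1. *)
Lemma zeta_neq0 s : 1 < Re s -> zeta s <> 0%C.
Proof.
 intros Hs HZ. set (z := (0, Im s) : C). set (B := 2/(Re s-1)*(1+2/(Re s-1))).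
 have Es : ((Re s)+z)%C = s by (unfold z; destruct s; Cring).
 have HC : forall x, Re s <= x -> Cdr (fun x => zeta (x+z)%C) x (-(zeta (x+z)*DS vMn (x+z)))%C.
 { intros x Hx. apply Cdr_hline. eapply Cd_eq; [apply Zeta_Cd; simpl; lra|]. rewrite lnn_product by go. go. }
 set (y := fun x => Re (zeta (x+z)%C)*Re (zeta (x+z)%C)+Im (zeta (x+z)%C)*Im (zeta (x+z)%C)).
 set (b := Rmax 3 (Re s)). have Hb1 := Rmax_l 3 (Re s). have Hb2 := Rmax_r 3 (Re s). fold b in Hb1, Hb2.
 have : y b*exp (-(2*B)*b) <= y (Re s)*exp (-(2*B)*Re s).
 { set (dy := fun x => - 2*Re (DS vMn (x+z)%C)*y x).
  apply (mono_decr (fun x => y x*exp (-(2*B)*x)) (fun x => dy x*exp (-(2*B)*x)+y x*(-(2*B)*exp (-(2*B)*x)))); [auto| |].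
  - intros x Hx. apply (is_derive_Rmult y (fun x => exp (-(2*B)*x))).
   + destruct (HC x $) as [D1 D2]. eapply is_derive_eq; [unfold y; apply is_derive_Rplus; apply is_derive_Rmult; eassumption|].
    unfold dy, y. go.
   + auto_derive; auto. ring.
  - intros x Hx. have Q := D_bound _ (x+z)%C Hs ltac:(go). have Q2 := re_le_Cmod (DS vMn (x+z)%C). apply Rabs_le_between in Q2.
   have : 0 <= y x by go. unfold dy.
   assert (0 <= (2*(Re (DS vMn (x+z)%C)+B))*(y x*exp (-(2*B)*x))); [|lra]. go. }
 have : y (Re s) = 0 by (unfold y; rewrite Es, HZ; simpl; ring). have Q := zeta_near_1 (b+z)%C ltac:(go). have : 0 < y b. { have : Cmod (zeta (b+z)%C)^2 = y b. { unfold Cmod. rewrite pow2_sqrt by nra. unfold y, Re, Im. ring. } go. }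
 have He := exp_pos (-(2*B)*b). nra.
Qed.

Lemma WW_neq0 s : 1 < Re s -> WW s <> 0%C.
Proof.
 intros Hs. repeat apply Cmult_neq_0.
 - apply Re_neq0; lra.
 - apply Cminus_neq0. intros ->; simpl in Hs; lra.
 - apply Cexp_neq_0.
 - apply Gam_neq0; lra.
Qed.

Lemma X_neq0_gt1 s : 1 < Re s -> X s <> 0%C.
Proof. intros Hs. rewrite X_zeta by auto. apply Cmult_neq_0; [apply WW_neq0|apply zeta_neq0]; auto. Qed.

Lemma Cl_Re_ge0 u l : Cl u l -> (forall n, 0 <= Re (u n)) -> 0 <= Re l.
Proof.
 intros H Hu. apply Rnot_lt_le. intros L. destruct (H (-Re l/2) $) as [N HN]. specialize (HN N ltac:(lia)). specialize (Hu N).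
 have Q := re_le_Cmod (u N-l)%C. apply Rabs_le_between in Q. change (Re (u N-l)%C) with (Re (u N)-Re l) in Q. lra.
Qed.

Lemma three_four_one x t : 1 < x -> 0 <= 3*Re (DS vMn (RtoC x))+4*Re (DS vMn (x, t))+Re (DS vMn (x, 2*t)).
Proof.
 intros Hx. set (d := (x-1)/2). have Hd : 0 < d by go.
 have H := fun s Hs => DS_Cl _ _ d s (fun n => vMn_bd d n Hd) Hs.
 have K := Cl_plus _ _ _ _ (Cl_scal 3 _ _ (H (x) ltac:(simpl; unfold d; lra))) (Cl_plus _ _ _ _ (Cl_scal 4 _ _ (H (x, t) ltac:(simpl; unfold d; lra))) (H (x, 2*t) ltac:(simpl; unfold d; lra))).
 apply Cl_Re_ge0 in K.
 - replace (3*Re (DS vMn (x))+4*Re (DS vMn (x, t))+Re (DS vMn (x, 2*t))) with (Re (3*DS vMn (x)+(4*DS vMn (x, t)+DS vMn (x, (2*t)%R)))%C); [go|].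
  go.
 - intros n. rewrite <- !csum_scal, <- !csum_plus, csum_Re. apply (rsum_incr _ 0 n); [|lia]. intros k.
  unfold ns. set (L := ln (INR (S k))). have V := vM_nonneg (S k). have E : forall y, Cexp (-((x, y)*L))%C = (exp (-(x*L))*cos (y*L), - (exp (-(x*L))*sin (y*L))).
  { intros y. unfold Cexp, Re, Im. simpl. replace (-(x*L-y*0)) with (-(x*L)) by ring. replace (-(x*0+y*L)) with (-(y*L)) by ring. rewrite cos_neg, sin_neg. go. }
  have E0 : Cexp (-(x*L))%C = (exp (-(x*L)), 0) by (change (RtoC x) with (x, 0); rewrite E, Rmult_0_l, cos_0, sin_0; Cring). rewrite E0, !E. replace (2*t*L) with (2*(t*L)) by ring. rewrite cos_2a_cos.
  simpl. set (e := exp (-(x*L))) in *. set (c := cos (t*L)).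
  match goal with |- 0 <= ?A => replace A with (2*(vMn k*e)*(1+c)^2) by ring end. go.
Qed.

Lemma Cmod_near f z l : Cd f z l -> exists M d, 0 < M /\ 0 < d /\ forall w, Cmod (w-z)%C < d -> Cmod (f w) <= M /\ Cmod (f w-f z)%C <= M*Cmod (w-z)%C.
Proof.
 intros H. destruct (H 1 $) as [d [Hd K]]. have A := Cmod_ge_0 (f z). have A2 := Cmod_ge_0 l.
 exists (Cmod (f z)+1+Cmod l), (Rmin d 1). split; [lra|]. split; [apply Rmin_pos; lra|]. intros w Hw.
 have w1 := Rlt_le_trans _ _ _ Hw (Rmin_l _ _). have w2 := Rlt_le_trans _ _ _ Hw (Rmin_r _ _).
 specialize (K _ w1). replace (z+(w-z))%C with w in K by Cring. have T := Cmod_triangle_inv (f w-f z)%C (l*(w-z))%C. rewrite Cmod_mult in T.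
 have T2 := Cmod_triangle_inv (f w) (f z). have A3 := Cmod_ge_0 (w-z)%C. go.
Qed.

Lemma X_at_1 : X 1 = 1%C.
Proof. go. Qed.

(** By [three_four_one] the function [F] decreases in x, so F(1+h) >= F(2). A zero at 1 + i t
    contributes 4 ln h against -3 ln h from the pole, hence F(1+h) <= ln h + B, impossible for small
    h. *)
Lemma X_neq0_line1 t : X (1, t) <> 0%C.
Proof.
 destruct (Req_dec t 0) as [->|Nt]. { change (X 1 <> 0%C). rewrite X_at_1. go. }
 intros HX.
 (* X / V is (s - 1) zeta(s), which stays regular on the line Re s = 1. *)
 set (V := fun s => (s*(piC s*Gam s))%C).
 have HV : forall s, 0 < Re s -> exists l, Cd (fun s => X s/V s)%C s l.
 { eexists. apply Cd_div; [|go|apply Cd_mult; [go|apply Cd_mult; [apply piC_Cd|go]]].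
  repeat apply Cmult_neq_0; [go|apply Cexp_neq_0|go]. }
 have HZ : forall s, 1 < Re s -> (zeta s*(s-1))%C = (X s/V s)%C.
 { intros s Hs. rewrite X_zeta by auto. unfold V, WW. field. repeat split; [apply Gam_neq0; lra|apply Cexp_neq_0|apply Re_neq0; lra]. }
 destruct (HV (1, 0) ltac:(go)) as [l0 D0]. destruct (HV (1, t) ltac:(go)) as [l1 D1]. destruct (HV (1, 2*t) ltac:(go)) as [l2 D2].
 destruct (Cmod_near _ _ _ D0) as [M0 [d0 [HM0 [Hd0 K0]]]]. destruct (Cmod_near _ _ _ D1) as [M1 [d1 [HM1 [Hd1 K1]]]]. destruct (Cmod_near _ _ _ D2) as [M2 [d2 [HM2 [Hd2 K2]]]].
 set (F := fun x => 3*ln (Cmod (zeta (x+(0, 0))%C))+4*ln (Cmod (zeta (x+(0, t))%C))+ln (Cmod (zeta (x+(0, (2*t)%R))%C))).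
 have EX : forall x y, (RtoC x+(0, y))%C = (x, y) by (intros; Cring).
 have FM : forall x, 1 < x <= 2 -> F 2 <= F x.
 { intros x Hx. apply (mono_decr F (fun x => - (3*Re (DS vMn (x))+4*Re (DS vMn (x, t))+Re (DS vMn (x, 2*t))))); [lra| |].
  - intros u Hu.
   have G : forall y, is_derive (fun x => ln (Cmod (zeta (RtoC x+(0, y))%C))) u (-Re (DS vMn (u, y))).
   { intros y. eapply is_derive_eq; [apply (is_derive_ln_Cmod (fun x => zeta (x+(0, y))%C)); [rewrite EX; apply zeta_neq0; simpl; lra|apply Cdr_hline; rewrite EX; apply Zeta_Cd; simpl; lra]|].
    rewrite EX, lnn_product by go. fold (zeta (u, y)). replace (-(zeta (u, y)*DS vMn (u, y))/zeta (u, y))%C with (-DS vMn (u, y))%C; [go|].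
    field. apply zeta_neq0; simpl; lra. }
   eapply is_derive_eq; [unfold F; apply is_derive_Rplus; [apply is_derive_Rplus; apply is_derive_Rscal; apply G|go]|]. change (u, 0) with (RtoC u). ring.
  - intros u Hu. have Q := three_four_one u t $. lra. }
 set (tt := Rabs t). set (B := 3*ln M0+4*(ln M1-ln tt)+(ln M2-ln (2*tt))).
 (* Small enough that ln h <= F 2 - B - 1 and that the three points 1 + h + i y lie in the discs
    where the local bounds hold. *)
 set (h := Rmin (Rmin 1 (exp (F 2-B-1))) (Rmin (Rmin d0 d1) d2/2)).
 have : 0 < h. { repeat apply Rmin_pos; try lra; [go|]. go. }
 have : h <= 1 by (unfold h; le_tr; [apply Rmin_l|apply Rmin_l]).
 have Hh2 : h <= exp (F 2-B-1) by (unfold h; le_tr; [apply Rmin_l|apply Rmin_r]).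
 have : h < d0 /\ h < d1 /\ h < d2.
 { assert (h <= Rmin (Rmin d0 d1) d2/2) by (unfold h; apply Rmin_r). have L1 := Rmin_l (Rmin d0 d1) d2. have L2 := Rmin_r (Rmin d0 d1) d2. have L3 := Rmin_l d0 d1. have L4 := Rmin_r d0 d1. lra. }
 have Dh : forall y, Cmod (((1+h)%R, y)-(1, y))%C = h. { intros y. replace (((1+h)%R, y)-(1, y))%C with (RtoC h) by Cring. rewrite Cmod_R, Rabs_pos_eq; lra. }
 have Zb : forall y, y <> 0 -> ln (Cmod (zeta ((1+h)%R, y))) <= ln (Cmod (X ((1+h)%R, y)/V ((1+h)%R, y))%C)-ln (Rabs y) \/ zeta ((1+h)%R, y) = 0%C.
 { intros y Ny. left. rewrite <- HZ by go. rewrite Cmod_mult. have Ns : 0 < Cmod (zeta ((1+h)%R, y)) by (apply Cmod_gt_0, zeta_neq0; simpl; lra).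
  have Q := im_le_Cmod (((1+h)%R, y)-1)%C. replace (Im (((1+h)%R, y)-1)%C) with y in Q by go. have P := Rabs_pos_lt y Ny. rewrite ln_mult by lra. apply ln_le in Q; lra. }
 have : forall y, 0 < Cmod (X ((1+h)%R, y)/V ((1+h)%R, y))%C.
 { intros y. apply Cmod_gt_0. rewrite <- HZ by go. apply Cmult_neq_0; [apply zeta_neq0; simpl; lra|apply Cminus_neq0; intros E; apply (f_equal Re) in E; simpl in E; lra]. }
 have : ln (Cmod (zeta ((1+h)%R, 0))) <= ln M0-ln h.
 { destruct (K0 ((1+h)%R, 0) ltac:(rewrite Dh; lra)) as [Q _]. have E := HZ ((1+h)%R, 0) ltac:(go). rewrite <- E, Cmod_mult in Q. rewrite Dh in Q.
  have Ns : 0 < Cmod (zeta ((1+h)%R, 0)) by (apply Cmod_gt_0, zeta_neq0; simpl; lra). apply ln_le in Q; [|go]. rewrite ln_mult in Q by lra. lra. }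
 have : ln (Cmod (zeta ((1+h)%R, t))) <= ln M1+ln h-ln tt.
 { destruct (K1 ((1+h)%R, t) ltac:(rewrite Dh; lra)) as [_ Q]. rewrite Dh, HX in Q. replace (X ((1+h)%R, t)/V ((1+h)%R, t)-0/V (1, t))%C with (X ((1+h)%R, t)/V ((1+h)%R, t))%C in Q by go.
  apply ln_le in Q; [|go]. rewrite ln_mult in Q by lra. destruct (Zb t Nt) as [Q2|Q2]; [go|exfalso; revert Q2; apply zeta_neq0; simpl; lra]. }
 have : ln (Cmod (zeta ((1+h)%R, 2*t))) <= ln M2-ln (2*tt).
 { destruct (K2 ((1+h)%R, 2*t) ltac:(rewrite Dh; lra)) as [Q _]. apply ln_le in Q; [|go]. destruct (Zb (2*t) $) as [Q2|Q2]; [|exfalso; revert Q2; apply zeta_neq0; simpl; lra].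
  rewrite Rabs_mult, Rabs_pos_eq in Q2 by lra. go. }
 have FF := FM (1+h) $. unfold F at 2 in FF. rewrite !EX in FF.
 apply ln_le in Hh2; [|auto]. rewrite ln_exp in Hh2. go.
Qed.

Lemma X_neq0 s : RiemannHypothesis -> /2 < Re s -> X s <> 0%C.
Proof.
 intros RH Hs. destruct (Rtotal_order (Re s) 1) as [H|[H|H]].
 - apply X_neq0_strip; auto.
 - destruct s as [a b]. simpl in H. subst a. apply X_neq0_line1.
 - apply X_neq0_gt1; auto.
Qed.

#[export] Hint Resolve Cdr_hline X_neq0 : cont.

(** * Growth of X1 / X under the Riemann hypothesis *)

Lemma X2_Cont s : Ccont X2 s.
Proof.
 have L : forall phi, RC phi -> dom phi (Re (s-RtoC (/2))%C-1) (Re (s-RtoC (/2))%C+1) -> Cd (fun x => Lap phi (x-RtoC (/2))) s (Lap (fun v => v*phi v) (s-RtoC (/2))).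
 { intros phi H1 H2. apply Cd_shift. apply (Lap_Cd _ (Re (s-RtoC (/2))%C-1) (Re (s-RtoC (/2))%C+1)); [auto|auto|lra]. }
 have L0 := L ph RC_ph (ph_dom _ _). have L1 := L vph RC_vph (vph_dom _ _).
 have L2 := L vvph (RC_mult _ _ RC_id RC_vph) (dom_id_mult _ _ _ (vph_dom _ _)).
 eapply Cd_Ccont. apply Cd_plus; [apply Cd_plus|].
 - apply Cd_scal. exact L0.
 - apply Cd_mult; [go|exact L1].
 - apply Cd_mult; [go|exact L2].
Qed.

Lemma lnPI_bounds : 0 <= ln PI <= 3.
Proof.
 have P4 := PI_4. have P3 := PI2_3_2. split.
 - rewrite <- ln_1. go.
 - have Q := ln_le_m1 _ PI_RGT_0. lra.
Qed.

Lemma vMn_0 : vMn 0 = 0.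
Proof.
 unfold vMn. apply Rle_antisym; [|go]. rewrite <- ln_1. apply vM_le_ln. lia.
Qed.

Lemma D_small s : 3 <= Re s -> Cmod (DS vMn s) <= /(Re s-2).
Proof.
 intros Hs. apply (Cl_bound _ _ _ 1%nat (DS_Cl _ _ 1 s (fun n => vMn_bd 1 n Rlt_0_1) $)).
 intros n Hn. replace n with (1+(n-1))%nat by lia.
 replace (csum (fun k => (vMn k)*ns s k)%C (1+(n-1))) with (csum (fun k => (vMn k)*ns s k) (1+(n-1))-csum (fun k => (vMn k)*ns s k) 1)%C.
 2:{ cbn [csum]. rewrite vMn_0. Cring. }
 ub ((csum_diff_abs _ (np (Re s-1)))).
 - intros k. le_tr; [apply (DS_term _ (/1) 1); intros; apply vMn_bd; lra|]. go.
 - have Q := np_sum (Re s-1) (1+(n-1)) $. replace (Re s-1-1) with (Re s-2) in Q by ring. replace (rsum (np (Re s-1)) 1) with 1; [lra|].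
  cbn [rsum]. unfold np. replace (INR 1) with 1 by reflexivity. rewrite ln_1, Rmult_0_r, Ropp_0, exp_0. ring.
Qed.

Lemma X_logder' s : 1 < Re s -> (X1 s/X s)%C = (AF s-DS vMn s)%C.
Proof. intros Hs. rewrite X_logder by auto. field. apply X_neq0_gt1; auto. Qed.

Lemma Re_Cinv_nonneg z : 0 <= Re z -> 0 <= Re (/z)%C.
Proof.
 intros H. rewrite Re_Cinv. destruct (Req_dec (Re z^2+Im z^2) 0) as [E|E].
 - go.
 - apply Rle_div_r; [|lra]. go.
Qed.

(** From real part 16 on, ln(Re s/(2 PI))/2 is at least 1/4, which outweighs 1/Re s <= 1/16 from
    [LG_Re_ge] together with the prime sum, at most 1/14. *)
Lemma h_pos16 s : 16 <= Re s -> 0 <= Re (X1 s/X s)%C.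
Proof.
 intros Hs. rewrite X_logder' by lra. have A1 := Re_Cinv_nonneg s $. have A2 := Re_Cinv_nonneg (s-1)%C ltac:(simpl; unfold Re in Hs; lra).
 have A3 := LG_Re_ge s $. have A4 := D_small s $. have A5 := re_le_Cmod (DS vMn s). apply Rabs_le_between in A5.
 have P4 := PI_4. have P0 := PI_RGT_0.
 have : ln (Re s/2)-ln PI >= /2.
 { rewrite <- ln_div by lra. have Q := ln_ge_1m (Re s/2/PI) ltac:(go).
  assert (/(Re s/2/PI) <= /2). { apply Rinv_le_contravar; [lra|]. apply (proj1 (Rle_div_r _ _ PI $)). lra. } lra. }
 have : /Re s <= /16 by go. have : /(Re s-2) <= /14 by go.
 change (Re (AF s-DS vMn s)%C) with (Re (/s)%C+Re (/(s-1))%C+- (ln PI/2)+Re (LG s)+- Re (DS vMn s)). lra.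
Qed.

Lemma is_derive_lnX_h x t : X (x, t) <> 0%C -> is_derive (fun x => ln (Cmod (X (x, t)))) x (Re (X1 (x, t)/X (x, t))%C).
Proof.
 intros H. have EX : forall x, (RtoC x+(0, t))%C = (x, t) by (intros; Cring).
 apply (is_derive_ext (fun x => ln (Cmod (X (RtoC x+(0, t))%C)))); [intros y; rewrite EX; reflexivity|].
 eapply is_derive_eq; [apply (is_derive_ln_Cmod (fun x => X (x+(0, t))%C)); [rewrite EX; auto|go]|]. rewrite EX. go.
Qed.

Lemma Cdr_vline (x t : R) : Cdr (fun t => (x, t) : C) t Ci.
Proof. split; [exact (is_derive_const x t)|exact (is_derive_id t)]. Qed.

Lemma mono_incr f df a b : a <= b -> (forall x, a <= x <= b -> is_derive f x (df x)) -> (forall x, a <= x <= b -> 0 <= df x) -> f a <= f b.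
Proof.
 intros Hab HD Hd. have K := mono_decr (fun x => (-(1))*f x) (fun x => (-(1))*df x) a b Hab. cbv beta in K.
 enough (-(1)*f b <= - (1)*f a) by lra. apply K; [intros x Hx; apply is_derive_Rscal; auto|intros x Hx; specialize (Hd x Hx); lra].
Qed.

Lemma X_mono16 x y t : 16 <= x <= y -> Cmod (X (x, t)) <= Cmod (X (y, t)).
Proof.
 intros H. have N : forall u, 16 <= u -> X (u, t) <> 0%C by (intros; apply X_neq0_gt1; simpl; lra).
 have K := mono_incr (fun x => ln (Cmod (X (x, t)))) (fun x => Re (X1 (x, t)/X (x, t))%C) x y $. cbv beta in K.
 have Q : ln (Cmod (X (x, t))) <= ln (Cmod (X (y, t))). { apply K; intros u Hu; [apply is_derive_lnX_h, N; lra|apply h_pos16; simpl; lra]. }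
 apply exp_le in Q. rewrite !exp_ln in Q by (apply Cmod_gt_0, N; lra). go.
Qed.

Lemma LG_bound s : /2 <= Re s <= 18 -> Cmod (LG s) <= 25*(1+Rabs (Im s)).
Proof.
 intros Hs. have A := LG_Im_growth s $. set (x := Re s) in *.
 have I0 : Im (LG (x)) = 0.
 { unfold LG. have G := Lap_real _ 0 _ x RC_ga (ga_dom 20) $. have G1 := Lap_real _ 0 _ x RC_vga (vga_dom 20) $. fold (Gam (x)) in G. fold (Gam1 (x)) in G1.
  destruct (Gam (x)) as [g1 g2]. destruct (Gam1 (x)) as [k1 k2]. simpl in G, G1. subst. go. }
 have U := LG_Re_le (x) ltac:(go). have L := LG_Re_ge (x) ltac:(go). simpl (Re (x)) in U, L. simpl (Im (x)) in U.
 have U2 := ln_le_m1 ((x/2-1/2)^2+(0/2)^2+1/4) ltac:(nra).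
 have L2 := ln_ge_1m (x/2) $. have : /(x/2) <= 4. { replace 4 with (/(/4)) by field. go. }
 have : /x <= 2. { replace 2 with (/(/2)) by field. go. } have : 0 < /x by go.
 have : Cmod (LG (x)) <= 25.
 { ub Cmod_le_Re_Im. rewrite I0, Rabs_R0. assert (Rabs (Re (LG (x))) <= 25); [|lra]. apply Rabs_le_between. nra. }
 have C0 := Cmod_triangle_inv (LG s) (LG (x)).
 have R0 := Rabs_pos (Im s). assert (/x^2+/2*/x <= 5). { replace (/x^2) with (/x*/x) by go. nra. }
 go.
Qed.

Lemma Cmod_inv_le z r : 0 < r -> r <= Re z -> Cmod (/z)%C <= /r.
Proof.
 intros Hr Hz. rewrite Cmod_inv by (apply Re_neq0; lra). apply Rinv_le_contravar; [auto|]. have Q := re_le_Cmod z. apply Rabs_le_between in Q. lra.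
Qed.

(** An anchor in the region of absolute convergence: the logarithmic derivative grows linearly along
    this line, so ln|X| falls at most quadratically. [logder_bound] starts from here and moves
    left. *)
Lemma lnX18_low : exists C0, 0 <= C0 /\ forall t, - (C0*(1+t^2)) <= ln (Cmod (X (18, t))).
Proof.
 have : forall t, X (18, t) <> 0%C by (intros; apply X_neq0_gt1; simpl; lra).
 have D : forall t, is_derive (fun t => ln (Cmod (X (18, t)))) t (Re (X1 (18, t)/X (18, t)*Ci)%C).
 { intros t. eapply is_derive_eq; [apply is_derive_ln_Cmod; [go|apply Cd_Cdr; [go|apply Cdr_vline]]|]. go. }
 have B : forall t, Rabs (Re (X1 (18, t)/X (18, t)*Ci)%C) <= 40*(1+Rabs t).
 { intros t. ub re_le_Cmod. rewrite Cmod_mult, Cmod_Ci, Rmult_1_r, X_logder' by go. unfold AF.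
  have Q1 := Cmod_inv_le (18, t) 18 $ ltac:(go). have Q2 := Cmod_inv_le ((18, t)-1)%C 17 $ ltac:(go).
  have Q3 := LG_bound (18, t) ltac:(go). have Q4 := D_small (18, t) ltac:(go). simpl (Re (18, t)) in Q4. simpl (Im (18, t)) in Q3. have Q5 := lnPI_bounds. have R0 := Rabs_pos t.
  have : Cmod (RtoC (ln PI/2)) <= 2 by (rewrite Cmod_R, Rabs_pos_eq; lra).
  set (a := (/(18, t))%C) in *. set (b := (/((18, t)-1))%C) in *. set (c := RtoC (ln PI/2)) in *. set (e := LG (18, t)) in *. set (f := DS vMn (18, t)) in *.
  have T1 := Cmod_triangle (a+b-c+e)%C (-f)%C. have T2 := Cmod_triangle (a+b-c)%C e. have T3 := Cmod_triangle (a+b)%C (-c)%C. have T4 := Cmod_triangle a b.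
  rewrite Cmod_opp in T1, T3. unfold Cminus in *. lra. }
 have L0 := Rabs_pos (ln (Cmod (X (18, 0)))). exists (Rabs (ln (Cmod (X (18, 0))))+80). split; [lra|]. intros t.
 destruct (MVT_gen (fun t => ln (Cmod (X (18, t)))) 0 t (fun t => Re (X1 (18, t)/X (18, t)*Ci)%C)) as [c [Hc E]].
 - go.
 - intros u _. apply continuity_pt_filterlim. apply (is_derive_cont _ _ _ (D u)).
 - have : Rabs c <= Rabs t. { unfold Rmin, Rmax in Hc. destruct Rle_dec; [rewrite !Rabs_pos_eq by lra|rewrite !Rabs_left1 by lra]; lra. }
  have Q : Rabs (Re (X1 (18, c)/X (18, c)*Ci)%C*t) <= 40*(1+Rabs t)*Rabs t.
  { rewrite Rabs_mult. mul_r; [go|]. specialize (B c). lra. }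
  apply Rabs_le_between in Q. have : t^2 = Rabs t^2 by (rewrite pow2_abs; reflexivity).
  have L1 := Rle_abs (-ln (Cmod (X (18, 0)))). rewrite Rabs_Ropp in L1. set (u := Rabs t) in *. assert (u <= 1+u^2) by nra. go.
Qed.

Lemma X_pos (RH : RiemannHypothesis) s : /2 < Re s -> 0 < Cmod (X s).
Proof. intros. apply Cmod_gt_0, X_neq0; auto. Qed.

Lemma lnX_upper (RH : RiemannHypothesis) : exists M0, 0 <= M0 /\ forall x t z, /2 < x <= 18 -> Cmod (z-(x, t))%C < x-/2 -> ln (Cmod (X z)) <= M0*(1+t^2).
Proof.
 destruct (X_bound 40 $) as [M [HM K]]. exists (ln (1+M)+1000). assert (0 <= ln (1+M)) by (rewrite <- ln_1; apply ln_le; lra). split; [lra|].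
 intros x t z Hx Hz. have U := re_le_Cmod (z-(x, t))%C. have V := im_le_Cmod (z-(x, t))%C.
 have U2 : Rabs (Re (z-(x, t))%C) <= x-/2 by lra. have V2 : Rabs (Im (z-(x, t))%C) <= 18 by lra. apply Rabs_le_between in U2, V2.
 change (Re (z-(x, t))%C) with (Re z-x) in U2. change (Im (z-(x, t))%C) with (Im z-t) in V2.
 have KX := K z ltac:(apply Rabs_le_between; lra).
 have P0 : /2 < Re z. { have U3 : Rabs (Re (z-(x, t))%C) < x-/2 by lra. apply Rabs_lt_between in U3. change (Re (z-(x, t))%C) with (Re z-x) in U3. lra. }
 have PX := X_pos RH z P0. apply ln_le in KX; [|auto]. le_tr; [exact KX|].
 have S2 := pow2_ge_0 (Im z). rewrite ln_mult by lra. have : ln M <= ln (1+M) by (apply ln_le; lra). have L2 := ln_le_m1 (1+Im z^2) $.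
 assert (Im z^2 <= 2*t^2+648) by (generalize (pow2_ge_0 (2*t-Im z)); nra). go.
Qed.

Lemma disc_right x t z : Cmod (z-(x, t))%C < x-/2 -> /2 < Re z.
Proof.
 intros Hz. have U := re_le_Cmod (z-(x, t))%C. have U3 : Rabs (Re (z-(x, t))%C) < x-/2 by lra. apply Rabs_lt_between in U3. change (Re (z-(x, t))%C) with (Re z-x) in U3. lra.
Qed.

(** Under RH the disc of radius x - 1/2 about x + i t has no zeros, so [gradient_estimate] bounds
    X1/X by v = M0 (1+t^2) - ln|X|. Read as a differential inequality in x, it says that (x - 1/2)^2
    v is nondecreasing, so its value at 18 controls it up to the critical line. *)
Lemma logder_bound (RH : RiemannHypothesis) : exists M0 C2, 0 <= M0 /\ 0 <= C2 /\ (forall x t, /2 < x <= 18 -> (x-/2)*Cmod (X1 (x, t)/X (x, t))%C <= 2*(M0*(1+t^2)-ln (Cmod (X (x, t))))) /\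
 (forall x t, /2 < x <= 18 -> (x-/2)^2*(M0*(1+t^2)-ln (Cmod (X (x, t)))) <= C2*(1+t^2)).
Proof.
 destruct (lnX_upper RH) as [M1 [HM1 K1]]. destruct lnX18_low as [C0 [HC0 K2]].
 have G : forall x t, /2 < x <= 18 -> (x-/2)*Cmod (X1 (x, t)/X (x, t))%C <= 2*(M1*(1+t^2)-ln (Cmod (X (x, t)))).
 { intros x t Hx. apply Rnot_lt_le. intros Hn. set (v := 2*(M1*(1+t^2)-ln (Cmod (X (x, t))))) in *. set (g := Cmod (X1 (x, t)/X (x, t))%C) in *.
  have Hg : 0 <= g by apply Cmod_ge_0.
  have GE : forall r, 0 < r < x-/2 -> r*g <= v.
  { intros r Hr. apply (gradient_estimate X _ X2 _ (x-/2)); auto. intros z Hz. repeat split; [go|go|apply X2_Cont|apply X_neq0; auto; eapply disc_right; eauto|].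
   have PX := X_pos RH z (disc_right x t z Hz). rewrite <- (exp_ln _) by auto. apply exp_le, (K1 x t); auto. }
  have : 0 < g. { destruct Hg as [|E]; auto. rewrite <- E in *. have Q := GE ((x-/2)/2) $. lra. }
  (* Only radii below x - 1/2 are available; this one is still large enough to contradict the
     assumed failure at the full radius. *)
  set (r := Rmax ((x-/2)/2) ((v/g+(x-/2))/2)).
  have : v/g < x-/2 by (apply Rlt_div_l; lra).
  have Hr : v/g < r < x-/2. { split; [eapply Rlt_le_trans; [|apply Rmax_r]; lra|apply Rmax_lub_lt; lra]. }
  have : 0 < r. { eapply Rlt_le_trans; [|apply Rmax_l]. lra. }
  have Q := GE r $. destruct Hr as [Hr _]. apply Rlt_div_l in Hr; lra. }
 (* 307 exceeds (18 - 1/2)^2. *)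
 exists M1, (307*(M1+C0)). split; [lra|]. split; [lra|]. split; [go|].
 - intros x t Hx.
  have Mn := mono_incr (fun u => (M1*(1+t^2)-ln (Cmod (X (u, t))))*(u-/2)^2)
    (fun u => (0-Re (X1 (u, t)/X (u, t))%C)*(u-/2)^2+(M1*(1+t^2)-ln (Cmod (X (u, t))))*(2*(u-/2))) x 18 $. cbv beta in Mn.
  have Mn' := Mn ltac:(intros u Hu; apply (is_derive_Rmult (fun u => M1*(1+t^2)-ln (Cmod (X (u, t)))) (fun u => (u-/2)^2)); [apply is_derive_Rminus; [exact (is_derive_const _ _)|apply is_derive_lnX_h, X_neq0; [auto|go]]|auto_derive; auto; ring]). clear Mn.
  have Mn := Mn' ltac:(intros u Hu; assert (Q := G u t $); assert (Q2 := re_le_Cmod (X1 (u, t)/X (u, t))%C); apply Rabs_le_between in Q2; set (w := M1*(1+t^2)-ln (Cmod (X (u, t)))) in *; set (g := Cmod (X1 (u, t)/X (u, t))%C) in *; set (h := Re (X1 (u, t)/X (u, t))%C) in *; assert (0 <= (u-/2)*(2*w-(u-/2)*g)) by go; assert (0 <= (u-/2)^2*(g-h)) by go; nra). specialize (K2 t). set (T := 1+t^2) in *. assert (0 <= M1*T) by go. assert (0 <= C0*T) by go.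
  rewrite Rmult_comm. le_tr; [exact Mn|]. go.
Qed.

(** * Comparison of X(s - a) with X(s + a) *)

(** The quotient in [X_shift_compare] is a priori only bounded by an exponential of C (1 + t^2), so
    the cutoff has order four. *)
Definition cut4 (e : R) (s : C) : C := Cexp (-(RtoC e*(s*s*(s*s))))%C.

Lemma Cmod_cut4 e s : Cmod (cut4 e s) = exp (-(e*(Re s^4-6*Re s^2*Im s^2+Im s^4))).
Proof. unfold cut4. rewrite Cmod_Cexp. f_equal. go. Qed.

Lemma cut4_Cd e s : Cd (cut4 e) s (-RtoC (4*e)*(s*(s*s))*cut4 e s)%C.
Proof.
 eapply Cd_eq; [apply (Cd_comp Cexp _ s); [go|]|].
 - apply (Cd_ext (fun s => (-e)*(s*s*(s*s)))%C); [go|]. go.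
 - go.
Qed.

Lemma exp_poly4 A B e : 0 < e -> exists T, forall t, T <= Rabs t -> A+B*t^2-e*t^4 <= - Rabs t.
Proof.
 intros He. set (K := Rabs A+Rabs B+1). have HA := Rle_abs A. have HB := Rle_abs B. have HA0 := Rabs_pos A. exists (K/e+1). intros t Ht. rewrite <- (pow2_abs t). replace (t^4) with (Rabs t^4) by (replace (Rabs t^4) with (Rabs t^2*Rabs t^2) by ring; rewrite pow2_abs; ring).
 have : 0 < K/e by go. set (u := Rabs t) in *.
 have : K <= e*(u-1). { rewrite Rmult_comm. apply (proj1 (Rle_div_l K _ e He)). lra. }
 have : u <= u^2 by nra. assert (K*u^2 <= e*u^4). { replace (e*u^4) with (e*u^2*u^2) by ring. go. }
 go.
Qed.

Lemma X_reflect x t : Cmod (X (1-x, t)) = Cmod (X (x, t)).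
Proof.
 replace ((1-x, t) : C) with (1-Cconj (x, t))%C by go. rewrite X_sym, X_conj, Cmod_conj. go.
Qed.

(** On Re s = 1/2 the two moduli agree by the functional equation and conjugation; on Re s = 17 they
    are ordered by [X_mono16]. The cutoff is removed by letting e tend to 0. *)
Lemma X_shift_compare (RH : RiemannHypothesis) a s : 0 < a < 1 -> /2 <= Re s <= 17 -> Cmod (X (s-RtoC a)%C) <= Cmod (X (s+RtoC a)%C).
Proof.
 intros Ha Hs.
 destruct (logder_bound RH) as [M0 [C2 [HM0 [HC2 [_ K2]]]]]. destruct (X_bound 40 $) as [M [HM KX]].
 set (Q := fun s => (X (s-a)/X (s+a))%C).
 have HN : forall z, /2 <= Re z -> X (z+a)%C <> 0%C by (intros z Hz; apply X_neq0; auto; simpl; unfold Re in *; lra).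
 (* Re(s^4) = (t^2 - 3x^2)^2 - 8x^4 >= -8 17^4 on the strip bounds the cutoff. *)
 have main : forall e, 0 < e -> Cmod (Q s*cut4 e s)%C <= exp (e*(8*17^4)).
 { intros e He.
  set (Q1 := fun s => ((X1 (s-a)*X (s+a)-X (s-a)*X1 (s+a))/(X (s+a)*X (s+a)))%C).
  have Sp : forall f l z, Cd f (z+a)%C l -> Cd (fun x => f (x+a)%C) z l.
  { intros f l z H. eapply Cd_eq; [apply Cd_comp; [exact H|]|]. apply Cd_plus; [apply Cd_id|apply Cd_const]. Cring. }
  have C1 : forall z, Cd (fun x => X (x-a)%C) z (X1 (z-a)%C) by (intros; apply Cd_shift, X_Cd).
  have C2' : forall z, Cd (fun x => X (x+RtoC a)%C) z (X1 (z+RtoC a)%C) by (intros; apply (Sp X), X_Cd).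
  have C3 : forall z, Cd (fun x => X1 (x-RtoC a)%C) z (X2 (z-RtoC a)%C) by (intros; apply (Cd_shift X1), X1_Cd).
  have C4 : forall z, Cd (fun x => X1 (x+RtoC a)%C) z (X2 (z+RtoC a)%C) by (intros; apply (Sp X1), X1_Cd).
  have DQ : forall z, /2 <= Re z -> Cd Q z (Q1 z).
  { intros z Hz. unfold Q, Q1. apply (Cd_div (fun x => X (x-RtoC a)%C) (fun x => X (x+RtoC a)%C)); auto. }
  apply (max_principle_strip (fun z => Q z*cut4 e z)%C (fun z => Q1 z*cut4 e z+Q z*(-RtoC (4*e)*(z*(z*z))*cut4 e z))%C (/2) 17); auto; [lra|go| | | |].
  - intros z Hz. apply (Cd_mult Q (cut4 e)); [apply DQ; lra|apply cut4_Cd].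
  - intros z Hz. have Hz' : /2 <= Re z by lra. apply Ccont_plus; apply Ccont_mult.
   + eapply Cd_Ccont. unfold Q1. apply Cd_div; [apply Cmult_neq_0; auto| |].
    * apply Cd_minus; [apply (Cd_mult (fun x => X1 (x-RtoC a)%C) (fun x => X (x+RtoC a)%C)); auto|apply (Cd_mult (fun x => X (x-RtoC a)%C) (fun x => X1 (x+RtoC a)%C)); auto].
    * apply (Cd_mult (fun x => X (x+RtoC a)%C) (fun x => X (x+RtoC a)%C)); auto.
   + eapply Cd_Ccont, cut4_Cd.
   + eapply Cd_Ccont, DQ; auto.
   + eapply Cd_Ccont. apply (Cd_mult (fun z => - RtoC (4*e)*(z*(z*z)))%C (cut4 e)); [|apply cut4_Cd].
    apply (Cd_mult (fun _ => - RtoC (4*e))%C (fun z => z*(z*z))%C); [apply Cd_const|]. apply (Cd_mult (fun z => z) (fun z => z*z)%C); [apply Cd_id|]. apply (Cd_mult (fun z => z) (fun z => z)); apply Cd_id.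
  - intros eps Heps.
   set (D := C2/a^2). destruct (exp_poly4 (ln M+D) (1+D+e*(6*17^2)) e He) as [T1 HT1]. exists (Rmax T1 (-ln eps)). intros z Hz Ht.
   have t1 := Rle_trans _ _ _ (Rmax_l _ _) Ht. have t2 := Rle_trans _ _ _ (Rmax_r _ _) Ht. specialize (HT1 _ t1).
   destruct z as [x t]. simpl (Re (x, t)) in *. simpl (Im (x, t)) in *.
   rewrite Cmod_mult. unfold Q. rewrite Cmod_div by (apply HN; simpl; lra).
   replace ((x, t)-RtoC a)%C with ((x-a)%R, t) by (Cring). replace ((x, t)+RtoC a)%C with ((x+a)%R, t) by (Cring).
   have U := KX (x-a, t) ltac:(simpl; apply Rabs_le_between; lra). have V := K2 (x+a) t $. have PX := X_pos RH (x+a, t) ltac:(simpl; lra).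
   have V2 : - ln (Cmod (X ((x+a)%R, t))) <= D*(1+t^2).
   { unfold D. replace (C2/a^2*(1+t^2)) with (C2*(1+t^2)/a^2) by go. apply (proj1 (Rle_div_r _ _ (a^2) ltac:(go))).
    assert (0 <= M0*(1+t^2)) by go.
    set (l := ln (Cmod (X ((x+a)%R, t)))) in *. set (N := M0*(1+t^2)) in *.
    have a2 : a^2 <= (x+a-/2)^2 by go. destruct (Rle_dec 0 (N-l)) as [L|L]; nra. }
   rewrite Cmod_cut4. have U2 : Cmod (X ((x-a)%R, t)) <= exp (ln M+t^2). { rewrite exp_plus, exp_ln by auto. le_tr; [exact U|]. mul_l; [lra|apply exp_ineq1_le]. }
   have V3 : /Cmod (X ((x+a)%R, t)) <= exp (D*(1+t^2)). { rewrite <- (exp_ln (Cmod (X ((x+a)%R, t)))) by auto. rewrite <- exp_Ropp. go. }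
   apply Rle_trans with (exp (ln M+t^2)*exp (D*(1+t^2))*exp (-(e*(x^4-6*x^2*t^2+t^4)))).
   + mul_r; [go|]. apply Rmult_le_compat; auto; [go|go].
   + rewrite <- !exp_plus. rewrite <- (exp_ln eps) by auto. apply exp_le. have x2 : x^2 <= 17^2 by go. assert (e*(6*x^2*t^2) <= e*(6*17^2)*t^2) by (replace (e*(6*17^2)*t^2) with (e*(6*17^2*t^2)) by ring; mul_l; nra).
    assert (0 <= e*x^4) by go. lra.
  - intros [x t] Hx. simpl in Hx. rewrite Cmod_mult, Cmod_cut4. simpl (Re (x, t)). simpl (Im (x, t)).
   have QQ : Cmod (Q (x, t)) <= 1.
   { unfold Q. rewrite Cmod_div by (apply HN; simpl; lra). have PX := X_pos RH (x+a, t) ltac:(simpl; lra).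
    replace ((x, t)-RtoC a)%C with ((x-a)%R, t) by (Cring). replace ((x, t)+RtoC a)%C with ((x+a)%R, t) by (Cring).
    apply (proj2 (Rle_div_l _ 1 _ PX)). rewrite Rmult_1_l. destruct Hx as [-> | ->].
    - replace (/2-a) with (1-(/2+a)) by field. rewrite X_reflect. lra.
    - apply X_mono16. lra. }
   rewrite <- (Rmult_1_l (exp (e*(8*17^4)))). have x4 : x^4 <= 17^4 by go. assert (0 <= (t^2-3*x^2)^2) by apply pow2_ge_0.
   go. }
 have Hm : Cmod (Q s) <= 1.
 { apply Rnot_lt_le. intros L. set (q := ln (Cmod (Q s))). have Hq : 0 < q by (unfold q; rewrite <- ln_1; apply ln_increasing; lra).
  set (W := 8*17^4+Rabs (Re s^4-6*Re s^2*Im s^2+Im s^4)+1).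
  have HW0 := Rabs_pos (Re s^4-6*Re s^2*Im s^2+Im s^4). have K := main (q/(2*W)) ltac:(go). rewrite Cmod_mult, Cmod_cut4 in K. apply ln_le in K; [|go].
  rewrite ln_mult, !ln_exp in K by go. fold q in K.
  have B := Rle_abs (Re s^4-6*Re s^2*Im s^2+Im s^4). have E : q/(2*W)*W = q/2 by go. unfold W in E at 2. nra. }
 unfold Q in Hm. rewrite Cmod_div in Hm by (apply HN; lra). have PX := X_pos RH (s+RtoC a)%C ltac:(simpl; unfold Re in *; lra).
 apply (proj1 (Rle_div_l _ 1 _ PX)) in Hm. lra.
Qed.

(** The difference ln|X(x+a+it)| - ln|X(x-a+it)| is nonnegative for small a > 0, vanishes at a = 0
    and has derivative 2h there. *)
Lemma h_nonneg (RH : RiemannHypothesis) s : /2 < Re s <= 17 -> 0 <= Re (X1 s/X s)%C.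
Proof.
 destruct s as [x t]. simpl. intros Hx. set (h := Re (X1 (x, t)/X (x, t))%C).
 have N : forall u, /2 < u -> X (u, t) <> 0%C by go.
 have D := is_derive_lnX_h x t (N x $). fold h in D. change (0 <= h). clearbody h.
 have DP : is_derive (fun a => ln (Cmod (X (x+a, t)))) 0 h.
 { eapply is_derive_eq; [apply (is_derive_comp (fun x => ln (Cmod (X (x, t)))) _); [rewrite Rplus_0_r; exact D|auto_derive; auto]|]. unfold scal; simpl; unfold mult; simpl. ring. }
 have DM : is_derive (fun a => ln (Cmod (X (x-a, t)))) 0 (-h).
 { eapply is_derive_eq; [apply (is_derive_comp (fun x => ln (Cmod (X (x, t)))) _); [rewrite Rminus_0_r; exact D|auto_derive; auto]|]. unfold scal; simpl; unfold mult; simpl. ring. }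
 have DD := is_derive_Rminus _ _ _ _ _ DP DM. apply Rnot_lt_le. intros L.
 destruct (proj1 (is_derive_eps _ 0 _) DD (-h) $) as [d [Hd K]].
 set (a := Rmin (d/2) (Rmin (/2) ((x-/2)/2))). have : 0 < a by (unfold a; repeat apply Rmin_pos; lra).
 have : a <= d/2 by apply Rmin_l. have : a <= /2 by (le_tr; [apply Rmin_r|apply Rmin_l]). have : a <= (x-/2)/2 by (le_tr; [apply Rmin_r|apply Rmin_r]).
 specialize (K a ltac:(rewrite Rabs_pos_eq; lra)). rewrite !Rplus_0_l, !Rplus_0_r, !Rminus_0_r in K.
 have S := X_shift_compare RH a (x, t) $ ltac:(go).
 replace ((x, t)-a)%C with ((x-a)%R, t) in S by go. replace ((x, t)+a)%C with ((x+a)%R, t) in S by go.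
 apply ln_le in S; [|apply Cmod_gt_0, N; lra]. rewrite (Rabs_pos_eq a) in K by lra. apply Rabs_le_between in K. nra.
Qed.

#[export] Hint Resolve Cdr_vline : cont.

(** * Shifting the line of integration *)

Lemma JC_plane f q : (forall t, Ccont f (q, t)) -> JC (fun r t => f (r, t)) q.
Proof.
 intros Hf t eps He. destruct (Ccont_mod _ _ (Hf t) _ He) as [d [Hd K]]. have Hd2 : 0 < d/2 by lra. exists (mkposreal _ Hd2). cbn [pos].
 intros r t' A B. apply K. eapply Rle_lt_trans; [apply Cmod_le_Re_Im|]. simpl. unfold Rminus in *. lra.
Qed.

Lemma Cdr_plane_x (f : C -> C) x t l : Cd f (x, t) l -> Cdr (fun x => f (x, t)) x l.
Proof.
 intros H. eapply Cdr_eq; [apply (Cd_Cdr f _ x l 1%C); [go|]|Cring]. split; [exact (is_derive_id x)|exact (is_derive_const t x)].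
Qed.

Lemma Cdr_plane_t (f : C -> C) x t l : Cd f (x, t) l -> Cdr (fun t => f (x, t)) t (Ci*l)%C.
Proof.
 intros H. eapply Cdr_eq; [apply (Cd_Cdr f _ t l Ci); [go|go]|Cring].
Qed.

(** Differentiating the truncated integral in x leaves an integral of f1, which is -i times a
    derivative along the line. Only the values of f at the two ends remain, and they decay. *)
Lemma line_shift f f1 c0 a b M c l : c0 < a <= b -> 0 < c -> 0 <= M ->
 (forall s, c0 < Re s -> Cd f s (f1 s) /\ Ccont f1 s) ->
 (forall x t, a <= x <= b -> Cmod (f (x, t)) <= M*exp (-c*Rabs t)) ->
 is_CL (fun t => f (a, t)) l -> is_CL (fun t => f (b, t)) l.
Proof.
 intros Hab Hc HM HD HB HL.
 have CF : forall x, c0 < x -> CC (fun t => f (x, t)) by (intros x Hx; apply (CC_Cdr _ (fun t => Ci*f1 (x, t))%C); intros t; apply Cdr_plane_t, HD; auto).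
 have CF1 : forall x, c0 < x -> CC (fun t => f1 (x, t)) by (intros x Hx; apply (JC_CC (fun r t => f1 (r, t)) x), JC_plane; intros t; apply HD; auto).
 have key : forall T S, 0 <= T -> 0 <= S -> Cmod (CI (fun t => f (b, t)) (-T) S-CI (fun t => f (a, t)) (-T) S)%C <= (M*exp (-c*T)+M*exp (-c*S))*(b-a).
 { intros T S HT HS. apply (C_mvt (fun x => CI (fun t => f (x, t)) (-T) S) (fun x => - Ci*(f (x, S)-f (x, (-T)%R)))%C); [lra| |].
  - intros x Hx. eapply Cdr_eq; [apply (leibniz _ (fun r t => f1 (r, t)) x _ S (x-c0)); [lra|lra| |apply CF1; lra| |]|].
   + intros r Hr. apply CF. apply Rabs_lt_between in Hr. lra.
   + intros r t Hr. apply Cdr_plane_x, HD. simpl. apply Rabs_lt_between in Hr. lra.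
   + intros t eps _ He. apply JC_plane; auto. intros t'. apply HD. go.
   + have E := CI_FTC (fun t => f (x, t)) _ (-T) S ltac:(intros; apply Cdr_plane_t, HD; simpl; lra) ltac:(apply CC_scalr, CF1; lra).
    rewrite CI_scal in E by (apply CF1; lra). rewrite <- E. generalize (CI (fun t => f1 (x, t)) (-T) S). intros w. Cring.
  - intros x Hx. rewrite Cmod_mult, Cmod_opp, Cmod_Ci, Rmult_1_l. ub Cmod_triangle. rewrite Cmod_opp.
   have B1 := HB x S Hx. have B2 := HB x (-T) Hx. rewrite Rabs_Ropp in B2. rewrite Rabs_pos_eq in B1, B2 by lra. lra. }
 intros eps He. destruct (HL (eps/2) $) as [N HN].
 destruct (exp_small c Hc (2*M*(b-a)) (eps/2) $) as [N1 [HN1 K1]].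
 exists (Rmax N N1). intros T S HT HS. have A1 := Rmax_l N N1. have A2 := Rmax_r N N1. specialize (HN T S $ $). have K := key T S $ $.
 have E1 := K1 T $. have E2 := K1 S $.
 replace (CI (fun t => f (b, t)) (-T) S-l)%C with ((CI (fun t => f (b, t)) (-T) S-CI (fun t => f (a, t)) (-T) S)+(CI (fun t => f (a, t)) (-T) S-l))%C by Cring.
 le_tr; [go|]. lra.
Qed.

(* On the line Re s = s0 this is exp(-al (t-tau)^2 + i xi t), with s0 = Re rho and tau = Im rho. *)
Definition FG (al : R) (rho : C) (xi : R) (s : C) : C := Cexp (RtoC al*((s-rho)*(s-rho))+RtoC xi*(s-RtoC (Re rho)))%C.

Lemma FG_Cd al rho xi s : Cd (FG al rho xi) s ((RtoC (2*al)*(s-rho)+RtoC xi)*FG al rho xi s)%C.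
Proof.
 eapply Cd_eq; [apply (Cd_comp Cexp _ s); [go|]|].
 - go.
 - go.
Qed.

Lemma Cmod_FG al rho xi x t : Cmod (FG al rho xi (x, t)) = exp (al*((x-Re rho)^2-(t-Im rho)^2)+xi*(x-Re rho)).
Proof. unfold FG. rewrite Cmod_Cexp. f_equal. go. Qed.

Definition mu_of (al : R) (rho : C) (xi x : R) : C := (2*al*Im rho, 2*al*(x-Re rho)+xi).
Definition cst_of (al : R) (rho : C) (xi x : R) : C := (al*(x-Re rho)^2-al*Im rho^2+xi*(x-Re rho), - (2*al*(x-Re rho)*Im rho)).

Lemma FG_line al rho xi x t : FG al rho xi (x, t) = (Cexp (cst_of al rho xi x)*Lin (gauss al) (mu_of al rho xi x) t)%C.
Proof.
 unfold Lin, gauss, FG. rewrite <- Cexp_RtoC, <- !Cexp_add. f_equal. unfold cst_of, mu_of, Re, Im. go.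
Qed.

Lemma line_gauss_CL al rho xi x : 0 < al -> is_CL (fun t => FG al rho xi (x, t)) (RtoC (Kg al)*Cexp ((-(xi^2/(4*al)))%R, (xi*Im rho)%R))%C.
Proof.
 intros Ha. set (mu := mu_of al rho xi x). set (k := cst_of al rho xi x).
 apply (is_CL_ext (fun t => Cexp k*Lin (gauss al) mu t)%C); [intros t; symmetry; apply FG_line|].
 replace ((Kg al)*Cexp ((-(xi^2/(4*al)))%R, (xi*Im rho)%R))%C with (Cexp k*Gs al mu)%C.
 - apply is_CL_scal; [go|]. apply (Lap_CL _ (Re mu-1) (Re mu+1)); [go|apply gauss_dom; auto|lra].
 - rewrite Gs_formula, Gs0_Kg by auto. transitivity ((Kg al)*(Cexp k*Cexp (mu*mu/RtoC (4*al))))%C; [Cring|]. f_equal. rewrite <- Cexp_add. f_equal.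
  go.
Qed.

Lemma CC_FG al rho xi x : CC (fun t => FG al rho xi (x, t)).
Proof. apply (CC_Cdr _ (fun t => Ci*((RtoC (2*al)*((x, t)-rho)+xi)*FG al rho xi (x, t)))%C). intros t. apply Cdr_plane_t, FG_Cd. Qed.

Lemma FG_decay al rho xi B : 0 < al -> exists M, 0 <= M /\ forall x t, Rabs (x-Re rho) <= B -> Cmod (FG al rho xi (x, t))*(1+t^2) <= M*exp (-(1)*Rabs t).
Proof.
 set (M := 2*exp (al*B^2+Rabs xi*B+2*Rabs (Im rho)+/al)).
 exists M. split; [go|]. intros x t Hx. rewrite Cmod_FG.
 set (b := x-Re rho) in *. set (tau := Im rho). have : b^2 <= B^2 by (rewrite <- (pow2_abs b); apply pow_incr; split; [go|auto]).
 have : 1+t^2 <= 2*exp (Rabs t). { have Q := exp_ge_3 _ (Rabs_pos t). rewrite <- (pow2_abs t). assert (0 <= Rabs t^3) by go. go. }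
 have : xi*b <= Rabs xi*B. { ub Rle_abs. rewrite Rabs_mult. go. }
 have : - (al*(t-tau)^2)+2*Rabs t <= 2*Rabs tau+/al.
 { have T := Rabs_triang (t-tau) tau. replace (t-tau+tau) with t in T by ring. rewrite <- (pow2_abs (t-tau)). set (w := Rabs (t-tau)) in *.
  have S : 0 <= al*(w-/al)^2 by go. replace (al*(w-/al)^2) with (al*w^2-2*w+/al) in S by go. lra. }
 apply Rle_trans with (exp (al*(b^2-(t-tau)^2)+xi*b)*(2*exp (Rabs t))); [go|].
 unfold M. fold tau. rewrite Rmult_comm. rewrite !Rmult_assoc. mul_l; [lra|]. rewrite <- !exp_plus. apply exp_le. go.
Qed.

Definition Gam2 (s : C) : C := Lap (fun v => v*vga v) s.
Definition LG1 (s : C) : C := ((Gam2 s*Gam s-Gam1 s*Gam1 s)/(Gam s*Gam s))%C.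

Lemma Gam1_Cd2 s : 0 < Re s -> Cd Gam1 s (Gam2 s).
Proof. intros Hs. apply (Lap_Cd _ 0 (Re s+1)); [go|apply vga_dom|lra]. Qed.

Lemma Gam2_Cont s : 0 < Re s -> Ccont Gam2 s.
Proof. intros Hs. eapply Cd_Ccont, (Lap_Cd _ 0 (Re s+1)); [go|apply dom_id_mult, vga_dom|lra]. Qed.

(* zeta'/zeta(s) + 1/(s-1): the pole is removed, so EE is regular for Re s > 1/2 under RH. *)
Definition EE (s : C) : C := (X1 s/X s+RtoC (ln PI/2)-LG (s+2))%C.
Definition EE1 (s : C) : C := ((X2 s*X s-X1 s*X1 s)/(X s*X s)+0-LG1 (s+2))%C.

Lemma Cd_shift_plus f s l c : Cd f (s+c)%C l -> Cd (fun x => f (x+c)%C) s l.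
Proof.
 intros H. eapply Cd_eq; [apply Cd_comp; [exact H|]|].
 - go.
 - Cring.
Qed.

Lemma Ccont_shift_plus f s c : Ccont f (s+c)%C -> Ccont (fun x => f (x+c)%C) s.
Proof.
 intros H eps He. destruct (H eps He) as [d [Hd K]]. exists d. split; auto. intros h Hh. replace (s+h+c)%C with (s+c+h)%C by Cring. go.
Qed.

Lemma Ccont_opp f s : Ccont f s -> Ccont (fun x => - f x)%C s.
Proof.
 intros H. apply (Ccont_ext (fun x => (-(1))*f x)%C); [go|]. apply Ccont_mult; auto. exact (Cd_Ccont _ _ _ (Cd_const _ _)).
Qed.

Lemma Ccont_div2 p q r s lq lr : Ccont p s -> Cd q s lq -> Cd r s lr -> r s <> 0%C -> Ccont (fun z => (p z*r z-q z*q z)/(r z*r z))%C s.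
Proof.
 intros Hp Hq Hr N. apply Ccont_mult.
 - apply Ccont_plus; [|apply Ccont_opp]; apply Ccont_mult; auto; eapply Cd_Ccont; eauto.
 - eapply Cd_Ccont, Cd_inv; [apply Cmult_neq_0; auto|apply Cd_mult; eauto].
Qed.

Lemma EE_Cd (RH : RiemannHypothesis) s : /2 < Re s -> Cd EE s (EE1 s) /\ Ccont EE1 s.
Proof.
 intros Hs. have NX := X_neq0 s RH Hs. have R2 : 0 < Re (s+2)%C by (simpl; unfold Re in *; lra). have NG := Gam_neq0 _ R2. split.
 - apply Cd_minus; [apply Cd_plus; [apply Cd_div; auto using X_Cd, X1_Cd|go]|].
  apply Cd_shift_plus. apply Cd_div; auto using Gam_Cd, Gam1_Cd2.
 - apply Ccont_plus; [apply Ccont_plus|].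
  + exact (Ccont_div2 _ _ X _ _ _ (X2_Cont s) (X1_Cd s) (X_Cd s) NX).
  + exact (Cd_Ccont _ _ _ (Cd_const _ _)).
  + apply Ccont_opp, Ccont_shift_plus. exact (Ccont_div2 _ _ _ _ _ _ (Gam2_Cont _ R2) (Gam1_Cd2 _ R2) (Gam_Cd _ R2) NG).
Qed.

Lemma EE_growth (RH : RiemannHypothesis) a : /2 < a -> exists M, 0 <= M /\ forall x t, a <= x <= 2 -> Cmod (EE (x, t)) <= M*(1+t^2).
Proof.
 intros Ha. destruct (logder_bound RH) as [M0 [C2 [HM0 [HC2 [K1 K2]]]]]. set (d := a-/2). have : 0 < d by go.
 exists (2*C2/d^3+3+50). split; [go|].
 intros x t Hx. specialize (K1 x t $). specialize (K2 x t $). set (T := 1+t^2) in *. set (v := M0*T-ln (Cmod (X (x, t)))) in *. set (g := Cmod (X1 (x, t)/X (x, t))%C) in *. have : g <= 2*C2/d^3*T.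
 { replace (2*C2/d^3*T) with (2*C2*T/d^3) by go. apply (proj1 (Rle_div_r _ _ (d^3) ltac:(apply pow_lt; auto))).
  apply Rle_trans with (g*(x-/2)^3); [go|].
  replace (g*(x-/2)^3) with ((x-/2)^2*((x-/2)*g)) by ring. apply Rle_trans with ((x-/2)^2*(2*v)); [go|]. lra. }
 have L := LG_bound ((x, t)+2)%C ltac:(go). replace (Im ((x, t)+2)%C) with t in L by go.
 have : Rabs t <= T. { unfold T. rewrite <- (pow2_abs t). go. }
 have P3 := lnPI_bounds. unfold EE. have Q1 := Cmod_triangle (X1 (x, t)/X (x, t)+RtoC (ln PI/2))%C (-LG ((x, t)+2))%C. have Q2 := Cmod_triangle (X1 (x, t)/X (x, t))%C (RtoC (ln PI/2)).
 rewrite Cmod_opp in Q1. rewrite Cmod_R, Rabs_pos_eq in Q2 by lra. unfold Cminus in *. go.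
Qed.

Lemma EE_right s : 1 < Re s -> EE s = (/(s-1)-DS vMn s)%C.
Proof.
 intros Hs. unfold EE. rewrite X_logder' by auto. have : 0 < Re s by lra.
 have E : LG (s+2)%C = (/s+LG s)%C.
 { unfold LG. rewrite Gam_step, Gam1_step by auto. go. }
 rewrite E. go.
Qed.

Lemma line_integral_shift (RH : RiemannHypothesis) al rho xi : 0 < al -> /2 < Re rho <= 2 ->
 exists l, is_CL (fun t => EE (Re rho, t)*FG al rho xi (Re rho, t))%C l /\ is_CL (fun t => EE (2, t)*FG al rho xi (2, t))%C l.
Proof.
 intros Ha Hr. destruct (EE_growth RH (Re rho) $) as [M1 [HM1 G]]. destruct (FG_decay _ rho xi 2 Ha) as [M2 [HM2 D]].
 have B : forall x t, Re rho <= x <= 2 -> Cmod (EE (x, t)*FG al rho xi (x, t))%C <= M1*M2*exp (-(1)*Rabs t).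
 { intros x t Hx. rewrite Cmod_mult. have D' := D x t ltac:(go). have G' := G x t Hx. have P := Cmod_ge_0 (FG al rho xi (x, t)).
  go. }
 set (f1 := fun s => (EE1 s*FG al rho xi s+EE s*((RtoC (2*al)*(s-rho)+xi)*FG al rho xi s))%C).
 have HD : forall s, /2 < Re s -> Cd (fun s => EE s*FG al rho xi s)%C s (f1 s) /\ Ccont f1 s.
 { intros s Hs. destruct (EE_Cd RH s Hs) as [E1 E2]. split; [apply Cd_mult; [auto|apply FG_Cd]|].
  apply Ccont_plus; apply Ccont_mult; auto; try (eapply Cd_Ccont; eauto using FG_Cd; fail).
  eapply Cd_Ccont, Cd_mult; [|apply FG_Cd].
  go. }
 destruct (CL_exists (M1*M2) 1 (fun t => EE (Re rho, t)*FG al rho xi (Re rho, t))%C Rlt_0_1) as [l Hl].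
 - apply (CC_Cdr _ (fun t => Ci*f1 (Re rho, t))%C). intros t. exact (Cdr_plane_t _ _ t _ (proj1 (HD (Re rho, t) (proj1 Hr)))).
 - intros t. apply B. lra.
 - exists l. split; auto. apply (line_shift (fun s => EE s*FG al rho xi s)%C f1 (/2) (Re rho) 2 (M1*M2) 1 l); auto; try lra. go.
Qed.

#[export] Hint Resolve Cdr_plane_x Cdr_plane_t CC_FG : cont.

(** * Gaussian integrals of the primes and of the pole *)

Lemma RC_abs_FG al rho xi x : RC (fun t => Cmod (FG al rho xi (x, t))).
Proof. go. Qed.

Lemma FG_abs_RL al rho xi x : 0 < al -> is_RL (fun t => Cmod (FG al rho xi (x, t))) (exp (al*(x-Re rho)^2+xi*(x-Re rho))*Kg al).
Proof.
 intros Ha. apply (is_RL_ext (fun t => exp (al*(x-Re rho)^2+xi*(x-Re rho))*gauss al (t+- Im rho))).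
 - intros t. rewrite Cmod_FG. unfold gauss. go.
 - apply is_RL_scal.
  + apply RC_comp; [go|go].
  + apply (is_CL_shift (fun t => (gauss al t))); [go|apply gauss_RL; auto].
Qed.

Lemma prime_term al rho xi x t n : (ns (x, t) n*FG al rho xi (x, t))%C = (RtoC (np (Re rho) n)*FG al rho (xi-ln (INR (S n))) (x, t))%C.
Proof.
 unfold ns, FG, np. rewrite <- Cexp_RtoC, <- !Cexp_add. f_equal. go.
Qed.

(** The Gaussian line integral at frequency u divided by [Kg al], see [line_gauss_CL]. *)
Definition gph (al tau u : R) : C := Cexp (-(u^2/(4*al)), u*tau).
Definition pv (al : R) (rho : C) (xi : R) (n : nat) : C := (RtoC (vMn n*np (Re rho) n)*gph al (Im rho) (xi-ln (INR (S n))))%C.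

Lemma CC_csum (u : nat -> R -> C) N : (forall n, CC (u n)) -> CC (fun t => csum (fun n => u n t) N).
Proof. intros H. induction N as [|N IH]; cbn [csum]; [go|go]. Qed.

Lemma is_CL_csum (u : nat -> R -> C) v N : (forall n, CC (u n)) -> (forall n, is_CL (u n) (v n)) -> is_CL (fun t => csum (fun n => u n t) N) (csum v N).
Proof.
 intros H1 H2. induction N as [|N IH]; cbn [csum].
 - exists 0. intros T S _ _. rewrite CI_const0. replace (RtoC (S-- T)*0-0)%C with (RtoC 0) by Cring. rewrite Cmod_0. lra.
 - apply is_CL_plus; auto. apply CC_csum; auto.
Qed.

Lemma partial_CL al rho xi x N : 0 < al -> is_CL (fun t => csum (fun n => RtoC (vMn n)*ns (x, t) n)%C N*FG al rho xi (x, t))%C (RtoC (Kg al)*csum (pv al rho xi) N)%C.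
Proof.
 intros Ha. rewrite <- csum_scal.
 apply (is_CL_ext (fun t => csum (fun n => RtoC (vMn n*np (Re rho) n)*FG al rho (xi-ln (INR (S n))) (x, t))%C N)).
 - intros t. rewrite <- csum_scal_r. apply csum_ext. intros n _. rewrite <- Cmult_assoc, prime_term, RtoC_mult. Cring.
 - apply is_CL_csum; [go|]. intros n.
  replace ((Kg al)*pv al rho xi n)%C with (RtoC (vMn n*np (Re rho) n)*((Kg al)*gph al (Im rho) (xi-ln (INR (S n)))))%C by go.
  apply is_CL_scal; [go|apply line_gauss_CL; auto].
Qed.

(** [fp1] and [fp2] are the real and imaginary parts of the Gaussian divided by 1 + i v, which is s
    - 1 on the line Re s = 2. *)
Definition fp1 (al v : R) : R := gauss al v*/(1+v^2).
Definition fp2 (al v : R) : R := - v*(gauss al v*/(1+v^2)).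

Lemma one_sq_pos v : 0 < 1+v^2.
Proof. go. Qed.

Lemma RC_fp1 al : RC (fp1 al).
Proof. apply RC_mult; [go|]. apply RC_derive. intros t. auto_derive. go. Qed.

Lemma RC_fp2 al : RC (fp2 al).
Proof. apply RC_mult; [|apply RC_fp1]. apply RC_derive. intros t. auto_derive. auto. Qed.

Lemma dom_le phi psi a b : (forall v, Rabs (phi v) <= Rabs (psi v)) -> dom psi a b -> dom phi a b.
Proof.
 intros H D sg Hs. destruct (D sg Hs) as [M [c [Hc K]]]. exists M, c. split; auto. intros v. le_tr; [|go]. go.
Qed.

Lemma fp1_dom al a b : 0 < al -> dom (fp1 al) a b.
Proof.
 intros Ha. apply (dom_le _ (gauss al)); [|apply gauss_dom; auto]. intros v. unfold fp1. rewrite Rabs_mult. rewrite <- (Rmult_1_r (Rabs (gauss al v))) at 2.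
 mul_l; [go|]. rewrite Rabs_pos_eq by go. rewrite <- Rinv_1. go.
Qed.

Lemma fp2_dom al a b : 0 < al -> dom (fp2 al) a b.
Proof.
 intros Ha. apply (dom_le _ (fun v => v*fp1 al v)); [|apply dom_id_mult, fp1_dom; auto]. intros v. unfold fp2, fp1. rewrite !Rabs_mult, Rabs_Ropp. lra.
Qed.

Definition PP (al : R) (mu : C) : C := (Lap (fp1 al) mu+Ci*Lap (fp2 al) mu)%C.

Lemma Lap_Cdall phi s : RC phi -> (forall a b, dom phi a b) -> Cd (Lap phi) s (Lap (fun v => v*phi v) s).
Proof. intros H1 H2. apply (Lap_Cd _ (Re s-1) (Re s+1)); auto. lra. Qed.

(** Multiplying by 1 + i v restores the Gaussian, and a factor v under the integral is a derivative
    in [mu]. *)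
Lemma PP_ode al mu : 0 < al -> exists l, Cd (PP al) mu l /\ (Ci*l+PP al mu)%C = Gs al mu.
Proof.
 intros Ha. exists (Lap (fun v => (v*fp1 al v)%R) mu+Ci*Lap (fun v => (v*fp2 al v)%R) mu)%C.
 have D1 := fun a b => fp1_dom _ a b Ha. have D2 := fun a b => fp2_dom _ a b Ha. split.
 - apply Cd_plus; [apply Lap_Cdall; auto using RC_fp1|apply Cd_scal, Lap_Cdall; auto using RC_fp2].
 - have E1 := Lap_lin _ _ (Re mu-1) (Re mu+1) mu 1 (-1) (RC_fp1 _) (RC_mult _ _ RC_id (RC_fp2 _)) (D1 _ _) (dom_id_mult _ _ _ (D2 _ _)) $.
  have E2 := Lap_lin _ _ (Re mu-1) (Re mu+1) mu 1 1 (RC_fp2 _) (RC_mult _ _ RC_id (RC_fp1 _)) (D2 _ _) (dom_id_mult _ _ _ (D1 _ _)) $.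
  have E3 := Lap_lin _ _ (Re mu-1) (Re mu+1) mu 0 0 (RC_fp2 _) (RC_mult _ _ RC_id (RC_fp1 _)) (D2 _ _) (dom_id_mult _ _ _ (D1 _ _)) $.
  unfold Lap in E1 at 1. unfold Lap in E2 at 1. unfold Lap in E3 at 1.
  rewrite (Lap_ext _ (gauss al)) in E1. 2:{ intros v. unfold fp1, fp2. field. go. }
  rewrite (Lap_ext _ (fun v => 0*fp2 al v+0*(v*fp1 al v))) in E2. 2:{ intros v. unfold fp1, fp2. ring. }
  rewrite E3 in E2. fold (Lap (gauss al) mu) in E1. unfold Gs, PP. rewrite E1.
  set (a := Lap (fp1 al) mu) in *. set (b := Lap (fp2 al) mu) in *. set (c := Lap (fun v => (v*fp1 al v)%R) mu) in *. set (d := Lap (fun v => (v*fp2 al v)%R) mu) in *.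
  transitivity (Ci*(1*b+1*c)+a+RtoC (-1)*d)%C; [Cring|]. rewrite <- E2. Cring.
Qed.

Lemma pole_CL al rho xi : 0 < al -> is_CL (fun t => /((2, t)-1)*FG al rho xi (2, t))%C (Cexp (cst_of al rho xi 2)*PP al (mu_of al rho xi 2))%C.
Proof.
 intros Ha. set (mu := mu_of al rho xi 2). set (k := cst_of al rho xi 2).
 apply (is_CL_ext (fun t => Cexp k*(Lin (fp1 al) mu t+Ci*Lin (fp2 al) mu t))%C).
 - intros t. rewrite FG_line. unfold Lin, fp1, fp2. have P := one_sq_pos t.
  go.
 - have C1 := CC_Lin _ mu (RC_fp1 al). have C2 := CC_Lin _ mu (RC_fp2 al).
  apply is_CL_scal; [go|]. apply is_CL_plus; auto; [go| |apply is_CL_scal; auto].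
  + apply (Lap_CL _ (Re mu-1) (Re mu+1)); auto using RC_fp1, fp1_dom. lra.
  + apply (Lap_CL _ (Re mu-1) (Re mu+1)); auto using RC_fp2, fp2_dom. lra.
Qed.

Definition pm (al : R) (rho : C) (xi : R) : C := (Cexp (cst_of al rho xi 2)*PP al (mu_of al rho xi 2))%C.

Lemma CC_inv_line : CC (fun t => /((2, t)-1))%C.
Proof.
 apply (CC_Cdr _ (fun t => Ci*(- 1/(((2, t)-1)*((2, t)-1))))%C). intros t. apply (Cdr_plane_t (fun s => /(s-1))%C).
 eapply Cd_eq; [apply Cd_inv; [apply Cminus_neq0; intros E; apply (f_equal Re) in E; simpl in E; lra|go]|].
 go.
Qed.

Lemma pm_bound al rho xi : 0 < al -> Cmod (pm al rho xi) <= exp (al*(2-Re rho)^2+xi*(2-Re rho))*Kg al.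
Proof.
 intros Ha. apply (is_CL_Re_le _ _ _ _ (CC_mult _ _ CC_inv_line (CC_FG _ _ _ 2)) (RC_abs_FG _ _ _ 2) (pole_CL _ _ _ Ha) (FG_abs_RL _ _ _ 2 Ha)).
 intros t. rewrite Cmod_mult. rewrite <- (Rmult_1_l (Cmod (FG al rho xi (2, t)))) at 2. have Q := Cmod_inv_le ((2, t)-1)%C 1 $ ltac:(go). go.
Qed.

Lemma CC_gph al tau (c : R) : CC (fun u => RtoC (exp (c*u))*gph al tau u)%C.
Proof.
 split; simpl; apply RC_derive; intros; auto_derive; auto.
Qed.

(** The pole term has no closed form. Integrating the equation of [PP] over the frequencies from -L
    to la splits off the main term, a Gaussian integral, from a multiple of [pm] at -L, which
    [pm_bound] makes exponentially small. *)
Lemma pm_diff al rho la L : 0 < al ->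
 pm al rho la = (RtoC (exp ((la+L)*(1-Re rho)))*pm al rho (-L) +
  RtoC (Kg al*exp (la*(1-Re rho)))*CI (fun u => RtoC (exp ((Re rho-1)*u))*gph al (Im rho) u)%C (-L) la)%C.
Proof.
 intros Ha. set (s0 := Re rho). set (tau := Im rho). set (k0 := cst_of al rho 0 2).
 have Ek : forall u, cst_of al rho u 2 = (k0+RtoC (u*(2-s0)))%C by (intros u; unfold k0, cst_of; fold s0 tau; Cring).
 have EG : forall u, (Cexp k0*((exp u)*Gs al (mu_of al rho u 2)))%C = ((Kg al)*(RtoC (exp ((s0-1)*u))*gph al tau u))%C.
 { intros u. have H1 := line_gauss_CL _ rho u 2 Ha.
  have H2 : is_CL (fun t => FG al rho u (2, t)) (Cexp (cst_of al rho u 2)*Gs al (mu_of al rho u 2))%C.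
  { apply (is_CL_ext (fun t => Cexp (cst_of al rho u 2)*Lin (gauss al) (mu_of al rho u 2) t)%C); [intros; symmetry; apply FG_line|].
   apply is_CL_scal; [go|]. apply (Lap_CL _ (Re (mu_of al rho u 2)-1) (Re (mu_of al rho u 2)+1)); [go|apply gauss_dom; auto|lra]. }
  have E := is_CL_unique _ _ _ H1 H2. change (Cexp ((-(u^2/(4*al)))%R, (u*Im rho)%R)) with (gph al tau u) in E.
  rewrite Ek, Cexp_add, Cexp_RtoC in E. transitivity ((exp u)*RtoC (exp (-(u*(2-s0))))*(RtoC (exp (u*(2-s0)))*(Cexp k0*Gs al (mu_of al rho u 2))))%C.
  - transitivity ((RtoC (exp (-(u*(2-s0))))*RtoC (exp (u*(2-s0))))*(Cexp k0*((exp u)*Gs al (mu_of al rho u 2))))%C; [|Cring].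
   rewrite <- RtoC_mult, <- exp_plus. replace (-(u*(2-s0))+u*(2-s0)) with 0 by ring. rewrite exp_0. Cring.
  - replace (RtoC (exp (u*(2-s0)))*(Cexp k0*Gs al (mu_of al rho u 2)))%C with (Cexp k0*RtoC (exp (u*(2-s0)))*Gs al (mu_of al rho u 2))%C by Cring. rewrite <- E.
   rewrite <- RtoC_mult, <- exp_plus. replace (u+- (u*(2-s0))) with ((s0-1)*u) by ring. Cring. }
 have : CC (fun u => RtoC (exp ((s0-1)*u))*gph al tau u)%C by apply CC_gph.
 have FT := CI_FTC (fun u => Cexp k0*((exp u)*PP al (mu_of al rho u 2)))%C (fun u => (Kg al)*(RtoC (exp ((s0-1)*u))*gph al tau u))%C (-L) la.
 cbv beta in FT. rewrite CI_scal in FT by auto.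
 have FT' := FT ltac:(intros u; destruct (PP_ode _ (mu_of al rho u 2) Ha) as [l [D E]]; rewrite <- EG, <- E; eapply Cdr_eq;
  [apply Cdr_scal, Cdr_mult;
   [apply Cdr_RtoC, is_derive_exp|apply (Cd_Cdr _ _ u l Ci); [go|]]
  |Cring];
  unfold mu_of; split; [exact (is_derive_const _ _)|eapply is_derive_eq; [apply is_derive_Rplus; [exact (is_derive_const _ _)|exact (is_derive_id _)]|simpl; unfold zero, Hierarchy.one; simpl; ring]]) ltac:(go). unfold pm. rewrite !Ek, !Cexp_add, !Cexp_RtoC. rewrite RtoC_mult. rewrite (Cmult_comm ((Kg al))), <- (Cmult_assoc (RtoC (exp (la*(1-s0))))). rewrite FT'. replace (exp (-L*(2-s0))) with (exp (-L)*exp (-L*(1-s0))) by go.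
 replace (exp (la*(2-s0))) with (exp la*exp (la*(1-s0))) by go.
 replace (exp ((la+L)*(1-s0))) with (exp (la*(1-s0))*exp (L*(1-s0))) by go.
 have E1 : (RtoC (exp (L*(1-s0)))*RtoC (exp (-L*(1-s0))))%C = 1%C. { rewrite <- RtoC_mult, <- exp_plus. replace (L*(1-s0)+- L*(1-s0)) with 0 by ring. rewrite exp_0. go. }
 generalize (PP al (mu_of al rho (-L) 2)) (PP al (mu_of al rho la 2)). intros p q.
 transitivity (Cexp k0*((exp la)*RtoC (exp (la*(1-s0))))*q+RtoC (exp (la*(1-s0)))*Cexp k0*(exp (-L))*p*(RtoC (exp (L*(1-s0)))*RtoC (exp (-L*(1-s0)))-1))%C; [rewrite E1; Cring|Cring].
Qed.

(* At Re s = 2 the sum over primes may be integrated term by term. *)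
Lemma line2_value al rho xi l : 0 < al -> is_CL (fun t => EE (2, t)*FG al rho xi (2, t))%C l ->
 Cl (fun N => RtoC (Kg al)*csum (pv al rho xi) N)%C (pm al rho xi-l)%C.
Proof.
 intros Ha Hl. set (R0 := exp (al*(2-Re rho)^2+xi*(2-Re rho))*Kg al).
 have : 0 < R0 by go.
 intros eps He.
 destruct (np_lim (/4) (eps/(R0*24)) $ ltac:(go)) as [N0 HN0]. exists N0. intros N HN. specialize (HN0 N HN). apply Rle_div_r in HN0; [|lra].
 have : forall t, Cmod (csum (fun n => (vMn n)*ns (2, t) n)%C N-DS vMn (2, t))%C <= 24*np (/4) N.
 { intros t. apply Cl_tail.
  - apply (DS_Cl _ (/(/4)) (/4)); [intros; apply vMn_bd; lra|go].
  - intros n Hn. replace n with (N+(n-N))%nat by lia. ub ((csum_diff_abs _ (fun k => 4*np (2-/4) k))).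
   + intros k. have Q := DS_term _ _ _ (2, t) k (fun n => vMn_bd (/4) n $). simpl (Re (2, t)) in Q. go.
   + rewrite !rsum_scal. have Q := np_tail (2-/4) (/4) N (n-N) $ $. have P := np_pos (/4) N. lra. }
 have C1 := CC_mult _ _ CC_inv_line (CC_FG al rho xi 2).
 have C2 : CC (fun t => csum (fun n => (vMn n)*ns (2, t) n)%C N*FG al rho xi (2, t))%C.
 { apply CC_mult; [|go]. apply CC_csum. split; simpl; apply RC_derive; intros; auto_derive; auto. }
 (* Continuity of the Dirichlet series along this line is read off from [EE_right], all other terms
    there being regular. *)
 have : CC (fun t => DS vMn (2, t)).
 { apply (CC_ext (fun t => /((2, t)-1)-EE (2, t))%C).
  - intros t. rewrite EE_right by go. go.
  - apply CC_minus; [apply CC_inv_line|]. have H : forall f, (forall s, 1 < Re s -> Ccont f s) -> CC (fun t => f (2, t)) by (intros f Hf; apply (JC_CC (fun r t => f (r, t)) 2), JC_plane; intros t; apply Hf; simpl; lra).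
   apply CC_minus; [apply CC_plus; [|go]|].
   + apply (H (fun s => X1 s/X s)%C). intros s Hs. eapply Cd_Ccont, Cd_div; [apply X_neq0_gt1; auto|go|go].
   + apply (H (fun s => LG (s+2))%C). intros s Hs. apply Ccont_shift_plus. eapply Cd_Ccont, Cd_div; [apply Gam_neq0|apply Gam1_Cd2|apply Gam_Cd]; simpl; unfold Re in *; lra. }
 have CE' : CC (fun t => EE (2, t)*FG al rho xi (2, t))%C.
 { apply CC_mult; [|go]. apply (CC_ext (fun t => /((2, t)-1)-DS vMn (2, t))%C); [intros t; rewrite EE_right by go; reflexivity|]. apply CC_minus; [apply CC_inv_line|auto]. }
 have K := is_CL_minus _ _ _ _ (CC_plus _ _ C2 CE') C1 (is_CL_plus _ _ _ _ C2 CE' (partial_CL _ _ _ 2 N Ha) Hl) (pole_CL _ _ _ Ha).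
 replace ((Kg al)*csum (pv al rho xi) N-(pm al rho xi-l))%C with ((Kg al)*csum (pv al rho xi) N+l-pm al rho xi)%C by go.
 have KR := is_RL_scal (24*np (/4) N) _ _ (RC_abs_FG _ _ _ 2) (FG_abs_RL _ rho xi 2 Ha).
 have F := is_CL_Re_le _ _ _ _ (CC_minus _ _ (CC_plus _ _ C2 CE') C1) (RC_mult _ _ (RC_const _) (RC_abs_FG _ _ _ 2)) K KR. cbv beta in F.
 le_tr; [apply F|change (24*np (/4) N*R0 <= eps); lra].
 intros t. rewrite EE_right by go. set (a := csum (fun n => (vMn n)*ns (2, t) n)%C N) in *. set (d := DS vMn (2, t)) in *. set (g := FG al rho xi (2, t)).
 replace (a*g+(/((2, t)-1)-d)*g-/((2, t)-1)*g)%C with ((a-d)*g)%C by go.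
 rewrite Cmod_mult. go.
Qed.

#[export] Hint Resolve CC_csum one_sq_pos CC_inv_line CC_gph : cont.

(** * Positivity against nonnegative kernels *)

Lemma FG_central al rho xi t : FG al rho xi (Re rho, t) = (RtoC (gauss al (t-Im rho))*(cos (xi*t), sin (xi*t)))%C.
Proof.
 unfold FG, gauss. replace (al*(((Re rho, t)-rho)*((Re rho, t)-rho))+xi*((Re rho, t)-(Re rho)))%C with ((-al*(t-Im rho)^2)%R, (xi*t)%R).
 - go.
 - unfold Re, Im. go.
Qed.

Lemma Lap_vgauss al mu : 0 < al -> Lap (fun v => v*gauss al v) mu = (mu/RtoC (2*al)*Gs al mu)%C.
Proof. intros Ha. apply (Cd_unique (Gs al) mu); [apply Lap_Cdall; [go|intros; apply gauss_dom; auto]|apply Gs_Cd; auto]. Qed.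

Lemma Lap_vvgauss al mu : 0 < al -> Lap (fun v => v*(v*gauss al v)) mu = ((RtoC (/(2*al))+mu/RtoC (2*al)*(mu/RtoC (2*al)))*Gs al mu)%C.
Proof.
 intros Ha. apply (Cd_unique (fun mu => Lap (fun v => v*gauss al v) mu) mu).
 - apply Lap_Cdall; [go|intros; apply dom_id_mult, gauss_dom; auto].
 - apply (Cd_ext (fun mu => mu/RtoC (2*al)*Gs al mu)%C); [intros; symmetry; apply Lap_vgauss; auto|].
  eapply Cd_eq; [apply Cd_mult; [|apply Gs_Cd; auto]|].
  + apply (Cd_ext (fun mu => /RtoC (2*al)*mu)%C); [intros; unfold Cdiv; apply Cmult_comm|]. go.
  + go.
Qed.

Lemma CC_t2FG al rho xi x : CC (fun t => RtoC (t^2)*FG al rho xi (x, t))%C.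
Proof. apply CC_mult; [apply CC_RtoC, RC_derive; intros; auto_derive; auto|go]. Qed.

(** The second moment is needed because [positivity] replaces the logarithmic density by a tangent
    line in t^2. *)
Lemma line_t2_CL al rho xi : 0 < al -> is_CL (fun t => RtoC (t^2)*FG al rho xi (Re rho, t))%C
 (RtoC (Kg al)*gph al (Im rho) xi*(RtoC (/(2*al))+(Im rho, (xi/(2*al))%R)*(Im rho, (xi/(2*al))%R)))%C.
Proof.
 intros Ha. set (mu := mu_of al rho xi (Re rho)). set (k := cst_of al rho xi (Re rho)).
 have H1 := line_gauss_CL _ rho xi (Re rho) Ha.
 have H2 : is_CL (fun t => FG al rho xi (Re rho, t)) (Cexp k*Gs al mu)%C.
 { apply (is_CL_ext (fun t => Cexp k*Lin (gauss al) mu t)%C); [intros; symmetry; apply FG_line|].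
  apply is_CL_scal; [go|]. apply (Lap_CL _ (Re mu-1) (Re mu+1)); [go|apply gauss_dom; auto|lra]. }
 have E := is_CL_unique _ _ _ H1 H2. change (Cexp ((-(xi^2/(4*al)))%R, (xi*Im rho)%R)) with (gph al (Im rho) xi) in E. rewrite E.
 apply (is_CL_ext (fun t => Cexp k*Lin (fun v => (v*(v*gauss al v))%R) mu t)%C).
 - intros t. rewrite FG_line. go.
 - replace (Cexp k*Gs al mu*(RtoC (/(2*al))+(Im rho, (xi/(2*al))%R)*(Im rho, (xi/(2*al))%R)))%C with (Cexp k*Lap (fun v => (v*(v*gauss al v))%R) mu)%C.
  + have : RC (fun v => v*(v*gauss al v)) by go.
   apply is_CL_scal; [go|]. apply (Lap_CL _ (Re mu-1) (Re mu+1)); [auto|apply dom_id_mult, dom_id_mult, gauss_dom; auto|lra].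
  + rewrite Lap_vvgauss by auto. replace (mu/RtoC (2*al))%C with ((Im rho, (xi/(2*al))%R)).
   * go.
   * go.
Qed.

Lemma CC_EE_line (RH : RiemannHypothesis) x : /2 < x -> CC (fun t => EE (x, t)).
Proof. intros Hx. apply (CC_Cdr _ (fun t => Ci*EE1 (x, t))%C). intros t. apply Cdr_plane_t, EE_Cd; auto. Qed.

(** [h_nonneg] discards X1/X, and what remains is the digamma bound at s + 2; for x <= 1 its
    argument is at most 1 + t^2/4 + 1/4. *)
Lemma EE_lower (RH : RiemannHypothesis) x t : /2 < x <= 1 -> ln PI/2-/4*ln ((t^2+5)/4) <= Re (EE (x, t)).
Proof.
 intros Hx. have H1 := h_nonneg RH (x, t) ltac:(go). have H2 := LG_Re_le ((x, t)+2)%C ltac:(go).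
 replace (Re ((x, t)+2)%C) with (x+2) in H2 by reflexivity. replace (Im ((x, t)+2)%C) with t in H2 by go.
 have : ln (((x+2)/2-1/2)^2+(t/2)^2+1/4) <= ln ((t^2+5)/4).
 { go. }
 unfold EE. change (Re (X1 (x, t)/X (x, t)+RtoC (ln PI/2)-LG ((x, t)+2))%C) with (Re (X1 (x, t)/X (x, t))%C+ln PI/2+- Re (LG ((x, t)+2)%C)). lra.
Qed.

(** The mean of t^2 + 5 under the Gaussian centred at tau with variance 1/(2 al). [dens] is the
    negative of the bound in [EE_lower] with t^2 + 5 replaced by this mean. *)
Definition T2 (al tau : R) : R := tau^2+/(2*al)+5.
Definition dens (al tau : R) : R := /4*ln (T2 al tau/(4*PI^2)).

Lemma T2_pos al tau : 0 < al -> 5 < T2 al tau.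
Proof. intros Ha. unfold T2. assert (0 < /(2*al)) by go. go. Qed.

Lemma Cmod_gph al tau u : Cmod (gph al tau u) = exp (-(u^2/(4*al))).
Proof. unfold gph. rewrite Cmod_Cexp. go. Qed.

(** Concavity of the logarithm: ln(t^2 + 5) lies below its tangent at the mean [T2], and the
    Gaussian average of the tangent is its value at the mean. Hence the nonnegative kernel with
    factor 1 - kap cos(la t) yields exactly [dens], up to the oscillating part, which carries
    e^(-la^2/(4 al)). *)
Lemma positivity (RH : RiemannHypothesis) al rho la kap l0 ll lm : 0 < al -> /2 < Re rho <= 1 -> kap = 1 \/ kap = -1 ->
 is_CL (fun t => EE (Re rho, t)*FG al rho 0 (Re rho, t))%C l0 ->
 is_CL (fun t => EE (Re rho, t)*FG al rho la (Re rho, t))%C ll ->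
 is_CL (fun t => EE (Re rho, t)*FG al rho (-la) (Re rho, t))%C lm ->
 0 <= Re l0-kap/2*(Re ll+Re lm)+Kg al*dens al (Im rho) +
    Kg al*exp (-(la^2/(4*al)))*(Rabs (dens al (Im rho))+/2+la^2/(8*al)).
Proof.
 intros Ha Hs Hk H0 Hl Hm. set (s0 := Re rho) in *. set (tau := Im rho). set (D := dens al tau). set (T := T2 al tau). have : 5 < T by (apply T2_pos; auto).
 (* A + B t^2 = D + ((t^2 + 5)/T - 1)/4 is the tangent line. *)
 set (A := D-/4+5/(4*T)). set (B := /(4*T)). have : 0 < B by go.
 set (w := fun t => gauss al (t-tau)*(1-kap*cos (la*t))).
 have : forall t, 0 <= w t. { intros t. apply Rmult_le_pos; [left; apply exp_pos|]. generalize (COS_bound (la*t)). go. }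
 set (comb := fun (a b c : C) => (a+RtoC (-kap/2)*(b+c))%C).
 have Ew : forall t, comb (FG al rho 0 (s0, t)) (FG al rho la (s0, t)) (FG al rho (-la) (s0, t)) = (w t).
 { intros t. unfold comb, s0. rewrite !FG_central. fold tau. unfold w. rewrite Rmult_0_l, cos_0, sin_0. replace (-la*t) with (-(la*t)) by ring. rewrite cos_neg, sin_neg. go. }
 have CE := CC_EE_line RH _ (proj1 Hs).
 have C3 : forall (u : R -> R) (f g h : R -> C) a b c, CC f -> CC g -> CC h -> is_CL f a -> is_CL g b -> is_CL h c -> is_CL (fun t => comb (f t) (g t) (h t)) (comb a b c) /\ CC (fun t => comb (f t) (g t) (h t)).
 { intros u f g h a b c F1 F2 F3 I1 I2 I3. unfold comb. split; [apply is_CL_plus; auto; [go|apply is_CL_scal; [go|apply is_CL_plus; auto]]|go]. }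
 have CG := fun xi => CC_FG al rho xi s0. have CT := fun xi => CC_t2FG al rho xi s0.
 have CEF : forall xi, CC (fun t => EE (s0, t)*FG al rho xi (s0, t))%C by go.
 destruct (C3 (fun _ => 0) _ _ _ _ _ _ (CEF 0) (CEF la) (CEF (-la)) H0 Hl Hm) as [J1 J2].
 destruct (C3 (fun _ => 0) _ _ _ _ _ _ (CG 0) (CG la) (CG (-la)) (line_gauss_CL _ _ 0 _ Ha) (line_gauss_CL _ _ _ _ Ha) (line_gauss_CL _ _ _ _ Ha)) as [G1 G2].
 destruct (C3 (fun _ => 0) _ _ _ _ _ _ (CT 0) (CT la) (CT (-la)) (line_t2_CL _ _ 0 Ha) (line_t2_CL al _ la Ha) (line_t2_CL al _ _ Ha)) as [Q1 Q2].
 set (K := Kg al) in *. have HK : 0 < K by go.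
 set (v1 := comb (RtoC K*Cexp ((-(0^2/(4*al)))%R, (0*Im rho)%R))%C (RtoC K*Cexp ((-(la^2/(4*al)))%R, (la*Im rho)%R))%C (RtoC K*Cexp ((-((-la)^2/(4*al)))%R, (-la*Im rho)%R))%C) in *.
 set (z := fun xi => (RtoC (/(2*al))+(tau, (xi/(2*al))%R)*(tau, (xi/(2*al))%R))%C).
 set (v2 := comb (RtoC K*gph al (Im rho) 0*(RtoC (/(2*al))+(Im rho, (0/(2*al))%R)*(Im rho, (0/(2*al))%R)))%C (RtoC K*gph al (Im rho) la*(RtoC (/(2*al))+(Im rho, (la/(2*al))%R)*(Im rho, (la/(2*al))%R)))%C (RtoC K*gph al (Im rho) (-la)*(RtoC (/(2*al))+(Im rho, (-la/(2*al))%R)*(Im rho, (-la/(2*al))%R)))%C) in *.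
 have S := is_CL_plus _ _ _ _ J2 (CC_plus _ _ (CC_scalr (RtoC A) _ G2) (CC_scalr (RtoC B) _ Q2)) J1 (is_CL_plus _ _ _ _ (CC_scalr (RtoC A) _ G2) (CC_scalr (RtoC B) _ Q2) (is_CL_scal (RtoC A) _ _ G2 G1) (is_CL_scal (RtoC B) _ _ Q2 Q1)).
 have CS := CC_plus _ _ J2 (CC_plus _ _ (CC_scalr (RtoC A) _ G2) (CC_scalr (RtoC B) _ Q2)).
 have P := is_CL_Re_ge0 _ _ (proj1 CS) (is_RL_Re _ _ CS S).
 have Hpos : 0 <= Re (comb l0 ll lm+(RtoC A*v1+RtoC B*v2))%C.
 { apply P. intros t.
  replace (comb (EE (s0, t)*FG al rho 0 (s0, t)) (EE (s0, t)*FG al rho la (s0, t)) (EE (s0, t)*FG al rho (-la) (s0, t))+(RtoC A*comb (FG al rho 0 (s0, t)) (FG al rho la (s0, t)) (FG al rho (-la) (s0, t))+RtoC B*comb (RtoC (t^2)*FG al rho 0 (s0, t)) (RtoC (t^2)*FG al rho la (s0, t)) (RtoC (t^2)*FG al rho (-la) (s0, t))))%C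
   with ((EE (s0, t)+RtoC (A+B*t^2))*comb (FG al rho 0 (s0, t)) (FG al rho la (s0, t)) (FG al rho (-la) (s0, t)))%C.
  2:{ rewrite RtoC_plus, RtoC_mult. unfold comb. go. }
  rewrite Ew. replace (Re ((EE (s0, t)+RtoC (A+B*t^2))*RtoC (w t))%C) with ((Re (EE (s0, t))+(A+B*t^2))*w t) by go.
  apply Rmult_le_pos; auto. have L := EE_lower RH s0 t Hs. have t2 := pow2_ge_0 t.
  have L2 : ln (t^2+5) <= ln T+(t^2+5)/T-1. { have Q := ln_le_m1 ((t^2+5)/T) ltac:(go). rewrite ln_div in Q by lra. lra. }
  have ED : D = /4*(ln T-(ln 4+2*ln PI)). { unfold D, dens. fold T. have Hpi := PI_RGT_0. rewrite ln_div, ln_mult by nra. replace (PI^2) with (PI*PI) by ring. rewrite ln_mult by auto. ring. }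
  rewrite ln_div in L by lra. have EB : B*t^2+5/(4*T) = /4*((t^2+5)/T) by go. go. }
 set (e := exp (-(la^2/(4*al)))) in *. (* The xi = 0 parts combine to K D exactly; the others carry the tiny factor e. *)
 set (Y := (RtoC A*gph al tau la+RtoC B*gph al tau la*z la+(RtoC A*gph al tau (-la)%R+RtoC B*gph al tau (-la)%R*z (-la)%R))%C).
 have EY : Re (comb l0 ll lm+(RtoC A*v1+RtoC B*v2))%C = Re l0-kap/2*(Re ll+Re lm)+K*D-kap/2*(K*Re Y).
 { have EV : (RtoC A*v1+RtoC B*v2)%C = (RtoC (K*D)+RtoC (-kap/2*K)*Y)%C.
  { unfold v1, v2, Y. fold tau. have G0 : gph al tau 0 = 1%C. { unfold gph. replace (-(0^2/(4*al)), 0*tau) with (RtoC 0) by go. apply Cexp_0. }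
   change (Cexp ((-(0^2/(4*al)))%R, (0*tau)%R)) with (gph al tau 0). rewrite G0.
   have E0 : D = A+B*(/(2*al)+tau^2). { have ET : T = tau^2+/(2*al)+5 by reflexivity. replace (/(2*al)+tau^2) with (T-5) by lra. go. }
   rewrite E0. go. }
  rewrite EV. go. }
 have Hz : forall xi, xi^2 = la^2 -> Cmod (z xi) <= /(2*al)+tau^2+la^2/(4*al^2).
 { intros xi Hxi. unfold z. have Pa : 0 < /(2*al) by go. le_tr; [go|]. rewrite Cmod_R, Rabs_pos_eq, Cmod_mult by lra.
  replace (Cmod (tau, (xi/(2*al))%R)*Cmod (tau, (xi/(2*al))%R)) with (Cmod (tau, (xi/(2*al))%R)^2) by ring. rewrite Cmod_sq. simpl (Re _). simpl (Im _). right.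
  replace ((xi/(2*al))^2) with (xi^2/(4*al^2)) by go. rewrite Hxi. ring. }
 have HAB : Rabs A+B*(/(2*al)+tau^2+la^2/(4*al^2)) <= Rabs D+/2+la^2/(8*al).
 { have ET : T = tau^2+/(2*al)+5 by reflexivity. have HA : Rabs A <= Rabs D+/4. { unfold A. have Q : 0 <= 5/(4*T) <= /4. { split; [go|]. apply (proj2 (Rle_div_l _ _ (4*T) $)). lra. } replace (D-/4+5/(4*T)) with (D+(- /4+5/(4*T))) by ring. ub Rabs_triang. apply Rplus_le_compat_l. go. }
  have HB1 : B*(/(2*al)+tau^2) <= /4. { rewrite Rmult_comm. apply (proj2 (Rle_div_l _ _ (4*T) $)). lra. }
  have HB2 : B*(la^2/(4*al^2)) <= la^2/(8*al).
  { replace (la^2/(8*al)) with (al/2*(la^2/(4*al^2))) by go. replace (al/2) with (/(4*/(2*al))) by go. go. }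
  go. }
 have HY : Rabs (Re Y) <= 2*e*(Rabs D+/2+la^2/(8*al)).
 { ub re_le_Cmod. unfold Y.
  have HYx : forall xi, xi^2 = la^2 -> Cmod (RtoC A*gph al tau xi+RtoC B*gph al tau xi*z xi)%C <= e*(Rabs D+/2+la^2/(8*al)).
  { intros xi Hxi. le_tr; [go|]. rewrite !Cmod_mult, !Cmod_R, Cmod_gph, Hxi, (Rabs_pos_eq B) by lra. fold e. apply Rle_trans with (e*(Rabs A+B*(/(2*al)+tau^2+la^2/(4*al^2)))); [|go].
   assert (B*e*Cmod (z xi) <= B*e*(/(2*al)+tau^2+la^2/(4*al^2))) by (mul_l; [go|auto]). lra. }
  have H1 := HYx la eq_refl. have H2 := HYx (-la) ltac:(ring). le_tr; [go|]. lra. }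
 apply Rabs_le_between in HY. go.
Qed.

#[export] Hint Resolve CC_EE_line : cont.

(** * The explicit inequality *)

Lemma RInt_le_RL g K a b : RC g -> (forall t, 0 <= g t) -> is_RL g K -> a <= b -> RInt g a b <= K.
Proof.
 intros Cg Hg HK Hab. apply le_epsilon. intros e He. destruct (is_RL_RInt _ _ HK e He) as [N HN].
 set (T := Rmax N (Rmax (-a) b)). have T1 := Rmax_l N (Rmax (-a) b). have T2 := Rmax_r N (Rmax (-a) b). have T3 := Rmax_l (-a) b. have T4 := Rmax_r (-a) b. fold T in T1, T2.
 specialize (HN T T T1 T1). apply Rabs_le_between in HN.
 have : RInt g (-T) T = RInt g (-T) a+(RInt g a b+RInt g b T).
 { rewrite <- (RInt_Chasles g _ a T) by go. rewrite <- (RInt_Chasles g a b T) by go. go. }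
 have : 0 <= RInt g (-T) a by (apply RInt_ge_0; [lra|go|go]).
 have : 0 <= RInt g b T by (apply RInt_ge_0; [lra|go|go]). lra.
Qed.

Lemma ln2_half : /2 <= ln 2.
Proof. have Q := ln_ge_1m 2 $. lra. Qed.

(** For xi <= 0 the Gaussian in xi - ln n is at most e^(-(ln n)^2/(4 al)), and ln n >= 1/2 turns
    this into the power n^(-1/(8 al)). *)
Lemma pv_small al rho xi n : 0 < al -> /2 <= Re rho -> xi <= 0 -> Cmod (pv al rho xi (S n)) <= np (/(8*al)-/2) (S n).
Proof.
 intros Ha Hs Hx. unfold pv. rewrite Cmod_mult, Cmod_gph, Cmod_R, Rabs_pos_eq by (apply Rmult_le_pos; [apply vM_nonneg|go]).
 set (L := ln (INR (S (S n)))). have : /2 <= L. { ub ln2_half. change 2 with (INR 2). go. }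
 have : vMn (S n) <= np (-(1)) (S n). { le_tr; [apply vM_le_ln; lia|]. have Q := ln_np 1 (S n) $. go. }
 have : np (Re rho) (S n) <= np (/2) (S n). { apply exp_le. go. }
 have : exp (-((xi-L)^2/(4*al))) <= np (/(8*al)) (S n).
 { unfold np. fold L. apply exp_le. apply Ropp_le_contravar. apply (proj1 (Rle_div_r _ _ (4*al) $)). replace (/(8*al)*L*(4*al)) with (L/2) by go. nra. }
 replace (/(8*al)-/2) with (-(1)+/2+/(8*al)) by go. rewrite <- !np_add.
 have : 0 <= vMn (S n) by apply vM_nonneg. go.
Qed.

Lemma pv_sum_small al rho xi S0 : 0 < al <= /64 -> /2 <= Re rho -> xi <= 0 -> Cl (csum (pv al rho xi)) S0 -> Cmod S0 <= 16*al.
Proof.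
 intros Ha Hs Hx HS. set (q := /(8*al)-/2). have Hq : 1 < q. { unfold q. assert (8 <= /(8*al)). { replace 8 with (/(/8)) at 1 by field. go. } lra. }
 apply (Cl_bound _ _ _ 1%nat HS). intros n Hn. replace n with (1+(n-1))%nat by lia.
 have E0 : pv al rho xi 0 = 0%C by (unfold pv; rewrite vMn_0, Rmult_0_l; Cring).
 replace (csum (pv al rho xi) (1+(n-1))) with (csum (pv al rho xi) (1+(n-1))-csum (pv al rho xi) 1)%C by (cbn [csum]; rewrite E0; Cring).
 ub ((csum_diff_abs _ (fun k => np q k))).
 - intros [|k]; [rewrite E0, Cmod_0; left; apply np_pos|]. apply pv_small; lra.
 - have Q := np_sum q (1+(n-1)) Hq. replace (rsum (fun k => np q k) 1) with 1. 2:{ cbn [rsum]. unfold np. replace (INR 1) with 1 by reflexivity. rewrite ln_1, Rmult_0_r, Ropp_0, exp_0. ring. }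
  assert (/(q-1) <= 16*al); [|change (rsum (fun k => np q k) (1+(n-1))) with (rsum (np q) (1+(n-1))); lra].
  replace (16*al) with (/(/(16*al))) by go. apply Rinv_le_contravar; [go|]. unfold q in *. replace (/(8*al)) with (2*/(16*al)) in * by go. assert (4 <= /(16*al)). { replace 4 with (/(/4)) at 1 by field. go. } lra.
Qed.

(** The first term is the pole at frequency 0. 24 al adds the prime sum at frequency 0 and half of
    the one at -la. 4 e^(-la/2) collects the remainders [pm] at -la, and the last term comes from
    [positivity]. *)
Definition errE (al la tau : R) : R :=
 2*Kg (/(8*al))+24*al+4*exp (-la/2)+exp (-(la^2/(4*al)))*(Rabs (dens al tau)+/2+la^2/(8*al)).

Lemma exp_le_2 y : y <= /2 -> exp y <= 2.
Proof. have Q := exp_ineq1_le (-y). rewrite exp_Ropp in Q. have P := exp_pos y. replace (exp y) with (/ /exp y) by go. replace 2 with (/(/2)) by field. go. Qed.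

Lemma CI_gph_half al rho la : 0 < al <= /64 -> /2 <= Re rho <= 1 -> 0 <= la ->
 Cmod (CI (fun u => RtoC (exp ((Re rho-1)*u))*gph al (Im rho) u)%C (-la) 0) <= 2*Kg (/(8*al)).
Proof.
 intros Ha Hs Hl. have : 0 < /(8*al) by go.
 le_tr; [apply (CI_bound _ (fun u => 2*gauss (/(8*al)) u)); [lra|go|go|]|].
 - intros u Hu. rewrite Cmod_mult, Cmod_gph, Cmod_R, Rabs_pos_eq by go. rewrite <- exp_plus.
  apply Rle_trans with (exp (al/2)*gauss (/(8*al)) u); [|mul_r; [left; apply exp_pos|apply exp_le_2; lra]].
  unfold gauss. rewrite <- exp_plus. apply exp_le. replace (u^2/(4*al)) with (2*(u^2/(8*al))) by go. have S2 : 0 <= (u/(2*al)+1)^2*(al/2) by go.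
  replace ((u/(2*al)+1)^2*(al/2)) with (u^2/(8*al)+u/2+al/2) in S2 by go.
  go.
 - rewrite RInt_Rscal by apply RC_gauss. mul_l; [lra|]. apply RInt_le_RL; [go|intros; left; apply exp_pos|apply gauss_RL; auto|lra].
Qed.

Lemma Cl_div_K K u v : 0 < K -> Cl (fun N => RtoC K*u N)%C v -> Cl u (v/RtoC K)%C.
Proof.
 intros HK H. have : RtoC K <> 0%C by go. apply (Cl_ext (fun n => /K*(K*u n))%C); [intros n; field; auto|].
 replace (v/K)%C with (/K*v)%C by go. apply Cl_scal. go.
Qed.

(** [positivity] with its three line integrals moved to Re s = 2. Only the frequency la meets the
    pole and the primes in earnest; 0 and -la go into [errE]. The two values of kap give both signs
    of the inequality. *)
Lemma explicit_ineq (RH : RiemannHypothesis) al s0 tau la kap : 0 < al <= /64 -> 0 <= la -> /2 < s0 <= 1 -> kap = 1 \/ kap = -1 ->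
 exists S0, Cl (csum (pv al (s0, tau) la)) S0 /\
 kap/2*(exp (la*(1-s0))*Re (CI (fun u => RtoC (exp ((s0-1)*u))*gph al tau u)%C (-la) la)-Re S0) <= dens al tau+errE al la tau.
Proof.
 intros Ha Hl Hs Hk. set (rho := (s0, tau) : C). have Ha0 : 0 < al by lra.
 destruct (line_integral_shift RH _ rho 0 Ha0 ltac:(go)) as [l0 [A1 A2]].
 destruct (line_integral_shift RH _ rho la Ha0 ltac:(go)) as [ll [B1 B2]].
 destruct (line_integral_shift RH _ rho (-la) Ha0 ltac:(go)) as [lm [C1 C2]].
 have P := positivity RH _ rho _ _ _ _ _ Ha0 ltac:(go) Hk A1 B1 C1.
 set (K := Kg al) in *. have HK : 0 < K by go.
 have V0 := Cl_div_K K _ _ HK (line2_value _ _ 0 _ Ha0 A2). have V1 := Cl_div_K K _ _ HK (line2_value _ _ _ _ Ha0 B2). have V2 := Cl_div_K K _ _ HK (line2_value _ _ _ _ Ha0 C2).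
 set (S0 := ((pm al rho 0-l0)/K)%C) in *. set (S1 := ((pm al rho la-ll)/K)%C) in *. set (S2 := ((pm al rho (-la)-lm)/K)%C) in *.
 have E0 : l0 = (pm al rho 0-K*S0)%C by go.
 have E1 : ll = (pm al rho la-K*S1)%C by go.
 have E2 : lm = (pm al rho (-la)-K*S2)%C by go.
 exists S1. split; [go|].
 have Q0 := pv_sum_small _ rho 0 _ Ha ltac:(go) $ V0. have Q2 := pv_sum_small _ rho (-la) _ Ha ltac:(go) $ V2.
 have D1 := pm_diff _ rho la la Ha0. have D0 := pm_diff _ rho 0 la Ha0. fold K in D1, D0.
 have BM := pm_bound _ rho (-la) Ha0. simpl (Re rho) in BM. set (pmm := pm al rho (-la)) in *. set (EX := exp (al*(2-s0)^2+- la*(2-s0))) in *.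
 have BX : forall y, y <= la*(2-s0)-la/2 -> exp y*EX <= 2*exp (-la/2).
 { intros y Hy. unfold EX. rewrite <- exp_plus. apply Rle_trans with (exp (/2)*exp (-la/2)); [rewrite <- exp_plus; apply exp_le; nra|]. mul_r; [go|apply exp_le_2; lra]. }
 have : Cmod (RtoC (exp ((la+la)*(1-s0)))*pmm)%C <= K*(2*exp (-la/2)).
 { rewrite Cmod_mult, Cmod_R, Rabs_pos_eq by go. have B := BX ((la+la)*(1-s0)) ltac:(nra).
  apply Rle_trans with (exp ((la+la)*(1-s0))*(EX*K)); [mul_l; [go|auto]|]. go. }
 have : Cmod pmm <= K*(2*exp (-la/2)).
 { have B := BX 0 ltac:(nra). rewrite exp_0 in B. go. }
 have : Cmod (pm al rho 0) <= K*(2*exp (-la/2))+K*(2*Kg (/(8*al))).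
 { rewrite D0. le_tr; [go|]. apply Rplus_le_compat.
  - rewrite Cmod_mult, Cmod_R, Rabs_pos_eq by go. have B := BX ((0+la)*(1-s0)) ltac:(nra).
   apply Rle_trans with (exp ((0+la)*(1-s0))*(EX*K)); [mul_l; [go|auto]|]. go.
  - rewrite Rmult_0_l, exp_0, Rmult_1_r, Cmod_mult, Cmod_R, Rabs_pos_eq by lra. mul_l; [lra|]. apply CI_gph_half; simpl; lra. }
 set (CIv := CI (fun u => RtoC (exp ((s0-1)*u))*gph al tau u)%C (-la) la) in *.
 have G1 : Rabs (Re ll-K*(exp (la*(1-s0))*Re CIv-Re S1)) <= K*(2*exp (-la/2)).
 { replace (Re ll-K*(exp (la*(1-s0))*Re CIv-Re S1)) with (Re (RtoC (exp ((la+la)*(1-s0)))*pmm)%C).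
  - le_tr; [apply re_le_Cmod|go].
  - rewrite E1, D1. go. }
 have : Re l0 <= K*(2*exp (-la/2))+K*(2*Kg (/(8*al)))+K*(16*al).
 { ub Re_le_Cmod. rewrite E0. ub Cmod_triangle. rewrite Cmod_opp, Cmod_mult, Cmod_R, Rabs_pos_eq by lra. go. }
 have G2 : Rabs (Re lm) <= K*(2*exp (-la/2))+K*(16*al).
 { ub re_le_Cmod. rewrite E2. ub Cmod_triangle. rewrite Cmod_opp, Cmod_mult, Cmod_R, Rabs_pos_eq by lra. go. }
 simpl (Im rho) in P. apply Rabs_le_between in G1. apply Rabs_le_between in G2.
 unfold errE.
 go.
Qed.

(** * Averaging over heights *)

Definition gw (al : R) (c tau : nat -> R) (m : nat) (u : R) : R := exp (-(u^2/(4*al)))*rsum (fun j => c j*cos (tau j*u)) m.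

Lemma Cl_lim_Re u l : Cl u l -> is_lim_seq (fun n => Re (u n)) (Re l).
Proof.
 intros H. apply is_lim_seq_spec. intros eps. destruct (H (eps/2) ltac:(generalize (cond_pos eps); lra)) as [N HN]. exists N. intros n Hn.
 specialize (HN n Hn). have Q := re_le_Cmod (u n-l)%C. change (Re (u n-l)%C) with (Re (u n)-Re l) in Q. generalize (cond_pos eps). lra.
Qed.

Lemma Re_pv al s0 tau la n : Re (pv al (s0, tau) la n) = vMn n*np s0 n*(exp (-((la-ln (INR (S n)))^2/(4*al)))*cos (tau*(la-ln (INR (S n))))).
Proof.
 unfold pv. change (Re (s0, tau)) with s0. generalize (ln (INR (S n))) (vMn n) (np s0 n). intros L v w. rewrite (Rmult_comm tau). go.
Qed.

Definition mainI (al s0 tau la : R) : R := Re (CI (fun u => RtoC (exp ((s0-1)*u))*gph al tau u)%C (-la) la).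

(** The prime sums at the different heights combine into one sum with weight [gw]. Discarding the
    negative part of the weight leaves a sum that an upper-bound sieve can handle. *)
Lemma weighted_ineq (RH : RiemannHypothesis) al s0 la (c tau : nat -> R) m B : 0 < al <= /64 -> 0 <= la -> /2 < s0 <= 1 ->
 (forall N, rsum (fun n => vMn n*np (/2) n*Rmax 0 (gw al c tau m (la-ln (INR (S n))))) N <= B) ->
 /2*(exp (la*(1-s0))*rsum (fun j => c j*mainI al s0 (tau j) la) m-B) <= rsum (fun j => Rabs (c j)*(dens al (tau j)+errE al la (tau j))) m.
Proof.
 intros Ha Hl Hs HB.
 assert (H : exists S0, is_lim_seq (fun N => rsum (fun n => vMn n*np s0 n*gw al c tau m (la-ln (INR (S n)))) N) (Finite S0) /\
  /2*(exp (la*(1-s0))*rsum (fun j => c j*mainI al s0 (tau j) la) m-S0) <= rsum (fun j => Rabs (c j)*(dens al (tau j)+errE al la (tau j))) m).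
 { clear HB. induction m as [|m [S0 [L0 I0]]].
  - exists 0. split; [|go]. apply (is_lim_seq_ext (fun _ => 0)); [|apply is_lim_seq_const]. intros N. symmetry.
   induction N as [|N IH]; cbn [rsum]; [go|]. rewrite IH. unfold gw. go.
  (* The sign kap follows the sign of [c m], so that the errors enter with the factor |c m|. *)
  - destruct (explicit_ineq RH _ _ (tau m) _ (if Rle_dec 0 (c m) then 1 else -1) Ha Hl Hs ltac:(destruct Rle_dec; auto)) as [S1 [L1 I1]].
   exists (S0+c m*Re S1). split.
   + apply (is_lim_seq_ext (fun N => rsum (fun n => vMn n*np s0 n*gw al c tau m (la-ln (INR (S n)))) N+c m*Re (csum (pv al (s0, tau m) la) N))).
    * intros N. rewrite csum_Re, <- rsum_scal, <- rsum_plus. apply rsum_ext. intros n _. rewrite Re_pv. unfold gw. go.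
    * apply is_lim_seq_plus'; auto. apply (is_lim_seq_scal_l _ _ (Finite (Re S1))). apply Cl_lim_Re; auto.
   + cbn [rsum]. fold (mainI al s0 (tau m) la) in I1. set (E := exp (la*(1-s0))) in *. set (v := E*mainI al s0 (tau m) la-Re S1) in *.
    have : /2*(c m*v) <= Rabs (c m)*(dens al (tau m)+errE al la (tau m)).
    { destruct Rle_dec as [Hc|Hc]; [rewrite Rabs_pos_eq by auto|rewrite Rabs_left by lra]; nra. }
    go. }
 destruct H as [S0 [L0 I0]]. le_tr; [|go].
 have HS : Rbar_le S0 B.
 { apply (is_lim_seq_le (fun N => rsum (fun n => vMn n*np s0 n*gw al c tau m (la-ln (INR (S n)))) N) (fun _ => B)); [|go|apply is_lim_seq_const].
  intros N. le_tr; [|go]. apply rsum_le. intros n _. set (w := gw al c tau m (la-ln (INR (S n)))).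
  have : 0 <= vMn n by apply vM_nonneg. have : np s0 n <= np (/2) n. { apply exp_le. go. }
  have R1 := Rmax_r 0 w. have R0 := Rmax_l 0 w.
  apply Rle_trans with (vMn n*np s0 n*Rmax 0 w); [go|]. go. }
 simpl in HS. lra.
Qed.

(** The integral [mainI] completed to the whole line: the Gaussian transform at s0 - 1 + i tau. *)
Definition closedI (al s0 tau : R) : R := Kg (/(4*al))*exp (al*((1-s0)^2-tau^2))*cos (2*al*(1-s0)*tau).

Lemma mainI_closed al s0 tau la : 0 < al <= /64 -> 1 <= la -> /2 < s0 <= 1 -> closedI al s0 tau-exp (la/2-la^2/(4*al)) <= mainI al s0 tau la <= closedI al s0 tau+exp (la/2-la^2/(4*al)).
Proof.
 intros Ha Hl Hs. set (b := /(4*al)). have Hb : 0 < b by go. set (mu := (s0-1, tau) : C).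
 have E : forall u, (RtoC (exp ((s0-1)*u))*gph al tau u)%C = Lin (gauss b) mu u.
 { intros u. unfold Lin, gph, gauss. rewrite <- !Cexp_RtoC, <- !Cexp_add. f_equal. unfold mu, b. go. }
 have CL := Lap_CL _ (Re mu-1) (Re mu+1) mu (RC_gauss b) (gauss_dom b _ _ Hb) $. have CL' := is_CL_ext _ _ _ (fun t => eq_sym (E t)) CL.
 set (c := la/(2*al)-/2). have : 32*la <= la/(2*al). { apply (proj1 (Rle_div_r _ _ (2*al) $)). nra. } have : 2 < c by go.
 have EB : ebound (exp (la^2/(4*al))) c (fun u => RtoC (exp ((s0-1)*u))*gph al tau u)%C.
 { intros u. rewrite Cmod_mult, Cmod_gph, Cmod_R, Rabs_pos_eq by go. rewrite <- !exp_plus. rewrite <- (pow2_abs u).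
  assert ((s0-1)*u <= Rabs u/2). { have Q := Rle_abs (-u). rewrite Rabs_Ropp in Q. have Q2 := Rle_abs u. go. }
  set (w := Rabs u) in *. have S : 0 <= (w-la)^2/(4*al) by go.
  replace ((w-la)^2/(4*al)) with (w^2/(4*al)-la/(2*al)*w+la^2/(4*al)) in S by go. go. }
 have T := CL_tail _ c _ _ $ (CC_gph _ _ _) EB CL' la la $ $.
 have T2 : exp (la^2/(4*al))/c*(exp (-c*la)+exp (-c*la)) <= exp (la/2-la^2/(4*al)).
 { replace (la/2-la^2/(4*al)) with (la^2/(4*al)+- c*la) by go. rewrite exp_plus. set (x := exp (la^2/(4*al))). set (y := exp (-c*la)). replace (x/c*(y+y)) with (x*y*2/c) by go. apply (proj2 (Rle_div_l _ _ c $)). go. }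
 have : Re (Gs b mu) = closedI al s0 tau.
 { rewrite Gs_formula, Gs0_Kg by auto. replace (mu*mu/RtoC (4*b))%C with ((al*((1-s0)^2-tau^2))%R, (-(2*al*(1-s0)*tau))%R).
  - unfold closedI, Cexp, Re, Im. simpl. fold b. rewrite cos_neg. ring.
  - unfold mu, b. go. }
 have Q := re_le_Cmod (CI (fun u => RtoC (exp ((s0-1)*u))*gph al tau u)%C (-la) la-Gs b mu)%C.
 change (Re (CI (fun u => RtoC (exp ((s0-1)*u))*gph al tau u)%C (-la) la-Gs b mu)%C) with (mainI al s0 tau la-Re (Gs b mu)) in Q. have Q2 := Rle_trans _ _ _ Q (Rle_trans _ _ _ T T2). apply Rabs_le_between in Q2. lra.
Qed.

Lemma RC_rsum (f : nat -> R -> R) m : (forall j, RC (f j)) -> RC (fun s => rsum (fun j => f j s) m).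
Proof. intros H. induction m as [|m IH]; cbn [rsum]; [go|go]. Qed.

Lemma limit_at_half F r : RC F -> (forall s, /2 < s <= 1 -> F s <= r) -> F (/2) <= r.
Proof.
 intros HF H. apply Rnot_lt_le. intros L. have C := HF (/2). apply continuity_pt_filterlim in C. destruct (C ((F (/2)-r)/2) $) as [d [Hd K]].
 set (h := Rmin (d/2) (/4)). have : 0 < h by (apply Rmin_pos; lra). have : h <= d/2 by apply Rmin_l. have : h <= /4 by apply Rmin_r.
 have B : Rabs (/2+h-/2) < d by (rewrite Rabs_pos_eq; lra). have N : /2 <> /2+h by lra.
 have K' := K (/2+h) (conj (conj I N) B). apply Rabs_lt_between in K'. specialize (H (/2+h) $). lra.
Qed.

(** For each s0 > 1/2 the right side can be bounded independently of s0, while the closed form on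
    the left is continuous in s0; so s0 = 1/2 may be inserted. *)
Theorem weighted_explicit (RH : RiemannHypothesis) al la (c tau : nat -> R) m B : 0 < al <= /64 -> 1 <= la ->
 (forall N, rsum (fun n => vMn n*np (/2) n*Rmax 0 (gw al c tau m (la-ln (INR (S n))))) N <= B) ->
 /2*(exp (la/2)*Kg (/(4*al))*rsum (fun j => c j*(exp (al*(/4-tau j^2))*cos (al*tau j))) m-B) <=
  rsum (fun j => Rabs (c j)*(dens al (tau j)+errE al la (tau j)+exp (la-la^2/(4*al)))) m.
Proof.
 intros Ha Hl HB. set (R0 := rsum (fun j => Rabs (c j)*(dens al (tau j)+errE al la (tau j)+exp (la-la^2/(4*al)))) m).
 set (F := fun s => /2*(exp (la*(1-s))*rsum (fun j => c j*closedI al s (tau j)) m-B)).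
 have HF : F (/2) <= R0.
 { apply limit_at_half.
  - apply RC_mult; [go|]. apply RC_minus; [|go]. apply RC_mult.
   + apply RC_derive. intros s. auto_derive. auto.
   + apply RC_rsum. intros j. unfold closedI. apply RC_derive. intros s. auto_derive. auto.
  - intros s Hs. have W := weighted_ineq RH _ s la c _ m B Ha $ Hs HB.
   set (e := exp (la/2-la^2/(4*al))). have : rsum (fun j => c j*closedI al s (tau j)-Rabs (c j)*e) m <= rsum (fun j => c j*mainI al s (tau j) la) m.
   { apply rsum_le. intros j _. have Q := mainI_closed _ s (tau j) _ Ha Hl Hs. fold e in Q. destruct (Rle_dec 0 (c j)); [rewrite Rabs_pos_eq by auto|rewrite Rabs_left by lra]; nra. }
   have : exp (la*(1-s))*e <= exp (la-la^2/(4*al)) by (unfold e; rewrite <- exp_plus; apply exp_le; nra). set (E := exp (la*(1-s))) in *. have : 0 < E by apply exp_pos.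
   have : E*rsum (fun j => c j*closedI al s (tau j)-Rabs (c j)*e) m = E*rsum (fun j => c j*closedI al s (tau j)) m-rsum (fun j => Rabs (c j)*(E*e)) m.
   { clear. induction m as [|m IH]; cbn [rsum]; [ring|]. go. }
   set (e3 := exp (la-la^2/(4*al))) in *.
   have : rsum (fun j => Rabs (c j)*(E*e)) m <= rsum (fun j => Rabs (c j)*e3) m by (apply rsum_le; intros; mul_l; [go|auto]).
   have : 0 <= rsum (fun j => Rabs (c j)*e3) m by (apply (rsum_incr _ 0 m); [intros; apply Rmult_le_pos; [go|go]|lia]).
   have : R0 = rsum (fun j => Rabs (c j)*(dens al (tau j)+errE al la (tau j))) m+rsum (fun j => Rabs (c j)*e3) m by (unfold R0; rewrite <- rsum_plus; apply rsum_ext; intros; ring).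
   go. }
 le_tr; [|exact HF]. right. unfold F. f_equal. f_equal. replace (la*(1-/2)) with (la/2) by field.
 rewrite Rmult_assoc. f_equal. rewrite <- rsum_scal. apply rsum_ext. intros j _. unfold closedI. replace (2*al*(1-/2)*tau j) with (al*tau j) by field. replace ((1-/2)^2) with (/4) by field. ring.
Qed.

#[export] Hint Resolve RC_rsum : cont.

(** * Selberg sieve *)

Definition dvR (d n : nat) : R := if dvb d n then 1 else 0.

Lemma dvR_count m k : (1 <= m)%nat -> rsum (dvR m) k = INR ((k+m-1)/m).
Proof.
 intros Hm. induction k as [|k IH]; [cbn [rsum]; rewrite Nat.div_small by lia; reflexivity|]. cbn [rsum]. rewrite IH. unfold dvR, dvb.
 have D := Nat.div_mod k m ltac:(lia). have B := Nat.mod_upper_bound k m ltac:(lia). set (q := (k/m)%nat) in *. set (r := (k mod m)%nat) in *.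
 destruct (Nat.eqb_spec r 0) as [E|E].
 - have E1 : ((k+m-1)/m = q)%nat by (symmetry; apply (Nat.div_unique _ m q (m-1)); lia).
  have E2 : ((S k+m-1)/m = S q)%nat by (symmetry; apply (Nat.div_unique _ m (S q) 0); lia). rewrite E1, E2, S_INR. ring.
 - have E1 : ((k+m-1)/m = S q)%nat by (symmetry; apply (Nat.div_unique _ m (S q) (r-1)); lia).
  have E2 : ((S k+m-1)/m = S q)%nat by (symmetry; apply (Nat.div_unique _ m (S q) r); lia). rewrite E1, E2. ring.
Qed.

Lemma dvR_interval m a N : (1 <= m)%nat -> Rabs (rsum (fun i => dvR m (a+i)) N-INR N/INR m) <= 1.
Proof.
 intros Hm. have E := rsum_split (dvR m) a N. rewrite !dvR_count in E by auto.
 have G : forall k, INR k <= INR m*INR ((k+m-1)/m) <= INR k+INR m-1.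
 { intros k. have D := Nat.div_mod (k+m-1) m ltac:(lia). have B := Nat.mod_upper_bound (k+m-1) m ltac:(lia). rewrite <- mult_INR. split; [go|].
  replace (INR k+INR m-1) with (INR (k+m-1)); [go|]. rewrite minus_INR, plus_INR by lia. go. }
 have G1 := G a. have G2 := G (a+N)%nat. rewrite plus_INR in G2.
 replace (rsum (fun i => dvR m (a+i)) N) with (INR ((a+N+m-1)/m)-INR ((a+m-1)/m)) by lra.
 set (u := INR ((a+N+m-1)/m)) in *. set (v := INR ((a+m-1)/m)) in *.
 apply Rabs_le_between. split.
 - apply Rmult_le_reg_l with (INR m); [lra|]. replace (INR m*(u-v-INR N/INR m)) with (INR m*u-INR m*v-INR N) by go. lra.
 - apply Rmult_le_reg_l with (INR m); [lra|]. replace (INR m*(u-v-INR N/INR m)) with (INR m*u-INR m*v-INR N) by go. lra.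
Qed.

(* The sum over squarefree products d <= z of primes p in L of the product of om p. *)
Fixpoint sW (om : nat -> R) (L : list nat) (z : R) : R :=
 match L with
 | nil => if Rle_dec 1 z then 1 else 0
 | p :: L => sW om L z+om p*sW om L (z/INR p)
 end.

(** With 1/(p-1) this is the sum of 1/phi(d); with (p+1)/(p-1) it is the sum of sigma(d)/phi(d).
    They govern the main term and the remainder of the sieve. *)
Definition selS := sW (fun p => /(INR p-1)).
Definition selT := sW (fun p => (INR p+1)/(INR p-1)).

(** The factor p 1_(p | n) - 1 is the Ramanujan sum c_p(n), so this is the sum of mu(d)
    c_d(n)/phi(d) over the admissible d: Selberg's weight before division by [selS], written in a
    basis that is orthogonal on average. *)
Fixpoint self (L : list nat) (z : R) (n : nat) : R :=
 match L with
 | nil => if Rle_dec 1 z then 1 else 0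
 | p :: L => self L z n-(INR p*dvR p n-1)/(INR p-1)*self L (z/INR p) n
 end.

Lemma sW_nonneg om L : (forall p, In p L -> 0 <= om p) -> forall z, 0 <= sW om L z.
Proof.
 induction L as [|p L IH]; intros H z; cbn [sW].
 - destruct Rle_dec; lra.
 - have H1 := H p ltac:(left; auto). have IH' := IH ltac:(intros; apply H; right; auto). go.
Qed.

Lemma dvR_mult p m n : pr p -> (1 <= m)%nat -> ~ Nat.divide p m -> dvR m n*dvR p n = dvR (m*p) n.
Proof.
 intros Hp Hm N. have Hp2 := pr_ge2 p Hp. unfold dvR.
 have E : dvb (m*p) n = (dvb m n && dvb p n)%bool.
 { apply Bool.eq_iff_eq_true. rewrite Bool.andb_true_iff, !dvb_spec by nia. split.
  - intros [c Hc]. split; [exists (c*p)%nat; lia|exists (c*m)%nat; lia].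
  - intros [[c Hc] D]. rewrite Hc in D. destruct (pr_mult p c m Hp D) as [[e He]|D2]; [|tauto]. exists e. go. }
 rewrite E. destruct (dvb m n), (dvb p n); simpl; ring.
Qed.

Lemma dvR_sq p n : dvR p n*dvR p n = dvR p n.
Proof. unfold dvR. destruct (dvb p n); ring. Qed.

Lemma Rmin_div z w p : 0 < p -> Rmin z w/p = Rmin (z/p) (w/p).
Proof.
 intros Hp. have : 0 < /p by go. unfold Rmin, Rdiv. destruct Rle_dec as [A|A]; destruct Rle_dec as [B|B]; auto.
 - go.
 - go.
Qed.

(* Selberg's quadratic form, diagonalised: the functions multiplying the coefficients of self are orthogonal on average. *)
Lemma selberg_form L : NoDup L -> (forall p, In p L -> pr p) -> forall z w m a N, (1 <= m)%nat -> (forall p, In p L -> ~ Nat.divide p m) ->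
 Rabs (rsum (fun i => dvR m (a+i)*(self L z (a+i)*self L w (a+i))) N-INR N/INR m*selS L (Rmin z w)) <= selT L z*selT L w.
Proof.
 induction L as [|p L IH]; intros HN HP z w m a N Hm Hc.
 - unfold selS, selT. cbn [self sW]. unfold Rmin. have D := dvR_interval m a N Hm.
  have Z : forall u : R, rsum (fun i => dvR m (a+i)*(u*0)) N = 0 by (intros u; rewrite (rsum_ext _ (fun i => 0*dvR m (a+i))) by go; rewrite rsum_scal; ring).
  have Z2 : forall u : R, rsum (fun i => dvR m (a+i)*(0*u)) N = 0 by (intros u; rewrite (rsum_ext _ (fun i => 0*dvR m (a+i))) by go; rewrite rsum_scal; ring).
  destruct (Rle_dec z w); destruct Rle_dec; destruct Rle_dec; try lra; rewrite ?Z, ?Z2, ?Rmult_0_r, ?Rminus_0_r, ?Rabs_R0; try lra;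
   rewrite (rsum_ext _ (fun i => dvR m (a+i))) by go; rewrite !Rmult_1_r; exact D.
 - inversion HN as [|p' L' N1 N2]; subst. have Hp : pr p by (apply HP; left; auto). have Hp2 := pr_ge2 p Hp.
  have IH' := IH N2 ltac:(intros; apply HP; right; auto). have : ~ Nat.divide p m by (apply Hc; left; auto).
  have Hmp : (1 <= m*p)%nat by nia.
  have Hc' : forall q, In q L -> ~ Nat.divide q (m*p).
  { intros q Hq D. have Pq : pr q by (apply HP; right; auto). destruct (pr_mult q m p Pq D) as [D1|D1]; [apply (Hc q); [right; auto|auto]|]. apply pr_eq in D1; auto. subst. auto. }
  have Hc0 : forall q, In q L -> ~ Nat.divide q m by (intros; apply Hc; right; auto).
  set (P := INR p). have : 2 <= P by (apply (le_INR 2); auto). have : 1 <= INR m by (apply (le_INR 1); auto).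
  set (z' := z/P). set (w' := w/P). set (c := /(P-1)). have : 0 < c by go. set (A := fun (m : nat) u v => rsum (fun i => dvR m (a+i)*(self L u (a+i)*self L v (a+i))) N).
  assert (EA : rsum (fun i => dvR m (a+i)*(self (p :: L) z (a+i)*self (p :: L) w (a+i))) N =
   A m z w-c*(P*A (m*p)%nat z w'-A m z w')-c*(P*A (m*p)%nat z' w-A m z' w)+c*c*((P*P-2*P)*A (m*p)%nat z' w'+A m z' w')).
  { unfold A. induction N as [|N IHN]; cbn [rsum]; [ring|]. rewrite IHN. set (n := (a+N)%nat). cbn [self]. rewrite <- dvR_mult by auto. fold P. fold z' w'.
   have E2 := dvR_sq p n. set (d := dvR m n). set (e := dvR p n) in *. set (f' := self L z' n). set (g' := self L w' n). unfold Rdiv. fold c.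
   match goal with |- ?l = ?r => have E3 : l = r+c*c*P*P*d*f'*g'*(e*e-e) by ring end. rewrite E3, E2. ring. }
  rewrite EA. set (K := INR N) in *.
  have I1 := IH' z w m a N Hm Hc0. have I2 := IH' z w' m a N Hm Hc0. have I3 := IH' z' w m a N Hm Hc0. have I4 := IH' z' w' m a N Hm Hc0.
  have I5 := IH' z w' (m*p)%nat a N Hmp Hc'. have I6 := IH' z' w (m*p)%nat a N Hmp Hc'. have I7 := IH' z' w' (m*p)%nat a N Hmp Hc'. fold (A m z w) in I1. fold (A m z w') in I2. fold (A m z' w) in I3. fold (A m z' w') in I4. fold (A (m*p)%nat z w') in I5. fold (A (m*p)%nat z' w) in I6. fold (A (m*p)%nat z' w') in I7.
  rewrite mult_INR in I5, I6, I7. fold P K in I5, I6, I7. fold K in I1, I2, I3, I4.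
  have ES : selS (p :: L) (Rmin z w) = selS L (Rmin z w)+c*selS L (Rmin z' w').
  { unfold z', w'. rewrite <- Rmin_div by lra. go. }
  have ETz : selT (p :: L) z = selT L z+(P+1)*c*selT L z' by go.
  have ETw : selT (p :: L) w = selT L w+(P+1)*c*selT L w' by go.
  rewrite ES, ETz, ETw. clear ES ETz ETw EA.
  set (S1 := selS L (Rmin z w)) in *. set (S2 := selS L (Rmin z w')) in *. set (S3 := selS L (Rmin z' w)) in *. set (S4 := selS L (Rmin z' w')) in *.
  set (Tz := selT L z) in *. set (Tw := selT L w) in *. set (Tz' := selT L z') in *. set (Tw' := selT L w') in *.
  set (M := INR m) in *. set (k := K/M) in *. have EK : K/(M*P) = k/P by go. rewrite EK in I5, I6, I7.
  generalize dependent (A m z w). generalize dependent (A m z w'). generalize dependent (A m z' w). generalize dependent (A m z' w'). generalize dependent (A (m*p)%nat z w'). generalize dependent (A (m*p)%nat z' w). generalize dependent (A (m*p)%nat z' w').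
  intros B3 J3 B2 J2 B1 J1 A4 I4 A3 I3 A2 I2 A1 I1.
  (* main terms cancel since P (k/P) = k *)
  set (e1 := A1-k*S1) in *. set (e2 := A2-k*S2) in *. set (e3 := A3-k*S3) in *. set (e4 := A4-k*S4) in *. set (f1 := B1-k/P*S2) in *. set (f2 := B2-k/P*S3) in *. set (f3 := B3-k/P*S4) in *.
  replace (A1-c*(P*B1-A2)-c*(P*B2-A3)+c*c*((P*P-2*P)*B3+A4)-k*(S1+c*S4)) with
   (e1-c*(P*f1-e2)-c*(P*f2-e3)+c*c*((P*P-2*P)*f3+e4)).
  2:{ go. }
  clearbody e1 e2 e3 e4 f1 f2 f3. clearbody Tz Tw Tz' Tw' c.
  have Q1 : Rabs (c*(P*f1-e2)) <= c*((P+1)*(Tz*Tw')).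
  { rewrite Rabs_mult, Rabs_pos_eq by lra. mul_l; [lra|]. apply Rabs_le_between. apply Rabs_le_between in I2. apply Rabs_le_between in J1. nra. }
  have Q2 : Rabs (c*(P*f2-e3)) <= c*((P+1)*(Tz'*Tw)).
  { rewrite Rabs_mult, Rabs_pos_eq by lra. mul_l; [lra|]. apply Rabs_le_between. apply Rabs_le_between in I3. apply Rabs_le_between in J2. nra. }
  have Q3 : Rabs (c*c*((P*P-2*P)*f3+e4)) <= c*c*((P+1)*(P+1)*(Tz'*Tw')).
  { rewrite Rabs_mult, Rabs_pos_eq by nra. mul_l; [nra|]. apply Rabs_le_between in I4. apply Rabs_le_between in J3. assert (0 <= P*P-2*P) by nra. set (t := Tz'*Tw') in *. set (r := P*P-2*P) in *. assert (-(r*t) <= r*f3 <= r*t) by go.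
   assert ((P+1)*(P+1)*t = r*t+(4*P+1)*t) by go. assert (1*t <= (4*P+1)*t) by go. go. }
  apply Rabs_le_between in I1. apply Rabs_le_between in Q1. apply Rabs_le_between in Q2. apply Rabs_le_between in Q3. go.
Qed.

Definition copr (L : list nat) (n : nat) : R := if excluded_middle_informative (forall p, In p L -> ~ Nat.divide p n) then 1 else 0.

Lemma self_copr L z n : (forall p, In p L -> pr p) -> (forall p, In p L -> ~ Nat.divide p n) -> self L z n = selS L z.
Proof.
 revert z. induction L as [|p L IH]; intros z HP H; [go|]. unfold selS in *. cbn [self sW]. rewrite !IH by (intros; (apply HP || apply H); right; auto).
 have Hp := pr_ge2 p (HP p (or_introl eq_refl)). unfold dvR. destruct (dvb p n) eqn:E; [exfalso; apply (H p); [left; auto|]; apply dvb_spec in E; [auto|lia]|]. go.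
Qed.

(** On integers free of the primes in L, [self] equals [selS]; its square is nonnegative elsewhere,
    so averaging the square over an interval majorises the count. *)
Lemma sieve_count L z a N : NoDup L -> (forall p, In p L -> pr p) -> rsum (fun i => copr L (a+i)) N*(selS L z)^2 <= INR N*selS L z+(selT L z)^2.
Proof.
 intros HN HP. have F := selberg_form L HN HP z z 1 a N ltac:(lia).
 have F' := F ltac:(intros p Hp D; apply Nat.divide_1_r in D; assert (Q := pr_ge2 p (HP p Hp)); lia). rewrite Rmin_left in F' by lra. simpl (INR 1) in F'. apply Rabs_le_between in F'.
 have : rsum (fun i => copr L (a+i)) N*selS L z^2 <= rsum (fun i => dvR 1 (a+i)*(self L z (a+i)*self L z (a+i))) N.
 { rewrite Rmult_comm, <- rsum_scal. apply rsum_le. intros i _. replace (dvR 1 (a+i)) with 1.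
  2:{ go. }
  unfold copr. destruct excluded_middle_informative as [E|E].
  - rewrite self_copr by auto. go.
  - go. }
 go.
Qed.

(** * Lower bound for [selS] by smooth numbers *)

Definition smooth (L : list nat) (n : nat) : Prop := forall q, pr q -> Nat.divide q n -> In q L.
Definition sm (L : list nat) (n : nat) : R := if excluded_middle_informative (smooth L n) then 1 else 0.
Definition Hs (L : list nat) (k : nat) : R := rsum (fun i => sm L (S i)/INR (S i)) k.

Lemma sm_nonneg L n : 0 <= sm L n.
Proof. unfold sm. em; lra. Qed.

Lemma sm_le L L' n n' : (smooth L n -> smooth L' n') -> sm L n <= sm L' n'.
Proof. unfold sm. destruct (excluded_middle_informative (smooth L n)); destruct (excluded_middle_informative (smooth L' n')); try lra. tauto. Qed.

Lemma Hs_mono L k k' : (k <= k')%nat -> Hs L k <= Hs L k'.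
Proof. apply rsum_incr; auto. intros i. apply Rmult_le_pos; [apply sm_nonneg|go]. Qed.

Lemma div_succ k p : (2 <= p)%nat -> (exists q, S k = (p*S q)%nat /\ (k/p = q)%nat /\ (S k/p = S q)%nat) \/ (~ Nat.divide p (S k) /\ (S k/p = k/p)%nat).
Proof.
 intros Hp. have D := Nat.div_mod k p ltac:(lia). have B := Nat.mod_upper_bound k p ltac:(lia). set (q := (k/p)%nat) in *. set (r := (k mod p)%nat) in *.
 destruct (Nat.eq_dec (S r) p) as [E|E].
 - left. exists q. repeat split; try nia. apply (eq_sym (Nat.div_unique (S k) p (S q) 0 ltac:(lia) ltac:(nia))).
 - right. split; [|apply (eq_sym (Nat.div_unique (S k) p q (S r) ltac:(lia) ltac:(nia)))]. intros [c Hc]. assert (c = q \/ c < q \/ q < c)%nat as [H|[H|H]] by lia; nia.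
Qed.

Lemma smooth_div p L n : smooth L (p*n) -> smooth L n.
Proof. intros H q Hq D. apply H; auto. apply Nat.divide_mul_r. auto. Qed.

Lemma smooth_drop p L n : ~ Nat.divide p n -> smooth (p :: L) n -> smooth L n.
Proof. intros N H q Hq D. destruct (H q Hq D) as [->|]; tauto. Qed.

Lemma Hs_cons p L k : (2 <= p)%nat -> Hs (p :: L) k <= Hs L k+/INR p*Hs (p :: L) (k/p).
Proof.
 intros Hp. have P2 := le_INR 2 p Hp. simpl in P2. induction k as [|k IH]; [rewrite Nat.div_small by lia; unfold Hs; cbn [rsum]; lra|].
 destruct (div_succ k p Hp) as [[q [E1 [E2 E3]]]|[E1 E2]].
 - rewrite E3. rewrite E2 in IH. have M := Hs_mono L k (S k) ltac:(lia). unfold Hs at 1 3. cbn [rsum]. fold (Hs (p :: L) k) (Hs (p :: L) q).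
  assert (sm (p :: L) (S k)/INR (S k) <= /INR p*(sm (p :: L) (S q)/INR (S q))).
  { rewrite E1, mult_INR. have : 0 < INR (S q) by go. replace (/INR p*(sm (p :: L) (S q)/INR (S q))) with (sm (p :: L) (S q)/(INR p*INR (S q))) by go.
   mul_r; [go|]. apply sm_le, smooth_div. }
  go.
 - rewrite E2. unfold Hs at 1 2. cbn [rsum]. fold (Hs (p :: L) k) (Hs L k).
  assert (sm (p :: L) (S k)/INR (S k) <= sm L (S k)/INR (S k)) by (mul_r; [go|apply sm_le, smooth_drop; auto]). lra.
Qed.

(** Iterating [Hs_cons] along k/p, k/p^2, ... sums the geometric series to 1/(p-1). *)
Lemma Hs_cons2 p L k : (2 <= p)%nat -> Hs (p :: L) k <= Hs L k+/(INR p-1)*Hs L (k/p).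
Proof.
 intros Hp. have P2 := le_INR 2 p Hp. simpl in P2. induction k as [k IH] using (well_founded_induction lt_wf).
 have : 0 < /(INR p-1) by go.
 destruct (Nat.eq_dec k 0) as [->|Nk]; [unfold Hs; cbn [rsum]; rewrite Nat.div_small by lia; cbn [rsum]; lra|].
 le_tr; [apply Hs_cons; auto|]. apply Rplus_le_compat_l.
 have Q := IH (k/p)%nat ltac:(apply Nat.div_lt; lia). have M := Hs_mono L (k/p/p) (k/p) ltac:(apply Nat.Div0.div_le_upper_bound; nia).
 apply Rle_trans with (/INR p*(Hs L (k/p)+/(INR p-1)*Hs L (k/p))).
 - go.
 - right. go.
Qed.

(** The sum of 1/n over all n with radical d is 1/phi(d), and a smooth n <= z has its radical below
    z. *)
Lemma Hs_le_S L : (forall p, In p L -> pr p) -> forall k z, INR k <= z -> Hs L k <= selS L z.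
Proof.
 induction L as [|p L IH]; intros HP k z Hk.
 - unfold selS. cbn [sW]. have G : forall k, Hs nil k <= 1 /\ (k = O -> Hs nil k = 0).
  { intros j. split; [|intros ->; reflexivity]. induction j as [|j IHj]; [unfold Hs; cbn [rsum]; lra|]. unfold Hs. cbn [rsum]. fold (Hs nil j). destruct j as [|j].
   - unfold Hs. cbn [rsum]. unfold sm. simpl INR. em; lra.
   - unfold sm. destruct excluded_middle_informative as [E|E]; [|lra]. exfalso. destruct (pr_divisor (S (S j)) ltac:(lia)) as [q [Hq D]]. apply (E q Hq D). }
  destruct (G k) as [G1 G2]. destruct Rle_dec as [Z|Z]; [lra|]. destruct k as [|k]; [rewrite G2; [lra|auto]|]. rewrite S_INR in Hk. have Q := pos_INR k. lra.
 - have Hp := pr_ge2 p (HP p (or_introl eq_refl)). have P2 := le_INR 2 p Hp. simpl in P2. le_tr; [apply Hs_cons2; auto|]. have IH' := IH ltac:(intros; apply HP; right; auto). apply Rplus_le_compat; [go|].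
  mul_l; [go|]. apply IH'. apply (proj1 (Rle_div_r _ _ (INR p) $)). rewrite <- mult_INR. le_tr; [|exact Hk]. apply le_INR. rewrite Nat.mul_comm. apply Nat.Div0.mul_div_le.
Qed.

#[export] Hint Resolve sW_nonneg sm_nonneg : cont.

(** * Upper bound for [selT] *)

Definition cnt (L : list nat) (k : nat) : R := rsum (fun i => sm L (S i)) k.

Lemma sm_le1 L n : sm L n <= 1.
Proof. unfold sm. em; lra. Qed.

Lemma cnt_le L k : cnt L k <= INR k.
Proof. unfold cnt. induction k as [|k IH]; [go|]. cbn [rsum]. rewrite S_INR. have Q := sm_le1 L (S k). lra. Qed.

Lemma cnt_cons p L k : pr p -> ~ In p L -> cnt L k+cnt L (k/p) <= cnt (p :: L) k.
Proof.
 intros Hp N. have Hp2 := pr_ge2 p Hp. induction k as [|k IH]; [rewrite Nat.div_small by lia; unfold cnt; cbn [rsum]; lra|].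
 destruct (div_succ k p Hp2) as [[q [E1 [E2 E3]]]|[E1 E2]].
 - rewrite E3. rewrite E2 in IH. unfold cnt in *. have : sm L (S k) = 0. { unfold sm. destruct excluded_middle_informative as [H|H]; [|go]. exfalso. apply N, H; auto. exists (S q). lia. }
  have B : sm L (S q) <= sm (p :: L) (S k). { apply sm_le. intros H r Hr D. rewrite E1 in D. destruct (pr_mult r p _ Hr D) as [D1|D1]; [left; symmetry; apply pr_eq; auto|right; apply H; auto]. }
  go.
 - rewrite E2. unfold cnt in *. cbn [rsum]. have B : sm L (S k) <= sm (p :: L) (S k) by (apply sm_le; intros H r Hr D; right; apply H; auto). lra.
Qed.

Definition sN := sW (fun _ => 1).

(** Distinct squarefree products are distinct smooth integers; [cnt_cons] separates those divisible
    by p from the others. *)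
Lemma sN_cnt L : NoDup L -> (forall p, In p L -> pr p) -> forall z k, z < INR (S k) -> sN L z <= cnt L k.
Proof.
 induction L as [|p L IH]; intros HN HP z k Hz.
 - unfold sN. cbn [sW]. have : forall j, 0 <= cnt nil j by (intros; apply (rsum_incr _ 0 j); [go|lia]).
  destruct Rle_dec as [Z|Z]; [|go]. destruct k as [|k]; [simpl in Hz; lra|].
  apply Rle_trans with (cnt nil 1); [|apply rsum_incr; [go|lia]]. unfold cnt. cbn [rsum]. unfold sm. destruct excluded_middle_informative as [E|E]; [lra|].
  exfalso. apply E. intros q Hq D. apply Nat.divide_1_r in D. apply pr_ge2 in Hq. lia.
 - inversion HN as [|p' L' N1 N2]; subst. have Hp := HP p (or_introl eq_refl). have Hp2 := pr_ge2 p Hp. have IH' := IH N2 ltac:(intros; apply HP; right; auto).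
  le_tr; [|apply cnt_cons; auto]. unfold sN in *. cbn [sW]. rewrite Rmult_1_l. apply Rplus_le_compat; apply IH'; auto.
  have P0 : 0 < INR p by go. apply (proj2 (Rlt_div_l z _ _ P0)). eapply Rlt_le_trans; [exact Hz|]. rewrite <- mult_INR. apply le_INR.
  have D := Nat.div_mod k p ltac:(lia). have B := Nat.mod_upper_bound k p ltac:(lia). nia.
Qed.

Lemma nat_floor z : 0 <= z -> exists k, INR k <= z < INR (S k).
Proof.
 intros Hz. destruct (nfloor_ex z Hz) as [k Hk]. exists k. rewrite S_INR. go.
Qed.

Lemma sN_le L z : NoDup L -> (forall p, In p L -> pr p) -> 0 <= z -> sN L z <= z.
Proof.
 intros HN HP Hz. destruct (nat_floor z Hz) as [k [H1 H2]]. ub ((sN_cnt L HN HP z k H2)). le_tr; [apply cnt_le|go].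
Qed.

Definition ap (p : nat) : R := 2/(INR p-1).

(** Writing (p+1)/(p-1) = 1 + ap p splits each d of [selT] into d' d'', with weight [ap] on d'.
    Forgetting that d' and d'' are coprime allows the number of d'' to be bounded by z/d', which
    leaves an Euler product. *)
Fixpoint sQ (L' L : list nat) (z : R) : R :=
 match L' with nil => sN L z | p :: L' => sQ L' L z+ap p*sQ L' L (z/INR p) end.

Fixpoint prodL (L : list nat) : R := match L with nil => 1 | p :: L => (1+ap p/INR p)*prodL L end.

Lemma ap_nonneg p : pr p -> 0 <= ap p.
Proof. intros Hp. have Q := le_INR 2 p (pr_ge2 p Hp). simpl in Q. unfold ap. go. Qed.

Lemma sQ_nonneg L' L z : (forall p, In p L' -> pr p) -> 0 <= sQ L' L z.
Proof.
 revert z. induction L' as [|p L' IH]; intros z HP; cbn [sQ].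
 - apply sW_nonneg. go.
 - have A := IH z ltac:(intros; apply HP; right; auto). have B := IH (z/INR p) ltac:(intros; apply HP; right; auto). have C := ap_nonneg p (HP p (or_introl eq_refl)). nra.
Qed.

Lemma sQ_cons L' p L z : sQ L' (p :: L) z = sQ L' L z+sQ L' L (z/INR p).
Proof.
 revert z. induction L' as [|q L' IH]; intros z; cbn [sQ].
 - unfold sN. go.
 - rewrite !IH. replace (z/INR q/INR p) with (z/INR p/INR q) by go. ring.
Qed.

Lemma selT_le_sQ L z : (forall p, In p L -> pr p) -> selT L z <= sQ L L z.
Proof.
 revert z. induction L as [|p L IH]; intros z HP.
 - go.
 - have Hp := HP p (or_introl eq_refl). have P2 := le_INR 2 p (pr_ge2 p Hp). simpl in P2. have HP' : forall q, In q L -> pr q by (intros; apply HP; right; auto).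
  unfold selT. cbn [sW sQ]. rewrite !sQ_cons.
  have A := IH z HP'. have B := IH (z/INR p) HP'. have C := sQ_nonneg L L (z/INR p/INR p) HP'. have a := ap_nonneg p Hp. unfold selT in A, B.
  replace ((INR p+1)/(INR p-1)) with (1+ap p) by (unfold ap; field; lra).
  go.
Qed.

Lemma sQ_le L' L : (forall p, In p L' -> pr p) -> (forall z, 0 <= z -> sN L z <= z) -> forall z, 0 <= z -> sQ L' L z <= z*prodL L'.
Proof.
 intros HP HN. induction L' as [|p L' IH]; intros z Hz; cbn [sQ prodL].
 - rewrite Rmult_1_r. auto.
 - have Hp := HP p (or_introl eq_refl). have P2 := le_INR 2 p (pr_ge2 p Hp). simpl in P2. have IH' := IH ltac:(intros; apply HP; right; auto).
  have A := IH' z Hz. have B := IH' (z/INR p) ltac:(go). have a := ap_nonneg p Hp.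
  go.
Qed.

Fixpoint pl (k : nat) : list nat := match k with O => nil | S k => if excluded_middle_informative (pr (S k)) then S k :: pl k else pl k end.

Lemma pl_spec k p : In p (pl k) <-> pr p /\ (p <= k)%nat.
Proof.
 induction k as [|k IH]; cbn [pl].
 - split; [go|]. intros [Hp H]. apply pr_ge2 in Hp. lia.
 - destruct excluded_middle_informative as [E|E]; simpl; rewrite ?IH; split; try tauto.
  + intros [<-|[H1 H2]]; split; auto.
  + intros [H1 H2]. destruct (Nat.eq_dec p (S k)) as [->|N]; [go|right; split; auto; lia].
  + intros [H1 H2]. go.
  + intros [H1 H2]. split; auto. destruct (Nat.eq_dec p (S k)) as [->|N]; [tauto|lia].
Qed.

Lemma pl_NoDup k : NoDup (pl k).
Proof. induction k as [|k IH]; cbn [pl]; [constructor|]. em; auto. constructor; auto. rewrite pl_spec. lia. Qed.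

(** Each factor is at most exp(2/(p(p-1))), and the exponents summed over all integers telescope.
    The resulting e^2 is the 9 of [selT_pl]. *)
Lemma prodL_pl k : (1 <= k)%nat -> prodL (pl k) <= exp (2*(1-/INR k)).
Proof.
 intros Hk. induction Hk as [|k Hk IH].
 - cbn [pl]. destruct excluded_middle_informative as [E|E]; [apply pr_ge2 in E; lia|]. cbn [prodL]. simpl INR. rewrite Rinv_1, Rminus_diag, Rmult_0_r, exp_0. lra.
 - have K1 := le_INR 1 k Hk. simpl (INR 1) in K1. have : /INR k-/INR (S k) = /(INR k*INR (S k)) by (rewrite S_INR; field; lra).
  have : 0 < /(INR k*INR (S k)) by go.
  have : exp (2*(1-/INR k)) <= exp (2*(1-/INR (S k))) by go.
  cbn [pl]. destruct excluded_middle_informative as [E|E]; [|lra]. cbn [prodL].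
  have : 0 <= prodL (pl k).
  { have G : forall L, (forall p, In p L -> pr p) -> 0 <= prodL L. { induction L as [|p L IHL]; intros HP; cbn [prodL]; [lra|]. have a := ap_nonneg p (HP p (or_introl eq_refl)). have P2 := le_INR 2 p (pr_ge2 p (HP p (or_introl eq_refl))). simpl in P2. apply Rmult_le_pos; [|apply IHL; intros; apply HP; right; auto]. go. } apply G. intros p Hp. apply pl_spec in Hp. tauto. }
  replace (2*(1-/INR (S k))) with (2*/(INR k*INR (S k))+2*(1-/INR k)) by lra. rewrite exp_plus.
  have Ea : ap (S k)/INR (S k) = 2*/(INR k*INR (S k)) by (unfold ap; rewrite S_INR; field; lra). rewrite Ea.
  apply Rmult_le_compat; auto; [lra|]. apply exp_ineq1_le.
Qed.

Lemma exp2_le9 : exp 2 <= 9.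
Proof. replace 2 with (1+1) by ring. rewrite exp_plus. have Q := exp_le_3. have P := exp_pos 1. nra. Qed.

Lemma selT_pl k z : (1 <= k)%nat -> 0 <= z -> selT (pl k) z <= 9*z.
Proof.
 intros Hk Hz. have : forall p, In p (pl k) -> pr p by (intros p Hp; apply pl_spec in Hp; tauto).
 le_tr; [apply selT_le_sQ; auto|]. le_tr; [apply sQ_le; auto; intros; apply sN_le; auto using pl_NoDup|].
 rewrite Rmult_comm. mul_r; auto. le_tr; [apply prodL_pl; auto|]. le_tr; [|apply exp2_le9].
 assert (0 < /INR k) by go. go.
Qed.

(** Every integer up to k is smooth for the primes up to k, so [Hs] is the full harmonic sum. *)
Lemma selS_pl k : ln (INR (S k)) <= selS (pl k) (INR k).
Proof.
 have HP : forall p, In p (pl k) -> pr p by (intros p Hp; apply pl_spec in Hp; tauto).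
 le_tr; [|apply (Hs_le_S _ HP k); lra].
 have : forall j, (j <= k)%nat -> ln (INR (S j)) <= Hs (pl k) j.
 { induction j as [|j IH]; intros Hj; [unfold Hs; cbn [rsum]; simpl INR; rewrite ln_1; lra|]. unfold Hs. cbn [rsum]. fold (Hs (pl k) j). specialize (IH ltac:(lia)).
  have : 0 < INR (S j) by go.
  have E : sm (pl k) (S j) = 1. { unfold sm. destruct excluded_middle_informative as [E|E]; [go|]. exfalso. apply E. intros q Hq D. apply pl_spec. split; auto. apply Nat.divide_pos_le in D; lia. }
  rewrite E. have Q := ln_le_m1 (INR (S (S j))/INR (S j)) ltac:(go). rewrite ln_div in Q by go.
  replace (INR (S (S j))/INR (S j)-1) with (1/INR (S j)) in Q by go. lra. }
 go.
Qed.

Lemma count_bound c S T N S0 : 0 < S0 <= S -> 0 <= N -> c*S^2 <= N*S+T^2 -> c <= N/S0+T^2/S0^2.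
Proof.
 intros HS HN H. apply Rle_trans with (N/S+T^2/S^2).
 - replace (N/S+T^2/S^2) with ((N*S+T^2)/S^2) by go. apply (proj1 (Rle_div_r _ _ (S^2) ltac:(go))). go.
 - go.
Qed.

Lemma sieve_large k a N : (2 <= k)%nat -> rsum (fun i => copr (pl k) (a+i)) N <= INR N/ln (INR (S k))+(9*INR k)^2/(ln (INR (S k)))^2.
Proof.
 intros Hk. have HP : forall p, In p (pl k) -> pr p by (intros p Hp; apply pl_spec in Hp; tauto).
 have Q := sieve_count _ (INR k) a N (pl_NoDup k) HP. have : 0 < ln (INR (S k)) by (rewrite <- ln_1; apply ln_increasing; [lra|]; apply (lt_INR 1); lia).
 have T0 := selT_pl k _ ltac:(lia) (pos_INR k).
 have : 0 <= selT (pl k) (INR k). { apply sW_nonneg. intros q Hq. have P2 := le_INR 2 q (pr_ge2 q (HP q Hq)). simpl in P2. go. }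
 apply (count_bound _ (selS (pl k) (INR k)) _ _); [split; [auto|apply selS_pl]|go|]. go.
Qed.

Lemma pr2 : pr 2. Proof. exact prime_2. Qed.
Lemma pr3 : pr 3. Proof. exact prime_3. Qed.

(** With z = 3 the divisors are 1, 2, 3: S = 1 + 1 + 1/2 and T = 1 + 3 + 2, so T^2/S^2 = 5.76 is
    below 6. *)
Lemma sieve_23 a N : rsum (fun i => copr (3 :: 2 :: nil)%nat (a+i)) N <= INR N*(2/5)+6.
Proof.
 have HP : forall p, In p (3 :: 2 :: nil)%nat -> pr p by (intros p [<-|[<-|[]]]; [apply pr3|apply pr2]).
 have Q := sieve_count (3 :: 2 :: nil)%nat 3 a N ltac:(repeat constructor; simpl; intros H; decompose [or] H; try lia; auto) HP.
 have : selS (3 :: 2 :: nil)%nat 3 = 5/2. { unfold selS. cbn [sW]. simpl INR. destruct Rle_dec; [|lra]. destruct Rle_dec; [|lra]. destruct Rle_dec; [|lra]. destruct Rle_dec; [lra|]. field. }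
 have : selT (3 :: 2 :: nil)%nat 3 = 6. { unfold selT. cbn [sW]. simpl INR. destruct Rle_dec; [|lra]. destruct Rle_dec; [|lra]. destruct Rle_dec; [|lra]. destruct Rle_dec; [lra|]. field. }
 go.
Qed.

(** * Sums over primes in blocks *)

Definition ind (P : Prop) : R := if excluded_middle_informative P then 1 else 0.

Lemma ind_T (P : Prop) : P -> ind P = 1.
Proof. unfold ind. em; tauto. Qed.
Lemma ind_F (P : Prop) : ~ P -> ind P = 0.
Proof. unfold ind. em; tauto. Qed.
Lemma ind_nonneg P : 0 <= ind P.
Proof. unfold ind. em; lra. Qed.
Lemma ind_le1 P : ind P <= 1.
Proof. unfold ind. em; lra. Qed.

Lemma rsum_swap (f : nat -> nat -> R) K N : rsum (fun n => rsum (fun k => f k n) K) N = rsum (fun k => rsum (fun n => f k n) N) K.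
Proof.
 induction N as [|N IH]; cbn [rsum].
 - symmetry. induction K as [|K IHK]; cbn [rsum]; [go|]. go.
 - rewrite IH, <- rsum_plus. go.
Qed.

Lemma rsum_ind_unique (P : nat -> Prop) N : (forall i j, P i -> P j -> i = j) -> rsum (fun i => ind (P i)) N <= 1.
Proof.
 intros H. induction N as [|N IH]; cbn [rsum]; [lra|].
 destruct (classic (P N)) as [HN|HN].
 - rewrite (rsum_zero _ 0 N); [cbn [rsum]; rewrite ind_T by auto; lra|lia|]. intros k Hk. apply ind_F. intros HP. assert (k = N) by go. lia.
 - rewrite (ind_F _ HN). lra.
Qed.

Lemma rsum_window (G : nat -> R) y0 y1 B : 0 <= y0 <= y1 -> (forall n, 0 <= G n) ->
 (forall a M, INR M <= y1-y0+1 -> y0 < INR a -> INR (a+M) <= y1+1 -> rsum (fun i => G (a+i)%nat) M <= B) ->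
 forall N, rsum (fun n => ind (y0 < INR (S n) <= y1)*G (S n)) N <= B.
Proof.
 intros Hy HG H N. destruct (nat_floor y0 $) as [a [A1 A2]]. destruct (nat_floor y1 $) as [b [B1 B2]].
 have : (a <= b)%nat. { assert (INR a < INR (S b)) by lra. apply INR_lt in H0. lia. }
 have : forall n, 0 <= ind (y0 < INR (S n) <= y1)*G (S n) by (intros; apply Rmult_le_pos; [apply ind_nonneg|auto]).
 apply Rle_trans with (rsum (fun n => ind (y0 < INR (S n) <= y1)*G (S n)) (a+(b-a)+N)).
 { apply rsum_incr; [auto|lia]. }
 rewrite (rsum_zero _ (a+(b-a)) _); [|lia|].
 - rewrite rsum_split. rewrite (rsum_zero _ 0 a); [cbn [rsum]|lia|].
  + rewrite Rplus_0_l. le_tr; [|apply (H (S a) (b-a)%nat)].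
   * apply rsum_le. intros i _. replace (S a+i)%nat with (S (a+i)) by lia. rewrite <- (Rmult_1_l (G (S (a+i)))) at 2. mul_r; [auto|apply ind_le1].
   * rewrite minus_INR by auto. rewrite S_INR in *. lra.
   * lra.
   * rewrite plus_INR, minus_INR, S_INR in * by auto. lra.
  + intros k Hk. rewrite ind_F; [ring|]. assert (INR (S k) <= INR a) by (apply le_INR; lia). lra.
 - intros k Hk. rewrite ind_F; [ring|]. assert (INR (S b) <= INR (S k)) by (apply le_INR; lia). lra.
Qed.

Definition lsum (f : nat -> R) (L : list nat) : R := fold_right (fun p s => f p+s) 0 L.

Lemma lsum_le_length (f : nat -> R) L : (forall p, In p L -> f p <= 1) -> lsum f L <= INR (length L).
Proof.
 induction L as [|p L IH]; intros H; [go|]. cbn [lsum fold_right length]. fold (lsum f L). rewrite S_INR. have A := H p (or_introl eq_refl). have B := IH ltac:(intros; apply H; right; auto). lra.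
Qed.

Lemma lsum_rsum (f : nat -> nat -> R) L N : rsum (fun n => lsum (fun p => f p n) L) N = lsum (fun p => rsum (fun n => f p n) N) L.
Proof.
 induction L as [|p L IH]; cbn [lsum fold_right].
 - induction N as [|N IHN]; cbn [rsum]; [go|]. go.
 - fold (lsum (fun p => rsum (fun n => f p n) N) L). rewrite <- IH, <- rsum_plus. go.
Qed.

Lemma lsum_nonneg f L : (forall p, 0 <= f p) -> 0 <= lsum f L.
Proof. induction L as [|p L IH]; cbn [lsum fold_right]; [lra|]. go. Qed.

Lemma lsum_ge f L p : (forall p, 0 <= f p) -> In p L -> f p <= lsum f L.
Proof.
 intros H. induction L as [|q L IH]; intros HI; [destruct HI|]. cbn [lsum fold_right]. fold (lsum f L). destruct HI as [->|HI].
 - have Q := lsum_nonneg f L H. lra.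
 - specialize (IH HI). specialize (H q). lra.
Qed.

Definition ispow (p n : nat) : Prop := exists j, n = (p^S j)%nat.

(** A prime power is either free of the primes of L or a power of one of them. The second kind is
    rare: by [ispow_unique] each p has at most one power in a dyadic block. *)
Lemma vM_sieve L n M : (forall p, In p L -> pr p) -> vM n <= M -> 0 <= M -> vM n <= M*(copr L n+lsum (fun p => ind (ispow p n)) L).
Proof.
 intros HP HM H0. have : 0 <= copr L n by (unfold copr; em; lra). have Q := lsum_nonneg (fun p => ind (ispow p n)) L ltac:(intros; apply ind_nonneg).
 destruct (classic (exists p, ppow n p)) as [[p Hp]|V].
 - apply Rle_trans with (M*1); [lra|]. mul_l; auto. destruct (classic (In p L)) as [I|I].
  + have K := lsum_ge (fun p => ind (ispow p n)) L p ltac:(intros; apply ind_nonneg) I. cbv beta in K. rewrite ind_T in K; [lra|]. destruct Hp as [_ [j E]]. exists j. auto.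
  + unfold copr. destruct excluded_middle_informative as [E|E]; [lra|]. exfalso. apply E. intros r Hr D. destruct Hp as [Hp [j ->]]. apply pr_pow in D; auto. apply pr_eq in D; auto. subst; auto.
 - rewrite vM_npp by auto. go.
Qed.

Lemma ispow_unique p n n' y0 y1 : (2 <= p)%nat -> 0 < y0 -> y1 <= 2*y0 -> y0 < INR n <= y1 -> y0 < INR n' <= y1 -> ispow p n -> ispow p n' -> n = n'.
Proof.
 intros Hp H0 H1 H2 H3 [i ->] [j ->].
 have G : forall i j, (i < j)%nat -> y0 < INR (p^S i) -> INR (p^S j) <= y1 -> False.
 { intros a b Hab A B. assert (p^S a*2 <= p^S b)%nat. { replace (S b) with (S a+(b-a))%nat by lia. rewrite Nat.pow_add_r. apply Nat.mul_le_mono_l. replace (b-a)%nat with (S (b-a-1)) by lia. cbn [Nat.pow]. assert (p^(b-a-1) <> 0)%nat by (apply Nat.pow_nonzero; lia). nia. }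
  apply le_INR in H. rewrite mult_INR in H. simpl (INR 2) in H. lra. }
 destruct (Nat.lt_trichotomy i j) as [H|[->|H]]; [exfalso; apply (G i j)|go|exfalso; apply (G j i)]; auto; tauto.
Qed.

Lemma np_half n : np (/2) n = /sqrt (INR (S n)).
Proof.
 have : 0 < INR (S n) by go. rewrite <- Rpower_sqrt by auto. unfold Rpower, np. rewrite exp_Ropp. go.
Qed.

Lemma block_sum L y0 y1 E : (forall p, In p L -> pr p) -> 1 <= y0 <= y1 -> y1 <= 2*y0 -> 0 <= E ->
 (forall a M, INR M <= y1-y0+1 -> rsum (fun i => copr L (a+i)%nat) M <= E) ->
 forall N, rsum (fun n => ind (y0 < INR (S n) <= y1)*(vMn n*np (/2) n)) N <= (E+INR (length L))*(ln y1/sqrt y0).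
Proof.
 intros HP Hy H2 HE HC N. have L1 : 0 <= ln y1 by (rewrite <- ln_1; apply ln_le; lra). have : 0 < sqrt y0 by go.
 set (c := ln y1/sqrt y0). have : 0 <= c by go.
 set (G := fun n => copr L n+lsum (fun p => ind (ispow p n /\ y0 < INR n <= y1)) L).
 have : forall n, 0 <= G n. { intros n. unfold G. have Q := lsum_nonneg (fun p => ind (ispow p n /\ y0 < INR n <= y1)) L ltac:(intros; apply ind_nonneg). unfold copr. em; lra. }
 apply Rle_trans with (rsum (fun n => c*(ind (y0 < INR (S n) <= y1)*G (S n))) N).
 - apply rsum_le. intros n _. unfold ind at 1 2. destruct excluded_middle_informative as [I|I]; [|lra]. have V : vMn n <= ln y1. { le_tr; [apply vM_le_ln; lia|]. go. }
  have V2 := vM_sieve L _ _ HP V L1. fold (vMn n) in V2.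
  have E1 : lsum (fun p => ind (ispow p (S n))) L = lsum (fun p => ind (ispow p (S n) /\ y0 < INR (S n) <= y1)) L.
  { clear-I. induction L as [|p L IH]; cbn [lsum fold_right]; [go|]. f_equal; [|go]. unfold ind. em; em; tauto. }
  rewrite E1 in V2. fold (G (S n)) in V2. rewrite np_half.
  have : /sqrt (INR (S n)) <= /sqrt y0 by (apply Rinv_le_contravar; [auto|apply sqrt_le_1_alt; lra]).
  have : 0 < /sqrt (INR (S n)) by go. have : 0 <= vMn n by apply vM_nonneg.
  unfold c, Rdiv. go.
 - rewrite rsum_scal, (Rmult_comm _ c). mul_l; auto. apply rsum_window; auto; [lra|]. intros a M HM Ha Hb.
  unfold G. rewrite rsum_plus. apply Rplus_le_compat; [go|]. rewrite lsum_rsum. apply lsum_le_length. intros p Hp.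
  apply rsum_ind_unique. intros i j [I1 I2] [J1 J2].
  assert (a+i = a+j)%nat by (apply (ispow_unique p _ _ y0 y1); auto; [go|lra]). lia.
Qed.

Notation blk_up la D k n := (exp (la+INR k*D) < INR (S n) <= exp (la+INR (S k)*D)) (only parsing).
Notation blk_lo la D k n := (exp (la-INR (S k)*D) < INR (S n) <= exp (la-INR k*D)) (only parsing).
Notation blk_end la D k n := (INR (S n) = exp (la-INR (S k)*D)) (only parsing).
Notation blk3 la D k n := (ind (blk_up la D k n)+ind (blk_lo la D k n)+ind (blk_end la D k n)) (only parsing).

(* The last block sum, over a single point, pays for the half-open blocks. *)
Lemma sum_split (la D a : R) (k0 K : nat) (W : R -> R) (sk : nat -> R) : 0 < D -> (k0 <= K)%nat -> (forall v, 0 <= W v) -> (forall k, 0 <= sk k) ->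
 (forall v, Rabs v <= INR k0*D -> W v <= 1) ->
 (forall k v, (k0 <= k < K)%nat -> INR k*D < Rabs v <= INR (S k)*D -> W v <= sk k) ->
 (forall v, INR K*D < Rabs v -> W v <= exp (-(a*v^2))) ->
 forall N, rsum (fun n => vMn n*np (/2) n*W (la-ln (INR (S n)))) N <=
  rsum (fun n => ind (Rabs (la-ln (INR (S n))) <= INR k0*D)*(vMn n*np (/2) n)) N +
  rsum (fun k => ind (k0 <= k)%nat*sk k*(rsum (fun n => ind (blk_up la D k n)*(vMn n*np (/2) n)) N +
            rsum (fun n => ind (blk_lo la D k n)*(vMn n*np (/2) n)) N +
            rsum (fun n => ind (blk_end la D k n)*(vMn n*np (/2) n)) N)) K +
  rsum (fun n => ind (INR K*D < Rabs (la-ln (INR (S n))))*(vMn n*np (/2) n)*exp (-(a*(la-ln (INR (S n)))^2))) N.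
Proof.
 intros HD Hk HW Hsk H1 H2 H3 N.
 set (g := fun n => vMn n*np (/2) n). have : forall n, 0 <= g n by (intros n; apply Rmult_le_pos; [apply vM_nonneg|go]).
 match goal with |- _ <= _+?M+_ => replace M with (rsum (fun n => rsum (fun k => ind (k0 <= k)%nat*sk k*(blk3 la D k n*g n)) K) N) end.
 2:{ rewrite rsum_swap. apply rsum_ext. intros k _. rewrite rsum_scal. f_equal. rewrite <- !rsum_plus. apply rsum_ext. intros n _. go. }
 rewrite <- !rsum_plus. apply rsum_le. intros n _. fold (g n). set (v := la-ln (INR (S n))). have : 0 < INR (S n) by go.
 set (mid := rsum (fun k => ind (k0 <= k)%nat*sk k*(blk3 la D k n*g n)) K).
 have Hterm : forall k, 0 <= ind (k0 <= k)%nat*sk k*(blk3 la D k n*g n).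
 { intros k. have P1 := ind_nonneg (blk_up la D k n). have P2 := ind_nonneg (blk_lo la D k n). have P3 := ind_nonneg (blk_end la D k n). have P4 := ind_nonneg (k0 <= k)%nat.
  go. }
 have : 0 <= mid by (apply (rsum_incr _ 0 K); [auto|lia]).
 have Hw := ind_nonneg (Rabs v <= INR k0*D). have Hf := ind_nonneg (INR K*D < Rabs v). have He := exp_pos (-(a*v^2)). have HWv := HW v. have : 0 <= ind (Rabs v <= INR k0*D)*g n by go. have : 0 <= ind (INR K*D < Rabs v)*g n*exp (-(a*v^2)) by go.
 destruct (Rle_dec (Rabs v) (INR k0*D)) as [C1|C1].
 - have Q := H1 v C1. rewrite ind_T in * by auto. nra.
 - destruct (Rlt_dec (INR K*D) (Rabs v)) as [C2|C2].
  + have Q := H3 v C2. rewrite (ind_T (INR K*D < Rabs v)) in * by auto. nra.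
  + apply Rnot_lt_le in C2.
   have Ex : exists k, (k0 <= k < K)%nat /\ INR k*D < Rabs v <= INR (S k)*D.
   { clear-C1 C2 HD Hk. have Hle : (k0 <= K)%nat by lia. clear Hk. induction Hle as [|m Hm IH]; [lra|]. destruct (Rle_dec (Rabs v) (INR m*D)) as [C|C].
    - destruct (IH C) as [k [A B]]. exists k. split; [lia|auto].
    - exists m. go. }
   destruct Ex as [k [Kk Kv]]. have Q := H2 k v Kk Kv.
   have : W v*g n <= mid; [|lra].
   have B : ind (k0 <= k)%nat*sk k*(blk3 la D k n*g n) <= mid.
   { unfold mid. clear-Hterm Kk. induction K as [|m IH]; [lia|]. cbn [rsum]. have T0 := Hterm m. have : 0 <= rsum (fun k => ind (k0 <= k)%nat*sk k*(blk3 la D k n*g n)) m by (apply (rsum_incr _ 0 m); [auto|lia]).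
    destruct (Nat.eq_dec k m) as [->|Nk]; [lra|]. have IH' := IH ltac:(lia). lra. }
   le_tr; [|exact B]. rewrite ind_T by lia. have : 1 <= ind (blk_up la D k n)+ind (blk_lo la D k n)+ind (blk_end la D k n).
   { have P1 := ind_nonneg (blk_up la D k n). have P2 := ind_nonneg (blk_lo la D k n). have P3 := ind_nonneg (blk_end la D k n).
    have En : INR (S n) = exp (la-v) by (unfold v; replace (la-(la-ln (INR (S n)))) with (ln (INR (S n))) by ring; rewrite exp_ln; auto).
    destruct (Rle_dec 0 v) as [V|V].
    - rewrite Rabs_pos_eq in Kv by auto. destruct (Req_dec v (INR (S k)*D)) as [EV|EV].
     + rewrite (ind_T (blk_end la D k n)) by (rewrite En, EV; reflexivity). lra.
     + rewrite (ind_T (blk_lo la D k n)) by (rewrite En; split; [apply exp_increasing; lra|apply exp_le; lra]). lra.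
    - rewrite Rabs_left in Kv by lra. rewrite ind_T by (rewrite En; split; [apply exp_increasing; lra|apply exp_le; lra]). lra. }
   rewrite <- Rmult_assoc. go.
Qed.

#[export] Hint Resolve ind_nonneg ind_le1 lsum_nonneg : cont.

(* x = e^l, q = sqrt x, and h is half the length of ln [x, x + 22/25 sqrt x ln x]. *)
Definition geo (l q h : R) : Prop := 15 <= l /\ q = exp (l/2) /\ h = /2*ln (1+22/25*l/q).

Lemma exp_mul_INR y n : exp (INR n*y) = exp y^n.
Proof. induction n as [|n IH]; [rewrite Rmult_0_l, exp_0; reflexivity|]. rewrite S_INR, Rmult_plus_distr_r, Rmult_1_l, exp_plus, IH. go. Qed.

Lemma exp_neg_ge y : 0 <= y -> 1-y+y^2/2-y^3/6 <= exp (-y).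
Proof.
 intros H. have K := mono_incr (fun z => exp (-z)-(1-z+z^2/2-z^3/6)) (fun z => - exp (-z)+1-z+z^2/2) 0 y H. cbv beta in K.
 replace (- 0) with 0 in K by ring. rewrite exp_0 in K. enough (1-(1-0+0^2/2-0^3/6) <= exp (-y)-(1-y+y^2/2-y^3/6)) by lra. apply K.
 - intros x _. auto_derive; [go|]. field.
 - intros x Hx. have A := exp_ge_3 x $. have B := exp_pos (-x). have E : exp (-x)*exp x = 1 by (rewrite <- exp_plus, Rplus_opp_l; apply exp_0).
  have : exp (-x)*(1+x+x^2/2) <= 1 by (rewrite <- E; mul_l; nra).
  go.
Qed.

Lemma exp_le_inv x c : 0 < c -> c <= exp (-x) -> exp x <= /c.
Proof. intros Hc H. rewrite <- (Ropp_involutive x), exp_Ropp. go. Qed.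

(** The value of q at the smallest admissible l = 15. *)
Lemma exp_75 : 1800 <= exp (15/2).
Proof.
 replace (15/2) with (INR 75*/10) by go. rewrite exp_mul_INR. apply Rle_trans with ((11051666/10000000)^75); [lra|].
 apply pow_incr. have A := exp_ge_3 (/10) $. lra.
Qed.

Lemma geo_q l q h : geo l q h -> 1800*(1+(l-15)/2+((l-15)/2)^2/2+((l-15)/2)^3/6) <= q.
Proof.
 intros [H [-> _]]. replace (l/2) with (15/2+(l-15)/2) by field. rewrite exp_plus. have A := exp_ge_3 ((l-15)/2) $. have B := exp_75. go.
Qed.

Lemma geo_facts l q h : geo l q h -> 1800 <= q /\ l/q <= /120 /\ 0 < h /\ h*q <= 11/25*l /\ 11/25*l <= h*q*(1+22/25*l/q) /\ h <= 11/3000 /\ exp (2*h) = 1+22/25*l/q.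
Proof.
 intros G. have Q := geo_q _ _ _ G. destruct G as [H [_ Eh]]. set (t := (l-15)/2) in *. have : 0 <= t by go.
 assert (0 <= t^2) by go. assert (0 <= t^3) by go.
 have : 1800 <= q by lra. have : l/q <= /120. { apply (proj2 (Rle_div_l l _ q $)). go. }
 set (r := l/q) in *. have El : l = r*q by go.
 replace (22/25*l/q) with (22/25*r) in * by go. set (Y := 22/25*r) in *. have : 0 < Y by go.
 have A := ln_ge_1m (1+Y) $. have B := ln_le_m1 (1+Y) $.
 have : Y <= ln (1+Y)*(1+Y). { apply Rle_trans with ((1-/(1+Y))*(1+Y)); [right; field; lra|]. go. }
 assert (0 < h) by nra. repeat split; auto.
 - unfold Y in *. nra.
 - rewrite El, Eh. replace (11/25*(r*q)) with (/2*q*Y) by go. go.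
 - go.
 - rewrite Eh. replace (2*(/2*ln (1+Y))) with (ln (1+Y)) by field. apply exp_ln. lra.
Qed.

Lemma exp_20 y : y <= /20 -> exp y <= 53/50.
Proof. intros H. le_tr; [apply exp_le, H|]. le_tr; [apply (exp_le_inv _ (95/100)); [lra|]|lra]. have A := exp_neg_ge (/20) $. lra. Qed.

Lemma sqrt_exp y : sqrt (exp y) = exp (y/2).
Proof. replace (exp y) with (exp (y/2)*exp (y/2)) by go. apply sqrt_square. go. Qed.

Lemma block_one l q h D b g L s t N : geo l q h -> (forall p, In p L -> pr p) -> 0 <= s -> 0 <= t ->
 (forall a M, rsum (fun i => copr L (a+i)%nat) M <= s*INR M+t) ->
 0 < D -> - /11 <= b -> b+D <= /11 -> exp ((h+b)/2) <= g ->
 rsum (fun n => ind (exp (l+h+b) < INR (S n) <= exp (l+h+b+D))*(vMn n*np (/2) n)) N <= (l+/5)*(s*(q*D*(1+2*D)*g)+53/50*(s+t+INR (length L))/q).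
Proof.
 intros G HL Hs Ht HS HD Hb1 Hb2 Hg. destruct (geo_facts _ _ _ G) as [Q0 [_ [H0 [_ [_ [H1 _]]]]]]. destruct G as [Hl [Eq _]].
 set (r := exp ((l+h+b)/2)). have : 0 < r by apply exp_pos. have LL := pos_INR (length L).
 have Er : r = q*exp ((h+b)/2) by (unfold r; rewrite Eq, <- exp_plus; f_equal; field).
 have Er2 : exp (l+h+b) = r*r by (unfold r; rewrite <- exp_plus; f_equal; field).
 have ED : exp (l+h+b+D) = r*r*exp D by (rewrite <- Er2, <- exp_plus; reflexivity).
 have : 1+D <= exp D by apply exp_ineq1_le. have : exp D <= 1+D+2*D^2.
 { le_tr; [apply (exp_le_inv D (1-D)); [lra|]|]; [have W := exp_ineq1_le (-D); lra|]. apply Rmult_le_reg_r with (1-D); [lra|]. rewrite Rinv_l by lra. nra. }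
 have : /r <= 53/50/q. { rewrite Er, Rinv_mult, Rmult_comm. mul_r; [go|]. rewrite <- exp_Ropp. apply exp_20. lra. }
 have : 1 <= r*r by (rewrite <- Er2, <- exp_0; apply exp_le; lra).
 le_tr; [apply (block_sum L _ _ (s*(r*r*(exp D-1)+1)+t)); auto|].
 - go.
 - rewrite ED, Er2, Rmult_comm. go.
 - go.
 - intros a M HM. le_tr; [go|]. go.
 - rewrite ln_exp, sqrt_exp. fold r.
  replace ((s*(r*r*(exp D-1)+1)+t+INR (length L))*((l+h+b+D)/r)) with ((l+h+b+D)*(s*(r*(exp D-1))+(s+t+INR (length L))*/r)) by go.
  have : 0 <= s*(r*(exp D-1)) by go.
  have : 0 <= (s+t+INR (length L))*/r by go.
  apply Rmult_le_compat; [lra|lra|lra|]. apply Rplus_le_compat.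
  + rewrite Er. replace (q*D*(1+2*D)*g) with (q*(g*(D*(1+2*D)))) by ring. rewrite Rmult_assoc. go.
  + go.
Qed.

Lemma block_point l q h b N : geo l q h -> - /11 <= b <= /11 ->
 rsum (fun n => ind (INR (S n) = exp (l+h+b))*(vMn n*np (/2) n)) N <= (l+/5)*(53/50/q).
Proof.
 intros G Hb. destruct (geo_facts _ _ _ G) as [Q0 [_ [H0 [_ [_ [H1 _]]]]]]. destruct G as [Hl [Eq _]].
 have : 0 <= (l+/5)*(53/50/q) by go.
 apply Rle_trans with (rsum (fun n => (l+/5)*(53/50/q)*ind (INR (S n) = exp (l+h+b))) N).
 - apply rsum_le. intros n _. unfold ind. destruct excluded_middle_informative as [E|E]; [|lra]. rewrite Rmult_1_l, Rmult_1_r.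
  have : vMn n <= l+h+b. { le_tr; [apply vM_le_ln; lia|]. rewrite E, ln_exp. lra. }
  rewrite np_half, E, sqrt_exp, <- exp_Ropp. replace (-((l+h+b)/2)) with (-(l/2)+(-(h+b)/2)) by field. rewrite exp_plus, exp_Ropp, <- Eq.
  have : 0 <= vMn n by apply vM_nonneg. have X := exp_20 (-(h+b)/2) $. go.
 - rewrite rsum_scal. rewrite <- (Rmult_1_r ((l+/5)*(53/50/q))) at 2. mul_l; auto. apply rsum_ind_unique. intros i j A B. rewrite <- B in A. apply INR_eq in A. lia.
Qed.

Lemma block_pair l q h k g L s t N : geo l q h -> (forall p, In p L -> pr p) -> 0 <= s -> 0 <= t ->
 (forall a M, rsum (fun i => copr L (a+i)%nat) M <= s*INR M+t) -> let D := h/100 in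
 INR (S k)*D <= /11 -> exp ((h+INR k*D)/2) <= g ->
 rsum (fun n => ind (blk_up (l+h) D k n)*(vMn n*np (/2) n)) N +
 rsum (fun n => ind (blk_lo (l+h) D k n)*(vMn n*np (/2) n)) N +
 rsum (fun n => ind (blk_end (l+h) D k n)*(vMn n*np (/2) n)) N <=
 2*(l+/5)*(s*(q*D*(1+2*D)*g)+53/50*(s+t+INR (length L)+/2)/q).
Proof.
 intros G HL Hs Ht HS D HD Hg. destruct (geo_facts _ _ _ G) as [Q0 [_ [H0 [_ [_ [H1 _]]]]]]. rewrite S_INR in *. have D0 : 0 < D by go. have : 0 <= INR k*D by go.
 have A := block_one l q h D (INR k*D) g L s t N G HL Hs Ht HS D0 $ $ Hg.
 have B := block_one l q h D (-((INR k+1)*D)) g L s t N G HL Hs Ht HS D0 $ $ ltac:(le_tr; [apply exp_le|exact Hg]; lra).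
 have C := block_point l q h (-((INR k+1)*D)) N G $.
 replace (l+h+INR k*D+D) with (l+h+(INR k+1)*D) in A by ring.
 replace (l+h+- ((INR k+1)*D)+D) with (l+h-INR k*D) in B by ring. change (l+h+- ((INR k+1)*D)) with (l+h-(INR k+1)*D) in *.
 go.
Qed.

Lemma ln2_lb : 69/100 <= ln 2.
Proof.
 rewrite <- (ln_exp _). apply ln_le; [go|]. replace (69/100) with (INR 3*(23/100)) by go. rewrite exp_mul_INR.
 apply Rle_trans with ((/(794/1000))^3); [|lra]. apply pow_incr; split; [go|]. apply exp_le_inv; [lra|]. have A := exp_neg_ge (23/100) $. lra.
Qed.

(** * Proper prime powers inside the window, and the far tail *)

(** The exponent is at least 2, so the next power is farther by at least 2 m^(1+k), and m^(1+k) is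
    at least the square root of m^(2+k). *)
Lemma pow_gap m m' k x : 0 <= x -> (m < m')%nat -> x <= INR (m^(2+k)) -> INR (m^(2+k))+2*sqrt x <= INR (m'^(2+k)).
Proof.
 intros Hx Hm H. have A : (m^(2+k)+2*m^(1+k) <= m'^(2+k))%nat.
 { apply Nat.le_trans with (S m^(2+k))%nat; [|apply Nat.pow_le_mono_l; lia]. assert (m^k <= S m^k)%nat by (apply Nat.pow_le_mono_l; lia). cbn [Nat.add Nat.pow]. nia. }
 apply le_INR in A. rewrite plus_INR, mult_INR in A. simpl (INR 2) in A.
 have : sqrt x <= INR (m^(1+k)); [|lra]. rewrite <- sqrt_square by apply pos_INR. apply sqrt_le_1_alt. le_tr; [go|]. rewrite <- mult_INR. apply le_INR.
 destruct m as [|m]; [go|]. rewrite <- Nat.pow_add_r. apply Nat.pow_le_mono_r; lia.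
Qed.

Lemma power_count k x B N : 0 < x -> 0 <= B -> rsum (fun n => ind (exists m, S n = (m^(2+k))%nat /\ x <= INR (S n) <= x+B)) N <= 1+B/(2*sqrt x).
Proof.
 intros Hx HB. set (P := fun n => exists m, S n = (m^(2+k))%nat /\ x <= INR (S n) <= x+B). have : 0 < sqrt x by go.
 have I : rsum (fun n => ind (P n)) N = 0 \/ exists m, (m^(2+k) <= N)%nat /\ x <= INR (m^(2+k)) <= x+B /\ x+2*sqrt x*(rsum (fun n => ind (P n)) N-1) <= INR (m^(2+k)).
 { induction N as [|N IH]; [go|]. cbn [rsum]. destruct (classic (P N)) as [H|H].
  - right. rewrite ind_T by auto. destruct H as [m' [E H]]. exists m'. rewrite E in H. split; [lia|]. split; [auto|]. destruct IH as [->|[m [M1 [M2 M3]]]]; [lra|].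
   have Hm : (m < m')%nat. { destruct (le_lt_dec m' m) as [C|C]; auto. apply (Nat.pow_le_mono_l _ _ (2+k)) in C. lia. }
   have Q := pow_gap m _ k x $ Hm $. lra.
  - rewrite ind_F by auto. destruct IH as [->|[m [M1 M2]]]; [go|]. right. exists m. go. }
 change (rsum (fun n => ind (P n)) N <= 1+B/(2*sqrt x)). have : 0 <= B/(2*sqrt x) by go.
 destruct I as [->|[m [_ [M2 M3]]]]; [lra|]. enough (rsum (fun n => ind (P n)) N-1 <= B/(2*sqrt x)) by lra. apply (proj1 (Rle_div_r _ _ (2*sqrt x) $)). lra.
Qed.

(** With no primes in the window only proper prime powers remain. Their exponent is at least 2,
    which halves the bound ln n for [vM]. The exponents are at most log_2 of the upper end, and
    [power_count] limits the powers with each exponent; 69/100 stands for ln 2. *)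
Lemma window_sum l q h N : geo l q h -> (forall p, pr p -> ~ (q*q <= INR p <= q*q+22/25*q*l)) ->
 rsum (fun n => ind (Rabs (l+h-ln (INR (S n))) <= h)*(vMn n*np (/2) n)) N <= (l+/5)/(2*q)*((100/69*(l+/5))*(1+11/25*l)).
Proof.
 intros G NP. destruct (geo_facts _ _ _ G) as [Q0 [_ [H0 [_ [_ [H1 E2]]]]]]. destruct G as [Hl [Eq _]]. set (x := q*q). set (B := 22/25*q*l).
 have X : x = exp l by (unfold x; rewrite Eq, <- exp_plus; f_equal; field). have X2 : x+B = exp (l+2*h) by (rewrite exp_plus, E2, <- X; unfold x, B; field; lra). have : 0 < x by go.
 have Sx : sqrt x = q by (apply sqrt_square; lra). have : 0 <= B by go. have : 0 <= (l+/5)/(2*q) by go.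
 destruct (nat_floor (100/69*(l+/5)) $) as [M [M1 M2]].
 apply Rle_trans with (rsum (fun n => (l+/5)/(2*q)*rsum (fun k => ind (exists m, S n = (m^(2+k))%nat /\ x <= INR (S n) <= x+B)) M) N).
 - apply rsum_le. intros n _. set (F := fun k => ind (exists m, S n = (m^(2+k))%nat /\ x <= INR (S n) <= x+B)). have : forall k, 0 <= F k by (intros; apply ind_nonneg).
  have : 0 <= (l+/5)/(2*q)*rsum F M by (apply Rmult_le_pos; [auto|apply (rsum_incr F 0 M); [auto|lia]]).
  unfold ind at 1. destruct excluded_middle_informative as [W|W]; [|lra]. rewrite Rmult_1_l. destruct (classic (exists p, ppow (S n) p)) as [[p V]|V]; [|unfold vMn; rewrite vM_npp by auto; lra].
  apply Rabs_le_between in W. have : 0 < INR (S n) by go. have WN : x <= INR (S n) <= x+B by (rewrite X2, X, <- (exp_ln (INR (S n))) by auto; split; apply exp_le; lra).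
  unfold vMn. rewrite (vM_pp _ _ V). destruct V as [Hp [k Ek]]. have p2 := pr_ge2 p Hp. have : 2 <= INR p by (apply (le_INR 2); lia). have : 69/100 <= ln (INR p) by (le_tr; [apply ln2_lb|apply ln_le; lra]).
  have Eln : ln (INR (S n)) = INR (S k)*ln (INR p) by (rewrite Ek, pow_INR, ln_pow by lra; reflexivity).
  destruct k as [|k]. { exfalso. apply (NP p Hp). rewrite Ek, Nat.pow_1_r in WN. go. }
  have : (k < M)%nat. { apply INR_lt. rewrite !S_INR in *. go. }
  have : 1 <= rsum F M. { apply Rle_trans with (rsum F (S k)); [|apply rsum_incr; [auto|lia]]. cbn [rsum]. assert (0 <= rsum F k) by (apply (rsum_incr F 0 k); [auto|lia]). enough (F k = 1) by lra. apply ind_T. exists p. go. }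
  apply Rle_trans with ((l+/5)/(2*q)*1); [|go]. rewrite Rmult_1_r, np_half. replace ((l+/5)/(2*q)) with ((l+/5)/2*/q) by go.
  have KK := pos_INR k. rewrite !S_INR in Eln. rewrite <- S_INR in Eln. rewrite <- Sx at 1. go.
 - rewrite rsum_scal. mul_l; auto. rewrite rsum_swap. apply Rle_trans with (rsum (fun k => 1+11/25*l) M).
  + apply rsum_le. intros k _. le_tr; [apply power_count; auto|]. rewrite Sx. apply Req_le. go.
  + have : rsum (fun _ => 1+11/25*l) M = INR M*(1+11/25*l) by (clear; induction M as [|M IH]; [go|]; cbn [rsum]; rewrite IH, S_INR; ring). go.
Qed.

(** [a] is 1/(4 al) for al = 25 h^2/18. Since h is of order l/q, [a] is so large that beyond
    distance 9/100 the Gaussian beats n^(-2)/q, by completing the square. *)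
Lemma far_sum l q h a K N : geo l q h -> a = 9/50/h^2 -> 9/100 <= K ->
 rsum (fun n => ind (K < Rabs (l+h-ln (INR (S n))))*(vMn n*np (/2) n)*exp (-(a*(l+h-ln (INR (S n)))^2))) N <= /q.
Proof.
 intros G Ea HK. have Q := geo_q _ _ _ G. destruct (geo_facts _ _ _ G) as [Q0 [_ [H0 [_ [H2 [H1 _]]]]]]. destruct (geo_facts _ _ _ G) as [_ [_ [_ [H3 _]]]]. destruct G as [Hl [Eq _]].
 set (v := fun n => l+h-ln (INR (S n))).
 have : 2+5*l/2 <= 81/20000*a.
 { rewrite Ea. have : 0 < h^2 by go. replace (81/20000*(9/50/h^2)) with (729/1000000/h^2) by go. apply (proj1 (Rle_div_r _ _ (h^2) ltac:(auto))).
  apply Rmult_le_reg_r with (q^2); [go|]. assert ((h*q)^2 <= (11/25*l)^2) by go.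
  apply Rle_trans with ((2+5*l/2)*(11/25*l)^2); [go|]. set (u := (l-15)/2) in *. have : 0 <= u by go. replace l with (15+2*u) by go. go. }
 have : 1 <= a by lra. have : 2/a <= 2 by (apply (proj2 (Rle_div_l 2 2 a $)); lra).
 apply Rle_trans with (rsum (fun n => /(2*q)*np 2 n) N).
 - apply rsum_le. intros n _. fold (v n). unfold ind. destruct excluded_middle_informative as [C|C]; [|rewrite !Rmult_0_l; apply Rmult_le_pos; [go|go]].
  have : vMn n*np (/2) n <= 2. { apply Rle_trans with (/ /2*np (- /2) n*np (/2) n); [mul_r; [go|]; le_tr; [apply vM_le_ln; lia|apply ln_np; lra]|]. rewrite Rmult_assoc, np_add, Rplus_opp_l. unfold np. rewrite Rmult_0_l, Ropp_0, exp_0. lra. }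
  have : (9/100)^2 <= v n^2. { rewrite <- (pow2_abs (v n)). go. }
  apply Rle_trans with (2*exp (-(a*v n^2))); [go|].
  have : 0 <= (a*v n+2)^2/(2*a) by go. have : (a*v n+2)^2/(2*a) = a/2*v n^2+2*v n+2/a by go.
  apply Rle_trans with (2*(exp (-2)*/q*exp (-(2*ln (INR (S n)))))).
  + rewrite Eq, <- exp_Ropp, <- !exp_plus. mul_l; [lra|]. apply exp_le. have EV : ln (INR (S n)) = l+h-v n by go. rewrite EV. nra.
  + unfold np. rewrite Rinv_mult. have : exp (-2) <= /4. { replace (-2) with (-(2)) by ring. rewrite exp_Ropp. apply Rinv_le_contravar; [lra|]. have Y := exp_ge_3 2 $. lra. } rewrite <- !Rmult_assoc. go.
 - rewrite rsum_scal. have Z := np_sum 2 N $. rewrite Rinv_mult. have : 0 < /q by go. nra.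
Qed.

(** * The weight *)

(** The heights are multiples of one base frequency, so the average is a polynomial in a single
    cosine; these are its cosine coefficients ([weight_cos]). *)
Definition cw (j : nat) : R :=
 nth j (3646025 :: 6770372 :: 5232954 :: 3143596 :: 1220379 :: 4110 :: -370767 :: -243858 :: -23617 :: 36100 :: nil) 0/20691778.

(* With c = cos(21u/25), the weight exp(-9u^2/50) wP(c) is negative where the cosine is below 97/200; Q was chosen numerically to make its integral as large as possible while the coefficients cw of its cosine expansion sum to 1 in absolute value. *)
Definition Qw (c : R) : R := /10+167/100*c+294/100*c^2-12/100*c^3-152/100*c^4.
Definition wP (c : R) : R := (c-97/200)*Qw c^2/(10345889/2000000).

Lemma cos_step j x : cos (INR (S (S j))*x) = 2*cos x*cos (INR (S j)*x)-cos (INR j*x).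
Proof.
 replace (INR (S (S j))*x) with (INR (S j)*x+x) by go. replace (INR j*x) with (INR (S j)*x-x) by (rewrite !S_INR; ring). rewrite cos_plus, cos_minus. ring.
Qed.

Lemma weight_cos x : rsum (fun j => cw j*cos (INR j*x)) 10 = wP (cos x).
Proof.
 cbn [rsum]. rewrite !cos_step. replace (INR 1*x) with x by go. replace (INR 0*x) with 0 by go. rewrite cos_0. unfold cw, wP, Qw; cbn [nth]. field.
Qed.

Lemma cw_abs : rsum (fun j => Rabs (cw j)) 10 = 1.
Proof. cbn [rsum]. unfold cw; cbn [nth]. rewrite !Rabs_div, !Rabs_pos_eq by lra. rewrite Rabs_left, Rabs_left, Rabs_left by lra. rewrite !Rabs_pos_eq by lra. field. Qed.

Lemma wP_le1 x : wP (cos x) <= 1.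
Proof.
 rewrite <- weight_cos, <- cw_abs. apply rsum_le. intros j _. ub RRle_abs. rewrite Rabs_mult. rewrite <- (Rmult_1_r (Rabs (cw j))) at 2. mul_l; [go|]. apply Rabs_le, COS_bound.
Qed.

Lemma wP_neg c : c <= 97/200 -> wP c <= 0.
Proof. intros H. unfold wP, Rdiv at 1. go. Qed.

Lemma wP_mono a b : 97/200 <= a -> a <= b <= 1 -> 0 <= wP a <= wP b.
Proof.
 intros Ha Hb. have Q : forall c, 97/200 <= c <= 1 -> 0 <= Qw c. { intros c Hc. unfold Qw. assert (0 <= c^2 <= 1) by nra. go. }
 have : Qw a <= Qw b.
 { have : Qw b-Qw a = (b-a)*(167/100+294/100*(a+b)-12/100*(a^2+a*b+b^2)-152/100*((a+b)*(a^2+b^2))) by (unfold Qw; ring).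
  assert (a^2 <= 1) by nra. assert (b^2 <= 1) by nra. assert (a*b <= 1) by nra. assert ((a+b)*(a^2+b^2) <= (a+b)*2) by go.
  go. }
 have Qa := Q a $. unfold wP. go.
Qed.

Lemma cos_term_S x n : cos_term x (S n) = - x^2/((2*INR n+1)*(2*INR n+2))*cos_term x n.
Proof.
 unfold cos_term. replace (2*S n)%nat with (S (S (2*n))) by lia. rewrite !fact_simpl, !mult_INR, !S_INR, mult_INR. have F := INR_fact_neq_0 (2*n). have P := pos_INR n. simpl (INR 2). cbn [pow]. go.
Qed.
Lemma cos_term_0 x : cos_term x 0 = 1.
Proof. unfold cos_term. go. Qed.

Definition c8 (x : R) : R := 1-x^2/2+x^4/24-x^6/720+x^8/40320.

Lemma cos_up x : 0 <= x <= 2 -> cos x <= c8 x.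
Proof.
 intros H. destruct (pre_cos_bound x 1 $ $) as [_ B]. le_tr; [exact B|]. change (2*(1+1))%nat with 4%nat. unfold c8.
 unfold cos_approx; cbn [sum_f_R0]. rewrite !cos_term_S, cos_term_0. go.
Qed.

(** The Taylor lower bound for cos at 1.5707 is positive, which is impossible beyond PI/2. *)
Lemma PI_lb : 31414/10000 <= PI.
Proof.
 destruct (Rle_dec (31414/10000) PI) as [H|H]; auto. exfalso. have P3 := PI2_3_2.
 have A := cos_le_0 (15707/10000) $ $. destruct (pre_cos_bound (15707/10000) 2 $ $) as [B _]. change (2*2+1)%nat with 5%nat in B.
 unfold cos_approx in B; cbn [sum_f_R0] in B. rewrite !cos_term_S, cos_term_0 in B. simpl INR in B. lra.
Qed.

Definition e4 (y : R) : R := 1+y+y^2/2+y^3/6+y^4/24.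

Lemma e4_spec y : 0 <= y -> 1 <= e4 y /\ exp (-y) <= /e4 y.
Proof.
 intros H. have K := exp_ge_taylor y 4 H. simpl in K. assert (0 <= y^2) by go. assert (0 <= y^3) by go. assert (0 <= y^4) by go.
 assert (e4 y <= exp y) by (unfold e4; simpl; lra). assert (1 <= e4 y) by (unfold e4; lra). split; auto. rewrite exp_Ropp. go.
Qed.

(* Bounds for the weight at u = k/100: vn just outside the window, 0 for 127 <= k < 620, and the Gaussian alone beyond. *)
Definition vn (k : R) : R := Rmax 0 (wP (c8 (21/2500*k))/e4 (9/500000*k^2)).
Definition sn (k : nat) : R := if (100 <=? k)%nat && (k <? 127)%nat then vn (INR k) else 0.
Definition sf (k : nat) : R := if (k <? 620)%nat then 0 else exp (-(9/500000*INR k^2)).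

Lemma vn_le k c e r : 97/200 <= c8 (21/2500*k) <= c -> c <= 1 -> 0 < e <= e4 (9/500000*k^2) -> wP c <= r*e -> vn k <= r.
Proof.
 intros Hc H1 He Hr. destruct (wP_mono _ _ (proj1 Hc) (conj (proj2 Hc) H1)) as [A B]. apply Rmax_lub; [nra|]. apply Rle_trans with (wP c/e).
 - go.
 - apply (proj2 (Rle_div_l _ _ e $)). auto.
Qed.

Ltac vb k c e r := assert (vn k <= r/1000000) by (apply (vn_le k (c/100000) (e/100000)); unfold c8, e4, wP, Qw; lra).

(** Values at the left ends u = k/100 of the blocks. The arguments of [vb] are k, an upper bound for
    cos(21u/25) and a lower bound for e^(9u^2/50) in units of 10^(-5), and the resulting bound for
    the weight in units of 10^(-6). *)
Lemma sn_total : rsum (fun i => vn (INR (100+i))) 27 <= 8/5.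
Proof.
 cbn [rsum]. rewrite !INR_IZR_INZ. cbn [Nat.add Z.of_nat Pos.of_succ_nat Pos.succ].
 vb 100 66747 119721 140938. vb 101 66119 120155 132780. vb 102 65486 120595 124833. vb 103 64849 121041 117112. vb 104 64208 121492 109619. vb 105 63561 121950 102333. vb 106 62911 122414 95288. vb 107 62255 122885 88454. vb 108 61596 123361 81865. vb 109 60932 123844 75498. vb 110 60264 124333 69365. vb 111 59591 124828 63458. vb 112 58915 125330 57791. vb 113 58234 125839 52348. vb 114 57549 126354 47136. vb 115 56860 126876 42153. vb 116 56167 127405 37397. vb 117 55470 127940 32867. vb 118 54769 128482 28560. vb 119 54064 129032 24472. vb 120 53356 129588 20607. vb 121 52644 130151 16955. vb 122 51928 130722 13513. vb 123 51208 131299 10277. vb 124 50485 131884 7248. vb 125 49758 132476 4416. vb 126 49027 133076 1777.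
 lra.
Qed.

(** The positive part of the weight; here u = v/h, so the window is |u| <= 1. *)
Definition wf (h v : R) : R := Rmax 0 (exp (-(9/50/h^2*v^2))*wP (cos (21/25*v/h))).

Lemma sf_total K : rsum sf K <= 9/200.
Proof.
 (* (620 + i)^2 >= 620^2 + 1240 i, so the tail is dominated by a geometric series with this ratio
    and first term e^(-6.9192). *)
 set (r := exp (-(279/12500))). have : r <= 97793/100000.
 { destruct (e4_spec (279/12500) $) as [A B]. le_tr; [exact B|]. unfold e4. lra. }
 have : exp (-(43245/6250)) <= 99/100000.
 { replace (-(43245/6250)) with (INR 20*- (43245/125000)) by go. rewrite exp_mul_INR. destruct (e4_spec (43245/125000) $) as [A B].
  apply Rle_trans with ((/e4 (43245/125000))^20); [apply pow_incr; split; [go|auto]|]. apply Rle_trans with ((70757/100000)^20); [|lra]. apply pow_incr. split; [go|]. unfold e4. lra. }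
 have G : forall n, (1-r)*rsum (fun i => r^i) n <= 1. { intros n. have : (1-r)*rsum (fun i => r^i) n = 1-r^n by (induction n as [|n IH]; cbn [rsum pow]; [ring|go]). assert (0 < r^n) by go. lra. }
 apply Rle_trans with (rsum sf (620+K)).
 { apply rsum_incr; [|lia]. intros k. unfold sf. destruct (k <? 620)%nat; [lra|go]. }
 rewrite rsum_split. rewrite (rsum_zero _ 0 _); [cbn [rsum]|lia|intros k Hk; unfold sf; destruct (Nat.ltb_spec k 620); [go|lia]].
 apply Rle_trans with (rsum (fun i => 99/100000*r^i) K).
 - rewrite Rplus_0_l. apply rsum_le. intros i _. unfold sf. unfold r. rewrite <- exp_mul_INR, plus_INR. replace (INR 620) with 620 by go.
  apply Rle_trans with (exp (-(43245/6250))*exp (INR i*- (279/12500))); [|mul_r; [go|auto]].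
  rewrite <- exp_plus. apply exp_le. nra.
 - rewrite rsum_scal. specialize (G K). set (SS := rsum (fun i => r^i) K) in *. go.
Qed.

Lemma sn_sum K : (127 <= K)%nat -> rsum sn K <= 8/5.
Proof.
 intros HK. rewrite (rsum_zero _ _ K HK); [|intros k Hk; unfold sn; destruct (Nat.ltb_spec k 127); [lia|rewrite andb_false_r; reflexivity]].
 change 127%nat with (100+27)%nat. rewrite rsum_split, (rsum_zero _ 0 _); [change (rsum sn 0) with 0|lia|intros k Hk; unfold sn; destruct (Nat.leb_spec 100 k); [lia|go]].
 rewrite Rplus_0_l. le_tr; [|apply sn_total]. go.
Qed.

(** With x = 21u/25 this is the range 1.27 <= u <= 6.2, on which the weight is nonpositive: hence
    the block numbers 127 and 620. *)
Lemma cos_mid x : 10668/10000 <= x <= 5208/1000 -> cos x <= 97/200.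
Proof.
 intros H. have P := PI_lb. have : cos (10668/10000) <= 97/200 by (le_tr; [apply cos_up; lra|unfold c8; lra]).
 destruct (Rle_dec x PI) as [L|L].
 - le_tr; [apply (cos_decr_1 (10668/10000) x); lra|go].
 - replace (cos x) with (cos (2*PI-x)) by (rewrite cos_minus, cos_2PI, sin_2PI; ring). le_tr; [apply (cos_decr_1 (10668/10000) _); lra|go].
Qed.

Lemma wf_far h v : wf h v <= exp (-(9/50/h^2*v^2)).
Proof. have E := exp_pos (-(9/50/h^2*v^2)). apply Rmax_lub; [lra|]. rewrite <- (Rmult_1_r (exp _)) at 2. mul_l; [lra|apply wP_le1]. Qed.

Lemma wf_block h v k : 0 < h -> (100 <= k)%nat -> INR k*(h/100) < Rabs v <= INR (S k)*(h/100) -> wf h v <= sn k+sf k.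
Proof.
 intros Hh Hk Hv. set (u := Rabs v/h). have Ev : Rabs v = u*h by go. rewrite S_INR in Hv. have : INR k/100 < u <= (INR k+1)/100 by nra. have K1 := le_INR _ _ Hk. replace (INR 100) with 100 in K1 by go.
 have Ew : wf h v = Rmax 0 (exp (-(9/50*u^2))*wP (cos (21/25*u))).
 { unfold wf. f_equal. f_equal.
  - f_equal. replace (v^2) with (Rabs v^2) by apply pow2_abs. go.
  - f_equal. unfold u. unfold Rabs. destruct Rcase_abs; [rewrite <- cos_neg; f_equal; field; lra|go]. }
 have : 0 <= sf k by (unfold sf; destruct (k <? 620)%nat; [lra|go]).
 have : 0 <= vn (INR k) by apply Rmax_l. have : 0 <= sn k by (unfold sn; destruct (_ && _); [auto|lra]).
 have EM : exp (-(9/50*u^2)) <= exp (-(9/500000*INR k^2)) by (apply exp_le; nra).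
 destruct (Rle_dec (cos (21/25*u)) (97/200)) as [C|C].
 { rewrite Ew, Rmax_left; [lra|]. have W := wP_neg _ C. have E0 := exp_pos (-(9/50*u^2)). nra. }
 apply Rnot_le_lt in C. destruct (le_lt_dec 620 k) as [F|F].
 - enough (wf h v <= sf k) by lra. ub wf_far. unfold sf. destruct (Nat.ltb_spec k 620); [lia|]. le_tr; [|exact EM]. right. rewrite <- (pow2_abs v), Ev. go.
 - destruct (le_lt_dec 127 k) as [M|M].
  + exfalso. apply le_INR in M. replace (INR 127) with 127 in M by go. have F2 : (S k <= 620)%nat by lia. apply le_INR in F2. rewrite S_INR in F2. replace (INR 620) with 620 in F2 by go. have Q := cos_mid (21/25*u) $. lra.
  + have M2 : (S k <= 127)%nat by lia. apply le_INR in M2. rewrite S_INR in M2. replace (INR 127) with 127 in M2 by go.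
   enough (wf h v <= sn k) by lra. unfold sn. destruct (Nat.leb_spec 100 k); [|lia]. destruct (Nat.ltb_spec k 127); [|lia]. rewrite Ew. apply Rle_max_compat_l.
   have P := PI_lb. have C1 : cos (21/25*u) <= c8 (21/2500*INR k) by (le_tr; [apply (cos_decr_1 (21/2500*INR k)); lra|apply cos_up; lra]).
   have C2 : c8 (21/2500*INR k) <= 1. { unfold c8. set (y := 21/2500*INR k). assert (0 <= y <= 2) by go. assert (0 <= y^2 <= 4) by nra. go. }
   destruct (wP_mono _ _ ltac:(left; exact C) (conj C1 C2)) as [W1 W2]. destruct (e4_spec (9/500000*INR k^2) ltac:(go)) as [_ W3].
   rewrite Rmult_comm. apply Rmult_le_compat; [auto|go|auto|lra].
Qed.

Definition Yb (q s t : R) (L : list nat) : R := 53/50*(s+t+INR (length L)+/2)/q.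
(** Four sources: proper powers inside the window, the blocks just outside it with total weight 8/5,
    the blocks from 620 on with total weight 9/200, and the far tail 1/q. *)
Definition Btot (l q h s t : R) (L : list nat) : R :=
 (l+/5)/(2*q)*((100/69*(l+/5))*(1+11/25*l)) +
 2*(l+/5)*((s*(q*(h/100)*(1+2*(h/100))*(1+5/4*h))+Yb q s t L)*(8/5)+(s*(q*(h/100)*(1+2*(h/100))*(53/50))+Yb q s t L)*(9/200))+/q.

Lemma prime_sum l q h s t L : geo l q h -> (forall p, pr p -> ~ (q*q <= INR p <= q*q+22/25*q*l)) -> (forall p, In p L -> pr p) -> 0 <= s -> 0 <= t ->
 (forall a M, rsum (fun i => copr L (a+i)%nat) M <= s*INR M+t) ->
 forall N, rsum (fun n => vMn n*np (/2) n*wf h (l+h-ln (INR (S n)))) N <= Btot l q h s t L.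
Proof.
 (* K blocks of width h/100 reach beyond 9/100, where [far_sum] takes over, and end before 1/11,
    where the estimates for single blocks are still valid. *)
 intros G NP HL Hs Ht HS N. destruct (geo_facts _ _ _ G) as [Q0 [_ [H0 [_ [_ [H1 _]]]]]]. destruct (nat_floor (9/h) ltac:(go)) as [K0 [K1 K2]]. set (K := S K0) in *.
 set (D := h/100). have D0 : 0 < D by go. have L0 := proj1 G.
 have : 9/100 <= INR K*D. { apply (Rmult_lt_compat_r h) in K2; [|auto]. unfold D. replace (9/h*h) with 9 in K2 by go. lra. }
 have : INR K*D <= /11. { apply (Rmult_le_compat_r h) in K1; [|lra]. unfold D, K. rewrite S_INR. replace (9/h*h) with 9 in K1 by go. lra. }
 have : (620 <= K)%nat. { apply INR_le. replace (INR 620) with 620 by go. go. }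
 have E100 : INR 100*D = h by (unfold D; replace (INR 100) with 100 by go; field).
 have S0 : forall k, 0 <= sn k+sf k. { intros k. unfold sn, sf. assert (0 <= vn (INR k)) by apply Rmax_l. have E0 := exp_pos (-(9/500000*INR k^2)). destruct (_ && _), (k <? 620)%nat; lra. }
 ub ((sum_split _ D _ 100 K _ (fun k => sn k+sf k) D0)).
 - lia.
 - intros; apply Rmax_l.
 - go.
 - intros v _. ub wf_far. rewrite <- exp_0. assert (0 <= 9/50/h^2) by go. go.
 - intros k v Hk Hv. apply wf_block; auto; lia.
 - intros v _. apply wf_far.
 - rewrite E100. apply Rplus_le_compat; [apply Rplus_le_compat; [apply window_sum; auto|]|apply far_sum; auto].
  set (X1 := s*(q*D*(1+2*D)*(1+5/4*h))+Yb q s t L). set (X2 := s*(q*D*(1+2*D)*(53/50))+Yb q s t L).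
  have : 0 <= Yb q s t L by (apply Rdiv_le_0_compat; [go|lra]).
  apply Rle_trans with (rsum (fun k => 2*(l+/5)*X1*sn k+2*(l+/5)*X2*sf k) K).
  + apply rsum_le. intros k Hk. rewrite Rmult_comm.
   match goal with |- ?Z*_ <= _ => set (Bk := Z) end.
   have : 0 <= Bk by (unfold Bk; repeat apply Rplus_le_le_0_compat; match goal with |- 0 <= rsum ?f N => apply (rsum_incr f 0 N); [intros i; apply Rmult_le_pos; [go|apply Rmult_le_pos; [apply vM_nonneg|go]]|lia] end).
   have KDk : INR (S k)*D <= /11 by (le_tr; [mul_r; [lra|apply le_INR; exact Hk]|go]).
   have BB : forall g, exp ((h+INR k*D)/2) <= g -> Bk <= 2*(l+/5)*(s*(q*D*(1+2*D)*g)+Yb q s t L) by (intros g Hg; apply block_pair; auto).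
   have : INR k*D <= /11 by (rewrite S_INR in KDk; lra).
   have I1 := ind_le1 (100 <= k)%nat. have : 0 <= sf k by (unfold sf; destruct (k <? 620)%nat; [lra|go]).
   have : Bk <= 2*(l+/5)*X2 by (apply BB, exp_20; lra).
   have : Bk*sn k <= 2*(l+/5)*X1*sn k.
   { unfold sn. destruct (Nat.leb_spec 100 k); [|go]. destruct (Nat.ltb_spec k 127) as [M2|]; [|go]. mul_r; [apply Rmax_l|]. apply BB.
    have M3 : (k <= 126)%nat by lia. apply le_INR in M3. replace (INR 126) with 126 in M3 by go. have : INR k*D <= 126/100*h by (unfold D; nra).
    (* The last block just outside the window has k = 126, and (h + 126h/100)/2 = 113h/100. *)
    apply Rle_trans with (exp (113/100*h)); [apply exp_le; lra|]. le_tr; [apply (exp_le_inv _ (1-113/100*h)); [lra|have Z := exp_ineq1_le (-(113/100*h)); lra]|].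
    apply Rmult_le_reg_r with (1-113/100*h); [lra|]. rewrite Rinv_l by lra. nra. }
   have : Bk*sf k <= 2*(l+/5)*X2*sf k by go.
   apply Rle_trans with (Bk*(sn k+sf k)); [|lra]. mul_l; auto. specialize (S0 k). nra.
  + rewrite rsum_plus, !rsum_scal. have A1 := sn_sum K ltac:(lia). have A2 := sf_total K.
   fold D X1 X2. replace (2*(l+/5)*(X1*(8/5)+X2*(9/200))) with (2*(l+/5)*X1*(8/5)+2*(l+/5)*X2*(9/200)) by ring. go.
Qed.

(** * Evaluation of both sides of the averaged inequality *)

Definition ta (h : R) (j : nat) : R := INR j*(21/25/h).

(** The choice al = 25 h^2/18 makes 1/(4 al) = 9/(50 h^2), so the weight depends on v/h alone. *)
Lemma gw_wf h v : 0 < h -> Rmax 0 (gw (25/18*h^2) cw (ta h) 10 v) = wf h v.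
Proof.
 intros Hh. unfold wf, gw. f_equal. f_equal; [go|]. rewrite <- weight_cos. apply rsum_ext. intros j _. f_equal. unfold ta. go.
Qed.

Lemma Kg_val y : 0 < y -> Kg y = sqrt (PI/y).
Proof.
 intros Hy. have P := PI_RGT_0. replace y with (PI*(y/PI)) at 1 by go. assert (0 < y/PI) by go. rewrite Kg_scale, Kg_PI, Rmult_1_r by auto.
 rewrite <- sqrt_inv. go.
Qed.

Lemma sqrt_ge_sq a b : 0 <= a -> a^2 <= b -> a <= sqrt b.
Proof. intros Ha H. rewrite <- (sqrt_pow2 a Ha). go. Qed.
Lemma sqrt_le_sq a b : 0 <= a -> b <= a^2 -> sqrt b <= a.
Proof. intros Ha H. rewrite <- (sqrt_pow2 a Ha). go. Qed.

(** Here al tau_j^2 = 49 j^2/50, while al tau_j is O(h) so the cosines are nearly 1. The sum is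
    close to that of cw_j z^(j^2) with z = e^(-49/50), and j = 0, 1, 2 supply the lower bound. *)
Lemma main_coef h : 0 < h <= 11/3000 -> let al := 25/18*h^2 in
 38/125 <= rsum (fun j => cw j*(exp (al*(/4-ta h j^2))*cos (al*ta h j))) 10.
Proof.
 intros Hh al. set (z := exp (-(49/50))). set (E := exp (al/4)). have : 0 <= h^2 by apply pow2_ge_0.
 have : 1 <= E by (unfold E; rewrite <- exp_0; apply exp_le; unfold al; lra).
 have : 3753/10000 <= z. { unfold z. replace (-(49/50)) with (INR 20*- (49/1000)) by go. rewrite exp_mul_INR. apply Rle_trans with ((95218/100000)^20); [lra|]. apply pow_incr. have A := exp_neg_ge (49/1000) $. lra. }
 have : z <= 377/1000. { destruct (e4_spec (49/50) $) as [_ B]. le_tr; [exact B|]. unfold e4. lra. }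
 have Ez : forall j, exp (al*(/4-ta h j^2)) = E*z^(j*j). { intros j. unfold E, z. rewrite <- exp_mul_INR, <- exp_plus, mult_INR. unfold al, ta. go. }
 have C : forall j, 1-(7/6*(INR j*h))^2/2 <= cos (al*ta h j) <= 1.
 { split; [|apply COS_bound]. replace (al*ta h j) with (7/6*(INR j*h)) by (unfold al, ta; field; lra). set (y := 7/6*(INR j*h)). clearbody y. replace y with (2*(y/2)) at 2 by field. rewrite cos_2a_sin. have : sin (y/2)*sin (y/2) <= (y/2)*(y/2); [|lra]. apply Rsqr_le_abs_1.
  have G : forall w, 0 <= w -> Rabs (sin w) <= w. { intros w Hw. destruct (Rle_dec w 1) as [L|L]; [|apply Rle_trans with 1; [apply Rabs_le; generalize (SIN_bound w); lra|lra]]. have P3 := PI2_3_2. destruct (Rle_lt_or_eq_dec _ _ Hw) as [Hp|<-]; [|rewrite sin_0, Rabs_R0; lra]. rewrite Rabs_pos_eq by (apply sin_ge_0; lra). left. apply sin_lt_x; auto. }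
  destruct (Rle_dec 0 (y/2)) as [P|P]; [rewrite (Rabs_pos_eq (y/2)) by auto; apply G; auto|]. rewrite <- Rabs_Ropp, <- sin_neg, (Rabs_left (y/2)) by lra. apply G. lra. }
 rewrite (rsum_ext _ (fun j => E*(cw j*(z^(j*j)*cos (al*ta h j))))) by (intros; rewrite Ez; ring). rewrite rsum_scal.
 set (T := fun j => cw j*(z^(j*j)*cos (al*ta h j))). enough (B : 38/125 <= rsum T 10) by nra.
 have Hj : forall j : nat, (j <= 10)%nat -> 999/1000 <= cos (al*ta h j) <= 1.
 { intros j Hj. apply le_INR in Hj. replace (INR 10) with 10 in Hj by go. destruct (C j) as [C1 C2]. split; auto. le_tr; [|exact C1]. assert (0 <= INR j*h <= 11/300) by go. nra. }
 have : 3753/10000*(3753/10000*(3753/10000*(3753/10000))) <= z^(2*2). { replace (3753/10000*(3753/10000*(3753/10000*(3753/10000)))) with ((3753/10000)^(2*2)) by go. go. }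
 have TP : forall j, 0 <= cw j -> (j <= 10)%nat -> 0 <= T j. { intros j H1 H2. unfold T. specialize (Hj j H2). go. }
 have TN : forall j, -1/50 <= cw j -> (6 <= j <= 10)%nat -> - /1000000 <= T j.
 { intros j H1 H2. unfold T. specialize (Hj j ltac:(lia)). have : z^(j*j) <= /100000.
  { apply Rle_trans with (z^36). - have Q : forall n, (36 <= n)%nat -> z^n <= z^36. { intros n Hn. induction Hn as [|n Hn IH]; [lra|]. cbn [pow]. go. } apply Q. nia.
   - apply Rle_trans with ((377/1000)^36); [apply pow_incr; lra|lra]. }
  assert (0 <= z^(j*j)*cos (al*ta h j) <= /100000) by go. nra. }
 have : T 0%nat = 3646025/20691778. { unfold T, cw, ta. cbn [nth Nat.mul pow INR]. replace (al*(0*(21/25/h))) with 0 by ring. rewrite cos_0. field. }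
 have : 3753/10000*(99999/100000)*(6770372/20691778) <= T 1%nat. { unfold T, cw. cbn [nth Nat.mul Nat.add]. destruct (C 1%nat) as [C1 _]. replace (INR 1) with 1 in C1 by reflexivity. go. }
 have : 3753/10000*(3753/10000*(3753/10000*(3753/10000)))*(999/1000)*(5232954/20691778) <= T 2%nat. { unfold T, cw. cbn [nth]. specialize (Hj 2%nat ltac:(lia)). go. }
 have T3 := TP 3%nat ltac:(unfold cw; cbn [nth]; lra) ltac:(lia). have T4 := TP 4%nat ltac:(unfold cw; cbn [nth]; lra) ltac:(lia). have T5 := TP 5%nat ltac:(unfold cw; cbn [nth]; lra) ltac:(lia). have T9 := TP 9%nat ltac:(unfold cw; cbn [nth]; lra) ltac:(lia).
 have T6 := TN 6%nat ltac:(unfold cw; cbn [nth]; lra) ltac:(lia). have T7 := TN 7%nat ltac:(unfold cw; cbn [nth]; lra) ltac:(lia). have T8 := TN 8%nat ltac:(unfold cw; cbn [nth]; lra) ltac:(lia).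
 go.
Qed.

(** The base exceeds e^(1/10), so a logarithm is bounded in steps of one tenth by rational
    arithmetic. *)
Lemma ln_le_tenth n y : 0 < y -> y*(1105177/1000000)^n <= 1 -> ln y <= - (INR n/10).
Proof.
 intros Hy H. rewrite <- ln_exp. apply ln_le; auto. replace (INR n/10) with (INR n*/10) by field. rewrite exp_Ropp, exp_mul_INR.
 have : exp (/10) <= 1105177/1000000. { le_tr; [apply (exp_le_inv _ (904833/1000000)); [lra|]|lra]. have B := exp_neg_ge (/10) $. lra. }
 have B : exp (/10)^n <= (1105177/1000000)^n by go. have : 0 < exp (/10)^n by go.
 apply Rmult_le_reg_r with (exp (/10)^n); auto. rewrite Rinv_l by lra. go.
Qed.

(** Separates the scale: -ln(h)/2 is common to all heights, and the rest depends on j up to a small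
    term in h^2. *)
Lemma dens_split h j : 0 < h -> dens (25/18*h^2) (ta h j) = - /2*ln h+/4*ln ((441/625*INR j^2+9/25+5*h^2)/(4*PI^2)).
Proof.
 intros Hh. have P := PI_RGT_0. have : 0 < h^2 by go. unfold dens. replace (T2 (25/18*h^2) (ta h j)/(4*PI^2)) with (/(h^2)*((441/625*INR j^2+9/25+5*h^2)/(4*PI^2))) by (unfold T2, ta; field; lra).
 rewrite ln_mult by go. rewrite ln_Rinv by auto. replace (ln (h^2)) with (2*ln h) by (rewrite ln_pow by auto; simpl; ring). field.
Qed.

Lemma dens_total h : 0 < h <= 11/3000 -> rsum (fun j => Rabs (cw j)*dens (25/18*h^2) (ta h j)) 10 <= - /2*ln h-7365/10000.
Proof.
 intros Hh. set (D := fun j => ln ((441/625*INR j^2+9/25+5*h^2)/(4*PI^2))).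
 rewrite (rsum_ext _ (fun j => - /2*ln h*Rabs (cw j)+/4*(Rabs (cw j)*D j))) by (intros j _; rewrite dens_split by lra; unfold D; ring). rewrite rsum_plus, !rsum_scal, cw_abs.
 enough (rsum (fun j => Rabs (cw j)*D j) 10 <= - 2946/1000) by lra.
 have PL := PI_lb. have : 39473/1000 <= 4*PI^2 by nra. have : 0 <= 5*h^2 <= /10000 by nra.
 have DB : forall j n, (441/625*INR j^2+9/25+/10000)*(1105177/1000000)^n <= 39473/1000 -> D j <= - (INR n/10).
 { intros j n H. apply ln_le_tenth; [go|]. set (w := (1105177/1000000)^n) in *. replace ((441/625*INR j^2+9/25+5*h^2)/(4*PI^2)*w) with ((441/625*INR j^2+9/25+5*h^2)*w/(4*PI^2)) by go. apply (proj2 (Rle_div_l _ _ (4*PI^2) $)). nra. }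
 (* The second argument is the number of tenths by which [D j] is shown to lie below 0. *)
 have D0 := DB 0%nat 46%nat ltac:(go). have D1 := DB 1%nat 36%nat ltac:(go). have D2 := DB 2%nat 25%nat ltac:(go). have D3 := DB 3%nat 17%nat ltac:(go). have D4 := DB 4%nat 12%nat ltac:(go).
 have D5 := DB 5%nat 0%nat ltac:(go). have D6 := DB 6%nat 0%nat ltac:(go). have D7 := DB 7%nat 0%nat ltac:(go).
 have DU : forall j, (j <= 9)%nat -> D j <= 1. { intros j Hj. apply le_INR in Hj. have J0 := pos_INR j. simpl (INR 9) in Hj. have : 0 <= INR j^2 <= 81 by nra. le_tr; [apply ln_le_m1, Rdiv_lt_0_compat; lra|]. enough ((441/625*INR j^2+9/25+5*h^2)/(4*PI^2) <= 2) by lra. apply (proj2 (Rle_div_l _ _ (4*PI^2) $)). lra. }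
 have D8 := DU 8%nat ltac:(lia). have D9 := DU 9%nat ltac:(lia). rewrite !INR_IZR_INZ in D0, D1, D2, D3, D4, D5, D6, D7. cbn [Z.of_nat Pos.of_succ_nat Pos.succ] in *. clearbody D. cbn [rsum]. unfold cw; cbn [nth]. rewrite !Rabs_div, !Rabs_pos_eq by lra. rewrite Rabs_left, Rabs_left, Rabs_left by lra. rewrite !Rabs_pos_eq by lra. lra.
Qed.

Lemma exp_neg_sq y : 0 < y -> exp (-y) <= 2/y^2.
Proof. intros H. have A := exp_ge_3 y $. rewrite exp_Ropp. replace (2/y^2) with (/(y^2/2)) by go. go. Qed.

(** The bulk is 2 Kg(1/(8 al)), below 67h/5. Everything that carries e^(-la^2/(4 al)) is negligible,
    because that exponent is of order (l/h)^2. *)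
Lemma err_total l q h j : geo l q h -> (j < 10)%nat -> let al := 25/18*h^2 in
 errE al (l+h) (ta h j)+exp (l+h-(l+h)^2/(4*al)) <= 69/5*h+4/q.
Proof.
 intros G Hj al. destruct (geo_facts _ _ _ G) as [Q0 [_ [H0 [_ [_ [H1 _]]]]]]. destruct G as [Hl [Eq _]]. have h2 : 0 < h^2 by go. have P4 := PI_4. have PL := PI_lb.
 set (y := (l+h)^2/(4*al)). have Ey : y = 9/50*(l+h)^2/h^2 by go.
 have : 40 <= y*h^2. { rewrite Ey. replace (9/50*(l+h)^2/h^2*h^2) with (9/50*(l+h)^2) by go. nra. }
 have : h^2 <= 11/3000*h by nra. have : 1000 <= y by nra.
 have : 2*(l+h) <= y. { rewrite Ey. apply (proj1 (Rle_div_r _ _ _ h2)). nra. }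
 have : 2*Kg (/(8*al)) <= 67/5*h.
 { rewrite Kg_val by go. enough (sqrt (PI// (8*al)) <= 67/10*h) by lra. apply sqrt_le_sq; [lra|]. replace (PI// (8*al)) with (PI*(100/9)*h^2) by go. go. }
 have : 4*exp (-(l+h)/2) <= 4/q. { mul_l; [lra|]. rewrite Eq, <- exp_Ropp. go. }
 have : Rabs (dens al (ta h j)) <= y.
 { unfold al. rewrite dens_split by auto. have : 0 <= INR j^2 <= 81. { have J0 := pos_INR j. have J9 : (j <= 9)%nat by lia. apply le_INR in J9. simpl (INR 9) in J9. nra. }
  set (w := (441/625*INR j^2+9/25+5*h^2)/(4*PI^2)). have : w <= 2 by (unfold w; apply (proj2 (Rle_div_l _ _ (4*PI^2) ltac:(nra))); nra). have : /200 <= w by (unfold w; apply (proj1 (Rle_div_r _ _ (4*PI^2) ltac:(nra))); nra).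
  have L1 := ln_le_m1 w $. have L2 := ln_ge_1m w $. assert (/w <= 200) by (rewrite <- Rinv_inv; apply Rinv_le_contravar; lra).
  have L3 := ln_le_m1 h H0. have L4 := ln_ge_1m h H0. have : /h <= y. { rewrite <- (Rmult_1_l _). apply (proj2 (Rle_div_l _ _ h H0)). nra. } apply Rabs_le. lra. }
 have E1 := exp_neg_sq y $. have : exp (-y)*(Rabs (dens al (ta h j))+/2+(l+h)^2/(8*al)) <= /10*h.
 { replace ((l+h)^2/(8*al)) with (y/2) by go. apply Rle_trans with (2/y^2*(2*y)); [go|].
  replace (2/y^2*(2*y)) with (4/y) by go. apply (proj2 (Rle_div_l _ _ y $)). nra. }
 have : exp (l+h-y) <= /100*h.
 { apply Rle_trans with (exp (-(y/2))); [apply exp_le; lra|]. le_tr; [apply exp_neg_sq; lra|]. replace (2/(y/2)^2) with (8/y^2) by go. apply (proj2 (Rle_div_l _ _ (y^2) ltac:(nra))). nra. }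
 unfold errE. go.
Qed.

(** The term l/4 arises from -ln(h)/2 = l/4 - ln(hq)/2. The factor 31749/25000 is 16710/4000, from
    the Gaussian constant, times 38/125 from [main_coef]; 477/10000 is 53/50 times 9/200, and
    329/200 is 8/5 + 9/200. *)
Lemma final_ineq (RH : RiemannHypothesis) l q h s t L : geo l q h -> (forall p, pr p -> ~ (q*q <= INR p <= q*q+22/25*q*l)) -> (forall p, In p L -> pr p) -> 0 <= s -> 0 <= t ->
 (forall a M, rsum (fun i => copr L (a+i)%nat) M <= s*INR M+t) ->
 /2*(h*q)*(31749/25000-(l+/5)*s*((1+h/50)*((1+5/4*h)*(8/5)+477/10000))/50)+/2*ln (h*q)+7365/10000 <=
 l/4+69/5*h+4/q+(l+/5)^2*(25/69)*(1+11/25*l)/q+329/200*(l+/5)*Yb q s t L+/(2*q).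
Proof.
 intros G NP HL Hs Ht HS. have PS := prime_sum l q h s t L G NP HL Hs Ht HS. destruct (geo_facts _ _ _ G) as [Q0 [_ [H0 [_ [_ [H1 _]]]]]]. have G' := G. destruct G as [Hl [Eq _]].
 set (al := 25/18*h^2). have Hal : 0 < al <= /64 by (unfold al; nra).
 have W := weighted_explicit RH _ (l+h) cw (ta h) 10 (Btot l q h s t L) Hal $.
 have W' := W ltac:(intros N; le_tr; [right; apply rsum_ext; intros n _; unfold al; rewrite gw_wf by auto; reflexivity|go]). have : rsum (fun j => Rabs (cw j)*(dens al (ta h j)+errE al (l+h) (ta h j)+exp (l+h-(l+h)^2/(4*al)))) 10 <= - /2*ln h-7365/10000+(69/5*h+4/q).
 { apply Rle_trans with (rsum (fun j => Rabs (cw j)*dens al (ta h j)+(69/5*h+4/q)*Rabs (cw j)) 10).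
  - apply rsum_le. intros j Hj. have A := err_total l q h j G' Hj. cbv zeta in A. fold al in A. have B := Rabs_pos (cw j). nra.
  - rewrite rsum_plus, rsum_scal, cw_abs. have A := dens_total h (conj H0 H1). go. }
 have M := main_coef h (conj H0 H1). cbv zeta in M. set (Mc := rsum (fun j => cw j*(exp (al*(/4-ta h j^2))*cos (al*ta h j))) 10) in *.
 have : 16710/4000*h <= Kg (/(4*al)).
 { rewrite Kg_val by go. have PL := PI_lb. apply sqrt_ge_sq; [lra|]. replace (PI// (4*al)) with (PI*(50/9)*h^2) by go. go. }
 have : q <= exp ((l+h)/2) by (rewrite Eq; apply exp_le; lra).
 have A : q*(16710/4000*h)*(38/125) <= exp ((l+h)/2)*Kg (/(4*al))*Mc.
 { go. }
 have : ln h = ln (h*q)-l/2 by (rewrite ln_mult by lra; rewrite Eq, ln_exp; ring).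
 have : Btot l q h s t L = 2*((l+/5)^2*(25/69)*(1+11/25*l)/q+329/200*(l+/5)*Yb q s t L+/(2*q)+/2*(h*q)*((l+/5)*s*((1+h/50)*((1+5/4*h)*(8/5)+477/10000))/50)) by (unfold Btot; field; lra).
 go.
Qed.

(** * Conclusion for large x *)

Lemma ln_lb n a c y : 0 < c -> c <= 1-a+a^2/2-a^3/6 -> 0 <= a -> 1 <= y*c^n -> INR n*a <= ln y.
Proof.
 intros Hc H Ha Hy. have : 0 < c^n by go. rewrite <- (ln_exp _). apply ln_le; [go|]. rewrite exp_mul_INR.
 apply Rle_trans with ((/c)^n); [apply pow_incr; split; [go|apply exp_le_inv; auto; le_tr; [exact H|apply exp_neg_ge; auto]]|].
 rewrite pow_inv. apply Rmult_le_reg_r with (c^n); auto. rewrite Rinv_l by lra. lra.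
Qed.

(** Up to l = 24 the density 2/5 obtained from the primes 2 and 3 keeps the left side of
    [final_ineq] too large; the error terms reduce to a polynomial in l divided by q. *)
Lemma regime_small l q h : geo l q h -> (forall p, pr p -> ~ (q*q <= INR p <= q*q+22/25*q*l)) -> RiemannHypothesis -> l <= 24 -> False.
Proof.
 intros G NP RH Hl2. have Q := geo_q _ _ _ G. destruct (geo_facts _ _ _ G) as [Q0 [LQ [H0 [H3 [H4 [H1 _]]]]]]. have Hl := proj1 G.
 have HL : forall p, In p (3 :: 2 :: nil)%nat -> pr p by (intros p [<-|[<-|[]]]; [apply pr3|apply pr2]).
 have F := final_ineq RH l q h (2/5) 6 _ G NP HL $ $ ltac:(intros a M; rewrite Rmult_comm; apply sieve_23).
 unfold Yb in F. replace (INR (length (3 :: 2 :: nil)%nat)) with 2 in F by go.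
 set (H := h*q) in *. have : 4367/10000*l <= H.
 { replace (22/25*l/q) with (22/25*(l/q)) in H4 by go. assert (0 < H) by go. nra. }
 have : 187/100 <= ln H. { replace (187/100) with (INR 10*(187/1000)) by go. apply (ln_lb _ _ (8293/10000)); [lra..|]. go. }
 set (Fc := (1+h/50)*((1+5/4*h)*(8/5)+477/10000)) in *. have : Fc <= 16552/10000 by (unfold Fc; nra).
 have : 69/5*h+4/q+(l+/5)^2*(25/69)*(1+11/25*l)/q+329/200*(l+/5)*(53/50*(2/5+6+2+/2)/q)+/(2*q) <= 545/1000.
 { apply Rle_trans with ((6072/1000*l+9/2+(l+/5)^2*(25/69)*(1+11/25*l)+1552/100*(l+/5))/q).
  - have Hh : h = H/q by go. rewrite Hh. apply Rmult_le_reg_r with q; [lra|].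
   replace ((6072/1000*l+9/2+(l+/5)^2*(25/69)*(1+11/25*l)+1552/100*(l+/5))/q*q) with (6072/1000*l+9/2+(l+/5)^2*(25/69)*(1+11/25*l)+1552/100*(l+/5)) by go.
   replace ((69/5*(H/q)+4/q+(l+/5)^2*(25/69)*(1+11/25*l)/q+329/200*(l+/5)*(53/50*(2/5+6+2+/2)/q)+/(2*q))*q) with (69/5*H+4+(l+/5)^2*(25/69)*(1+11/25*l)+329/200*(53/50*(2/5+6+2+/2))*(l+/5)+/2) by go. lra.
  - apply (proj2 (Rle_div_l _ _ q $)). set (u := (l-15)/2) in *. replace l with (15+2*u) in * by go. go. }
 have : 0 <= (l+/5)*(2/5) by lra. have : (l+/5)*(2/5)*Fc <= (l+/5)*(2/5)*(16552/10000) by go.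
 have : /2*(4367/10000*l)*(31749/25000-(l+/5)*(2/5)*(16552/10000)/50) <= /2*H*(31749/25000-(l+/5)*(2/5)*Fc/50) by go.
 nra.
Qed.

Lemma regime_large l q h : geo l q h -> (forall p, pr p -> ~ (q*q <= INR p <= q*q+22/25*q*l)) -> RiemannHypothesis -> 24 <= l -> False.
Proof.
 intros G NP RH Hl. have Q := geo_q _ _ _ G. destruct (geo_facts _ _ _ G) as [Q0 [_ [H0 [H3 [H4 [H1 _]]]]]]. have Eq := proj1 (proj2 G).
 (* Logarithm of the sieving limit. The subtracted 39/10 gives k^2 <= 0.00042 q, which keeps the
    sieve remainder small, while l/p still tends to 4. *)
 set (p := l/4-39/10). have Hp : 21/10 <= p by go.
 destruct (nat_floor (exp p) ltac:(go)) as [k [K1 K2]]. have KP := pos_INR k.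
 have : 4 <= exp p. { le_tr; [|apply exp_le, Hp]. have A := exp_ge_3 (21/10) $. lra. }
 have : (2 <= k)%nat. { apply INR_le. rewrite S_INR in K2. go. }
 have : p <= ln (INR (S k)) by (rewrite <- ln_exp at 1; apply ln_le; [go|lra]).
 have : INR k^2 <= 42/100000*q.
 { apply Rle_trans with (exp p^2); [go|]. rewrite <- exp_mul_INR. replace (INR 2*p) with (l/2+INR 20*- (39/100)) by (unfold p; simpl; field). rewrite exp_plus, <- Eq, Rmult_comm. mul_r; [lra|]. rewrite exp_mul_INR.
  destruct (e4_spec (39/100) $) as [A B]. apply Rle_trans with ((6776/10000)^20); [|lra]. apply pow_incr; split; [go|]. le_tr; [exact B|]. unfold e4. lra. }
 set (w := /p). have : w*p = 1 by go. have : 0 < w <= 10/21 by go.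
 have HL : forall p, In p (pl k) -> pr p by (intros r Hr; apply pl_spec in Hr; tauto).
 have : INR (length (pl k)) <= INR k. { apply le_INR. apply Nat.le_trans with (length (seq 1 k)); [|rewrite length_seq; auto]. apply NoDup_incl_length; [apply pl_NoDup|]. intros r Hr. apply pl_spec in Hr. apply in_seq. destruct Hr as [Hr ?]. apply pr_ge2 in Hr. lia. }
 have F := final_ineq RH l q h w (81*INR k^2*w^2) _ G NP HL $ ltac:(go).
 have HS : forall a M, rsum (fun i => copr (pl k) (a+i)%nat) M <= w*INR M+81*INR k^2*w^2.
 { intros a M. le_tr; [apply sieve_large; auto|]. have A : /ln (INR (S k)) <= w by (apply Rinv_le_contravar; lra). have : 0 < /ln (INR (S k)) by go. have MP := pos_INR M.
  unfold Rdiv. rewrite Rmult_comm, <- pow_inv, Rpow_mult_distr. go. }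
 specialize (F HS). unfold Yb in F.
 have LQ : l/q <= 44/100000. { apply (proj2 (Rle_div_l _ _ q $)). set (u := (l-15)/2) in *. replace l with (15+2*u) in * by go. go. }
 have : 0 < l/q by go.
 set (H := h*q) in *. have : 43982/100000*l <= H.
 { go. }
 have Hh : h = H/q by go. have : h <= 2/10000. { rewrite Hh. apply (proj2 (Rle_div_l _ _ q $)). apply (proj1 (Rle_div_l _ _ q $)) in LQ. lra. }
 have : 235/100 <= ln H. { replace (235/100) with (INR 10*(235/1000)) by go. apply (ln_lb _ _ (7904/10000)); [lra..|]. go. }
 set (Fc := (1+h/50)*((1+5/4*h)*(8/5)+477/10000)) in *. have : Fc <= 16482/10000 by (unfold Fc; nra).
 have : INR k <= INR k^2/20+5 by (assert (0 <= (INR k-10)^2) by apply pow2_ge_0; lra).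
 have : 53/50*(w+81*INR k^2*w^2+INR (length (pl k))+/2)/q <= 53/50*(3402/100000*w^2+21/1000000+6/q).
 { apply (proj2 (Rle_div_l _ _ q $)). replace (53/50*(3402/100000*w^2+21/1000000+6/q)*q) with (53/50*(81*(42/100000*q)*w^2+(42/100000*q)/20+6)) by go.
  mul_l; [lra|]. have w2 : 0 <= w^2 by apply pow2_ge_0. assert (INR k^2*w^2 <= 42/100000*q*w^2) by go. lra. }
 have : 69/5*h+4/q+(l+/5)^2*(25/69)*(1+11/25*l)/q+329/200*(l+/5)*(53/50*(6/q))+/(2*q) <= 56/1000.
 { apply Rle_trans with ((6072/1000*l+9/2+(l+/5)^2*(25/69)*(1+11/25*l)+1047/100*(l+/5))/q).
  - rewrite Hh. apply Rmult_le_reg_r with q; [lra|].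
   replace ((6072/1000*l+9/2+(l+/5)^2*(25/69)*(1+11/25*l)+1047/100*(l+/5))/q*q) with (6072/1000*l+9/2+(l+/5)^2*(25/69)*(1+11/25*l)+1047/100*(l+/5)) by go.
   replace ((69/5*(H/q)+4/q+(l+/5)^2*(25/69)*(1+11/25*l)/q+329/200*(l+/5)*(53/50*(6/q))+/(2*q))*q) with (69/5*H+4+(l+/5)^2*(25/69)*(1+11/25*l)+329/200*(53/50*6)*(l+/5)+/2) by go. lra.
  - apply (proj2 (Rle_div_l _ _ q $)). set (u := (l-15)/2) in *. replace l with (15+2*u) in * by go. set (z := u-9/2). have Z : 0 <= z by (unfold z; lra). replace u with (z+9/2) in * by go. clear-Q Z.
   go. }
 have : 0 <= (l+/5)*w by go. have : (l+/5)*w*Fc <= (l+/5)*w*(16482/10000) by go.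
 have : l = 4*p+78/5 by go. have Elw : (l+/5)*w = 4+79/5*w by go.
 rewrite Elw in *.
 (* The coefficient of l tends to 0.21991 (1.26996 - 4 1.6482/50), about 0.25028, and has to exceed
    the 1/4 on the other side. *)
 have : /2*(43982/100000*l)*(31749/25000-(4+79/5*w)*(16482/10000)/50) <= /2*H*(31749/25000-(4+79/5*w)*Fc/50) by (apply Rmult_le_compat; lra).
 have : 329/200*(l+/5)*(53/50*(w+81*INR k^2*w^2+INR (length (pl k))+/2)/q) <= 329/200*(l+/5)*(53/50*(3402/100000*w^2+21/1000000+6/q)) by (mul_l; lra).
 have : 329/200*(l+/5)*(53/50*(3402/100000*w^2)) = 329/200*(53/50*(3402/100000))*(4*w+79/5*w^2) by go.
 have : l*w = 4+78/5*w by lra. have w2 : w^2 <= (10/21)*w by (cbn [pow]; rewrite Rmult_1_r; mul_r; lra).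
 go.
Qed.

(** * Small x *)

Definition small_primes : list Z := (2 :: 3 :: 5 :: 7 :: 11 :: 13 :: 17 :: 19 :: 23 :: 29 :: 31 :: 37 :: 41 :: nil)%Z.

(* Trial division by the primes up to 41 leaves exactly the primes below 43^2. *)
Definition primorial : Z :=
 fold_right (fun d P => if existsb (fun r => (d mod r =? 0)%Z) small_primes then P else (d*P)%Z) (fold_right Z.mul 1%Z small_primes) (map Z.of_nat (seq 2 1809)).

(** Below 1811 this is trial division. Above, a gcd with [primorial] excludes all divisors under
    1811, which decides primality below 1811^2. *)
Definition prime_test (P p : Z) : bool :=
 (1 <? p)%Z && (p <? 1811*1811)%Z &&
 (if (p <? 1811)%Z then forallb (fun d => negb (p mod d =? 0)%Z) (map Z.of_nat (seq 2 (Z.to_nat (p-2)))) else (Z.gcd p (P mod p) =? 1)%Z).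

(** The gap condition in integers: sqrt p is replaced by a tenth of the integer root of 100p, and ln
    p by (69/100)/8 times the integer logarithm of p^8, the eighth power reducing the loss from
    rounding. *)
Definition short_step (p p' : Z) : bool := (800000*(p'-p) <=? 88*69*Z.sqrt (100*p)*Z.log2 (p^8))%Z.

Fixpoint chain (P p : Z) (l : list Z) (E : Z) : bool :=
 match l with nil => (E <=? p)%Z | p' :: l => (p <? p')%Z && prime_test P p' && short_step p p' && chain P p' l E end.

Lemma primorial_spec d : (1 < d < 1811)%Z -> exists r, (1 < r)%Z /\ (r | d)%Z /\ (r | primorial)%Z.
Proof.
 intros Hd. unfold primorial. have HI : In d (map Z.of_nat (seq 2 1809)) by (apply in_map_iff; exists (Z.to_nat d); split; [lia|apply in_seq; lia]).
 revert HI. generalize (map Z.of_nat (seq 2 1809)). set (S0 := fold_right Z.mul 1%Z small_primes). set (F := fun d P => if existsb (fun r => (d mod r =? 0)%Z) small_primes then P else (d*P)%Z).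
 have G : forall l r, (r | S0)%Z -> (r | fold_right F S0 l)%Z. { intros l0 r Hr. induction l0 as [|e l0 IH]; cbn [fold_right]; auto. unfold F at 1. destruct existsb; auto. apply Z.divide_mul_r; auto. }
 destruct (existsb (fun r => (d mod r =? 0)%Z) small_primes) eqn:E.
 - apply existsb_exists in E. destruct E as [r [R1 R2]]. exists r.
  have : (1 < r)%Z by (unfold small_primes in R1; cbn [In] in R1; lia). split; auto. split; [apply Z.mod_divide; lia|]. apply G. clear-R1. induction small_primes as [|e l IH]; [destruct R1|]. destruct R1 as [->|R1]; [apply Z.divide_factor_l|apply Z.divide_mul_r; auto].
 - exists d. split; [lia|]. split; [go|]. induction l as [|e l IH]; [destruct HI|]. cbn [fold_right]. destruct HI as [->|HI]; [unfold F at 1; rewrite E; apply Z.divide_factor_l|]. unfold F at 1. destruct (existsb (fun r => (e mod r =? 0)%Z) small_primes); auto. apply Z.divide_mul_r; auto.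
Qed.

Lemma prime_test_ok p : prime_test primorial p = true -> prime p.
Proof.
 unfold prime_test. intros H; apply andb_prop in H as [H H3]; apply andb_prop in H as [H1 H2]. apply Z.ltb_lt in H1, H2. apply prime_alt. split; auto. destruct (Z.ltb_spec p 1811) as [Hs|Hs].
 { intros n Hn D. rewrite forallb_forall in H3. have Q := H3 n ltac:(apply in_map_iff; exists (Z.to_nat n); split; [lia|apply in_seq; lia]). apply Z.mod_divide in D; [|lia]. go. }
 apply Z.eqb_eq in H3.
 have G : forall n, (1 < n < 1811)%Z -> ~ (n | p)%Z.
 { intros n Hn D. destruct (primorial_spec n Hn) as [r [R1 [R2 R3]]]. have Rp : (r | p)%Z by (exact (Z.divide_trans _ _ _ R2 D)).
  have Rm : (r | primorial mod p)%Z by (rewrite Z.mod_eq by lia; apply Z.divide_sub_r; auto; apply Z.divide_mul_l; auto).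
  have R := Z.gcd_greatest _ _ _ Rp Rm. rewrite H3 in R. apply Z.divide_1_r_nonneg in R; lia. }
 intros n Hn D. destruct (Z_lt_dec n 1811) as [C|C]; [apply (G n); auto; lia|]. destruct D as [m Hm]. apply (G m); [nia|]. exists n. lia.
Qed.

Lemma short_step_ok p p' : (5 <= p)%Z -> short_step p p' = true -> IZR p' <= IZR p+22/25*sqrt (IZR p)*ln (IZR p).
Proof.
 intros Hp H. apply Z.leb_le in H. have P5 := IZR_le _ _ Hp. have : IZR (Z.sqrt (100*p))/10 <= sqrt (IZR p).
 { apply sqrt_ge_sq. - have B := IZR_le _ _ (Z.sqrt_nonneg (100*p)). lra. - have B := proj1 (Z.sqrt_spec (100*p) ltac:(lia)). apply IZR_le in B. rewrite !mult_IZR in B. lra. }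
 have : IZR (Z.log2 (p^8))*(69/100) <= 8*ln (IZR p).
 { have L0 := Z.log2_nonneg (p^8). have B := proj1 (Z.log2_spec (p^8) ltac:(go)). apply IZR_le in B. rewrite <- (Z2Nat.id _ L0), <- pow_IZR in B. change 8%Z with (Z.of_nat 8) in B at 2. rewrite <- pow_IZR in B.
  apply ln_le in B; [|go]. rewrite !ln_pow in B by lra. rewrite INR_IZR_INZ, (Z2Nat.id _ L0) in B. replace (INR 8) with 8 in B by go. have B2 := IZR_le _ _ L0. have L2 := ln2_lb. nra. }
 apply IZR_le in H. rewrite !mult_IZR, minus_IZR in H. have S0 := IZR_le _ _ (Z.sqrt_nonneg (100*p)). have S1 := IZR_le _ _ (Z.log2_nonneg (p^8)).
 go.
Qed.

(** For x between consecutive primes p and p' the admissible length at x is at least that at p, so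
    the gap condition at p is enough. *)
Lemma chain_ok l E p x : chain primorial p l E = true -> (5 <= p)%Z -> IZR p < x <= IZR E -> exists p', prime p' /\ x <= IZR p' <= x+22/25*sqrt x*ln x.
Proof.
 revert p. induction l as [|p' l IH]; intros p H Hp Hx; have P5 := IZR_le _ _ Hp; cbn [chain] in H.
 - apply Z.leb_le, IZR_le in H. lra.
 - apply andb_prop in H as [H H4]; apply andb_prop in H as [H H3]; apply andb_prop in H as [H1 H2]. destruct (Rle_dec x (IZR p')) as [C|C]; [|apply (IH p'); auto; [lia|lra]].
  exists p'. split; [apply prime_test_ok; auto|]. split; auto. le_tr; [apply short_step_ok; [exact Hp|go]|]. apply Rplus_le_compat; [lra|]. rewrite !Rmult_assoc. mul_l; [lra|].
  apply Rmult_le_compat; [go|rewrite <- ln_1; apply ln_le; lra|apply sqrt_le_1_alt; lra|apply ln_le; lra].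
Qed.

Lemma small_chain : chain primorial 5 (7 :: 11 :: 17 :: 23 :: 31 :: 47 :: 67 :: 89 :: 113 :: 151 :: 199 :: 263 :: 337 :: 421 :: 523 :: 647 :: 787 :: 947 :: 1129 :: 1327 :: 1553 :: 1801 ::
  2069 :: 2371 :: 2699 :: 3049 :: 3433 :: 3833 :: 4273 :: 4733 :: 5237 :: 5749 :: 6317 :: 6917 :: 7559 :: 8237 :: 8951 :: 9697 :: 10477 :: 11299 ::
  12161 :: 13063 :: 13999 :: 14983 :: 16001 :: 17053 :: 18149 :: 19301 :: 20483 :: 21713 :: 22993 :: 24281 :: 25643 :: 27061 :: 28517 :: 30013 :: 31547
  :: 33151 :: 34807 :: 36497 :: 38239 :: 40031 :: 41879 :: 43759 :: 45707 :: 47701 :: 49747 :: 51839 :: 53993 :: 56179 :: 58441 :: 60737 :: 63103 ::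
  65521 :: 67987 :: 70507 :: 73079 :: 75721 :: 78401 :: 81163 :: 83969 :: 86813 :: 89689 :: 92657 :: 95651 :: 98737 :: 101879 :: 105097 :: 108359 ::
  111667 :: 115061 :: 118493 :: 121993 :: 125551 :: 129169 :: 132851 :: 136607 :: 140419 :: 144271 :: 148207 :: 152203 :: 156259 :: 160397 :: 164587 ::
  168803 :: 173099 :: 177487 :: 181927 :: 186419 :: 190997 :: 195599 :: 200297 :: 205043 :: 209887 :: 214789 :: 219731 :: 224743 :: 229849 :: 235013 ::
  240209 :: 245477 :: 250853 :: 256279 :: 261773 :: 267317 :: 272959 :: 278651 :: 284413 :: 290233 :: 296159 :: 302143 :: 308153 :: 314261 :: 320471 ::
  326741 :: 333071 :: 339433 :: 345889 :: 352441 :: 359063 :: 365747 :: 372481 :: 379333 :: 386249 :: 393209 :: 400249 :: 407347 :: 414559 :: 421831 ::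
  429161 :: 436549 :: 444007 :: 451579 :: 459223 :: 466919 :: 474671 :: 482513 :: 490463 :: 498469 :: 506551 :: 514681 :: 522887 :: 531173 :: 539573 ::
  548039 :: 556573 :: 565177 :: 573847 :: 582643 :: 591499 :: 600421 :: 609407 :: 618463 :: 627593 :: 636851 :: 646169 :: 655561 :: 665017 :: 674537 ::
  684127 :: 693851 :: 703643 :: 713509 :: 723439 :: 733433 :: 743507 :: 753707 :: 763967 :: 774313 :: 784727 :: 795211 :: 805757 :: 816377 :: 827143 ::
  837979 :: 848879 :: 859853 :: 870901 :: 882019 :: 893261 :: 904577 :: 915973 :: 927439 :: 938983 :: 950569 :: 962257 :: 974089 :: 985997 :: 997973 ::
  1010003 :: 1022129 :: 1034323 :: 1046587 :: 1058921 :: 1071407 :: 1083949 :: 1096583 :: 1109291 :: 1122071 :: 1134929 :: 1147843 :: 1160927 :: 1174091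
  :: 1187321 :: 1200611 :: 1213981 :: 1227437 :: 1240973 :: 1254577 :: 1268341 :: 1282187 :: 1296109 :: 1310093 :: 1324159 :: 1338299 :: 1352521 ::
  1366801 :: 1381231 :: 1395749 :: 1410361 :: 1425049 :: 1439803 :: 1454633 :: 1469543 :: 1484537 :: 1499699 :: 1514917 :: 1530233 :: 1545619 :: 1561069
  :: 1576613 :: 1592207 :: 1607873 :: 1623647 :: 1639597 :: 1655627 :: 1671739 :: 1687909 :: 1704169 :: 1720517 :: 1736939 :: 1753441 :: 1770001 ::
  1786753 :: 1803583 :: 1820501 :: 1837489 :: 1854563 :: 1871713 :: 1888933 :: 1906243 :: 1923613 :: 1941187 :: 1958837 :: 1976563 :: 1994381 :: 2012243
  :: 2030213 :: 2048269 :: 2066399 :: 2084611 :: 2102897 :: 2121377 :: 2139947 :: 2158591 :: 2177323 :: 2196137 :: 2215013 :: 2233969 :: 2253023 ::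
  2272141 :: 2291353 :: 2310769 :: 2330249 :: 2349829 :: 2369489 :: 2389213 :: 2409031 :: 2428931 :: 2448883 :: 2468953 :: 2489077 :: 2509313 :: 2529749
  :: 2550269 :: 2570851 :: 2591521 :: 2612287 :: 2633131 :: 2654059 :: 2675077 :: 2696171 :: 2717339 :: 2738599 :: 2760061 :: 2781617 :: 2803259 ::
  2824973 :: 2846783 :: 2868673 :: 2890649 :: 2912699 :: 2934847 :: 2957057 :: 2979367 :: 3001883 :: 3024499 :: 3047197 :: 3069967 :: 3092813 :: 3115769
  :: 3138809 :: 3161897 :: 3185107 :: 3208399 :: 3231779 :: 3255247 :: 3278927 :: nil)%Z 3273000 = true.
Proof. vm_compute. go. Qed.

Theorem theorem5 :
 RiemannHypothesis ->
 forall x : R, 4 <= x ->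
  exists p : nat, prime (Z.of_nat p) /\
   x <= INR p <= x+22/25*sqrt x*ln x.
Proof.
 (* 3273000 is slightly more than e^15, where [geo] becomes available. *)
 intros RH x Hx. destruct (Rle_dec x 3273000) as [Hs|Hs].
 - have E : exists p', prime p' /\ x <= IZR p' <= x+22/25*sqrt x*ln x.
  (* The chain starts at 5, so [4, 5] is treated apart: already at x = 4 the interval reaches 5. *)
  { destruct (Rle_dec x 5) as [H5|H5]; [|eapply (chain_ok _ _ 5 x small_chain); [lia|lra]].
   exists 5%Z. split; [apply prime_test_ok; vm_compute; reflexivity|]. split; [lra|].
   assert (2 <= sqrt x) by (apply sqrt_ge_sq; lra). assert (138/100 <= ln x) by (apply Rle_trans with (ln (2*2)); [rewrite ln_mult by lra; generalize ln2_lb; lra|go]). go. }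
  destruct E as [p [Hp E]]. exists (Z.to_nat p). have H0 := prime_ge_2 p Hp. rewrite INR_IZR_INZ, Z2Nat.id by lia. auto.
 - apply NNPP. intros NE. set (l := ln x). set (q := sqrt x). have Q2 : q*q = x by (apply sqrt_sqrt; lra).
  have : 15 <= l. { replace 15 with (INR 150*/10) by go. apply (ln_lb _ _ (904833/1000000)); [lra..|]. set (w := (904833/1000000)^150). assert (305539/1000000000000 <= w) by go. nra. }
  have G : geo l q (/2*ln (1+22/25*l/q)). { split; [auto|split; [|go]]. unfold q, l. rewrite <- sqrt_exp, exp_ln by lra. go. }
  have NP : forall p, pr p -> ~ (q*q <= INR p <= q*q+22/25*q*l) by (intros p Hp C; apply NE; exists p; rewrite Q2 in C; split; auto).
  destruct (Rle_dec l 24) as [L|L]; [apply (regime_small _ _ _ G NP RH L)|apply (regime_large _ _ _ G NP RH); lra].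
Qed.
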